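(* Let $(M^8,g,\Phi)$ be a complete, simply connected $\mathrm{Spin}(7)$-manifold with non-zero parallel characteristic torsion, $\nabla^c\mathrm{T}^c=0$, such that $\mathfrak{iso}(\mathrm{T}^c)=\mathfrak{so}(3)$ or $\mathfrak{iso}(\mathrm{T}^c)=\mathfrak{su}(3)$ and $\mathrm{T}^c$ is of type $II$. Then $(M^8,g)$ is isometric to the Riemannian product $X^6\times\mathbb{R}^2$, where $X^6$ is an almost Hermitian manifold of Gray–Hervella type $W_1\oplus W_3$ with characteristic holonomy contained in $\mathfrak{iso}(\mathrm{T}^c)$.
   Context: On $\mathbb{R}^8$ with oriented orthonormal basis $(e_1,\dots,e_8)$ (vectors and covectors identified, $e_{i_1\ldots i_m}=e_{i_1}\wedge\dots\wedge e_{i_m}$) put $Z=e_{12}+e_{34}+e_{56}$, $D=e_{246}-e_{235}-e_{145}-e_{136}$, $\phi=(Z\wedge e_7+D)\wedge e_8$ and $\Phi=\phi+\ast\phi$. $\mathrm{Spin}(7)\subset\mathrm{SO}(8)$ is the isotropy group of the $4$-form $\Phi$. A $\mathrm{Spin}(7)$-manifold $(M^8,g,\Phi)$ is a Riemannian $8$-manifold with a $4$-form $\Phi$ such that at every point there is an oriented orthonormal frame (adapted frame) in which $\Phi$ has this form. It admits a unique metric connection $\nabla^c$ (the characteristic connection) with totally skew-symmetric torsion $\mathrm{T}^c\in\Lambda^3$ (the characteristic torsion), i.e. $g(\nabla^c_XY,W)=g(\nabla^g_XY,W)+\frac12\mathrm{T}^c(X,Y,W)$ with $\nabla^g$ the Levi-Civita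 connection, such that $\nabla^c\Phi=0$. $\mathfrak{iso}(\mathrm{T}^c)\leqslant\mathfrak{spin}(7)$ is the isotropy algebra of $\mathrm{T}^c$ (at a point, with respect to an adapted frame); equalities and inclusions of subalgebras of $\mathfrak{spin}(7)$ are meant up to conjugation, i.e. for suitable adapted frames. $2$-forms $e_{ij}$ are identified with elements of $\mathfrak{so}(8)$. With $P_1=e_{35}+e_{46}$, $P_2=e_{36}-e_{45}$, $P_3=e_{15}+e_{26}$, $P_4=e_{16}-e_{25}$, $P_5=e_{13}+e_{24}$, $P_6=e_{14}-e_{23}$, $P_7=e_{12}-e_{34}$, $P_8=e_{34}-e_{56}$ one has $\mathfrak{su}(3)=\mathrm{span}(P_1,\dots,P_8)$ and $\mathfrak{so}(3)=\mathrm{span}(P_1+P_5,\,P_2+P_6,\,P_7+P_8)$. Torsion type $II$ (for these isotropy algebras) means that in suitable adapted frames $$\mathrm{T}^c=a_1\,(D_3+D_4)+a_2\,(2D_1+5D_2+3D_5)+b_1\,(D_1-D_2-2D_5)$$ with constants $a_1,a_2,b_1\in\mathbb{R}$, $b_1>0$, where $D_1=e_{246}-e_{145}$, $D_2=-e_{235}-e_{136}$, $D_3=-e_{135}+e_{245}$, $D_4=e_{146}+e_{236}$, $D_5=e_{123}-e_{356}$. For an almost Hermitian $6$-manifold, the characteristic connection is the metric connection with totally skew-symmetric torsion preserving the almost Hermitian structure, and the characteristic holonomy is its holonomy algebra. $W_1\oplus W_3$ refers to the Gray–Hervella classification of almost Hermitian manifolds. *)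

(* Defs.v *)
From HB Require Import structures.
From mathcomp Require Import all_boot all_order all_algebra all_fingroup.
From mathcomp Require Import all_classical all_reals all_analysis.

Set Implicit Arguments.
Unset Strict Implicit.
Unset Printing Implicit Defensive.
Import Order.TTheory GRing.Theory Num.Theory numFieldNormedType.Exports.
Local Open Scope classical_set_scope.
Local Open Scope ring_scope.

(* A tangent vector is a row vector of components, a linear map acts on row
   vectors by right multiplication, and a frame is a matrix whose rows are the
   frame vectors. *)

(** * Covariant tensors *)

(* A rank k tensor on R^n is given by its components t (e_(j 0), e_(j 1), ...),
   one for every multi-index j. *)
Definition tens (R : realType) (n k : nat) := {ffun {ffun 'I_k -> 'I_n} -> R}.

Section Tensors.
Context {R : realType}.

Definition ix2 n (i j : 'I_n) : {ffun 'I_2 -> 'I_n} :=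
  [ffun a : 'I_2 => nth i [:: i; j] a].

Definition ix3 n (i j k : 'I_n) : {ffun 'I_3 -> 'I_n} :=
  [ffun a : 'I_3 => nth i [:: i; j; k] a].

Definition alternating n k (t : tens R n k) :=
  forall (s : 'S_k) (j : {ffun 'I_k -> 'I_n}),
    t [ffun a => j (s a)] = (-1) ^+ s * t j.

(* The tensor (v_1, ..., v_k) |-> t (v_1 A, ..., v_k A); when the rows of A form
   a frame, these are the components of t in that frame. *)
Definition pull m n k (A : 'M[R]_(m, n)) (t : tens R n k) : tens R m k :=
  [ffun i : {ffun 'I_k -> 'I_m} =>
    \sum_(j : {ffun 'I_k -> 'I_n}) t j * \prod_(a < k) A (i a) (j a)].

Definition subst_ix n k (j : {ffun 'I_k -> 'I_n}) (a : 'I_k) (l : 'I_n) :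
  {ffun 'I_k -> 'I_n} := [ffun b => if b == a then l else j b].

(* The tensor (v_1, ..., v_k) |-> \sum_a t (v_1, ..., v_a A, ..., v_k). *)
Definition dact n k (A : 'M[R]_n) (t : tens R n k) : tens R n k :=
  [ffun j : {ffun 'I_k -> 'I_n} =>
    \sum_(a < k) \sum_(l < n) A (j a) l * t (subst_ix j a l)].

End Tensors.

(** * The model Spin(7) structure on R^8 *)

Section Model.
Variable R : realType.

(* The form e_{s_1 ... s_m}, with 1-based indices as on paper and the
   normalisation (e_1 /\ e_2)(e_1, e_2) = 1. *)
Definition eform (s : seq nat) : tens R 8 (size s) :=
  [ffun j : {ffun 'I_(size s) -> 'I_8} =>
    \det (\matrix_(a < size s, b < size s) ((j a).+1 == nth 0%N s b)%:R)].

Definition e3 (i j k : nat) : tens R 8 3 := eform [:: i; j; k].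
Definition e4 (i j k l : nat) : tens R 8 4 := eform [:: i; j; k; l].

Definition ix_mx (j : {ffun 'I_4 -> 'I_8}) : 'M[R]_(4, 8) :=
  \matrix_(a, s) (j a == s)%:R.

(* Here the determinant is the sign of the concatenated multi-index, so that
   hodge e_I = e_J whenever e_I /\ e_J = e_{12345678}. *)
Definition hodge (t : tens R 8 4) : tens R 8 4 :=
  [ffun j : {ffun 'I_4 -> 'I_8} => (4`!)%:R^-1 *
    \sum_(i : {ffun 'I_4 -> 'I_8})
      t i * \det (col_mx (ix_mx i) (ix_mx j) : 'M[R]_8)].

(* (Z /\ e_7 + D) /\ e_8, expanded. *)
Definition phi0 : tens R 8 4 :=
  (e4 1 2 7 8 + e4 3 4 7 8 + e4 5 6 7 8)
  + (e4 2 4 6 8 - e4 2 3 5 8 - e4 1 4 5 8 - e4 1 3 6 8).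

Definition Phi0 : tens R 8 4 := phi0 + hodge phi0.

Definition D1 : tens R 8 3 := e3 2 4 6 - e3 1 4 5.
Definition D2 : tens R 8 3 := - e3 2 3 5 - e3 1 3 6.
Definition D3 : tens R 8 3 := - e3 1 3 5 + e3 2 4 5.
Definition D4 : tens R 8 3 := e3 1 4 6 + e3 2 3 6.
Definition D5 : tens R 8 3 := e3 1 2 3 - e3 3 5 6.

Definition torsion_II (a1 a2 b1 : R) : tens R 8 3 :=
  a1 *: (D3 + D4) + a2 *: (2 *: D1 + 5 *: D2 + 3 *: D5)
  + b1 *: (D1 - D2 - 2 *: D5).

(* The 2-form e_{ij} as an element of so(8). *)
Definition so_e (i j : nat) : 'M[R]_8 :=
  \matrix_(a, b) (((a.+1 == i) && (b.+1 == j))%:R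
                  - ((a.+1 == j) && (b.+1 == i))%:R).

Definition P1 : 'M[R]_8 := so_e 3 5 + so_e 4 6.
Definition P2 : 'M[R]_8 := so_e 3 6 - so_e 4 5.
Definition P3 : 'M[R]_8 := so_e 1 5 + so_e 2 6.
Definition P4 : 'M[R]_8 := so_e 1 6 - so_e 2 5.
Definition P5 : 'M[R]_8 := so_e 1 3 + so_e 2 4.
Definition P6 : 'M[R]_8 := so_e 1 4 - so_e 2 3.
Definition P7 : 'M[R]_8 := so_e 1 2 - so_e 3 4.
Definition P8 : 'M[R]_8 := so_e 3 4 - so_e 5 6.

Definition su3 : {vspace 'M[R]_8} := span [:: P1; P2; P3; P4; P5; P6; P7; P8].
Definition so3 : {vspace 'M[R]_8} := span [:: P1 + P5; P2 + P6; P7 + P8].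

Definition spin7 : set 'M[R]_8 := [set A | A^T = - A /\ dact A Phi0 = 0].

Definition isotropy_algebra (t : tens R 8 3) : set 'M[R]_8 :=
  [set A | spin7 A /\ dact A t = 0].

End Model.

(** * Smooth and Riemannian manifolds *)

Section Smooth.
Context {R : realType}.

Definition iter_partial n (V : normedModType R) (s : seq 'I_n)
    (f : 'rV[R]_n -> V) : 'rV[R]_n -> V :=
  foldr (fun i (g : 'rV[R]_n -> V) x => 'D_(delta_mx 0 i) g x) f s.

(* C^infinity; only used on open sets A. *)
Definition smooth_on n (V : normedModType R) (A : set 'rV[R]_n)
    (f : 'rV[R]_n -> V) :=
  forall (s : seq 'I_n) x, A x -> differentiable (iter_partial s f) x.

End Smooth.

(* Raw data of a Riemannian n-manifold: a space, an atlas, and for every chart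
   the Gram matrices of the metric. The values of chart_map c, chart_inv c and
   metric c outside of the chart c are junk. The axioms are in
   [smooth_manifold] and [riemannian]. *)
Record rmfd (R : realType) (n : nat) := RMfd {
  pt :> topologicalType;
  chart : Type;
  chart_dom : chart -> set pt;
  chart_map : chart -> pt -> 'rV[R]_n;
  chart_inv : chart -> 'rV[R]_n -> pt;
  metric : chart -> pt -> 'M[R]_n
}.
Arguments chart_dom {R n r}.
Arguments chart_map {R n r}.
Arguments chart_inv {R n r}.
Arguments metric {R n r}.

Section Manifolds.
Context {R : realType} {n : nat}.
Variable M : rmfd R n.

Definition chart_codom (c : chart M) : set 'rV[R]_n :=
  chart_map c @` chart_dom c.

Definition jac (c d : chart M) (p : M) : 'M[R]_n :=
  jacobian (chart_map d \o chart_inv c) (chart_map c p).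

Definition smooth_manifold :=
  [/\ hausdorff_space M, @second_countable M,
      forall p : M, exists c : chart M, chart_dom c p,
      forall c : chart M,
        [/\ open (chart_dom c), open (chart_codom c),
            {in chart_dom c, continuous (chart_map c)},
            {in chart_codom c, continuous (chart_inv c)} &
            forall p, chart_dom c p -> chart_inv c (chart_map c p) = p] &
      forall c d : chart M,
        smooth_on (chart_map c @` (chart_dom c `&` chart_dom d))
          (chart_map d \o chart_inv c)].

Definition oriented :=
  forall (c d : chart M) p, chart_dom c p -> chart_dom d p ->
    0 < \det (jac c d p).

Definition riemannian :=
  smooth_manifold /\
  [/\ forall (c : chart M) p, chart_dom c p -> (metric c p)^T = metric c p,
      forall (c : chart M) p (v : 'rV[R]_n), chart_dom c p -> v != 0 ->
        0 < (v *m metric c p *m v^T) 0 0,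
      forall (c d : chart M) p, chart_dom c p -> chart_dom d p ->
        metric c p = jac c d p *m metric d p *m (jac c d p)^T &
      forall c : chart M, smooth_on (chart_codom c) (metric c \o chart_inv c)].

Definition path_connected :=
  forall p q : M, exists g : R -> M,
    [/\ {within `[0, 1], continuous g}, g 0 = p & g 1 = q].

Definition simply_connected :=
  path_connected /\
  forall (p : M) (g : R -> M), {within `[0, 1], continuous g} ->
    g 0 = p -> g 1 = p ->
    exists H : R * R -> M,
      [/\ {within `[0, 1] `*` `[0, 1], continuous H},
          forall t, t \in `[0, 1] -> H (0, t) = g t,
          forall t, t \in `[0, 1] -> H (1, t) = p &
          forall s, s \in `[0, 1] -> H (s, 0) = p /\ H (s, 1) = p].

(* A covariant tensor field, given by its components in every chart. *)
Definition tensor_field (k : nat) := chart M -> M -> tens R n k.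

Definition is_form k (t : tensor_field k) :=
  [/\ forall (c d : chart M) p, chart_dom c p -> chart_dom d p ->
        t c p = pull (jac c d p) (t d p),
      forall (c : chart M) j,
        smooth_on (chart_codom c) (fun x => t c (chart_inv c x) j : R) &
      forall (c : chart M) p, chart_dom c p -> alternating (t c p)].

Definition partial (V : normedModType R) (c : chart M) (i : 'I_n)
    (f : M -> V) (p : M) : V :=
  'D_(delta_mx 0 i) (f \o chart_inv c) (chart_map c p).

(** * Connections and holonomy *)

(* An affine connection is given in every chart by matrices G i with
   nabla_(d_i) d_j = \sum_l (G i) j l d_l. *)
Definition connection := chart M -> M -> 'I_n -> 'M[R]_n.

(* The metric connection with totally skew-symmetric torsion T:
   g(nabla_X Y, W) = g(nabla^g_X Y, W) + T(X, Y, W) / 2, where the first term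
   is given by the Christoffel symbols. *)
Definition skew_connection (T : tensor_field 3) : connection :=
  fun c p i => \matrix_(j, l) (2^-1 * \sum_(m < n)
    (partial c i (fun q => metric c q j m : R) p
     + partial c j (fun q => metric c q i m : R) p
     - partial c m (fun q => metric c q i j : R) p
     + T c p (ix3 i j m)) * invmx (metric c p) m l).

Definition levi_civita : connection := skew_connection (fun _ _ => 0).

Definition nabla (G : connection) k (t : tensor_field k) (c : chart M) (p : M)
    (i : 'I_n) : tens R n k :=
  [ffun j => partial c i (fun q => t c q j : R) p] - dact (G c p i) (t c p).

Definition parallel_tensor (G : connection) k (t : tensor_field k) :=
  forall (c : chart M) p i, chart_dom c p -> nabla G t c p i = 0.

Definition velocity (c : chart M) (g : R -> M) : R -> 'rV[R]_n :=
  derive1 (chart_map c \o g).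

Definition geodesic (g : R -> M) :=
  continuous g /\
  forall (c : chart M) (t : R), chart_dom c (g t) ->
    derivable (chart_map c \o g) t 1 /\
    is_derive t 1 (velocity c g)
      (- \sum_(i < n) velocity c g t 0 i *:
           (velocity c g t *m levi_civita c (g t) i)).

Definition geodesically_complete :=
  forall (c : chart M) p (v : 'rV[R]_n), chart_dom c p ->
    exists g : R -> M, [/\ geodesic g, g 0 = p & velocity c g 0 = v].

Definition C1_curve (g : R -> M) :=
  continuous g /\
  forall (c : chart M) (t : R), chart_dom c (g t) ->
    derivable (chart_map c \o g) t 1 /\ {for t, continuous (velocity c g)}.

(* F c t has as rows the components in the chart c of n parallel vector fields
   along the curve g. *)
Definition parallel_along (G : connection) (g : R -> M)
    (F : chart M -> R -> 'M[R]_n) :=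
  (forall (c d : chart M) t, chart_dom c (g t) -> chart_dom d (g t) ->
     F d t = F c t *m jac c d (g t)) /\
  (forall (c : chart M) t, chart_dom c (g t) ->
     is_derive t 1 (F c)
       (- \sum_(i < n) velocity c g t 0 i *: (F c t *m G c (g t) i))).

(* transport G p c q d P: some parallel transport along a piecewise C^1 curve
   from p to q is v |-> v *m P in the coordinates c at p and d at q. *)
Inductive transport (G : connection) :
    M -> chart M -> M -> chart M -> 'M[R]_n -> Prop :=
| Transport_C1 (g : R -> M) (F : chart M -> R -> 'M[R]_n) c d :
    C1_curve g -> parallel_along G g F ->
    chart_dom c (g 0) -> chart_dom d (g 1) ->
    F c 0 = 1%:M -> transport G (g 0) c (g 1) d (F d 1)
| Transport_cat p c q d r e P Q :
    transport G p c q d P -> transport G q d r e Q ->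
    transport G p c r e (P *m Q).

Definition holonomy_group (G : connection) (c : chart M) (p : M) :
    set 'M[R]_n :=
  [set P | transport G p c p c P].

(* The Lie algebra of the holonomy group: the generators A of the one-parameter
   groups exp (t A) that lie in it. *)
Definition holonomy_algebra (G : connection) (c : chart M) (p : M) :
    set 'M[R]_n :=
  [set A | exists u : R -> 'M[R]_n,
    [/\ u 0 = 1%:M, forall t : R, is_derive t 1 u (u t *m A) &
        forall t, holonomy_group G c p (u t)]].

(** * Almost Hermitian manifolds *)

(* The components of a field of endomorphisms of the tangent spaces. *)
Definition endo_field := chart M -> M -> 'M[R]_n.

Definition almost_hermitian (J : endo_field) :=
  riemannian /\
  [/\ forall (c d : chart M) p, chart_dom c p -> chart_dom d p ->
        J c p *m jac c d p = jac c d p *m J d p,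
      forall c : chart M, smooth_on (chart_codom c) (J c \o chart_inv c),
      forall (c : chart M) p, chart_dom c p -> J c p *m J c p = - 1%:M &
      forall (c : chart M) p, chart_dom c p ->
        J c p *m metric c p *m (J c p)^T = metric c p].

(* Omega(X, Y) = g(JX, Y) *)
Definition kahler_form (J : endo_field) : tensor_field 2 :=
  fun c p => [ffun j : {ffun 'I_2 -> 'I_n} =>
    (J c p *m metric c p) (j 0) (j 1)].

(* The trilinear form with components a i j k = (A i) j k. *)
Definition trilin (A : 'I_n -> 'M[R]_n) (x y z : 'rV[R]_n) : R :=
  \sum_(i < n) x 0 i * (y *m A i *m z^T) 0 0.

(* The Gray-Hervella space W of tensors with the symmetries of nabla Omega, and
   its submodules W_1 and W_3, in a Euclidean space with Gram matrix g and
   orthogonal complex structure J. *)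
Definition GH_W (J : 'M[R]_n) (A : 'I_n -> 'M[R]_n) :=
  forall x y z, trilin A x y z = - trilin A x z y /\
                trilin A x y z = - trilin A x (y *m J) (z *m J).

Definition GH_W1 (J : 'M[R]_n) (A : 'I_n -> 'M[R]_n) :=
  GH_W J A /\ forall x z, trilin A x x z = 0.

Definition GH_W3 (g J : 'M[R]_n) (A : 'I_n -> 'M[R]_n) :=
  [/\ GH_W J A,
      forall x y z, trilin A x y z - trilin A (x *m J) (y *m J) z = 0 &
      forall z, \sum_(i < n) \sum_(j < n) invmx g i j *
        trilin A (delta_mx 0 i) (delta_mx 0 j) z = 0].

(* Type W_1 + W_3: nabla^g Omega lies in the sum at every point. *)
Definition type_W1_W3 (J : endo_field) :=
  forall (c : chart M) p, chart_dom c p ->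
    exists A1 A3 : 'I_n -> 'M[R]_n,
      [/\ GH_W1 (J c p) A1, GH_W3 (metric c p) (J c p) A3 &
          forall i, A1 i + A3 i =
            \matrix_(j, k)
              nabla levi_civita (kahler_form J) c p i (ix2 j k)].

Definition ah_characteristic_torsion (J : endo_field) (T : tensor_field 3) :=
  is_form T /\
  forall (c : chart M) p i, chart_dom c p ->
    partial c i (J c) p + J c p *m skew_connection T c p i
      - skew_connection T c p i *m J c p = 0.

End Manifolds.

(** * Products and isometries *)

Section Isometries.
Context {R : realType}.

Definition euclidean (m : nat) : rmfd R m :=
  @RMfd R m 'rV[R]_m unit (fun=> setT) (fun=> id) (fun=> id) (fun _ _ => 1%:M).

Definition product n m (M : rmfd R n) (N : rmfd R m) : rmfd R (n + m) :=
  @RMfd R (n + m) (M * N)%type (chart M * chart N)%type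
    (fun c => chart_dom c.1 `*` chart_dom c.2)
    (fun c p => row_mx (chart_map c.1 p.1) (chart_map c.2 p.2))
    (fun c x => (chart_inv c.1 (lsubmx x), chart_inv c.2 (rsubmx x)))
    (fun c p => block_mx (metric c.1 p.1) 0 0 (metric c.2 p.2)).

Definition dmap n m (M : rmfd R n) (N : rmfd R m) (f : M -> N)
    (c : chart M) (d : chart N) (p : M) : 'M[R]_(n, m) :=
  jacobian (chart_map d \o f \o chart_inv c) (chart_map c p).

Definition smooth_map n m (M : rmfd R n) (N : rmfd R m) (f : M -> N) :=
  continuous f /\
  forall (c : chart M) (d : chart N),
    smooth_on (chart_map c @` (chart_dom c `&` f @^-1` chart_dom d))
      (chart_map d \o f \o chart_inv c).

Definition riemannian_isometry n m (M : rmfd R n) (N : rmfd R m) (f : M -> N) :=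
  [/\ smooth_map f,
      exists h : N -> M, [/\ cancel f h, cancel h f & smooth_map h] &
      forall (c : chart M) (d : chart N) p,
        chart_dom c p -> chart_dom d (f p) ->
        metric c p =
          dmap f c d p *m metric d (f p) *m (dmap f c d p)^T].

End Isometries.

(** * Spin(7)-manifolds *)

Section Spin7.
Context {R : realType}.
Variable M : rmfd R 8.

Definition adapted (Phi : tensor_field M 4) (c : chart M) (p : M)
    (E : 'M[R]_8) :=
  [/\ E *m metric c p *m E^T = 1%:M, 0 < \det E & pull E (Phi c p) = Phi0 R].

Definition spin7_manifold (Phi : tensor_field M 4) :=
  [/\ riemannian M, oriented M, is_form Phi &
      forall (c : chart M) p, chart_dom c p -> exists E, adapted Phi c p E].

Definition characteristic_torsion (Phi : tensor_field M 4)
    (T : tensor_field M 3) :=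
  is_form T /\ parallel_tensor (skew_connection T) Phi.

(* iso(T^c) = h for suitable adapted frames. *)
Definition isotropy_is (Phi : tensor_field M 4) (T : tensor_field M 3)
    (h : {vspace 'M[R]_8}) :=
  forall (c : chart M) p, chart_dom c p ->
    exists E, adapted Phi c p E /\
      isotropy_algebra (pull E (T c p)) = [set A | A \in h].

Definition type_II (Phi : tensor_field M 4) (T : tensor_field M 3) :=
  exists a1 a2 b1 : R, 0 < b1 /\
    forall (c : chart M) p, chart_dom c p ->
      exists E, adapted Phi c p E /\ pull E (T c p) = torsion_II a1 a2 b1.

(* The holonomy algebra of the connection G on X at the first component of f p
   is contained in iso(T) at p. An endomorphism A of a tangent space of X acts
   by block_mx A 0 0 0 on that of X x R^2, hence on that of M by means of the
   differential of f; conjugation by E gives its matrix in the frame E. *)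
Definition holonomy_in_iso (Phi : tensor_field M 4) (T : tensor_field M 3)
    (X : rmfd R 6) (G : connection X) (f : M -> product X (euclidean 2)) :=
  forall (c : chart M) (d : chart X) (p : M),
      chart_dom c p -> chart_dom d (f p).1 ->
    exists E, adapted Phi c p E /\
      forall A : 'M[R]_6, holonomy_algebra G d (f p).1 A ->
        let df : 'M[R]_8 :=
          dmap f c ((d, tt) : chart (product X (euclidean 2))) p in
        let B : 'M[R]_8 :=
          df *m (block_mx A 0 0 0 : 'M[R]_(6 + 2)) *m invmx df in
        isotropy_algebra (pull E (T c p)) (E *m B *m invmx E).

End Spin7.

(* Main.v *)
Require Import Defs.
From HB Require Import structures.
From mathcomp Require Import all_boot all_order all_algebra all_fingroup.
From mathcomp Require Import all_classical all_reals all_analysis.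
From mathcomp Require Import ring lra.
Set Implicit Arguments.
Unset Strict Implicit.
Unset Printing Implicit Defensive.
Import Order.TTheory GRing.Theory Num.Theory numFieldNormedType.Exports.
Local Open Scope classical_set_scope.
Local Open Scope ring_scope.

(* Write g, T, Phi for the metric, the torsion and the 4-form. Contracting T with
   itself gives the parallel symmetric endomorphism Q(X, Y) = <i_X T, i_Y T>; in
   the given frames its kernel is span(e_7, e_8), unless T is, up to scale,
   e_3 /\ (e_1 - e_5) /\ (e_2 + e_6), and then the isotropy algebra of T is
   larger than so(3) and su(3). The contraction of T (or of the pull-back of T by
   Q) with Phi is a parallel vector field in this kernel, and simple
   connectedness gives a parallel unit field on the rest of the kernel. Hence
   there are two orthonormal parallel fields V_i with i_{V_i} T = 0.

   The metric duals of the V_i are closed, so they have a primitive F : M -> R^2.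
   Completeness gives flows of the V_i, which preserve all parallel tensors, and
   these flows split M isometrically as X x R^2 with X = F^{-1}(0). The forms
   Phi(V_1, V_2, ., .) and T restrict to parallel forms on X: the first one is
   the Kaehler form, and T is the characteristic torsion. The (3,0) + (0,3) part
   of T yields the W_1 component, and the rest is in W_3 because the contraction
   of T with the Kaehler form vanishes. Parallel transport of X,
   extended by the V_i, preserves Phi and T, so its holonomy algebra lies in the
   isotropy algebra of T. *)

(** * Calculus *)

(** The adapted frames in the hypotheses exist point by point without regularity, and the frame
    exhibiting the isotropy algebra need not be the one that puts the torsion in normal form. So
    every field is first built globally, by contractions of [T], [Phi] and the metric with constant
    coefficients, and frames only identify its values. Since [a1], [a2], [b1] do not depend on the
    point, a fixed polynomial in Q is the projector on its kernel. This needs the product of the two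
    other eigenvalues to be nonzero; it vanishes only for [a1 = 0], [b1 = - 2 a2], when the isotropy
    algebra contains elements whose common kernel is a line, whereas so(3) and su(3) annihilate a
    plane. Contracting [T] with [Phi] gives 24 a1 e_7 - 84 a2 e_8, which is zero if [a1 = a2 = 0];
    then the nonzero eigenvalues of Q are distinct, and the pull-back by Q reweights the components
    of [T] so that their contributions no longer cancel. Subtracting the square of the unit field so
    obtained from the kernel projector leaves a tensor u^T u, and the choice of the sign of u is a
    double covering of M. *)

Section Differentiability.
Context {R : realType}.
Implicit Types V W : normedModType R.

Lemma is_diff_littleo V W (f : V -> W) (x : V) (L : {linear V -> W}) :
  continuous L -> f \o shift x = cst (f x) + L +o_ (0 : V) id -> is_diff x f L.
Proof.
move=> cL E.
have D : 'd f x = L :> (V -> W) by exact: diff_unique.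
by apply: DiffDef => //; apply/diff_locallyP; rewrite D; split.
Qed.

(** A quadratic remainder is what can be estimated directly for local inverses, flows and primitives
    of closed forms; the differentiability of each of them is obtained from this criterion. *)
Lemma is_diff_quad V W (f : V -> W) (x : V) (L : {linear V -> W}) (C : R) :
  continuous L ->
  (\forall h \near 0, `|f (x + h) - f x - L h| <= C * `|h| ^+ 2) ->
  is_diff x f L.
Proof.
move=> cL hq.
have E : f \o shift x = cst (f x) + L +o_ (0 : V) id.
  apply/eqaddoP => e e0.
  have C0 : 0 < `|C| + 1 by rewrite ltr_pwDr.
  near=> h => /=.
  have -> : (f \o shift x - (cst (f x) + L)) h = f (x + h) - f x - L h.
    transitivity (f (h + x) - (f x + L h)) => //.
    by rewrite (addrC h x) opprD addrA.
  apply: (@le_trans _ _ (C * `|h| ^+ 2)); first by near: h.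
  rewrite expr2 mulrA ler_wpM2r //.
  apply: (@le_trans _ _ ((`|C| + 1) * `|h|)).
    by rewrite ler_wpM2r // ler_wpDr // ler_norm.
  rewrite -ler_pdivlMl // mulrC.
  by near: h; apply: nbhs0_le; rewrite divr_gt0.
exact: is_diff_littleo cL E.
Unshelve. all: by end_near. Qed.

Lemma is_derive_comp V W (g : R -> V) (f : V -> W) (t : R) (l : V) :
  differentiable f (g t) -> is_derive t 1 g l ->
  is_derive t 1 (f \o g) ('d f (g t) l).
Proof.
move=> df [/derivable1_diffP dg <-].
have dfg : differentiable (f \o g) t by exact: differentiable_comp.
apply: DeriveDef; first exact/derivable1_diffP.
by rewrite !deriveE // diff_comp.
Qed.

Lemma is_derive_line V W (f : V -> W) (x v : V) (t : R) :
  differentiable f (x + t *: v) ->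
  is_derive t 1 (fun s : R => f (x + s *: v)) ('D_v f (x + t *: v)).
Proof.
move=> df; rewrite deriveE //.
apply: (@is_derive_comp _ _ (fun s => x + s *: v) f) => //.
have : is_derive t 1 (cst x + (fun s : R => s *: v)) (0 + v).
  apply: is_deriveD.
  have dz : differentiable (fun s : R => s *: v) t by exact: differentiableZl.
  apply: DeriveDef; first exact/derivable1_diffP.
  by rewrite deriveE // diffZl //= diff_val scale1r.
by rewrite add0r.
Qed.

Lemma is_derive_mxP V m n (g : V -> 'M[R]_(m, n)) (t v : V) (l : 'M[R]_(m, n)) :
  is_derive t v g l <-> forall i j, is_derive t v (fun s => g s i j) (l i j).
Proof.
split=> [[dg <-] i j|H].
  rewrite derive_mx // mxE; apply: derivableP.
  exact: (derivable_mxP g t v).1.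
have dg : derivable g t v.
  by apply/derivable_mxP => i j; case: (H i j).
apply: DeriveDef => //; rewrite derive_mx //; apply/matrixP => i j.
by rewrite mxE; case: (H i j).
Qed.

Lemma differentiable_mxP V m n (f : V -> 'M[R]_(m, n)) (x : V) :
  differentiable f x <-> forall i j, differentiable (fun s => f s i j) x.
Proof.
split=> [df i j|H].
  exact: (differentiable_comp df (differentiable_coord _ i j)).
have -> : f = \sum_(i < m) \sum_(j < n) (fun s => f s i j *: delta_mx i j).
  apply/funext => s; rewrite [LHS]matrix_sum_delta fct_sumE.
  by apply: eq_bigr => i _; rewrite fct_sumE.
apply: differentiable_sum => i; apply: differentiable_sum => j.
exact: differentiableZl.
Qed.

Lemma mx_norm_leP m n (A : 'M[R]_(m, n)) (C : R) : 0 <= C ->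
  (`|A| <= C <-> forall i j, `|A i j| <= C).
Proof.
move=> C0; rewrite [`|A|]/Num.Def.normr /= mx_normrE; split=> [H i j|H].
  by apply: le_trans H; exact: (le_bigmax _ (fun ij => `|A ij.1 ij.2|) (i, j)).
by apply: bigmax_le => // ij _; exact: H.
Qed.

Lemma mx_norm_entry m n (A : 'M[R]_(m, n)) i j : `|A i j| <= `|A|.
Proof. by have [/(_ (lexx _) i j)] := @mx_norm_leP _ _ A _ (normr_ge0 A). Qed.

Lemma MVT_le (g dg : R -> R) (a b C : R) : a <= b ->
  (forall t, t \in `[a, b]%R -> is_derive t 1 g (dg t)) ->
  (forall t, t \in `[a, b]%R -> `|dg t| <= C) ->
  `|g b - g a| <= C * (b - a).
Proof.
move=> ab dgP dgC.
have dgP' t : t \in `]a, b[%R -> is_derive t 1 g (dg t).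
  by move=> /subset_itv_oo_cc; exact: dgP.
have cg : {within `[a, b], continuous g}.
  by apply: derivable_within_continuous => t /dgP[].
have [c cab ->] := MVT_segment ab dgP' cg.
rewrite normrM (ger0_norm (_ : 0 <= b - a)) ?subr_ge0 //.
by rewrite ler_wpM2r ?subr_ge0 //; exact: dgC.
Qed.

(** The norm is the maximum of the absolute values of the entries, so the scalar mean value theorem
    can be applied to each entry with the same constant. *)
Lemma mx_MVT m n (g dg : R -> 'M[R]_(m, n)) (a b C : R) : a <= b ->
  (forall t, t \in `[a, b]%R -> is_derive t 1 g (dg t)) ->
  (forall t, t \in `[a, b]%R -> `|dg t| <= C) ->
  `|g b - g a| <= C * (b - a).
Proof.
move=> ab dgP dgC.
have C0 : 0 <= C.
  by apply: le_trans (dgC a _); rewrite ?normr_ge0 // in_itv /= lexx.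
apply/mx_norm_leP; first by rewrite mulr_ge0 // subr_ge0.
move=> i j; rewrite !mxE.
apply: (@MVT_le (fun t => g t i j) (fun t => dg t i j)) => // t tab.
  exact: ((is_derive_mxP _ _ _ _).1 (dgP t tab)).
exact: le_trans (mx_norm_entry _ _ _) (dgC _ tab).
Qed.

Lemma is_derive0_cst m n (g : R -> 'M[R]_(m, n)) :
  (forall t : R, is_derive t 1 g 0) -> forall s t, g s = g t.
Proof.
move=> dg0; suff H s t : s <= t -> g s = g t.
  by move=> s t; case/orP: (le_total s t) => /H.
move=> st; apply/esym/eqP; rewrite -subr_eq0 -normr_le0.
have := @mx_MVT _ _ g (fun=> 0) s t 0 st (fun t _ => dg0 t).
by rewrite mul0r; apply=> u _; rewrite normr0.
Qed.

End Differentiability.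

(** * Closure properties of smooth maps *)

Section Smoothness.
Context {R : realType}.
Implicit Types V W : normedModType R.

(** Existence of [k] successive derivatives, the innermost taken first. The words of partial
    derivatives in [smooth_on] give no induction for products and composites; the order [k] does,
    and [smooth_onP] translates. *)
Fixpoint ck n V (k : nat) (A : set 'rV[R]_n) (f : 'rV[R]_n -> V) : Prop :=
  if k is k'.+1 then
    (forall x, A x -> differentiable f x) /\
    forall i, ck k' A (fun x => 'D_(delta_mx 0 i) f x)
  else True.

Lemma smooth_onP n V (A : set 'rV[R]_n) (f : 'rV[R]_n -> V) :
  smooth_on A f <-> forall k, ck k A f.
Proof.
split=> [sf k|H].
  elim: k f sf => //= k IH f sf; split; first by move=> x; exact: (sf [::]).
  move=> i; apply: IH => s x Ax.
  by have := sf (rcons s i) x Ax; rewrite /iter_partial foldr_rcons.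
move=> s; elim/last_ind: s f H => [|s i IH] f H x Ax.
  by have [/(_ x Ax)] := H 1%N.
rewrite /iter_partial foldr_rcons; apply: IH => // k.
by have [_ /(_ i)] := H k.+1.
Qed.

Lemma near_eq_diff V W (f g : V -> W) (x : V) :
  (\forall y \near x, f y = g y) -> differentiable f x -> is_diff x g ('d f x).
Proof.
move=> fg /diff_locallyP[c /eqaddoP e].
have E : g \o shift x = cst (g x) + 'd f x +o_ (0 : V) id.
  apply/eqaddoP => eps eps0; have := e eps eps0.
  have {}fg0 : f x = g x by exact: nbhs_singleton fg.
  have fgs : \forall h \near (0 : V), f (h + x) = g (h + x).
    by move: fg; rewrite (near_shift 0 x) subr0.
  apply: filterS2 fgs => h hE.
  suff -> : (f \o shift x - (cst (f x) + 'd f x)) h =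
            (g \o shift x - (cst (g x) + 'd f x)) h by [].
  by transitivity (f (h + x) - (f x + 'd f x h)) => //; rewrite hE fg0.
exact: is_diff_littleo c E.
Qed.

Lemma ck_ext n V k (A : set 'rV[R]_n) (f g : 'rV[R]_n -> V) : open A ->
  (forall x, A x -> f x = g x) -> ck k A f -> ck k A g.
Proof.
move=> oA; elim: k f g => //= k IH f g fg [df ckf].
have nfg x : A x -> \forall y \near x, f y = g y.
  by move=> Ax; apply: filterS (open_nbhs_nbhs (conj oA Ax)) => y /fg.
split=> [x Ax|i]; first by case: (near_eq_diff (nfg x Ax) (df x Ax)).
by apply: IH (ckf i) => x Ax; exact: near_eq_derive (nfg x Ax).
Qed.

Lemma ck_le n V k l (A : set 'rV[R]_n) (f : 'rV[R]_n -> V) :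
  (k <= l)%N -> ck l A f -> ck k A f.
Proof.
elim: k l f => //= k IH [//|l] f kl [df ckf].
by split=> // i; exact: IH (ckf i).
Qed.

Lemma ck_mxP n m p k (A : set 'rV[R]_n) (f : 'rV[R]_n -> 'M[R]_(m, p)) :
  open A -> (ck k A f <-> forall i j, ck k A (fun x => f x i j)).
Proof.
move=> oA; elim: k f => //= k IH f; split.
  move=> [df ckf] i j; split=> [x Ax|l].
    exact: (differentiable_mxP _ _).1 (df x Ax) i j.
  apply: (ck_ext oA _ ((IH _).1 (ckf l) i j)) => x Ax.
  by rewrite derive_mx ?mxE //; exact: diff_derivable (df x Ax).
move=> H; have df x : A x -> differentiable f x.
  by move=> Ax; apply/differentiable_mxP => i j; exact: (H i j).1.
split=> // l; apply/IH => i j.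
apply: (ck_ext oA _ ((H i j).2 l)) => x Ax.
by rewrite derive_mx ?mxE //; exact: diff_derivable (df x Ax).
Qed.

Lemma ck_cst n V k (A : set 'rV[R]_n) (c : V) : ck k A (fun=> c).
Proof.
elim: k c => //= k IH c; split=> [x _|i]; first exact: differentiable_cst.
have -> : (fun x : 'rV[R]_n => 'D_(delta_mx 0 i) (fun=> c) x) = fun=> 0.
  by apply/funext => x; exact: derive_cst.
exact: IH.
Qed.

Section Scalar.
Context {n : nat} {A : set 'rV[R]_n} (oA : open A).
Implicit Types f g : 'rV[R]_n -> R.

Lemma ckD k f g : ck k A f -> ck k A g -> ck k A (fun x => f x + g x).
Proof.
elim: k f g => //= k IH f g [df cf] [dg cg].
split=> [x Ax|i]; first by apply: differentiableD; [exact: df | exact: dg].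
apply: ck_ext oA _ (IH _ _ (cf i) (cg i)) => x Ax.
by rewrite -deriveD //; [exact: diff_derivable (df x Ax) | exact: diff_derivable (dg x Ax)].
Qed.

Lemma ckM k f g : ck k A f -> ck k A g -> ck k A (fun x => f x * g x).
Proof.
elim: k f g => //= k IH f g H1 H2.
have [cf cg] := (ck_le (leqnSn k) H1, ck_le (leqnSn k) H2).
move: H1 H2 => [df Df] [dg Dg].
split=> [x Ax|i]; first by apply: differentiableM; [exact: df | exact: dg].
apply: ck_ext oA _ (ckD (IH _ _ cf (Dg i)) (IH _ _ cg (Df i))) => x Ax.
have /= := deriveM (diff_derivable (v := delta_mx 0 i) (df x Ax)) (diff_derivable (dg x Ax)).
by move=> ->.
Qed.

Lemma ck_sum k (I : Type) (r : seq I) (P : pred I) (f : I -> 'rV[R]_n -> R) :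
  (forall i, P i -> ck k A (f i)) -> ck k A (fun x => \sum_(i <- r | P i) f i x).
Proof.
move=> H; elim: r => [|i r IH].
  by rewrite (_ : (fun _ => _) = fun=> 0); [exact: ck_cst | apply/funext => x; rewrite big_nil].
case E : (P i).
  by rewrite (_ : (fun _ => _) = fun x => f i x + \sum_(i <- r | P i) f i x);
    [exact: ckD (H i E) IH | apply/funext => x; rewrite big_cons E].
by rewrite (_ : (fun _ => _) = fun x => \sum_(i <- r | P i) f i x);
    [exact: IH | apply/funext => x; rewrite big_cons E].
Qed.

Lemma ck_prod k (I : Type) (r : seq I) (P : pred I) (f : I -> 'rV[R]_n -> R) :
  (forall i, P i -> ck k A (f i)) -> ck k A (fun x => \prod_(i <- r | P i) f i x).
Proof.
move=> H; elim: r => [|i r IH].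
  by rewrite (_ : (fun _ => _) = fun=> 1); [exact: ck_cst | apply/funext => x; rewrite big_nil].
case E : (P i).
  by rewrite (_ : (fun _ => _) = fun x => f i x * \prod_(i <- r | P i) f i x);
    [exact: ckM (H i E) IH | apply/funext => x; rewrite big_cons E].
by rewrite (_ : (fun _ => _) = fun x => \prod_(i <- r | P i) f i x);
    [exact: IH | apply/funext => x; rewrite big_cons E].
Qed.

(** The derivative - f^-2 f' involves only the inverse itself and one derivative of [f], so the
    induction hypothesis for the inverse yields its next order. [ck_sqrt] follows the same
    scheme. *)
Lemma ckV k f : (forall x, A x -> f x != 0) -> ck k A f ->
  ck k A (fun x => (f x)^-1).
Proof.
move=> f0; elim: k f f0 => //= k IH f f0 H1.
have cf := ck_le (leqnSn k) H1; move: H1 => [df Df].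
split=> [x Ax|i]; first by apply: differentiableV; [exact: df | exact: f0].
have cV := IH f f0 cf.
apply: ck_ext oA _ (ckM (ckM (@ck_cst _ _ _ _ (-1 : R)) (ckM cV cV)) (Df i)) => x Ax.
have /= := deriveV (f0 x Ax) (diff_derivable (v := delta_mx 0 i) (df x Ax)).
by move=> ->; rewrite -exprVn expr2 mulN1r.
Qed.

Lemma ck_sqrt k f : (forall x, A x -> 0 < f x) -> ck k A f ->
  ck k A (fun x => Num.sqrt (f x)).
Proof.
move=> f0; elim: k f f0 => //= k IH f f0 H1.
have cf := ck_le (leqnSn k) H1; move: H1 => [df Df].
have dsq x : A x -> is_derive (f x) 1 Num.sqrt (2 * Num.sqrt (f x))^-1.
  by move=> /f0; exact: is_derive1_sqrt.
have dS x : A x -> differentiable (fun x => Num.sqrt (f x)) x.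
  move=> Ax; apply: (differentiable_comp (df x Ax)).
  by apply/derivable1_diffP; case: (dsq x Ax).
split=> // i.
have sq0 x : A x -> 2 * Num.sqrt (f x) != 0.
  by move=> /f0 fx0; rewrite mulf_neq0 // gt_eqF // sqrtr_gt0.
have cV := ckV sq0 (ckM (@ck_cst _ _ _ _ (2 : R)) (IH f f0 cf)).
apply: ck_ext oA _ (ckM cV (Df i)) => x Ax.
rewrite [RHS]deriveE; last exact: dS.
rewrite (diff_comp (df x Ax)); last by apply/derivable1_diffP; case: (dsq x Ax).
rewrite /= deriveE; last exact: df.
rewrite diff1E; last by apply/derivable1_diffP; case: (dsq x Ax).
by rewrite derive1E; case: (dsq x Ax) => _ ->; rewrite mulrC.
Qed.

End Scalar.

Lemma diff_partial n V (g : 'rV[R]_n -> V) (y v : 'rV[R]_n) :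
  differentiable g y -> 'd g y v = \sum_(j < n) v 0 j *: 'D_(delta_mx 0 j) g y.
Proof.
move=> dg; rewrite [in LHS](row_sum_delta v) linear_sum; apply: eq_bigr => j _.
by rewrite linearZ /= deriveE.
Qed.

Lemma ck_comp n m k (A : set 'rV[R]_n) (B : set 'rV[R]_m)
    (f : 'rV[R]_n -> 'rV[R]_m) (g : 'rV[R]_m -> R) : open A ->
  (forall x, A x -> B (f x)) -> ck k A f -> ck k B g -> ck k A (g \o f).
Proof.
move=> oA AB; elim: k g => //= k IH g H1 H2.
have cf := ck_le (leqnSn k) (H1 : ck k.+1 A f).
move: H1 H2 => [df Df] [dg Dg].
split=> [x Ax|i].
  by apply: differentiable_comp; [exact: df | exact: dg (AB _ Ax)].
have H j : ck k A (fun x => ('D_(delta_mx 0 i) f x) 0 j * 'D_(delta_mx 0 j) g (f x)).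
  apply: ckM => //; first exact: ((ck_mxP _ _ oA).1 (Df i) 0 j).
  exact: IH (Dg j).
apply: ck_ext oA _ (ck_sum oA (index_enum 'I_m) (fun j _ => H j)) => x Ax.
rewrite [RHS]deriveE; last by apply: differentiable_comp; [exact: df | exact: dg (AB _ Ax)].
rewrite (diff_comp (df x Ax)) /=; last exact: dg (AB _ Ax).
rewrite diff_partial; last exact: dg (AB _ Ax).
by apply: eq_bigr => j _; rewrite -deriveE //; exact: df.
Qed.

End Smoothness.

Section SmoothOn.
Context {R : realType} {n : nat} {A : set 'rV[R]_n} (oA : open A).

Lemma smooth_on_ext (V : normedModType R) (f g : 'rV[R]_n -> V) :
  (forall x, A x -> f x = g x) -> smooth_on A f -> smooth_on A g.
Proof. by move=> fg /smooth_onP H; apply/smooth_onP => k; exact: ck_ext (H k). Qed.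

Lemma smooth_on_sub (V : normedModType R) B (f : 'rV[R]_n -> V) :
  B `<=` A -> smooth_on A f -> smooth_on B f.
Proof. by move=> BA H s x /BA; exact: H. Qed.

Lemma smooth_on_diff (V : normedModType R) (f : 'rV[R]_n -> V) x :
  smooth_on A f -> A x -> differentiable f x.
Proof. by move=> H; exact: (H [::]). Qed.

Lemma smooth_on_partial (V : normedModType R) (f : 'rV[R]_n -> V) i :
  smooth_on A f -> smooth_on A (fun x => 'D_(delta_mx 0 i) f x).
Proof. by move=> /smooth_onP H; apply/smooth_onP => k; exact: (H k.+1).2. Qed.

Lemma smooth_on_mxP m p (f : 'rV[R]_n -> 'M[R]_(m, p)) :
  smooth_on A f <-> forall i j, smooth_on A (fun x => f x i j).
Proof.
split=> [/smooth_onP H i j|H]; apply/smooth_onP => k.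
  exact: (ck_mxP _ _ oA).1 (H k) i j.
by apply/(ck_mxP _ _ oA) => i j; move: (H i j) => /smooth_onP.
Qed.

Lemma smooth_on_cst (V : normedModType R) (c : V) : smooth_on A (fun=> c).
Proof. by apply/smooth_onP => k; exact: ck_cst. Qed.

Section Scal.
Implicit Types f g : 'rV[R]_n -> R.

Lemma smooth_onD f g :
  smooth_on A f -> smooth_on A g -> smooth_on A (fun x => f x + g x).
Proof. by move=> /smooth_onP H /smooth_onP G; apply/smooth_onP => k; exact: ckD. Qed.

Lemma smooth_onM f g :
  smooth_on A f -> smooth_on A g -> smooth_on A (fun x => f x * g x).
Proof. by move=> /smooth_onP H /smooth_onP G; apply/smooth_onP => k; exact: ckM. Qed.

Lemma smooth_onN f : smooth_on A f -> smooth_on A (fun x => - f x).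
Proof.
move=> H; apply: smooth_on_ext (smooth_onM (smooth_on_cst (-1 : R)) H) => x _.
exact: mulN1r.
Qed.

Lemma smooth_on_sum (I : Type) (r : seq I) (P : pred I) (f : I -> 'rV[R]_n -> R) :
  (forall i, P i -> smooth_on A (f i)) ->
  smooth_on A (fun x => \sum_(i <- r | P i) f i x).
Proof.
move=> H; apply/smooth_onP => k; apply: ck_sum => // i Pi.
by move: (H i Pi) => /smooth_onP.
Qed.

Lemma smooth_on_prod (I : Type) (r : seq I) (P : pred I) (f : I -> 'rV[R]_n -> R) :
  (forall i, P i -> smooth_on A (f i)) ->
  smooth_on A (fun x => \prod_(i <- r | P i) f i x).
Proof.
move=> H; apply/smooth_onP => k; apply: ck_prod => // i Pi.
by move: (H i Pi) => /smooth_onP.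
Qed.

Lemma smooth_onV f : (forall x, A x -> f x != 0) ->
  smooth_on A f -> smooth_on A (fun x => (f x)^-1).
Proof. by move=> f0 /smooth_onP H; apply/smooth_onP => k; exact: ckV. Qed.

Lemma smooth_on_sqrt f : (forall x, A x -> 0 < f x) ->
  smooth_on A f -> smooth_on A (fun x => Num.sqrt (f x)).
Proof. by move=> f0 /smooth_onP H; apply/smooth_onP => k; exact: ck_sqrt. Qed.

End Scal.

Lemma smooth_on_linear m p (f : {linear 'rV[R]_n -> 'M[R]_(m, p)}) :
  smooth_on A f.
Proof.
apply/smooth_on_mxP => i j.
have E (x : 'rV[R]_n) : \sum_(l < n) x 0 l * f (delta_mx 0 l) i j = f x i j.
  rewrite [in RHS](row_sum_delta x) linear_sum summxE.
  by apply: eq_bigr => l _; rewrite linearZ mxE.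
apply: smooth_on_ext => [x _|]; first exact: E.
apply: smooth_on_sum => l _; apply: smooth_onM; last exact: smooth_on_cst.
apply/smooth_onP => k; case: k => // k /=; split=> [x _|i'].
  exact: differentiable_coord.
have -> : (fun x : 'rV[R]_n => 'D_(delta_mx 0 i') (fun y : 'rV[R]_n => y 0 l : R) x) =
          fun=> (i' == l)%:R.
  apply/funext => x.
  have := @derive_mx _ _ _ _ (fun y : 'rV[R]_n => y) x (delta_mx 0 i') (@derivable_id _ _ _ _).
  move=> /matrixP /(_ 0 l); rewrite derive_id !mxE /= => <-.
  by rewrite eq_sym.
exact: ck_cst.
Qed.

Lemma smooth_on_id : smooth_on A id.
Proof. exact: (@smooth_on_linear _ _ idfun). Qed.

Lemma smooth_on_coord i : smooth_on A (fun x : 'rV[R]_n => x 0 i).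
Proof. by have /smooth_on_mxP := smooth_on_id; apply. Qed.

Section Mx.
Implicit Types m p q : nat.

Lemma smooth_on_addmx m p (f g : 'rV[R]_n -> 'M[R]_(m, p)) :
  smooth_on A f -> smooth_on A g -> smooth_on A (fun x => f x + g x).
Proof.
move=> /smooth_on_mxP H /smooth_on_mxP G; apply/smooth_on_mxP => i j.
by apply: smooth_on_ext (smooth_onD (H i j) (G i j)) => x _; rewrite mxE.
Qed.

Lemma smooth_on_scalemx m p (k : 'rV[R]_n -> R) (g : 'rV[R]_n -> 'M[R]_(m, p)) :
  smooth_on A k -> smooth_on A g -> smooth_on A (fun x => k x *: g x).
Proof.
move=> H /smooth_on_mxP G; apply/smooth_on_mxP => i j.
by apply: smooth_on_ext (smooth_onM H (G i j)) => x _; rewrite mxE.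
Qed.

Lemma smooth_on_oppmx m p (g : 'rV[R]_n -> 'M[R]_(m, p)) :
  smooth_on A g -> smooth_on A (fun x => - g x).
Proof.
move=> /smooth_on_mxP G; apply/smooth_on_mxP => i j.
by apply: smooth_on_ext (smooth_onN (G i j)) => x _; rewrite mxE.
Qed.

Lemma smooth_on_trmx m p (f : 'rV[R]_n -> 'M[R]_(m, p)) :
  smooth_on A f -> smooth_on A (fun x => (f x)^T).
Proof.
move=> /smooth_on_mxP H; apply/smooth_on_mxP => i j.
by apply: smooth_on_ext (H j i) => x _; rewrite mxE.
Qed.

Lemma smooth_on_mulmx m p q (f : 'rV[R]_n -> 'M[R]_(m, p))
    (g : 'rV[R]_n -> 'M[R]_(p, q)) :
  smooth_on A f -> smooth_on A g -> smooth_on A (fun x => f x *m g x).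
Proof.
move=> /smooth_on_mxP H /smooth_on_mxP G; apply/smooth_on_mxP => i j.
apply: (@smooth_on_ext _ (fun x => \sum_k f x i k * g x k j)).
  by move=> x _; rewrite mxE.
by apply: smooth_on_sum => k _; exact: smooth_onM.
Qed.

Lemma smooth_on_det m (f : 'rV[R]_n -> 'M[R]_m) :
  smooth_on A f -> smooth_on A (fun x => \det (f x)).
Proof.
move=> /smooth_on_mxP H; apply: smooth_on_sum => s _.
by apply: smooth_onM; [exact: smooth_on_cst | apply: smooth_on_prod].
Qed.

Lemma smooth_on_invmx m (f : 'rV[R]_n -> 'M[R]_m) :
  (forall x, A x -> f x \in unitmx) ->
  smooth_on A f -> smooth_on A (fun x => invmx (f x)).
Proof.
move=> fU sf; have /smooth_on_mxP H := sf; apply/smooth_on_mxP => i j.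
apply: (@smooth_on_ext _ (fun x => (\det (f x))^-1 *
   ((-1) ^+ (j + i) * \det (row' j (col' i (f x)))))).
  by move=> x Ax; rewrite /invmx fU // !mxE.
apply: smooth_onM.
  apply: smooth_onV; last exact: smooth_on_det.
  by move=> x /fU; rewrite unitmxE unitfE.
apply: smooth_onM; first exact: smooth_on_cst.
apply: smooth_on_det; apply/smooth_on_mxP => a b.
by apply: smooth_on_ext (H (lift j a) (lift i b)) => x _; rewrite !mxE.
Qed.

Lemma smooth_on_col_mx m p q (f : 'rV[R]_n -> 'M[R]_(m, q))
    (g : 'rV[R]_n -> 'M[R]_(p, q)) :
  smooth_on A f -> smooth_on A g -> smooth_on A (fun x => col_mx (f x) (g x)).
Proof.
move=> /smooth_on_mxP H /smooth_on_mxP G; apply/smooth_on_mxP => i j.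
rewrite -[i]fintype.splitK; case: (fintype.split i) => k /=.
  by apply: smooth_on_ext (H k j) => x _; rewrite col_mxEu.
by apply: smooth_on_ext (G k j) => x _; rewrite col_mxEd.
Qed.

Lemma smooth_on_row_mx m p q (f : 'rV[R]_n -> 'M[R]_(m, p))
    (g : 'rV[R]_n -> 'M[R]_(m, q)) :
  smooth_on A f -> smooth_on A g -> smooth_on A (fun x => row_mx (f x) (g x)).
Proof.
move=> /smooth_on_trmx H /smooth_on_trmx G.
apply: smooth_on_ext (smooth_on_trmx (smooth_on_col_mx H G)) => x _.
by rewrite tr_col_mx !trmxK.
Qed.

End Mx.

Lemma smooth_on_compR m (B : set 'rV[R]_m) (f : 'rV[R]_n -> 'rV[R]_m)
    (g : 'rV[R]_m -> R) :
  (forall x, A x -> B (f x)) -> smooth_on A f -> smooth_on B g ->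
  smooth_on A (g \o f).
Proof.
move=> AB /smooth_onP F /smooth_onP G; apply/smooth_onP => k.
exact: ck_comp (G k).
Qed.

End SmoothOn.

Lemma smooth_on_comp {R : realType} n m p q (A : set 'rV[R]_n) (B : set 'rV[R]_m)
    (f : 'rV[R]_n -> 'rV[R]_m) (g : 'rV[R]_m -> 'M[R]_(p, q)) :
  open A -> open B ->
  (forall x, A x -> B (f x)) -> smooth_on A f -> smooth_on B g ->
  smooth_on A (g \o f).
Proof.
move=> oA oB AB F G; apply/(smooth_on_mxP oA) => i j.
exact: (smooth_on_compR oA AB F ((smooth_on_mxP oB _).1 G i j)).
Qed.

(** * Symmetry of second derivatives and estimates with uniform constants *)

Section Taylor.
Context {R : realType}.

Let e n (k : 'I_n) : 'rV[R]_n := delta_mx 0 k.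

Lemma norm_delta n (k : 'I_n) : `|e k| <= 1.
Proof.
apply/mx_norm_leP => // i j; rewrite mxE.
by case: (_ && _); rewrite ?normr1 ?normr0.
Qed.

Lemma is_derive_mulrc (c t : R) : is_derive t 1 (fun s : R => s * c) c.
Proof.
apply: is_derive_eq (is_deriveM (is_derive_id t 1) (is_derive_cst c t 1)) _.
by rewrite scaler0 add0r [_ *: _]mulr1.
Qed.

(** The second difference over a square of side [h] is h^2 times the mixed derivative up to o(h^2).
    The mean value inequality is applied to one side of the square, and the derivative in direction
    [l] is expanded to first order at [x]. *)
Lemma young_aux n (f : 'rV[R]_n -> R) (x : 'rV[R]_n) k l (eps : R) :
  0 < eps -> (\forall y \near x, differentiable f y) ->
  differentiable (fun y => 'D_(e l) f y) x ->
  exists2 d, 0 < d & forall h, 0 < h -> h < d ->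
    `|f (x + h *: e k + h *: e l) - f (x + h *: e k) - f (x + h *: e l) + f x
      - h ^+ 2 * 'D_(e k) (fun y => 'D_(e l) f y) x| <= 3 * eps * h ^+ 2.
Proof.
move=> eps0 df dDf; pose D y := 'D_(e l) f y.
have /diff_locallyP[_ /eqaddoP /(_ eps eps0)] := dDf.
rewrite -/D => Hd.
have df0 : \forall v \near (0 : 'rV[R]_n), differentiable f (v + x).
  by move: df; rewrite (near_shift 0 x) subr0.
have [d /= d0 dP] := (nbhs_ballP _ _).1 (filterI df0 Hd).
have inb (h a b : R) : 0 < h -> h < d / 2 -> `|a| <= h -> `|b| <= h ->
    ball (0 : 'rV[R]_n) d (a *: e k + b *: e l).
  move=> h0 hd ah bh; rewrite -ball_normE /ball_ /= sub0r normrN.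
  apply: le_lt_trans (ler_normD _ _) _; rewrite !normrZ.
  have := ler_pM (normr_ge0 a) (normr_ge0 (e k)) ah (norm_delta k).
  have := ler_pM (normr_ge0 b) (normr_ge0 (e l)) bh (norm_delta l).
  by rewrite !mulr1; lra.
have est v : ball 0 d v -> `|D (v + x) - D x - 'd D x v| <= eps * `|v|.
  by move=> /dP[_]; rewrite opprD addrA.
exists (d / 2); first by rewrite divr_gt0.
move=> h h0 hd.
have in0 : 0 <= h by exact: ltW.
pose g t := f (x + h *: e k + t *: e l) - f (x + t *: e l) - t * (h * 'D_(e k) D x).
pose dg t := D (x + h *: e k + t *: e l) - D (x + t *: e l) - h * 'D_(e k) D x.
have dif a b : `|a| <= h -> `|b| <= h -> differentiable f (x + a *: e k + b *: e l).
  move=> ah bh; rewrite -addrA addrC.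
  by have [] := dP _ (inb h a b h0 hd ah bh).
have dgP t : t \in `[0, h]%R -> is_derive t 1 g (dg t).
  rewrite in_itv /= => /andP[t0 th].
  have tn : `|t| <= h by rewrite ger0_norm.
  rewrite /g /dg; apply: is_deriveB.
    apply: is_deriveB.
      by apply: (is_derive_line (x := x + h *: e k)); apply: dif => //; rewrite ger0_norm.
    apply: (is_derive_line (x := x)).
    by have := dif 0 t; rewrite scale0r addr0 normr0; exact.
  exact: is_derive_mulrc.
(* The difference of two remainders of the expansion of [D] at [x], for displacements of norm at
   most 2h and h; whence the factor 3. *)
have dgC t : t \in `[0, h]%R -> `|dg t| <= 3 * eps * h.
  rewrite in_itv /= => /andP[t0 th].
  have tn : `|t| <= h by rewrite ger0_norm.
  have hn : `|h| <= h by rewrite ger0_norm.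
  have z0 : `|0 : R| <= h by rewrite normr0.
  have b1 := inb h h t h0 hd hn tn.
  have b2 := inb h 0 t h0 hd z0 tn.
  have E1 := est _ b1; have E2 := est _ b2.
  have n1 : `|h *: e k + t *: e l| <= 2 * h.
    apply: le_trans (ler_normD _ _) _; rewrite !normrZ.
    have := ler_pM (normr_ge0 h) (normr_ge0 (e k)) hn (norm_delta k).
    have := ler_pM (normr_ge0 t) (normr_ge0 (e l)) tn (norm_delta l).
    by rewrite !mulr1; lra.
  have n2 : `|0 *: e k + t *: e l| <= h.
    rewrite scale0r add0r normrZ.
    have := ler_pM (normr_ge0 t) (normr_ge0 (e l)) tn (norm_delta l).
    by rewrite !mulr1.
  have -> : dg t = (D ((h *: e k + t *: e l) + x) - D x - 'd D x (h *: e k + t *: e l)) -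
         (D ((0 *: e k + t *: e l) + x) - D x - 'd D x (0 *: e k + t *: e l)).
    have dE (a b : R) : 'd D x (a *: e k + b *: e l) = a * 'D_(e k) D x + b * 'D_(e l) D x.
      by rewrite linearD !linearZ /= !deriveE.
    have alg (a b y c d' : R) :
      a - b - h * c = (a - y - (h * c + t * d')) - (b - y - (0 * c + t * d')) by ring.
    rewrite !dE scale0r add0r (addrC _ x) (addrC _ x) addrA; exact: alg.
  apply: le_trans (ler_normB _ _) _.
  apply: le_trans (lerD E1 E2) _.
  have := ler_wpM2l (ltW eps0) n1; have := ler_wpM2l (ltW eps0) n2.
  by rewrite mulrA; lra.
have := MVT_le (ltW h0) dgP dgC; rewrite subr0.
have -> : g h - g 0 = f (x + h *: e k + h *: e l) - f (x + h *: e k) -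
  f (x + h *: e l) + f x - h ^+ 2 * 'D_(e k) D x.
  by rewrite /g scale0r !addr0; ring.
by rewrite -mulrA -expr2.
Qed.

(** The second difference is symmetric in the two directions, so [young_aux] compares both mixed
    derivatives with the same number. *)
Lemma young n (A : set 'rV[R]_n) (f : 'rV[R]_n -> R) (x : 'rV[R]_n) i j :
  open A -> smooth_on A f -> A x ->
  'D_(delta_mx 0 i) (fun y => 'D_(delta_mx 0 j) f y) x =
  'D_(delta_mx 0 j) (fun y => 'D_(delta_mx 0 i) f y) x.
Proof.
move=> oA sf Ax.
have df : \forall y \near x, differentiable f y.
  apply: filterS (open_nbhs_nbhs (conj oA Ax)) => y; exact: smooth_on_diff sf.
have dD k : differentiable (fun y => 'D_(e k) f y) x.
  exact: smooth_on_diff (smooth_on_partial k sf) Ax.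
apply/eqP; rewrite -subr_eq0 -normr_le0; apply/ler_addgt0Pr => eps eps0.
(* Two applications of [young_aux], each with factor 3, add up to [eps]. *)
have eps6 : 0 < eps / 6 by rewrite divr_gt0.
have [d1 d10 H1] := young_aux i eps6 df (dD j).
have [d2 d20 H2] := young_aux j eps6 df (dD i).
pose h := Num.min d1 d2 / 2.
have h0 : 0 < h by rewrite divr_gt0 // lt_min d10.
have m1 : Num.min d1 d2 <= d1 by rewrite ge_min lexx.
have m2 : Num.min d1 d2 <= d2 by rewrite ge_min lexx orbT.
have hd1 : h < d1 by rewrite /h in h0 *; lra.
have hd2 : h < d2 by rewrite /h in h0 *; lra.
have := H1 h h0 hd1; have := H2 h h0 hd2.
rewrite -/(e i) -/(e j) (addrAC x (h *: e j)).
set a := 'D_(e i) _ x; set b := 'D_(e j) _ x; set F := f (x + _ + _).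
set Fi := f (x + h *: e i); set Fj := f (x + h *: e j) => K2 K1.
have h20 : 0 < h ^+ 2 by rewrite exprn_gt0.
rewrite add0r -(ler_pM2l h20) -{1}(gtr0_norm h20) -normrM.
have alg (F' G H y a' b' h' : R) : h' * (a' - b') =
    (F' - H - G + y - h' * b') - (F' - G - H + y - h' * a') by ring.
rewrite (alg F Fi Fj (f x)).
apply: le_trans (ler_normB _ _) _; apply: le_trans (lerD K2 K1) _.
by rewrite le_eqVlt; apply/orP; left; apply/eqP; field.
Qed.

Lemma cball_convex (V : normedModType R) (a : V) (r : R) (x y : V) (t : R) : `|x - a| <= r -> `|y - a| <= r ->
  0 <= t <= 1 -> `|x + t *: (y - x) - a| <= r.
Proof.
move=> xr yr /andP[t0 t1].
have -> : x + t *: (y - x) - a = (1 - t) *: (x - a) + t *: (y - a).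
  rewrite [in RHS]scalerBl scale1r -[RHS]addrA [X in _ = _ + X]addrC -scalerBr opprB addrA subrK.
  exact: addrAC.
apply: le_trans (ler_normD _ _) _; rewrite !normrZ !ger0_norm ?subr_ge0 //.
have : (1 - t) * `|x - a| <= (1 - t) * r by rewrite ler_wpM2l // subr_ge0.
have : t * `|y - a| <= t * r by rewrite ler_wpM2l.
by lra.
Qed.

Lemma mx_MVT01 m n (g dg : R -> 'M[R]_(m, n)) (C : R) :
  (forall t : R, 0 <= t <= 1 -> is_derive t 1 g (dg t)) ->
  (forall t : R, 0 <= t <= 1 -> `|dg t| <= C) -> `|g 1 - g 0| <= C.
Proof.
move=> dgP dgC; have := @mx_MVT R m n g dg 0 1 C ler01.
rewrite subr0 mulr1; by apply=> t; rewrite in_itv /=; first [exact: dgC | exact: dgP].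
Qed.

Lemma cball_lipschitz n m p (f : 'rV[R]_n -> 'M[R]_(m, p)) (a : 'rV[R]_n) (r C : R) :
  (forall z, `|z - a| <= r -> differentiable f z) ->
  (forall z v, `|z - a| <= r -> `|'d f z v| <= C * `|v|) ->
  forall x y, `|x - a| <= r -> `|y - a| <= r -> `|f y - f x| <= C * `|y - x|.
Proof.
move=> df dC x y xr yr; pose g (t : R) := f (x + t *: (y - x)).
have -> : f y - f x = g 1 - g 0 by rewrite /g scale1r scale0r addr0 addrCA subrr addr0.
pose dg (t : R) := 'D_(y - x) f (x + t *: (y - x)).
apply: (@mx_MVT01 _ _ g dg) => t t01; have H := cball_convex xr yr t01.
  by apply: is_derive_line; exact: df.
by rewrite /dg deriveE; [exact: dC | exact: df].
Qed.

Lemma cball_closed n (a : 'rV[R]_n) (r : R) :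
  closed [set x : 'rV[R]_n | `|x - a| <= r].
Proof.
have -> : [set x : 'rV[R]_n | `|x - a| <= r] =
    (fun x : 'rV[R]_n => `|x - a|) @^-1` [set s | s <= r] by [].
apply: closed_comp => [x _|]; last exact: closed_le.
apply: (@continuous_comp _ _ _ (fun x : 'rV[R]_n => x - a) Num.norm); last exact: norm_continuous.
have dx : differentiable (fun y : 'rV[R]_n => y - a) x.
  apply: (smooth_on_diff (A := setT)) => //.
  by apply: (smooth_on_addmx openT); [exact: smooth_on_id openT | exact: smooth_on_cst].
exact: differentiable_continuous dx.
Qed.

Lemma cball_compact n (a : 'rV[R]_n) (r : R) :
  compact [set x : 'rV[R]_n | `|x - a| <= r].
Proof.
apply: bounded_closed_compact; last exact: cball_closed.
exists (r + `|a|); split; first exact: num_real.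
move=> s rs x /= Kx; apply: le_trans (ltW rs).
by rewrite -[x](subrK a); apply: le_trans (ler_normD _ _) _; rewrite lerD2r.
Qed.

Section Convex.
Context {n m p : nat} {A : set 'rV[R]_n}.
Context {a : 'rV[R]_n} {r : R} (aA : forall y, `|y - a| <= r -> A y).
Variable f : 'rV[R]_n -> 'M[R]_(m, p).
Hypothesis sf : smooth_on A f.

Lemma cball_bounded : exists2 C, 0 <= C & forall x, `|x - a| <= r -> `|f x| <= C.
Proof.
have [r0|r0] := leP 0 r; last first.
  exists 0 => // x xr; have := le_lt_trans xr r0.
  by rewrite ltNge normr_ge0.
pose K := [set x : 'rV[R]_n | `|x - a| <= r].
have cK : compact K by exact: cball_compact.
have K0 : K !=set0 by exists a; rewrite /K /= subrr normr0.
have cf : {within K, continuous (fun x => `|f x|)}.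
  apply: continuous_in_subspaceT => x /[1!inE] Kx.
  apply: (@continuous_comp _ _ _ f Num.norm); last exact: norm_continuous.
  exact/differentiable_continuous/(smooth_on_diff sf)/aA.
have [c cK' H] := compact_EVT_max K0 cK cf.
exists `|f c|; first exact: normr_ge0.
by move=> x xr; apply: H; rewrite inE.
Qed.

End Convex.

Section Bounds.
Context {n m p : nat} {A : set 'rV[R]_n}.
Context {a : 'rV[R]_n} {r : R} (aA : forall y, `|y - a| <= r -> A y).
Variable f : 'rV[R]_n -> 'M[R]_(m, p).
Hypothesis sf : smooth_on A f.

Lemma diff_bounded : exists2 C, 0 <= C & forall x v, `|x - a| <= r ->
  `|'d f x v| <= C * `|v|.
Proof.
have H i : exists2 C, 0 <= C & forall x, `|x - a| <= r -> `|'D_(e i) f x| <= C.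
  exact: cball_bounded (smooth_on_partial i sf).
pose C i := projT1 (cid2 (H i)).
have CP i x : `|x - a| <= r -> `|'D_(e i) f x| <= C i.
  by rewrite /C; case: (cid2 (H i)) => /= c _; exact.
have C0 i : 0 <= C i by rewrite /C; case: (cid2 (H i)).
exists (\sum_i C i) => [|x v xr]; first exact: sumr_ge0.
rewrite diff_partial; last exact/(smooth_on_diff sf)/aA.
apply: le_trans (ler_norm_sum _ _ _) _; rewrite mulr_suml; apply: ler_sum => i _.
by rewrite normrZ mulrC ler_pM // ?CP // mx_norm_entry.
Qed.

Lemma smooth_lipschitz : exists2 C, 0 <= C & forall x y, `|x - a| <= r ->
  `|y - a| <= r -> `|f y - f x| <= C * `|y - x|.
Proof.
have [C C0 CP] := diff_bounded; exists C => //; apply: cball_lipschitz => // z zr.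
exact/(smooth_on_diff sf)/aA.
Qed.

End Bounds.

(** The constant is uniform on the ball. The mean value inequality is applied along the segment to
    [f] minus its linear part at [x]; the derivative of this difference is bounded through the
    Lipschitz constants of the partial derivatives. *)
Lemma smooth_quadratic {n m p : nat} {A : set 'rV[R]_n}
    {a : 'rV[R]_n} {r : R} (aA : forall y, `|y - a| <= r -> A y)
    (f : 'rV[R]_n -> 'M[R]_(m, p)) (sf : smooth_on A f) :
  exists2 C, 0 <= C & forall x y, `|x - a| <= r -> `|y - a| <= r ->
  `|f y - f x - 'd f x (y - x)| <= C * `|y - x| ^+ 2.
Proof.
have H i : exists2 C, 0 <= C & forall x y, `|x - a| <= r -> `|y - a| <= r ->
    `|'D_(e i) f y - 'D_(e i) f x| <= C * `|y - x|.
  exact: smooth_lipschitz (smooth_on_partial i sf).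
pose C i := projT1 (cid2 (H i)).
have CP i x y : `|x - a| <= r -> `|y - a| <= r ->
    `|'D_(e i) f y - 'D_(e i) f x| <= C i * `|y - x|.
  by rewrite /C; case: (cid2 (H i)) => /= c _; exact.
have C0 i : 0 <= C i by rewrite /C; case: (cid2 (H i)).
exists (\sum_i C i) => [|x y xr yr]; first exact: sumr_ge0.
have df z : `|z - a| <= r -> differentiable f z by move=> /aA; exact: smooth_on_diff sf.
pose g (t : R) := f (x + t *: (y - x)) - t *: 'd f x (y - x).
have -> : f y - f x - 'd f x (y - x) = g 1 - g 0.
  by rewrite /g !scale1r !scale0r addr0 subr0 addrCA subrr addr0 addrAC.
pose dg (t : R) := 'D_(y - x) f (x + t *: (y - x)) - 'd f x (y - x).
apply: (@mx_MVT01 _ _ g dg) => t t01; have Hb := cball_convex xr yr t01.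
  apply: is_deriveB; first by apply: is_derive_line; exact: df.
  apply/is_derive_mxP => i j; rewrite (_ : (fun _ => _) = fun s : R => s * 'd f x (y - x) i j).
    exact: is_derive_mulrc.
  by apply/funext => s; rewrite mxE.
rewrite /dg deriveE; last exact: df.
have E1 := diff_partial (y - x) (df _ Hb).
have E2 := diff_partial (y - x) (df _ xr).
have -> : 'd f (x + t *: (y - x)) (y - x) - 'd f x (y - x) = \sum_(i < n)
    ((y - x) 0 i *: 'D_(e i) f (x + t *: (y - x)) - (y - x) 0 i *: 'D_(e i) f x).
  by rewrite sumrB; congr (_ - _); [exact: E1 | exact: E2].
rewrite mulr_suml; apply: le_trans (ler_norm_sum _ _ _) _; apply: ler_sum => i _.
rewrite -scalerBr normrZ mulrC expr2 mulrA ler_pM // ?mx_norm_entry //.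
apply: le_trans (CP _ _ _ xr Hb) _; rewrite addrAC subrr add0r normrZ.
rewrite ler_wpM2l // ler_piMl //; case/andP: t01 => t0 t1.
by rewrite ger0_norm.
Qed.

End Taylor.

Lemma open_setI_preimage (T S : topologicalType) (f : T -> S) (V : set T) (W : set S) :
  open V -> open W -> (forall x, V x -> {for x, continuous f}) ->
  open [set x | V x /\ W (f x)].
Proof.
move=> oV oW cf; rewrite openE => x [Vx Wfx].
have n1 : nbhs x V by exact: open_nbhs_nbhs (conj oV Vx).
have n2 : nbhs x (f @^-1` W) by apply: cf => //; exact: open_nbhs_nbhs (conj oW Wfx).
exact: filterI n1 n2.
Qed.

(** * The inverse function theorem *)

Section InverseFunction.
Context {R : realType}.

Lemma oball_open n (a : 'rV[R]_n) (r : R) : open [set x : 'rV[R]_n | `|x - a| < r].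
Proof.
have -> : [set x : 'rV[R]_n | `|x - a| < r] = ball a r; last exact: ball_open.
by apply/seteqP; split=> x; rewrite -ball_normE /ball_ /= distrC.
Qed.

Lemma open_cball n (A : set 'rV[R]_n) (a : 'rV[R]_n) : open A -> A a ->
  exists2 r, 0 < r & forall y, `|y - a| <= r -> A y.
Proof.
move=> oA Aa; have /nbhs_ballP[r /= r0 rA] := open_nbhs_nbhs (conj oA Aa).
exists (r / 2) => [|y yr]; first by rewrite divr_gt0.
apply: rA; rewrite -ball_normE /ball_ /= distrC; apply: le_lt_trans yr _.
by rewrite gtr_pMr // invf_lt1 // ltr1n.
Qed.

Lemma mulmx_norm_le m n (A : 'M[R]_(m, n)) :
  exists2 C, 0 <= C & forall v : 'rV[R]_m, `|v *m A| <= C * `|v|.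
Proof.
exists (\sum_i \sum_j `|A i j|) => [|v].
  by apply: sumr_ge0 => i _; apply: sumr_ge0.
apply/mx_norm_leP => [|i j]; first by rewrite mulr_ge0 // sumr_ge0 // => i _; apply: sumr_ge0.
rewrite mxE; apply: le_trans (ler_norm_sum _ _ _) _; rewrite mulr_suml; apply: ler_sum => k _.
rewrite normrM mulrC ler_pM ?normr_ge0 // ?mx_norm_entry //.
by rewrite (bigD1 j) //= lerDl sumr_ge0.
Qed.

Lemma mulmxr_continuous m n (A : 'M[R]_(m, n)) :
  continuous (mulmxr A : 'rV[R]_m -> 'rV[R]_n).
Proof.
move=> x; apply: differentiable_continuous.
apply: (smooth_on_diff (A := setT)) => //.
exact: (smooth_on_linear openT (mulmxr A : {linear 'rV[R]_m -> 'rV[R]_n})).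
Qed.

Lemma diff_jacobian n m (f : 'rV[R]_n -> 'rV[R]_m) x v :
  'd f x v = v *m jacobian f x.
Proof. by rewrite /jacobian mul_rV_lin1. Qed.

Lemma jacobianE n m (f : 'rV[R]_n -> 'rV[R]_m) x i j : differentiable f x ->
  jacobian f x i j = 'D_(delta_mx 0 i) f x 0 j.
Proof. by move=> df; rewrite deriveE // mxE. Qed.

Lemma smooth_on_jacobian n m (A : set 'rV[R]_n) (f : 'rV[R]_n -> 'rV[R]_m) :
  open A -> smooth_on A f -> smooth_on A (jacobian f).
Proof.
move=> oA sf; apply/(smooth_on_mxP oA) => i j.
have := (smooth_on_mxP oA _).1 (smooth_on_partial i sf) 0 j.
apply: smooth_on_ext => // x Ax; rewrite jacobianE //.
exact: smooth_on_diff sf Ax.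
Qed.

Lemma jacobian_comp n m p (f : 'rV[R]_n -> 'rV[R]_m) (g : 'rV[R]_m -> 'rV[R]_p) x :
  differentiable f x -> differentiable g (f x) ->
  jacobian (g \o f) x = jacobian f x *m jacobian g (f x).
Proof.
move=> df dg; apply/row_matrixP => i; rewrite rowE -diff_jacobian diff_comp //=.
by rewrite [RHS]rowE mulmxA -!diff_jacobian.
Qed.

Lemma jacobian_comp_at n m p (f : 'rV[R]_n -> 'rV[R]_m) (g : 'rV[R]_m -> 'rV[R]_p) x y :
  f x = y -> differentiable f x -> differentiable g y ->
  jacobian (g \o f) x = jacobian f x *m jacobian g y.
Proof. by move=> <-; exact: jacobian_comp. Qed.

Lemma near_eq_jacobian n m (f g : 'rV[R]_n -> 'rV[R]_m) x :
  (\forall y \near x, f y = g y) -> differentiable f x -> jacobian g x = jacobian f x.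
Proof.
move=> fg df; have [_ E] := near_eq_diff fg df.
apply/row_matrixP => i; rewrite [LHS]rowE [RHS]rowE.
apply: (eq_trans (esym (diff_jacobian g x (delta_mx 0 i)))).
apply: (eq_trans _ (diff_jacobian f x (delta_mx 0 i))).
by move: E => /(congr1 (fun h : 'rV[R]_n -> 'rV[R]_m => h (delta_mx 0 i))).
Qed.

Lemma jacobian_linear n m (L : 'M[R]_(n, m)) x :
  jacobian (mulmxr L : 'rV[R]_n -> 'rV[R]_m) x = L.
Proof.
apply/row_matrixP => i; rewrite rowE -diff_jacobian.
by rewrite (diff_lin _ (@mulmxr_continuous _ _ L)) /= [RHS]rowE.
Qed.

(** The partial derivatives vanish at [x0] and are Lipschitz, so they are small on a ball whose
    radius is [eps] divided by the sum of the Lipschitz constants. *)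
Lemma near_diff_small n (A : set 'rV[R]_n) (f : 'rV[R]_n -> 'rV[R]_n) x0 (eps : R) :
  open A -> smooth_on A f -> A x0 -> jacobian f x0 = 0 -> 0 < eps ->
  exists r, [/\ 0 < r, forall y, `|y - x0| <= r -> A y &
   forall z v, `|z - x0| <= r -> `|'d f z v| <= eps * `|v|].
Proof.
move=> oA sf Ax0 J0 eps0; have [r r0 rA] := open_cball oA Ax0.
have H i : exists2 C, 0 <= C & forall y, `|y - x0| <= r ->
    `|'D_(delta_mx 0 i) f y| <= C * `|y - x0|.
  have [C C0 CP] := smooth_lipschitz rA (smooth_on_partial i sf).
  exists C => // y yr; have := CP x0 y; rewrite subrr normr0.
  move=> /(_ (ltW r0) yr); congr (_ <= _); congr `|_|.
  have -> : 'D_(delta_mx 0 i) f x0 = 0.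
    by rewrite deriveE; [rewrite diff_jacobian J0 mulmx0 | exact: smooth_on_diff sf Ax0].
  by rewrite subr0.
pose C i := projT1 (cid2 (H i)).
have CP i y : `|y - x0| <= r -> `|'D_(delta_mx 0 i) f y| <= C i * `|y - x0|.
  by rewrite /C; case: (cid2 (H i)) => /= c _; exact.
have C0 i : 0 <= C i by rewrite /C; case: (cid2 (H i)).
pose S := \sum_i C i; have S0 : 0 <= S by exact: sumr_ge0.
pose r' := Num.min r (eps / (S + 1)).
have S1 : 0 < S + 1 by rewrite ltr_wpDl.
have r'r : r' <= r by rewrite ge_min lexx.
exists r'; split; first by rewrite lt_min r0 divr_gt0.
  by move=> y /le_trans /(_ r'r); exact: rA.
move=> z v zr; have zr' := le_trans zr r'r.
rewrite diff_partial; last exact/(smooth_on_diff sf)/rA.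
apply: le_trans (ler_norm_sum _ _ _) _.
apply: (@le_trans _ _ (\sum_i C i * `|z - x0| * `|v|)).
  apply: ler_sum => i _; rewrite normrZ mulrC ler_pM ?normr_ge0 // ?mx_norm_entry //.
  exact: CP.
rewrite -mulr_suml -mulr_suml ler_wpM2r //.
have : `|z - x0| <= eps / (S + 1) by apply: le_trans zr _; rewrite ge_min lexx orbT.
rewrite ler_pdivlMr // => ze; apply: le_trans ze.
by rewrite mulrC ler_wpM2l // lerDl.
Qed.

(** With the jacobian normalised to 1, x - f x contracts distances by 1/2 on a small ball, and a
    solution of f x = y is a fixed point of T x = x - f x + y. The same contraction makes [f]
    injective with a local inverse of Lipschitz constant 2. *)
Lemma inverse_function_id n (A : set 'rV[R]_n) (f : 'rV[R]_n -> 'rV[R]_n) x0 :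
  open A -> smooth_on A f -> A x0 -> jacobian f x0 = 1%:M ->
  exists U W (g : 'rV[R]_n -> 'rV[R]_n),
    [/\ open U, U `<=` A, U x0 & open W] /\
    [/\ forall x, U x -> W (f x) /\ g (f x) = x,
        forall y, W y -> U (g y) /\ f (g y) = y & smooth_on W g].
Proof.
move=> oA sf Ax0 J1.
have sphi : smooth_on A (fun x => x - f x).
  apply: (smooth_on_addmx oA); first exact: smooth_on_id.
  exact: smooth_on_oppmx.
have df x : A x -> differentiable f x by exact: smooth_on_diff sf.
have dphi x v : A x -> 'd (fun x => x - f x) x v = v - 'd f x v.
  move=> Ax; have dx := smooth_on_diff sphi Ax.
  apply: (eq_trans (esym (deriveE v dx))).
  apply: (eq_trans (deriveB (f := id) (@derivable_id _ _ x v) (diff_derivable (df x Ax)))).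
  by rewrite derive_id; congr (_ - _); exact: deriveE (df x Ax).
have J0 : jacobian (fun x => x - f x) x0 = 0.
  apply/row_matrixP => i; rewrite rowE -diff_jacobian dphi //.
  by rewrite diff_jacobian J1 mulmx1 subrr row0.
have h2 : 0 < 2^-1 :> R by rewrite invr_gt0.
have [r [r0 rA rd]] := near_diff_small oA sphi Ax0 J0 h2.
pose B := [set x : 'rV[R]_n | `|x - x0| <= r].
have lip x y : B x -> B y -> `|(y - f y) - (x - f x)| <= 2^-1 * `|y - x|.
  move=> xr yr; apply: (@cball_lipschitz _ _ _ _ (fun x => x - f x) x0 r) => //.
  by move=> z zr; exact/(smooth_on_diff sphi)/rA.
have inj x y : B x -> B y -> `|y - x| <= 2 * `|f y - f x|.
  move=> xr yr; have := lip x y xr yr.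
  have -> : (y - f y) - (x - f x) = (y - x) - (f y - f x).
    by rewrite opprB addrCA !opprB; apply/matrixP => i j; rewrite !mxE; ring.
  have := ler_normD ((y - x) - (f y - f x)) (f y - f x); rewrite subrK.
  by lra.
pose W := [set y : 'rV[R]_n | `|y - f x0| < r / 2].
have sol y : W y -> exists x, `|x - x0| < r /\ f x = y.
  move=> Wy; pose T x := x - f x + y.
  have TB x : B x -> `|T x - x0| < r.
    move=> Bx; have -> : T x - x0 = (x - f x) - (x0 - f x0) + (y - f x0).
      by rewrite /T; apply/matrixP => i j; rewrite !mxE; ring.
    apply: le_lt_trans (ler_normD _ _) _.
    have := lip x0 x (_ : B x0) Bx; rewrite /B /= subrr normr0 => /(_ (ltW r0)).
    by move: Wy Bx; rewrite /W /B /=; lra.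
  have TL u v : B u -> B v -> `|T u - T v| <= 2^-1 * `|u - v|.
    move=> Bu Bv; have := lip v u Bv Bu; congr (_ <= _); congr `|_|.
    by rewrite [X in _ = _ + X]opprD [RHS]addrACA subrr addr0.
  have B0 : B !=set0 by exists x0; rewrite /B /= subrr normr0 ltW.
  have cT : {within B, continuous (fun x => `|T x - x|)}.
    apply: continuous_in_subspaceT => x /[1!inE] Bx.
    have -> : (fun x => `|T x - x|) = (fun x => `|y - f x|).
      by apply/funext => z; rewrite /T addrAC [z - _ - _]addrAC subrr add0r addrC.
    have dx : differentiable (fun x => y - f x) x.
      apply: (smooth_on_diff (A := A)); last exact: rA.
      apply: (smooth_on_addmx oA); first exact: smooth_on_cst.
      exact: smooth_on_oppmx.
    apply: (@continuous_comp _ _ _ (fun x => y - f x) Num.norm); last exact: norm_continuous.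
    exact: differentiable_continuous dx.
  (* The fixed point is a minimum of |T x - x| on the compact ball: at a minimum [p], passing to
     [T p] at least halves this distance, so it is zero. *)
  have [p pB pm] := compact_EVT_min B0 (@cball_compact _ _ x0 r) cT.
  have Bp : B p by move: pB; rewrite inE.
  exists p; have Tp : T p = p.
    have Bq : B (T p) by exact/ltW/TB.
    have := pm (T p); rewrite inE => /(_ Bq) m1; have m2 := TL (T p) p Bq Bp.
    by apply/eqP; rewrite -subr_eq0 -normr_le0; lra.
  split; first by rewrite -Tp; exact: TB.
  move: Tp => /eqP; rewrite /T -subr_eq0 addrAC [p - _ - _]addrAC subrr add0r addrC subr_eq0.
  by move=> /eqP.
pose g y := xget x0 [set x | `|x - x0| < r /\ f x = y].
have gP y : W y -> `|g y - x0| < r /\ f (g y) = y.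
  by move=> /sol Wy; rewrite /g; exact: (xgetPex x0 Wy).
pose U := [set x | `|x - x0| < r /\ W (f x)].
pose V := [set x : 'rV[R]_n | `|x - x0| < r].
have oV : open V by exact: oball_open.
have oW : open W by exact: oball_open.
have VA : V `<=` A by move=> x /ltW /rA.
have oU : open U.
  by apply: open_setI_preimage => // x /VA /df; exact: differentiable_continuous.
have gLip y y' : W y -> W y' -> `|g y' - g y| <= 2 * `|y' - y|.
  move=> /gP[gy fgy] /gP[gy' fgy'].
  by have := inj (g y) (g y') (ltW gy) (ltW gy'); rewrite fgy fgy'.
(* A vector annihilated by the jacobian of [f] is fixed by the differential of x - f x, which has
   norm at most 1/2. *)
have Ju x : V x -> jacobian f x \in unitmx.
  move=> Vx; rewrite -row_free_unit; apply: inj_row_free => v.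
  rewrite -diff_jacobian => dv0; apply/eqP; rewrite -normr_le0.
  by have := rd x v (ltW Vx); rewrite dphi ?dv0 ?subr0; [lra | exact: VA].
have gd y : W y -> is_diff y g (mulmxr (invmx (jacobian f (g y)))).
  move=> Wy; have [gy fgy] := gP _ Wy; set x := g y; set Ji := invmx _.
  have [C C0 CP] := smooth_quadratic rA sf.
  have [C' C'0 C'P] := mulmx_norm_le Ji.
  (* The factor 4 is the square of the Lipschitz constant of [g], which converts a remainder
     quadratic in the increment of [g] into one quadratic in the increment of [y]. *)
  apply: (@is_diff_quad _ _ _ g y (mulmxr Ji : {linear 'rV[R]_n -> 'rV[R]_n}) (C' * (C * 4))); first exact: mulmxr_continuous.
  have : \forall k \near (0 : 'rV[R]_n), W (k + y).
    have : \forall z \near y, W z by exact: open_nbhs_nbhs (conj oW Wy).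
    by rewrite (near_shift 0 y) subr0.
  apply: filterS => k; rewrite addrC => Wyk; have [gk fgk] := gP _ Wyk.
  set x' := g (y + k).
  have q := CP x x' (ltW gy) (ltW gk).
  have E : x' - x - k *m Ji = - (f x' - f x - 'd f x (x' - x)) *m Ji.
    rewrite diff_jacobian /x' /x fgk fgy (addrC y) addrK opprB mulmxBl -/x -/x'.
    by rewrite -mulmxA mulmxV ?mulmx1 //; exact: Ju.
  rewrite [X in `|X|](_ : _ = x' - x - k *m Ji) // E.
  apply: le_trans (C'P _) _; rewrite -mulrA ler_wpM2l // normrN.
  apply: le_trans q _; rewrite -mulrA ler_wpM2l //.
  have := gLip y (y + k) Wy Wyk; rewrite [y + k - y]addrAC subrr add0r -/x -/x' => gl.
  have -> : 4 * `|k| ^+ 2 = (2 * `|k|) ^+ 2 by rewrite exprMn; congr (_ * _); ring.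
  by apply: lerXn2r; rewrite ?nnegrE ?mulr_ge0 ?normr_ge0.
have sJi i : smooth_on V (fun x => delta_mx 0 i *m invmx (jacobian f x) : 'rV[R]_n).
  apply: (smooth_on_mulmx oV); first exact: smooth_on_cst.
  apply: (smooth_on_invmx oV) => //; apply: smooth_on_sub VA _.
  exact: smooth_on_jacobian.
exists U, W, g; split.
  split=> //; first by move=> x [/ltW /rA].
  by split; rewrite /W /= subrr normr0 // divr_gt0.
split=> [x [xr Wfx]|y Wy|].
- split=> //; have [gr fg] := gP _ Wfx.
  apply/eqP; rewrite -subr_eq0 -normr_le0.
  by have := inj x (g (f x)) (ltW xr) (ltW gr); rewrite fg subrr normr0 mulr0.
- by have [gr fg] := gP _ Wy; split=> //; split=> //; rewrite fg.
(* The derivative of [g] is the inverse jacobian of [f] at [g y], so each order of differentiability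
   of [g] produces the next. *)
apply/smooth_onP; elim=> // k IH; split=> [y /gd[]//|i].
apply: (@ck_ext _ _ _ _ _ (fun y => delta_mx 0 i *m invmx (jacobian f (g y)))) => //.
  move=> y Wy; have [dg dgE] := gd _ Wy.
  by rewrite deriveE // dgE.
apply/(ck_mxP _ _ oW) => a b.
apply: (ck_comp (B := V) (f := g) (g := fun x => (delta_mx 0 i *m invmx (jacobian f x)) a b)) => //.
  by move=> y /gP[].
by have /(smooth_on_mxP oV) /(_ a b) /smooth_onP := sJi i.
Qed.

Theorem inverse_function n (A : set 'rV[R]_n) (f : 'rV[R]_n -> 'rV[R]_n) x0 :
  open A -> smooth_on A f -> A x0 -> jacobian f x0 \in unitmx ->
  exists U W (g : 'rV[R]_n -> 'rV[R]_n),
    [/\ open U, U `<=` A, U x0 & open W] /\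
    [/\ forall x, U x -> W (f x) /\ g (f x) = x,
        forall y, W y -> U (g y) /\ f (g y) = y & smooth_on W g].
Proof.
move=> oA sf Ax0 Ju; pose J := jacobian f x0.
have sh : smooth_on A (fun x => f x *m invmx J).
  by apply: (smooth_on_mulmx oA) => //; exact: smooth_on_cst.
have Jh : jacobian (fun x => f x *m invmx J) x0 = 1%:M.
  have df := smooth_on_diff sf Ax0.
  have dL : differentiable (mulmxr (invmx J) : 'rV[R]_n -> 'rV[R]_n) (f x0).
    exact: (smooth_on_diff (smooth_on_linear openT (mulmxr (invmx J) : {linear 'rV[R]_n -> 'rV[R]_n}))).
  by have := jacobian_comp df dL; rewrite jacobian_linear mulmxV.
have [U [W [g [[oU UA Ux0 oW] [H1 H2 sg]]]]] := inverse_function_id oA sh Ax0 Jh.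
pose W' := [set y | W (y *m invmx J)].
have oW' : open W'.
  by apply: open_comp => // y _; exact: (@mulmxr_continuous _ _ (invmx J)).
exists U, W', (fun y => g (y *m invmx J)); split; first by split.
split=> [x /H1//|y /H2[Uy fy]|].
  by split=> //; rewrite -[LHS](mulmxKV Ju) fy mulmxKV.
apply: (smooth_on_comp (A := W') (B := W) (f := fun y => y *m invmx J)) => //.
exact: (smooth_on_linear oW' (mulmxr (invmx J) : {linear 'rV[R]_n -> 'rV[R]_n})).
Qed.

End InverseFunction.

(** * Smooth dependence of flows *)

Section Gronwall.
Context {R : realType}.

Lemma gronwall_ge0 (G dG : R -> R) (a T : R) :
  (forall t : R, 0 <= t < T -> is_derive t 1 G (dG t)) ->
  (forall t : R, 0 <= t < T -> dG t <= a * G t) ->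
  forall t : R, 0 <= t < T -> G t <= G 0 * expR (a * t).
Proof.
move=> dGP dGa t /andP[t0 tT].
pose H s := G s * expR (- (a * s)).
pose dH s := G s * (expR (- (a * s)) * - a) + dG s * expR (- (a * s)).
have dHP s : s \in `[0, t]%R -> is_derive s 1 H (dH s).
  rewrite in_itv /= => /andP[s0 st].
  have dGs : is_derive s 1 G (dG s) by apply: dGP; rewrite s0 (le_lt_trans st).
  have de : is_derive s 1 (fun s => expR (- (a * s))) (expR (- (a * s)) * - a).
    apply: is_derive1_comp; apply: is_deriveN.
    have := is_derive_mulrc a s.
    by rewrite (_ : (fun s : R => s * a) = fun s => a * s) //; apply/funext => u; rewrite mulrC.
  apply: is_derive_eq (is_deriveM dGs de) _.
  by rewrite /dH; congr (_ + _); rewrite [_ *: _]mulrC.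
have dH0 s : s \in `[0, t]%R -> dH s <= 0.
  rewrite in_itv /= => /andP[s0 st].
  have : dG s <= a * G s by apply: dGa; rewrite s0 (le_lt_trans st).
  rewrite /dH => h; have e0 := expR_gt0 (- (a * s)).
  have := ler_wpM2r (ltW e0) h; set E := expR _; nra.
have HH : H t <= H 0.
  have [|c cI E] := MVT_segment t0 (fun s (hs : s \in `]0, t[%R) => dHP s (subset_itv_oo_cc hs)).
    by apply: derivable_within_continuous => s /dHP[].
  by rewrite -subr_le0 E subr0 mulr_le0_ge0 // dH0.
move: HH; rewrite /H mulr0 oppr0 expR0 mulr1 expRN => h.
by rewrite -ler_pdivrMr // expR_gt0.
Qed.

Lemma gronwall (G dG : R -> R) (a T : R) : 0 <= a -> 0 <= G 0 ->
  (forall t : R, `|t| < T -> is_derive t 1 G (dG t)) ->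
  (forall t : R, `|t| < T -> `|dG t| <= a * G t) ->
  forall t : R, `|t| < T -> G t <= G 0 * expR (a * T).
Proof.
move=> a0 G0 dGP dGa t tT.
have T0 : 0 < T by apply: le_lt_trans tT.
have key (F dF : R -> R) (s : R) : F 0 = G 0 ->
  (forall t : R, `|t| < T -> is_derive t 1 F (dF t)) ->
  (forall t : R, `|t| < T -> `|dF t| <= a * F t) -> 0 <= s -> s < T -> F s <= G 0 * expR (a * T).
  move=> F0 FP Fa s0 sT.
  have := @gronwall_ge0 F dF a T _ _ s; rewrite F0 s0 sT.
  move=> h; apply: le_trans (h _ _ isT) _.
  - by move=> u /andP[u0 uT]; apply: FP; rewrite ger0_norm.
  - by move=> u /andP[u0 uT]; apply: le_trans (ler_norm _) _; apply: Fa; rewrite ger0_norm.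
  by rewrite ler_wpM2l // ler_expR ler_wpM2l // ltW.
have [t0|t0] := leP 0 t; first by apply: (key G dG) => //; rewrite -(ger0_norm t0).
rewrite -[t]opprK; apply: (key (fun s => G (- s)) (fun s => - dG (- s))) => //.
- by rewrite oppr0.
- move=> s sT; have dGs : is_derive (- s) 1 G (dG (- s)) by apply: dGP; rewrite normrN.
  have dn : is_derive s (1 : R) (fun u : R => - u) (- 1) by apply: is_deriveN.
  by apply: is_derive_eq (is_derive1_comp dGs dn) _; rewrite mulrN1.
- by move=> s sT; rewrite normrN; apply: dGa; rewrite normrN.
- by rewrite oppr_ge0 ltW.
- by rewrite -(ltr0_norm t0).
Qed.

(** The maximum norm is not differentiable along a curve, so the scalar estimate is applied to the
    sum of the squares of the components plus b^2; the second summand absorbs the inhomogeneous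
    term. The constant [K] depends only on [n], [L] and [T], not on the curve. *)
Lemma gronwall_rV n (L T : R) : 0 <= L -> exists2 K, 1 <= K &
  forall (w dw : R -> 'rV[R]_n) (b : R), 0 <= b ->
  (forall t : R, `|t| < T -> is_derive t 1 w (dw t)) ->
  (forall t : R, `|t| < T -> `|dw t| <= L * `|w t| + b) ->
  forall t : R, `|t| < T -> `|w t| <= K * (`|w 0| + b).
Proof.
move=> L0; pose N : R := n%:R; have N0 : 0 <= N by rewrite ler0n.
(* The derivative of the sum of squares is at most 2N |w| |dw|, and b |w| is at most half of |w|^2 +
   b^2; this gives 2NL + N, and 1 is slack. *)
pose a := 2 * N * L + N + 1.
have a0 : 0 <= a by rewrite !addr_ge0 // !mulr_ge0.
have [Tp|Tn] := ltP 0 T; last first.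
  by exists 1 => // w dw b b0 _ _ t /lt_le_trans /(_ Tn); rewrite normr_lt0.
have e1 : 1 <= expR (a * T) by rewrite -expR0 ler_expR mulr_ge0 // ltW.
exists ((N + 1) * expR (a * T)).
  by apply: (le_trans e1); rewrite ler_peMl ?lerDr // ltW // expR_gt0.
move=> w dw b b0 dwP dwL t tT.
pose E s := \sum_i w s 0 i * w s 0 i.
pose G s := E s + b ^+ 2.
pose dG s := \sum_i (w s 0 i * dw s 0 i + w s 0 i * dw s 0 i).
have wE s i : w s 0 i ^+ 2 <= E s.
  by rewrite /E (bigD1 i) //= -expr2 lerDl sumr_ge0 // => j _; rewrite -expr2 sqr_ge0.
have E0 s : 0 <= E s by apply: sumr_ge0 => j _; rewrite -expr2 sqr_ge0.
have nwE s : `|w s| ^+ 2 <= E s.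
  have : `|w s| <= Num.sqrt (E s).
    apply/mx_norm_leP => [|i j]; first exact: sqrtr_ge0.
    by rewrite (ord1 i) -sqrtr_sqr ler_wsqrtr.
  by move=> h; rewrite -[leRHS]sqr_sqrtr //; apply: lerXn2r; rewrite ?nnegrE ?sqrtr_ge0.
have dGP (s : R) : `|s| < T -> is_derive s 1 G (dG s).
  move=> /dwP /is_derive_mxP dws; rewrite -[dG s]addr0; apply: is_deriveD.
  rewrite (_ : E = \sum_i (fun s => w s 0 i * w s 0 i)); last first.
    by apply/funext => u; rewrite fct_sumE.
  apply: is_derive_sum => i; exact: is_deriveM (dws 0 i) (dws 0 i).
have dGa s : `|s| < T -> `|dG s| <= a * G s.
  move=> sT; have h := dwL s sT.
  apply: (@le_trans _ _ (\sum_(i < n) 2 * (`|w s| * `|dw s|))).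
    apply: le_trans (ler_norm_sum _ _ _) _; apply: ler_sum => i _.
    have e : `|w s 0 i * dw s 0 i| <= `|w s| * `|dw s|.
      by rewrite normrM ler_pM ?normr_ge0 // mx_norm_entry.
    by apply: le_trans (ler_normD _ _) _; lra.
  rewrite sumr_const card_ord -[_ *+ n]mulr_natl -/N.
  have h2 : `|w s| * `|dw s| <= L * `|w s| ^+ 2 + (`|w s| ^+ 2 + b ^+ 2) / 2.
    have := ler_wpM2l (normr_ge0 (w s)) h; have := sqr_ge0 (`|w s| - b).
    by set x := `|w s|; set y := `|dw s|; nra.
  apply: (@le_trans _ _ (N * (2 * (L * `|w s| ^+ 2 + (`|w s| ^+ 2 + b ^+ 2) / 2)))).
    by rewrite ler_wpM2l // ler_wpM2l.
  have := nwE s; have := E0 s; have := sqr_ge0 b; rewrite /G /a.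
  set x := `|w s| ^+ 2; set bb := b ^+ 2; set e := E s => bb0 e0 xe.
  have : N * L * x <= N * L * e by rewrite ler_wpM2l // mulr_ge0.
  have : N * x <= N * e by rewrite ler_wpM2l.
  have : 0 <= N * L * bb by rewrite !mulr_ge0.
  nra.
have G00 : 0 <= G 0 by rewrite addr_ge0 ?sqr_ge0.
have := gronwall a0 G00 dGP dGa tT => Gt.
have w2 : `|w t| ^+ 2 <= ((N + 1) * expR (a * T) * (`|w 0| + b)) ^+ 2.
  apply: le_trans (nwE t) _; apply: (@le_trans _ _ (G t)); first by rewrite lerDl sqr_ge0.
  apply: le_trans Gt _.
  have G0 : G 0 <= N * `|w 0| ^+ 2 + b ^+ 2.
    rewrite lerD2r; apply: (@le_trans _ _ (\sum_(i < n) `|w 0| ^+ 2)).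
      apply: ler_sum => i _; rewrite -expr2 -real_normK ?num_real //.
      by apply: lerXn2r; rewrite ?nnegrE ?normr_ge0 // mx_norm_entry.
    by rewrite sumr_const card_ord -[_ *+ n]mulr_natl.
  apply: le_trans (ler_wpM2r (ltW (expR_gt0 _)) G0) _.
  set x := `|w 0|; set e := expR _; have x0 : 0 <= x by exact: normr_ge0.
  have h1 : N * x ^+ 2 + b ^+ 2 <= (N + 1) ^+ 2 * (x + b) ^+ 2.
    have : 0 <= x * b by rewrite mulr_ge0.
    have : 0 <= N ^+ 2 * (x + b) ^+ 2 by rewrite mulr_ge0 ?sqr_ge0.
    have : 0 <= N * (x * b) by rewrite !mulr_ge0.
    have : 0 <= N * b ^+ 2 by rewrite mulr_ge0 // sqr_ge0.
    have : 0 <= N * x ^+ 2 by rewrite mulr_ge0 // sqr_ge0.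
    have := sqr_ge0 x. nra.
  have h2 : e <= e ^+ 2 by rewrite expr2 ler_peMr // (le_trans ler01).
  rewrite mulrAC 2!exprMn; apply: ler_pM => //.
    by rewrite addr_ge0 ?mulr_ge0 ?sqr_ge0.
  by rewrite (le_trans ler01).
rewrite -(@ler_pXn2r _ 2) ?nnegrE //.
by rewrite !mulr_ge0 ?addr_ge0 // (le_trans ler01).
Qed.

(** The limit is explicit: in each component it is the supremum of the lower bounds
    [u m - c / m.+1], all of which lie below every [u l + c / l.+1]. *)
Lemma cauchy_rV n (u : nat -> 'rV[R]_n) (c : R) : 0 <= c ->
  (forall m l, `|u m - u l| <= c / m.+1%:R + c / l.+1%:R) ->
  exists v, forall m, `|u m - v| <= c / m.+1%:R.
Proof.
move=> c0 H.
pose S i := [set x | exists m, x = u m 0 i - c / m.+1%:R].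
exists (\row_i sup (S i)) => m; apply/mx_norm_leP; first by rewrite divr_ge0.
move=> a i; rewrite (ord1 a) !mxE.
have ub k x : S i x -> x <= u k 0 i + c / k.+1%:R.
  move=> [l ->]; have := le_trans (mx_norm_entry _ 0 i) (H l k); rewrite !mxE ler_norml => /andP[_].
  by move: (c / _) (c / _) (u l _ _) (u k _ _) => *; lra.
have S0 : S i !=set0 by exists (u 0%N 0 i - c / 1); exists 0%N.
have hub : has_ubound (S i) by exists (u 0%N 0 i + c / 1%:R) => x; exact: ub.
have h1 : sup (S i) <= u m 0 i + c / m.+1%:R.
  by apply: ge_sup => // x; exact: ub.
have h2 : u m 0 i - c / m.+1%:R <= sup (S i).
  by apply: ub_le_sup => //; exists m.
rewrite ler_norml; move: h1 h2; move: (c / _) (sup _) (u m _ _) => *; apply/andP; split; lra.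
Qed.

End Gronwall.

(** * Differentiability of a local flow in the initial point *)

Section Flow.
Context {R : realType}.

Lemma is_derive_quad (W : normedModType R) (f : R -> W) (t : R) (l : W) (C : R) :
  (\forall s \near (0 : R), `|f (t + s) - f t - s *: l| <= C * `|s| ^+ 2) ->
  is_derive t 1 f l.
Proof.
move=> H; pose d (s : R) := s *: l.
have lin_d : linear d by move=> k u v; rewrite /d scalerDl scalerA.
pose dM := GRing.isLinear.Build _ _ _ _ _ lin_d.
pose dL : {linear R -> W} := HB.pack d dM.
have cd : continuous dL by exact: scalel_continuous.
have [df dfE] := is_diff_quad (L := dL) cd H.
apply: DeriveDef; first exact/derivable1_diffP.
by rewrite deriveE // dfE /= /d scale1r.
Qed.

Lemma is_derive_affine (W : normedModType R) (f : R -> W) (t s tau : R) (l : W) :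
  is_derive (t + tau * s) 1 f l ->
  is_derive tau 1 (fun u : R => f (t + u * s)) (s *: l).
Proof.
move=> [df dfE].
have d1 : is_derive tau (1 : R) (fun u : R => t + u * s) (0 + s).
  by apply: is_deriveD; exact: is_derive_mulrc.
rewrite add0r in d1.
have df' : differentiable f (t + tau * s) by exact/derivable1_diffP.
have := @is_derive_comp R R W (fun u : R => t + u * s) f tau s df' d1.
by rewrite diff1E // derive1E dfE.
Qed.

Section Fixed.
Context {n : nat} {A : set 'rV[R]_n}.
Context {a : 'rV[R]_n} {r T : R} (T0 : 0 < T) (aA : forall y, `|y - a| <= r -> A y).
Variable V : 'rV[R]_n -> 'rV[R]_n.
Hypothesis sV : smooth_on A V.
Context {U : set 'rV[R]_n} (oU : open U).
Variable phi : R -> 'rV[R]_n -> 'rV[R]_n.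
Hypothesis phi0 : forall x, U x -> phi 0 x = x.
Hypothesis phiB : forall x t, U x -> `|t| < T -> `|phi t x - a| <= r.
Hypothesis phiP : forall x (t : R), U x -> `|t| < T ->
  is_derive t 1 (phi ^~ x) (V (phi t x)).

Let dV z : `|z - a| <= r -> differentiable V z.
Proof. by move=> /aA; exact: smooth_on_diff sV. Qed.

Lemma flow_bound : exists2 K, 1 <= K & forall x y t, U x -> U y -> `|t| < T ->
  `|phi t y - phi t x| <= K * `|y - x|.
Proof.
have [L L0 LP] := smooth_lipschitz aA sV.
have [K K1 KP] := gronwall_rV n T L0; exists K => // x y t Ux Uy tT.
have := KP (fun t => phi t y - phi t x) (fun t => V (phi t y) - V (phi t x)) 0 (lexx _).
rewrite !phi0 // addr0; apply=> // s sT; first by apply: is_deriveB; exact: phiP.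
by rewrite addr0; apply: LP; exact: phiB.
Qed.

Lemma flow_quadratic : exists2 C, 0 <= C & forall x y t, U x -> U y -> `|t| < T ->
  `|V (phi t y) - V (phi t x) - 'd V (phi t x) (phi t y - phi t x)| <= C * `|y - x| ^+ 2.
Proof.
have [C C0 CP] := smooth_quadratic aA sV; have [K K1 KP] := flow_bound.
exists (C * K ^+ 2) => [|x y t Ux Uy tT]; first by rewrite mulr_ge0 // sqr_ge0.
apply: le_trans (CP _ _ (phiB Ux tT) (phiB Uy tT)) _.
rewrite -mulrA ler_wpM2l // -exprMn; apply: lerXn2r; rewrite ?nnegrE ?normr_ge0 //.
  by rewrite mulr_ge0 // (le_trans ler01).
exact: KP.
Qed.

Lemma jacobian_lipschitz : exists2 C, 0 <= C & forall x y (v : 'rV[R]_n), `|x - a| <= r ->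
  `|y - a| <= r -> `|v *m jacobian V y - v *m jacobian V x| <= C * `|y - x| * `|v|.
Proof.
have H i : exists2 C, 0 <= C & forall x y, `|x - a| <= r -> `|y - a| <= r ->
    `|'D_(delta_mx 0 i) V y - 'D_(delta_mx 0 i) V x| <= C * `|y - x|.
  exact: smooth_lipschitz (smooth_on_partial i sV).
pose C i := projT1 (cid2 (H i)).
have CP i x y : `|x - a| <= r -> `|y - a| <= r ->
    `|'D_(delta_mx 0 i) V y - 'D_(delta_mx 0 i) V x| <= C i * `|y - x|.
  by rewrite /C; case: (cid2 (H i)) => /= c _; exact.
have C0 i : 0 <= C i by rewrite /C; case: (cid2 (H i)).
exists (\sum_i C i) => [|x y v xr yr]; first exact: sumr_ge0.
have E1 := etrans (esym (diff_jacobian V y v)) (diff_partial v (dV yr)).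
have E2 := etrans (esym (diff_jacobian V x v)) (diff_partial v (dV xr)).
have -> : v *m jacobian V y - v *m jacobian V x = \sum_(i < n)
    (v 0 i *: 'D_(delta_mx 0 i) V y - v 0 i *: 'D_(delta_mx 0 i) V x).
  by rewrite sumrB; congr (_ - _); [exact: E1 | exact: E2].
rewrite -mulrA mulr_suml; apply: le_trans (ler_norm_sum _ _ _) _; apply: ler_sum => i _.
rewrite -scalerBr normrZ mulrC mulrA ler_pM ?normr_ge0 ?mx_norm_entry //.
exact: CP.
Qed.

(* The difference quotients of the flow are a Cauchy family by Gronwall, and
   their limit is a solution of the variational equation. *)
Lemma variational_solution x xi : U x -> (forall h, 0 <= h <= 1 -> U (x + h *: xi)) ->
  exists Q : R -> 'rV[R]_n, Q 0 = xi /\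
    forall t : R, `|t| < T -> is_derive t 1 Q (Q t *m jacobian V (phi t x)).
Proof.
move=> Ux Uxi.
have [L L0 LP'] := diff_bounded aA sV.
have [K K1 KP] := flow_bound; have [C C0 CP'] := flow_quadratic.
have [B B0 BP'] := jacobian_lipschitz.
pose J u := jacobian V (phi u x).
have LP u (v : 'rV[R]_n) : `|u| < T -> `|v *m J u| <= L * `|v|.
  by move=> uT; have := LP' _ v (phiB Ux uT); rewrite diff_jacobian.
have CP y u : U y -> `|u| < T ->
    `|V (phi u y) - V (phi u x) - (phi u y - phi u x) *m J u| <= C * `|y - x| ^+ 2.
  by move=> Uy uT; have := CP' x y u Ux Uy uT; rewrite diff_jacobian.
have BP u u' (v : 'rV[R]_n) : `|u| < T -> `|u'| < T ->
    `|v *m J u' - v *m J u| <= B * `|phi u' x - phi u x| * `|v|.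
  by move=> uT u'T; exact: BP' _ _ v (phiB Ux uT) (phiB Ux u'T).
have [M M0 MP] := cball_bounded aA sV.
have [G G1 GP] := gronwall_rV n T L0.
have K0 : 0 <= K by exact: le_trans ler01 K1.
pose h (m : nat) : R := m.+1%:R^-1.
have h0 m : 0 < h m by rewrite invr_gt0 ltr0Sn.
have h1 m : h m <= 1 by rewrite invf_le1 ?ler1n ?ltr0Sn.
have Uh m : U (x + h m *: xi) by apply: Uxi; rewrite ltW //= h1.
pose N := `|xi|; have N0 : 0 <= N by exact: normr_ge0.
have xh m : `|x + h m *: xi - x| = h m * N.
  by rewrite addrAC subrr add0r normrZ gtr0_norm.
pose q m t := (h m)^-1 *: (phi t (x + h m *: xi) - phi t x).
pose dq m t := (h m)^-1 *: (V (phi t (x + h m *: xi)) - V (phi t x)).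
have hK m : (h m)^-1 * h m = 1 by rewrite mulVf // gt_eqF.
have qP m (t : R) : `|t| < T -> is_derive t 1 (q m) (dq m t).
  by move=> tT; apply: is_deriveZ; apply: is_deriveB; exact: phiP.
have qN m t : `|t| < T -> `|q m t| <= K * N.
  move=> tT; rewrite normrZ gtr0_norm ?invr_gt0 // ler_pdivrMl //.
  by apply: le_trans (KP _ _ _ Ux (Uh m) tT) _; rewrite xh mulrCA.
have qE m t : `|t| < T -> `|dq m t - (q m t) *m J t| <= C * N ^+ 2 * h m.
  move=> tT; rewrite -scalemxAl -scalerBr normrZ gtr0_norm ?invr_gt0 // ler_pdivrMl //.
  apply: le_trans (CP _ _ (Uh m) tT) _; rewrite xh exprMn.
  by rewrite le_eqVlt; apply/orP; left; apply/eqP; ring.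
have q0 m : q m 0 = xi.
  by rewrite /q !phi0 // addrAC subrr add0r scalerA hK scale1r.
suff : exists Q : R -> 'rV[R]_n, Q 0 = xi /\
    forall t : R, `|t| < T -> is_derive t 1 Q (Q t *m J t) by [].
clearbody q dq J.
pose c := G * (C * N ^+ 2); have c0 : 0 <= c.
  by rewrite !mulr_ge0 ?sqr_ge0 // (le_trans ler01).
have qC t : `|t| < T -> exists v, forall m, `|q m t - v| <= c / m.+1%:R.
  move=> tT; apply: cauchy_rV => // m l.
  have b0 : 0 <= C * N ^+ 2 * (h m + h l).
    by rewrite mulr_ge0 ?addr_ge0 ?mulr_ge0 ?sqr_ge0 // ltW.
  have := GP (fun t => q m t - q l t) (fun t => dq m t - dq l t) _ b0 _ _ t tT.
  rewrite !q0 subrr normr0 add0r -mulrDr -/(h m) -/(h l) mulrA; apply=> s sT.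
    by apply: is_deriveB; exact: qP.
  have -> : dq m s - dq l s = (q m s - q l s) *m J s +
      ((dq m s - (q m s) *m J s) - (dq l s - (q l s) *m J s)).
    rewrite mulmxBl; move: (dq m s) (dq l s) (q m s *m J s) (q l s *m J s) => a1 a2 a3 a4.
    by apply/matrixP => i j; rewrite !mxE; ring.
  apply: le_trans (ler_normD _ _) _; apply: lerD; first by exact: LP.
  apply: le_trans (ler_normB _ _) _; rewrite mulrDr; apply: lerD; exact: qE.
(* The limit of the difference quotients; the default value 0 is only taken outside the interval of
   time where they converge. *)
pose Q t := xget 0 [set v | forall m, `|q m t - v| <= c / m.+1%:R].
have QP t m : `|t| < T -> `|q m t - Q t| <= c * h m.
  by move=> /qC [v vP]; exact: (xgetPex 0 (ex_intro _ v vP : exists v, [set v | forall m, `|q m t - v| <= c / m.+1%:R] v)).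
clearbody c.
(* Lets the error terms proportional to [h m] disappear as [m] grows. *)
have small y (b : R) : 0 <= b -> (forall m, y <= b * h m) -> y <= 0.
  move=> b0 H; rewrite leNgt; apply/negP => y0.
  have := archi_boundP (divr_ge0 b0 (ltW y0)); set m := Num.bound _ => bm.
  have := H m; rewrite /h ler_pdivlMr ?ltr0Sn // leNgt => /negP; apply.
  move: bm; rewrite ltr_pdivrMr // mulrC => /lt_le_trans; apply.
  by rewrite ler_wpM2l ?ler_nat // ltW.
exists Q; split.
  have T0' : `|0 : R| < T by rewrite normr0.
  apply/eqP; rewrite -subr_eq0 -normr_le0; apply: (small _ c c0) => m.
  by have := QP 0 m T0'; rewrite q0 distrC.
move=> t tT.
have sT (s u : R) : `|t + s| < T -> 0 <= u <= 1 -> `|t + u * s| < T.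
  move=> tsT /andP[u0 u1].
  have -> : t + u * s = (1 - u) * t + u * (t + s) by ring.
  apply: le_lt_trans (ler_normD _ _) _.
  have u1' : 0 <= 1 - u by rewrite subr_ge0.
  rewrite !normrM (ger0_norm u0) (ger0_norm u1').
  have [->|un0] := eqVneq u 0; first by rewrite subr0 mul0r addr0 mul1r.
  have up : 0 < u by rewrite lt_neqAle eq_sym un0.
  have : u * `|t + s| < u * T by rewrite ltr_pM2l.
  have : (1 - u) * `|t| <= (1 - u) * T by rewrite ler_wpM2l // ltW.
  by lra.
pose D := L * (K * N) + C * N ^+ 2.
have D0 : 0 <= D by rewrite addr_ge0 ?mulr_ge0 ?sqr_ge0.
have dqN m s : `|s| < T -> `|dq m s| <= D.
  move=> s'T; rewrite -[dq m s](subrK ((q m s) *m J s)) addrC.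
  apply: le_trans (ler_normD _ _) _; apply: lerD.
    by apply: le_trans (LP _ _ s'T) _; rewrite ler_wpM2l // qN.
  by apply: le_trans (qE m s s'T) _; rewrite ler_piMr // mulr_ge0 // sqr_ge0.
have lipC (f df : R -> 'rV[R]_n) (E : R) (s : R) :
    (forall u : R, `|u| < T -> is_derive u 1 f (df u)) ->
    (forall u : R, 0 <= u <= 1 -> `|df (t + u * s)| <= E) ->
    `|t + s| < T -> `|f (t + s) - f t| <= E * `|s|.
  move=> dfP dfE tsT.
  have := @mx_MVT01 _ _ _ (fun u : R => f (t + u * s)) (fun u => s *: df (t + u * s)) (E * `|s|).
  rewrite mul1r mul0r addr0; apply=> u u01; last first.
    by rewrite normrZ mulrC ler_wpM2r // dfE.
  by apply: is_derive_affine; apply: dfP; exact: sT.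
have phiL s : `|t + s| < T -> `|phi (t + s) x - phi t x| <= M * `|s|.
  move=> tsT; apply: (lipC (phi ^~ x) (fun u => V (phi u x))) => // u uT.
    exact: phiP.
  by apply: MP; apply: phiB => //; exact: sT.
have qL m s : `|t + s| < T -> `|q m (t + s) - q m t| <= D * `|s|.
  move=> tsT; apply: (lipC (q m) (dq m) D s (qP m)) => // u u01.
  by apply: dqN; exact: sT.
pose E := B * M * (K * N) + L * D.
have E0 : 0 <= E by rewrite addr_ge0 ?mulr_ge0.
(* A second order estimate for the difference quotients in which only the term with [h m] depends on
   [m]. It survives the limit and shows that [Q] is differentiable with the derivative required by
   the variational equation. *)
have step m s : `|t + s| < T ->
    `|q m (t + s) - q m t - s *: ((q m t) *m J t)| <= (C * N ^+ 2 * h m + E * `|s|) * `|s|.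
  move=> tsT; pose f u := q m u - (u - t) *: ((q m t) *m J t).
  pose df u := dq m u - (q m t) *m J t.
  have -> : q m (t + s) - q m t - s *: ((q m t) *m J t) = f (t + s) - f t.
    by rewrite /f subrr scale0r subr0 [t + s - t]addrAC subrr add0r addrAC.
  apply: (lipC f df) => // [u uT|u u01].
    apply: is_deriveB; first exact: qP.
    apply/is_derive_mxP => i j.
    rewrite (_ : (fun _ => _) = fun u : R => u * (q m t *m J t) i j - t * (q m t *m J t) i j).
      by rewrite -[X in is_derive _ _ _ X]subr0; apply: is_deriveB; exact: is_derive_mulrc.
    by apply/funext => u'; rewrite mxE mulrBl.
  have uT := sT _ _ tsT u01.
  have us : `|u * s| <= `|s|.
    by case/andP: u01 => u0 u1; rewrite normrM ger0_norm // ler_piMl.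
  have -> : df (t + u * s) = (dq m (t + u * s) - (q m (t + u * s)) *m J (t + u * s))
     + (((q m (t + u * s)) *m J (t + u * s) - (q m (t + u * s)) *m J t)
     + (q m (t + u * s) - q m t) *m J t).
    rewrite /df mulmxBl; move: (dq m (t + u * s)) (q m (t + u * s) *m J (t + u * s))
      (q m (t + u * s) *m J t) (q m t *m J t) => a1 a2 a3 a4.
    by rewrite !subrKA.
  apply: le_trans (ler_normD _ _) _; apply: lerD; first exact: qE.
  apply: le_trans (ler_normD _ _) _; rewrite mulrDl; apply: lerD.
    apply: le_trans (BP _ _ _ tT uT) _.
    have e1 : `|phi (t + u * s) x - phi t x| <= M * `|s|.
      by apply: le_trans (phiL _ uT) _; rewrite ler_wpM2l.
    apply: (@le_trans _ _ (B * (M * `|s|) * (K * N))).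
      by apply: ler_pM; rewrite ?mulr_ge0 ?normr_ge0 ?qN // ler_wpM2l.
    by rewrite le_eqVlt; apply/orP; left; apply/eqP; ring.
  apply: le_trans (LP _ _ tT) _; rewrite -mulrA ler_wpM2l //.
  by apply: le_trans (qL _ _ uT) _; rewrite ler_wpM2l.
apply: (@is_derive_quad _ _ _ _ E).
have nT : \forall s \near (0 : R), `|t + s| < T.
  have d0 : 0 < T - `|t| by rewrite subr_gt0.
  apply: filterS (nbhs0_lt d0) => s; rewrite ltrBrDl.
  exact: le_lt_trans (ler_normD _ _).
apply: filterS nT => s tsT.
rewrite -subr_le0; apply: (small _ (C * N ^+ 2 * `|s| + (c + c + `|s| * (L * c)))).
  by rewrite !addr_ge0 ?mulr_ge0 ?sqr_ge0.
move=> m; rewrite lerBlDr.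
have -> : Q (t + s) - Q t - s *: ((Q t) *m J t) =
   (q m (t + s) - q m t - s *: ((q m t) *m J t)) +
   (- (q m (t + s) - Q (t + s)) + ((q m t - Q t) + s *: ((q m t - Q t) *m J t))).
  rewrite mulmxBl scalerBr; move: (Q (t + s)) (Q t) (q m (t + s)) (q m t)
    (s *: (Q t *m J t)) (s *: (q m t *m J t)) => a1 a2 a3 a4 a5 a6.
  by apply/matrixP => i j; rewrite !mxE; ring.
apply: le_trans (ler_normD _ _) _.
apply: le_trans (lerD (step m s tsT) (ler_normD _ _)) _.
have H1 := QP _ m tsT; have H2 := QP _ m tT.
have H3 : `|s *: ((q m t - Q t) *m J t)| <= `|s| * (L * c) * h m.
  rewrite normrZ -mulrA ler_wpM2l // -mulrA; apply: le_trans (LP _ _ tT) _.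
  by rewrite ler_wpM2l.
have H4 := ler_normD (q m t - Q t) (s *: ((q m t - Q t) *m J t)).
rewrite normrN.
have e : (C * N ^+ 2 * h m + E * `|s|) * `|s| = C * N ^+ 2 * `|s| * h m + E * `|s| ^+ 2 by ring.
rewrite e; move: H1 H2 H3 H4; clear; move: `|_ - _| `|_ - _| `|_ *: _| `|_ + _| => *; lra.
Qed.

Lemma flow_diff x : U x -> exists Q : R -> 'M[R]_n, [/\ Q 0 = 1%:M,
  forall t : R, `|t| < T -> is_derive t 1 Q (Q t *m jacobian V (phi t x)) &
  forall t : R, `|t| < T -> is_diff x (phi t) (mulmxr (Q t))].
Proof.
move=> Ux; have [rho rho0 rhoU] := open_cball oU Ux.
(* The basis vectors are scaled by [rho] so that the segments from [x] stay in [U], as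
   [variational_solution] requires; linearity undoes the scaling in the matrix [Q]. *)
have H i : exists Q : R -> 'rV[R]_n, Q 0 = rho *: delta_mx 0 i /\
    forall t : R, `|t| < T -> is_derive t 1 Q (Q t *m jacobian V (phi t x)).
  apply: variational_solution => // h /andP[h0 h1]; apply: rhoU.
  rewrite addrAC subrr add0r !normrZ !ger0_norm ?(ltW rho0) //.
  apply: (@le_trans _ _ (1 * (rho * 1))); last by rewrite mulr1 mul1r.
  by rewrite ler_pM ?mulr_ge0 ?(ltW rho0) // ler_wpM2l ?(ltW rho0) // norm_delta.
pose q i := projT1 (cid (H i)).
have q0 i : q i 0 = rho *: delta_mx 0 i by rewrite /q; case: (cid (H i)) => /= c [].
have qP i (t : R) : `|t| < T -> is_derive t 1 (q i) (q i t *m jacobian V (phi t x)).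
  by rewrite /q; case: (cid (H i)) => /= c [_]; exact.
pose Q t : 'M[R]_n := \matrix_(i, j) (rho^-1 * q i t 0 j).
have rQ i t : row i (Q t) = rho^-1 *: q i t by apply/rowP => j; rewrite !mxE.
have dQ (t : R) : `|t| < T -> is_derive t 1 Q (Q t *m jacobian V (phi t x)).
  move=> tT; apply/is_derive_mxP => i j.
  have -> : (Q t *m jacobian V (phi t x)) i j = rho^-1 * (q i t *m jacobian V (phi t x)) 0 j.
    transitivity (row i (Q t *m jacobian V (phi t x)) 0 j); first by rewrite [RHS]mxE.
    by rewrite row_mul rQ -scalemxAl mxE.
  rewrite (_ : (fun _ => _) = fun s => rho^-1 *: q i s 0 j); last by apply/funext => s; rewrite mxE.
  by apply: is_deriveZ; exact: (is_derive_mxP _ _ _ _).1 (qP i t tT) 0 j.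
have [L L0 LP] := diff_bounded aA sV.
have [C C0 CP] := flow_quadratic.
have [G G1 GP] := gronwall_rV n T L0.
exists Q; split=> //.
  apply/row_matrixP => i; rewrite rQ q0 scalerA mulVf ?gt_eqF // scale1r.
  by rewrite rowE mulmx1.
move=> t tT; apply: (@is_diff_quad _ _ _ _ _ (mulmxr (Q t) : {linear 'rV[R]_n -> 'rV[R]_n}) (G * C)).
  exact: mulmxr_continuous.
have : \forall k \near (0 : 'rV[R]_n), U (k + x).
  have : \forall z \near x, U z by exact: open_nbhs_nbhs (conj oU Ux).
  by rewrite (near_shift 0 x) subr0.
apply: filterS => k; rewrite addrC => Uk.
have b0 : 0 <= C * `|k| ^+ 2 by rewrite mulr_ge0 ?sqr_ge0.
(* The error of the linear approximation starts at 0 and satisfies the linearised equation up to a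
   term of size [C |k|^2], so it stays of that order. *)
have := GP (fun t => phi t (x + k) - phi t x - k *m Q t)
  (fun t => V (phi t (x + k)) - V (phi t x) - k *m (Q t *m jacobian V (phi t x))) _ b0 _ _ t tT.
have Q0 : Q 0 = 1%:M.
  apply/row_matrixP => i; rewrite rQ q0 scalerA mulVf ?gt_eqF // scale1r.
  by rewrite rowE mulmx1.
have -> : phi 0 (x + k) - phi 0 x - k *m Q 0 = 0.
  by rewrite Q0 mulmx1 !phi0 // [x + k - x]addrAC subrr add0r subrr.
rewrite normr0 add0r mulrA; apply=> s sT.
  apply: is_deriveB; first by apply: is_deriveB; exact: phiP.
  apply/is_derive_mxP => i j.
  rewrite (_ : (fun _ => _) = \sum_l (fun u => k i l *: Q u l j)); last first.
    by apply/funext => u; rewrite fct_sumE mxE; apply: eq_bigr.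
  rewrite mxE; apply: is_derive_sum => l; apply: is_deriveZ.
  exact: (is_derive_mxP _ _ _ _).1 (dQ s sT) l j.
rewrite mulmxA -diff_jacobian.
have -> : V (phi s (x + k)) - V (phi s x) - 'd V (phi s x) (k *m Q s) =
  'd V (phi s x) (phi s (x + k) - phi s x - k *m Q s) +
  (V (phi s (x + k)) - V (phi s x) - 'd V (phi s x) (phi s (x + k) - phi s x)).
  rewrite [X in _ = X + _]linearB /=; apply/matrixP => i j; rewrite !mxE; ring.
apply: le_trans (ler_normD _ _) _; apply: lerD; first by apply: LP; exact: phiB.
by have := CP x (x + k) s Ux Uk sT; rewrite [x + k - x]addrAC subrr add0r.
Qed.

Lemma flow_diff_bound : exists2 K, 1 <= K & forall x v t, U x -> `|t| < T ->
  `|'d (phi t) x v| <= K * `|v|.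
Proof.
have [L L0 LP] := diff_bounded aA sV.
have [G G1 GP] := gronwall_rV n T L0.
exists G => // x v t Ux tT; have [Q [Q0 dQ QP]] := flow_diff Ux.
have [_ ->] := QP t tT => /=.
have := GP (fun t => v *m Q t) (fun t => v *m (Q t *m jacobian V (phi t x))) 0 (lexx _) _ _ t tT.
rewrite Q0 mulmx1 addr0; apply=> s sT; last first.
  by rewrite addr0 mulmxA -diff_jacobian; apply: LP; exact: phiB.
apply/is_derive_mxP => i j.
rewrite (_ : (fun _ => _) = \sum_l (fun u => v i l *: Q u l j)); last first.
  by apply/funext => u; rewrite fct_sumE mxE; apply: eq_bigr.
rewrite mxE; apply: is_derive_sum => l; apply: is_deriveZ.
exact: (is_derive_mxP _ _ _ _).1 (dQ s sT) l j.
Qed.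

End Fixed.

Lemma row_mx_norm_le m n (u : 'rV[R]_m) (v : 'rV[R]_n) (C : R) :
  `|u| <= C -> `|v| <= C -> `|row_mx u v| <= C.
Proof.
move=> uC vC; have C0 := le_trans (normr_ge0 _) uC.
apply/mx_norm_leP => // i j; rewrite mxE; case: fintype.split => k.
  exact: le_trans (mx_norm_entry _ _ _) uC.
exact: le_trans (mx_norm_entry _ _ _) vC.
Qed.

Lemma lsubmx_norm_le m n (u : 'rV[R]_(m + n)) : `|lsubmx u| <= `|u|.
Proof. by apply/mx_norm_leP => // i j; rewrite mxE mx_norm_entry. Qed.

Lemma rsubmx_norm_le m n (u : 'rV[R]_(m + n)) : `|rsubmx u| <= `|u|.
Proof. by apply/mx_norm_leP => // i j; rewrite mxE mx_norm_entry. Qed.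

Lemma lsubmx_continuous m n : continuous (lsubmx : 'rV[R]_(m + n) -> 'rV[R]_m).
Proof.
move=> x; apply: differentiable_continuous; apply: (smooth_on_diff (A := setT)) => //.
exact: (smooth_on_linear openT (lsubmx : {linear 'rV[R]_(m + n) -> 'rV[R]_m})).
Qed.

Lemma rsubmx_continuous m n : continuous (rsubmx : 'rV[R]_(m + n) -> 'rV[R]_n).
Proof.
move=> x; apply: differentiable_continuous; apply: (smooth_on_diff (A := setT)) => //.
exact: (smooth_on_linear openT (rsubmx : {linear 'rV[R]_(m + n) -> 'rV[R]_n})).
Qed.

Lemma is_derive_row_mx m n (f : R -> 'rV[R]_m) (g : R -> 'rV[R]_n) (t : R) df dg :
  is_derive t 1 f df -> is_derive t 1 g dg ->
  is_derive t 1 (fun s => row_mx (f s) (g s)) (row_mx df dg).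
Proof.
move=> /is_derive_mxP dfP /is_derive_mxP dgP; apply/is_derive_mxP => i j.
rewrite -[j]fintype.splitK; case: (fintype.split j) => k /=.
  rewrite row_mxEl (_ : (fun _ => _) = fun s => f s i k); first exact: dfP.
  by apply/funext => s; rewrite row_mxEl.
rewrite row_mxEr (_ : (fun _ => _) = fun s => g s i k); first exact: dgP.
by apply/funext => s; rewrite row_mxEr.
Qed.

Lemma is_derive_mulmxl m n (v : 'rV[R]_m) (f : R -> 'M[R]_(m, n)) (t : R) df :
  is_derive t 1 f df -> is_derive t 1 (fun s => v *m f s) (v *m df).
Proof.
move=> /is_derive_mxP dfP; apply/is_derive_mxP => i j.
rewrite (_ : (fun _ => _) = \sum_l (fun u => v i l *: f u l j)); last first.
  by apply/funext => u; rewrite fct_sumE mxE; apply: eq_bigr.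
by rewrite mxE; apply: is_derive_sum => l; apply: is_deriveZ; exact: dfP.
Qed.

(* The derivative of a flow is, together with the flow, the flow of the field
   (V, DV), so each order of differentiability follows from the previous one. *)
Lemma flow_ck k n (A : set 'rV[R]_n) (a : 'rV[R]_n) (r T : R)
    (V : 'rV[R]_n -> 'rV[R]_n) (U : set 'rV[R]_n) (phi : R -> 'rV[R]_n -> 'rV[R]_n) :
  open A -> 0 < r -> 0 < T -> (forall y, `|y - a| <= r -> A y) -> smooth_on A V -> open U ->
  (forall x, U x -> phi 0 x = x) ->
  (forall x t, U x -> `|t| < T -> `|phi t x - a| <= r) ->
  (forall x (t : R), U x -> `|t| < T -> is_derive t 1 (phi ^~ x) (V (phi t x))) ->
  forall t, `|t| < T -> ck k U (phi t).
Proof.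
elim: k n A a r V U phi => // k IH n A a r V U phi oA r0 T0 aA sV oU phi0 phiB phiP t tT.
have FD x (Ux : U x) := flow_diff T0 aA sV oU phi0 phiB phiP Ux.
have [K K1 KP] := flow_diff_bound T0 aA sV oU phi0 phiB phiP.
have K0 : 0 < K by exact: lt_le_trans ltr01 K1.
pose Q x := xget (fun=> 1%:M) [set Q : R -> 'M[R]_n | [/\ Q 0 = 1%:M,
  forall t : R, `|t| < T -> is_derive t 1 Q (Q t *m jacobian V (phi t x)) &
  forall t : R, `|t| < T -> is_diff x (phi t) (mulmxr (Q t))]].
have QP x : U x -> [/\ Q x 0 = 1%:M,
  forall t : R, `|t| < T -> is_derive t 1 (Q x) (Q x t *m jacobian V (phi t x)) &
  forall t : R, `|t| < T -> is_diff x (phi t) (mulmxr (Q x t))].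
  by move=> /FD h; exact: (xgetPex (fun=> 1%:M) h).
have dQ x v s : U x -> `|s| < T -> 'd (phi s) x v = v *m Q x s.
  by move=> /QP[_ _ h] /h [_ ->].
have dphi x s : U x -> `|s| < T -> differentiable (phi s) x.
  by move=> /QP[_ _ h] /h [].
split=> [x Ux|i]; first exact: dphi.
pose A2 : set 'rV[R]_(n + n) := [set z | A (lsubmx z)].
pose V2 (z : 'rV[R]_(n + n)) := row_mx (V (lsubmx z)) (rsubmx z *m jacobian V (lsubmx z)).
(* With vectors shorter than [d] the derivative of the flow stays within [r], so the doubled flow
   remains in the ball of radius [r] around [(a, 0)] and the induction hypothesis applies to it. *)
pose d := r / K; have d0 : 0 < d by rewrite divr_gt0.
pose U2 : set 'rV[R]_(n + n) := [set z | U (lsubmx z) /\ `|rsubmx z - 0| < d].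
pose phi2 s (z : 'rV[R]_(n + n)) := row_mx (phi s (lsubmx z)) (rsubmx z *m Q (lsubmx z) s).
have oA2 : open A2 by apply: open_comp => // z _; exact: lsubmx_continuous.
have oU2 : open U2.
  apply: (@open_setI_preimage _ _ rsubmx [set z | U (lsubmx z)] [set w | `|w - 0| < d]).
  - by apply: open_comp => // z _; exact: lsubmx_continuous.
  - exact: oball_open.
  - by move=> z _; exact: rsubmx_continuous.
have sl : smooth_on A2 (lsubmx : 'rV[R]_(n + n) -> 'rV[R]_n).
  exact: (smooth_on_linear oA2 (lsubmx : {linear 'rV[R]_(n + n) -> 'rV[R]_n})).
have sr : smooth_on A2 (rsubmx : 'rV[R]_(n + n) -> 'rV[R]_n).
  exact: (smooth_on_linear oA2 (rsubmx : {linear 'rV[R]_(n + n) -> 'rV[R]_n})).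
have sV2 : smooth_on A2 V2.
  apply: (smooth_on_row_mx oA2).
    exact: (smooth_on_comp oA2 oA (f := lsubmx)).
  apply: (smooth_on_mulmx oA2) => //.
  exact: (smooth_on_comp oA2 oA (f := lsubmx) (g := jacobian V)) (smooth_on_jacobian oA sV).
have H2 : ck k U2 (phi2 t).
  apply: (IH _ A2 (row_mx a 0) r V2 U2 phi2) => //.
  - move=> z zr; apply: aA; apply: le_trans zr.
    have -> : lsubmx z - a = lsubmx (z - row_mx a 0) by rewrite linearB /= row_mxKl.
    exact: lsubmx_norm_le.
  - move=> z [Uz _]; have [Q0 _ _] := QP _ Uz.
    by rewrite /phi2 phi0 // Q0 mulmx1 hsubmxK.
  - move=> z s [Uz]; rewrite subr0 => zd sT.
    rewrite /phi2 opp_row_mx add_row_mx; apply: row_mx_norm_le; first exact: phiB.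
    rewrite subr0 -dQ //; apply: le_trans (KP _ _ _ Uz sT) _.
    by rewrite -ler_pdivlMl // mulrC ltW.
  - move=> z s [Uz _] sT; have [_ dQz _] := QP _ Uz.
    rewrite /V2 /phi2 row_mxKl row_mxKr -mulmxA.
    apply: is_derive_row_mx; first exact: phiP.
    by apply: is_derive_mulmxl; exact: dQz.
(* A multiple of the basis vector short enough to be an admissible initial value of the doubled
   flow; dividing by d / 2 recovers the partial derivative. *)
pose c : 'rV[R]_n := (d / 2) *: delta_mx 0 i.
have c2 : d / 2 < d by rewrite gtr_pMr // invf_lt1 // ltr1n.
have cd : `|c - 0| < d.
  rewrite subr0 normrZ gtr0_norm ?divr_gt0 //; apply: le_lt_trans c2.
  by rewrite ler_piMr ?norm_delta // divr_ge0 // ltW.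
have sg : ck k U (fun x => row_mx x c).
  have : smooth_on U (fun x => row_mx x c).
    apply: (smooth_on_row_mx oU); first exact: (smooth_on_id oU).
    exact: smooth_on_cst.
  by move=> /smooth_onP.
apply: (@ck_ext _ _ _ _ _ (fun x => (d / 2)^-1 *: rsubmx (phi2 t (row_mx x c)))) => //.
  move=> x Ux; rewrite /phi2 !row_mxKl !row_mxKr deriveE; last exact: dphi.
  by rewrite dQ // -scalemxAl scalerA mulVf ?scale1r // gt_eqF // divr_gt0.
apply/(ck_mxP _ _ oU) => b j.
have cc : ck k U (fun x => (d / 2)^-1 * phi2 t (row_mx x c) 0 (rshift n j)).
  apply: (ckM oU); first exact: ck_cst.
  apply: (ck_comp (B := U2) (f := fun x => row_mx x c) (g := fun z => phi2 t z 0 (rshift n j))) => //.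
    by move=> x Ux; split; rewrite ?row_mxKl ?row_mxKr.
  exact: (ck_mxP _ _ oU2).1 H2 0 _.
apply: (ck_ext oU _ cc) => x Ux; rewrite (ord1 b) !mxE.
by [].
Qed.

End Flow.

(** * Monodromy *)

Section RealInduction.
Context {R : realType}.

(** Connectedness of a segment in the form used for all continuation arguments below. The supremum
    of the [t] such that [P] holds up to [t] cannot be smaller than [b], because [P] passes from a
    point just below it to points just above it. *)
Lemma real_induction (P : R -> Prop) (a b : R) : a <= b ->
  (forall t, a <= t <= b -> exists2 e, 0 < e & forall u v, a <= u <= b -> a <= v <= b ->
     `|u - t| < e -> `|v - t| < e -> P u -> P v) ->
  P a -> P b.
Proof.
move=> ab H Pa.
pose A := [set t | a <= t <= b /\ forall u, a <= u <= t -> P u].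
have Aa : A a.
  by split=> [|u]; rewrite ?lexx //= => /le_anti <-.
have hA : has_ubound A by exists b => t [/andP[]].
have A0 : A !=set0 by exists a.
pose c := sup A.
have ac : a <= c by exact: ub_le_sup.
have cb : c <= b by apply: ge_sup => // t [/andP[]].
have [e e0 eP] : exists2 e, 0 < e & forall u v, a <= u <= b -> a <= v <= b ->
     `|u - c| < e -> `|v - c| < e -> P u -> P v by apply: H; rewrite ac.
have [u [/andP[au ub] Pu] cu] : exists2 u, A u & c - e < u.
  have [u Au cu] := sup_adherent e0 (conj A0 hA).
  by exists u.
have uc : u <= c by apply: ub_le_sup => //; split=> //; rewrite au.
have Pv v : a <= v <= b -> v < c + e -> P v.
  move=> /andP[av vb] vc; have [vu|uv] := leP v u; first by apply: Pu; rewrite av.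
  apply: (eP u v); rewrite ?au ?av ?ub ?vb //.
  - by rewrite ltr_norml; apply/andP; split; lra.
  - by rewrite ltr_norml; apply/andP; split; lra.
  - by apply: Pu; rewrite au lexx.
have [cb'|bc] := ltP c b; last by apply: Pv; rewrite ?ab ?lexx //; lra.
pose w := Num.min b (c + e / 2).
have cw : c < w by rewrite lt_min cb' ltrDl divr_gt0.
have we : w <= c + e / 2 by rewrite ge_min lexx orbT.
have wb : w <= b by rewrite ge_min lexx.
have : w <= c.
  apply: ub_le_sup => //; split=> [|v /andP[av vw]]; first by rewrite wb (le_trans ac (ltW cw)).
  by apply: Pv; [rewrite av (le_trans vw) | lra].
by rewrite leNgt cw.
Qed.

End RealInduction.

Section Monodromy.
Context {R : realType} {M : topologicalType} {Y : Type}.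
Variable E : M -> Y -> Prop.
Variable S : set M -> (M -> Y) -> Prop.

(* S U s says that s is a section over U of a covering of M whose fibre over p
   consists of the y with E p y. *)
Hypothesis S_open : forall U s, S U s -> open U.
Hypothesis S_fibre : forall U s q, S U s -> U q -> E q (s q).
Hypothesis S_uniq : forall U s U' s' p, S U s -> S U' s' -> U p -> U' p ->
  s p = s' p -> \forall q \near p, s q = s' q.
(** Every point has an evenly covered neighbourhood that is moreover path connected: sections
    through all points of the fibres exist, and two of them that meet once coincide. *)
Hypothesis S_cover : forall p, exists U, [/\ open U, U p,
  forall q y, U q -> E q y -> exists2 s, S U s & s q = y,
  forall s s', S U s -> S U s' -> forall q q', U q -> U q' -> s q = s' q -> s q' = s' q' &
  forall q q', U q -> U q' -> exists g : R -> M,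
    [/\ continuous g, forall t, U (g t), g 0 = q & g 1 = q']].

(** The fibre type [Y] is a bare type; agreeing locally with a section composed with [H] takes the
    place of continuity. The set [K] restricts where this is asked, so that liftings over closed
    pieces can be glued. *)
Definition lifts (X : topologicalType) (K : set X) (H : X -> M) (sg : X -> Y) :=
  forall x, K x -> exists U s, [/\ S U s, U (H x) &
    \forall x' \near x, K x' -> sg x' = s (H x')].

Lemma lifts_fibre (X : topologicalType) (K : set X) (H : X -> M) sg x :
  lifts K H sg -> K x -> E (H x) (sg x).
Proof.
move=> L Kx; have [U [s [SUs UHx /nbhs_singleton ->//]]] := L x Kx.
exact: S_fibre SUs UHx.
Qed.

Lemma lifts_comp (X X' : topologicalType) (K : set X) (K' : set X') (H : X -> M)
    (f : X' -> X) sg : continuous f -> (forall x, K' x -> K (f x)) ->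
  lifts K H sg -> lifts K' (H \o f) (sg \o f).
Proof.
move=> cf KK L x K'x; have [U [s [SUs UHx n]]] := L (f x) (KK x K'x).
have n' : \forall y \near x, K (f y) -> sg (f y) = s (H (f y)) := cf x _ n.
by exists U, s; split=> //; apply: filterS n' => y /= h /KK; exact: h.
Qed.

Lemma lifts_section (X : topologicalType) (K : set X) (H : X -> M) U s :
  S U s -> (forall x, K x -> U (H x)) -> lifts K H (s \o H).
Proof. by move=> SUs KU x /KU UHx; exists U, s; split=> //; apply: nearW. Qed.

Lemma lifts_uniq_seg (H : R -> M) sg sg' (a b : R) : continuous H -> a <= b ->
  lifts [set t : R | a <= t <= b] H sg -> lifts [set t : R | a <= t <= b] H sg' ->
  sg a = sg' a -> sg b = sg' b.
Proof.
move=> cH ab L L'; apply: (@real_induction R (fun t => sg t = sg' t)) => // t tab.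
have [U [oU Ut Uex Uuq _]] := S_cover (H t).
have loc sg1 : lifts [set t : R | a <= t <= b] H sg1 -> exists s, S U s /\
    \forall u \near t, a <= u <= b -> sg1 u = s (H u).
  move=> L1; have [s SUs st] := Uex _ _ Ut (lifts_fibre L1 tab).
  exists s; split=> //; have [U1 [s1 [SU1 U1t n]]] := L1 t tab.
  have st1 : s1 (H t) = s (H t) by rewrite st (nbhs_singleton n).
  have := cH t _ (S_uniq SU1 SUs U1t Ut st1).
  by apply: filterS2 n => u h1 /= h2 uab; rewrite h1.
have [s [SUs ns]] := loc _ L; have [s' [SUs' ns']] := loc _ L'.
have nU : \forall u \near t, U (H u) by exact: cH t _ (open_nbhs_nbhs (conj oU Ut)).
have [e /= e0 eP] := (nbhs_ballP _ _).1 (filterI (filterI ns ns') nU).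
exists e => // u v uab vab ut vt su.
have /eP [[su1 su1'] Uu] : ball t e u by rewrite /ball /= distrC.
have /eP [[sv1 sv1'] Uv] : ball t e v by rewrite /ball /= distrC.
by rewrite sv1 // sv1' //; apply: (Uuq _ _ SUs SUs' (H u)) => //; rewrite -su1 // -su1'.
Qed.

Lemma lifts_uniq_convex (K : set (R * R)) (H : R * R -> M) sg sg' x y :
  continuous H ->
  (forall t : R, 0 <= t <= 1 -> K (x.1 + t * (y.1 - x.1), x.2 + t * (y.2 - x.2))) ->
  lifts K H sg -> lifts K H sg' -> sg x = sg' x -> sg y = sg' y.
Proof.
move=> cH KK L L' sx.
pose f (t : R) : R * R := (x.1 + t * (y.1 - x.1), x.2 + t * (y.2 - x.2)).
have cf : continuous f.
  have ca (a b : R) : continuous (fun t : R => a + t * b).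
    move=> t; apply: cvgD; first exact: cvg_cst.
    by apply: cvgMl; exact: cvg_id.
  by move=> t; exact: (cvg_pair (ca _ _ t) (ca _ _ t)).
have f0 : f 0 = x by rewrite /f !mul0r !addr0 -surjective_pairing.
have e (a b : R) : a + (b - a) = b by rewrite addrCA subrr addr0.
have f1 : f 1 = y by rewrite /f !mul1r !e -surjective_pairing.
have := @lifts_uniq_seg (H \o f) (sg \o f) (sg' \o f) 0 1.
rewrite /= f0 f1; apply=> //.
- by move=> t; apply: continuous_comp; [exact: cf | exact: cH].
- exact: (lifts_comp cf KK L).
- exact: (lifts_comp cf KK L').
Qed.

Definition rect (a b c d : R) : set (R * R) := [set x | a <= x.1 <= b /\ c <= x.2 <= d].

Lemma rect_convex a b c d x y (t : R) : rect a b c d x -> rect a b c d y -> 0 <= t <= 1 ->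
  rect a b c d (x.1 + t * (y.1 - x.1), x.2 + t * (y.2 - x.2)).
Proof. by rewrite /rect /= => -[/andP[? ?] /andP[? ?]] [/andP[? ?] /andP[? ?]] /andP[? ?]; split; apply/andP; split; nra. Qed.

Lemma rect_sub a b c d a' b' c' d' : a' <= a -> b <= b' -> c' <= c -> d <= d' ->
  rect a b c d `<=` rect a' b' c' d'.
Proof. by move=> ? ? ? ? [x y]; rewrite /rect /= => -[/andP[? ?] /andP[? ?]]; split; apply/andP; split; lra. Qed.

Lemma rect_closed a b c d : closed (rect a b c d).
Proof.
have -> : rect a b c d = (fst @^-1` `[a, b]%classic) `&` (snd @^-1` `[c, d]%classic).
  by apply/seteqP; split=> x; rewrite /rect /= !in_itv.
apply: closedI; apply: closed_comp => [x _|]; try exact: interval_closed.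
  exact: cvg_fst.
exact: cvg_snd.
Qed.

Definition liftable (H : R * R -> M) (K : set (R * R)) :=
  forall x y, K x -> E (H x) y -> exists2 sg, lifts K H sg & sg x = y.

Lemma liftable_sub H K K' : K' `<=` K -> liftable H K -> liftable H K'.
Proof.
move=> KK L x y /KK Kx /(L _ _ Kx) [sg Lsg sx]; exists sg => // z /KK Kz.
have [U [s [SUs Uz n]]] := Lsg z Kz; exists U, s; split=> //.
by apply: filterS n => w h /KK.
Qed.

(** Liftings over the two pieces that agree at one point agree on the intersection, any two points
    of which are joined by a segment. Away from the intersection the other piece is closed and hence
    absent from a neighbourhood. *)
Lemma liftable_glue H (K1 K2 : set (R * R)) x0 : continuous H ->
  closed K1 -> closed K2 -> K1 x0 -> K2 x0 ->
  (forall x y (t : R), K1 x -> K2 x -> K1 y -> K2 y -> 0 <= t <= 1 ->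
     (K1 `&` K2) (x.1 + t * (y.1 - x.1), x.2 + t * (y.2 - x.2))) ->
  liftable H K1 -> liftable H K2 -> liftable H (K1 `|` K2).
Proof.
move=> cH c1 c2 K1x0 K2x0 cv L1 L2.
suff glue sg1 sg2 : lifts K1 H sg1 -> lifts K2 H sg2 -> sg1 x0 = sg2 x0 ->
    exists sg, [/\ lifts (K1 `|` K2) H sg, forall x, K1 x -> sg x = sg1 x &
      forall x, K2 x -> sg x = sg2 x].
  move=> x y [Kx|Kx] Exy.
    have [sg1 l1 s1] := L1 x y Kx Exy.
    have [sg2 l2 s2] := L2 x0 (sg1 x0) K2x0 (lifts_fibre l1 K1x0).
    by have [sg [l h1 h2]] := glue _ _ l1 l2 (esym s2); exists sg => //; rewrite h1.
  have [sg2 l2 s2] := L2 x y Kx Exy.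
  have [sg1 l1 s1] := L1 x0 (sg2 x0) K1x0 (lifts_fibre l2 K2x0).
  by have [sg [l h1 h2]] := glue _ _ l1 l2 s1; exists sg => //; rewrite h2.
move=> l1 l2 s12.
have ag x : K1 x -> K2 x -> sg1 x = sg2 x.
  move=> K1x K2x; apply: (@lifts_uniq_convex (K1 `&` K2) H sg1 sg2 x0 x) => //.
  - by move=> t t01; apply: cv.
  - move=> z [Kz _]; have [U [s [SUs Uz n]]] := l1 z Kz; exists U, s; split=> //.
    by apply: filterS n => w h [K1w _]; exact: h.
  - move=> z [_ Kz]; have [U [s [SUs Uz n]]] := l2 z Kz; exists U, s; split=> //.
    by apply: filterS n => w h [_ K2w]; exact: h.
pose sg x := if pselect (K1 x) then sg1 x else sg2 x.
have sgE1 x : K1 x -> sg x = sg1 x by rewrite /sg; case: pselect.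
have sgE2 x : K2 x -> sg x = sg2 x by rewrite /sg; case: pselect => // ? ?; exact: ag.
exists sg; split=> // z.
have far (K : set (R * R)) : closed K -> ~ K z -> \forall w \near z, ~ K w.
  move=> cK nK; have : open (~` K) by exact: closed_openC.
  by move=> oK; exact: open_nbhs_nbhs (conj oK nK).
have [K1z|nK1] := pselect (K1 z); have [K2z|nK2] := pselect (K2 z); last by case.
- move=> _; have [U [s [SUs Uz n]]] := l1 z K1z; have [U' [s' [SUs' U'z n']]] := l2 z K2z.
  exists U, s; split=> //.
  have sz : s' (H z) = s (H z).
    by rewrite -(nbhs_singleton n') // -(nbhs_singleton n) // ag.
  have n2 : \forall w \near z, s' (H w) = s (H w) := cH z _ (S_uniq SUs' SUs U'z Uz sz).
  apply: filterS3 n n' n2 => w h h' h2 [K1w|K2w]; first by rewrite sgE1 // h.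
  by rewrite sgE2 // h'.
- move=> _; have [U [s [SUs Uz n]]] := l1 z K1z; exists U, s; split=> //.
  by apply: filterS2 n (far _ c2 nK2) => w h nKw [K1w|//]; rewrite sgE1 // h.
- move=> _; have [U [s [SUs Uz n]]] := l2 z K2z; exists U, s; split=> //.
  by apply: filterS2 n (far _ c1 nK1) => w h nKw [//|K2w]; rewrite sgE2 // h.
Qed.

Lemma liftable_section H (K : set (R * R)) U :
  (forall q y, U q -> E q y -> exists2 s, S U s & s q = y) ->
  (forall x, K x -> U (H x)) -> liftable H K.
Proof.
move=> Uex KU x y Kx Exy; have [s SUs sx] := Uex _ _ (KU _ Kx) Exy.
by exists (s \o H); [exact: lifts_section SUs KU | exact: sx].
Qed.

(** Real induction replaces the subdivision of the square by a Lebesgue number: for each [s] a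
    vertical strip of positive width around [s] is lifted by induction on its height, and then the
    strips are joined by induction on [s]. *)
Lemma liftable_square H : continuous H -> liftable H (rect 0 1 0 1).
Proof.
move=> cH.
have strip s : exists2 e, 0 < e & liftable H (rect (s - e) (s + e) 0 1).
  apply: (@real_induction R (fun t => exists2 e, 0 < e & liftable H (rect (s - e) (s + e) 0 t)) 0 1) => //.
    move=> t t01; have [U [oU Ut Uex _ _]] := S_cover (H (s, t)).
    have nU : \forall z \near (s, t), U (H z) by exact: cH _ _ (open_nbhs_nbhs (conj oU Ut)).
    have [[A B] /= [/nbhs_ballP[d1 /= d10 dA] /nbhs_ballP[d2 /= d20 dB]] AB] := nU.
    exists d2 => // u v /andP[u0 u1] /andP[v0 v1] ut vt [e e0 Le].
    pose e' := Num.min e (d1 / 2).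
    have e'0 : 0 < e' by rewrite lt_min e0 divr_gt0.
    have e'e : e' <= e by rewrite ge_min lexx.
    have e'd : e' <= d1 / 2 by rewrite ge_min lexx orbT.
    have LB : liftable H (rect (s - e') (s + e') (Num.min u v) (Num.max u v)).
      apply: (liftable_section Uex) => -[x1 x2]; rewrite /rect /= => -[/andP[xa xb] /andP[xc xd]].
      apply: AB; split; [apply: dA | apply: dB]; rewrite /ball /= ltr_norml; apply/andP.
        by split; lra.
      move: ut vt; rewrite !ltr_norml => /andP[? ?] /andP[? ?].
      by move: xc xd; rewrite ge_min le_max => /orP[] ? /orP[] ?; split; lra.
    exists e' => //.
    have [vu|uv] := leP v u.
      by apply: liftable_sub Le; apply: rect_sub; lra.
    have -> : rect (s - e') (s + e') 0 v = rect (s - e') (s + e') 0 u `|` rect (s - e') (s + e') u v.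
      apply/seteqP; split=> -[x1 x2] /=; rewrite /rect /=.
        move=> [? /andP[? ?]]; have [?|?] := leP x2 u; [left | right]; split=> //; apply/andP; split=> //; exact: ltW.
      by move=> [] [? /andP[? ?]]; split=> //; apply/andP; split=> //; lra.
    apply: (@liftable_glue _ _ _ (s, u)) => //.
    - exact: rect_closed.
    - exact: rect_closed.
    - by split; apply/andP; split=> /=; lra.
    - by split; apply/andP; split=> /=; lra.
    - by move=> x y w ? ? ? ? ?; split; apply: rect_convex.
    - by apply: liftable_sub Le; apply: rect_sub; lra.
    - by move: LB; rewrite min_l ?max_r // ltW.
  have [U [oU Ut Uex _ _]] := S_cover (H (s, 0)).
  have nU : \forall z \near (s, 0 : R), U (H z) by exact: cH _ _ (open_nbhs_nbhs (conj oU Ut)).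
  have [[A B] /= [/nbhs_ballP[d1 /= d10 dA] /nbhs_ballP[d2 /= d20 dB]] AB] := nU.
  exists (d1 / 2); first by rewrite divr_gt0.
  apply: (liftable_section Uex) => -[x1 x2]; rewrite /rect /= => -[/andP[xa xb] /andP[xc xd]].
  apply: AB; split; [apply: dA | apply: dB]; rewrite /ball /= ltr_norml; apply/andP; split; lra.
apply: (@real_induction R (fun s => liftable H (rect 0 s 0 1)) 0 1) => //.
  move=> s s01; have [e e0 Le] := strip s; exists e => // u v /andP[u0 u1] /andP[v0 v1].
  rewrite !ltr_norml => /andP[? ?] /andP[? ?] Lu.
  have [vu|uv] := leP v u.
    by apply: liftable_sub Lu; apply: rect_sub; lra.
  have -> : rect 0 v 0 1 = rect 0 u 0 1 `|` rect u v 0 1.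
    apply/seteqP; split=> -[x1 x2] /=; rewrite /rect /=.
      move=> [/andP[? ?] ?]; have [?|?] := leP x1 u; [left | right]; split=> //; apply/andP; split=> //; exact: ltW.
    by move=> [] [/andP[? ?] ?]; split=> //; apply/andP; split=> //; lra.
  apply: (@liftable_glue _ _ _ (u, 0)) => //.
  - exact: rect_closed.
  - exact: rect_closed.
  - by split; apply/andP; split=> /=; lra.
  - by split; apply/andP; split=> /=; lra.
  - by move=> x y w ? ? ? ? ?; split; apply: rect_convex.
  - by apply: liftable_sub Le; apply: rect_sub; lra.
have [e e0 Le] := strip 0.
by apply: liftable_sub Le; apply: rect_sub; lra.
Qed.

Lemma path_lift (g : R -> M) y : continuous g -> E (g 0) y ->
  exists2 sg, lifts [set t : R | 0 <= t <= 1] g sg & sg 0 = y.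
Proof.
move=> cg Ey; pose H (z : R * R) := g z.2.
have cH : continuous H.
  by move=> z; apply: continuous_comp; [exact: cvg_snd | exact: cg].
have [|sg L s0] := liftable_square cH (x := (0, 0)) (y := y) _ Ey.
  by split; rewrite /= lexx ler01.
exists (fun t => sg (0, t)) => //.
have cf : continuous (fun t : R => (0 : R, t)).
  have c0 : continuous (fun t : R => (0 : R)) by move=> t; exact: cvg_cst.
  have c1 : continuous (fun t : R => t) by move=> t; exact: cvg_id.
  by move=> t; exact: (cvg_pair (c0 t) (c1 t)).
have KK (t : R) : 0 <= t <= 1 -> rect 0 1 0 1 (0, t).
  by move=> t01; split; rewrite /= ?lexx ?ler01.
exact: (lifts_comp (K' := [set t : R | 0 <= t <= 1]) cf KK L).
Qed.

Lemma lifts_const (X : topologicalType) (K : set X) (H : X -> M) p y :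
  (forall x, K x -> H x = p) -> E p y -> lifts K H (fun=> y).
Proof.
move=> Hp Ey x Kx; have [U [oU Up Uex _ _]] := S_cover p.
have [s SUs sp] := Uex p y Up Ey; exists U, s; split=> //; first by rewrite Hp.
by apply: nearW => x' Kx'; rewrite Hp.
Qed.

Lemma lifts_congr (X : topologicalType) (K : set X) (H H' : X -> M) sg :
  (forall x, K x -> H x = H' x) -> lifts K H sg -> lifts K H' sg.
Proof.
move=> HH L x Kx; have [U [s [SUs UHx n]]] := L x Kx.
exists U, s; split=> //; first by rewrite -HH.
by apply: filterS n => x' h Kx'; rewrite -HH // h.
Qed.

Let I : set R := [set t | 0 <= t <= 1].

Lemma continuous_affine (a b : R) : continuous (fun t : R => a + t * b).
Proof.
move=> t; apply: cvgD; first exact: cvg_cst.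
by apply: cvgMl; exact: cvg_id.
Qed.

Lemma continuous_affine2 (a b c d : R) : continuous (fun t : R => (a + t * b, c + t * d)).
Proof. by move=> t; exact: (cvg_pair (@continuous_affine _ _ t) (@continuous_affine _ _ t)). Qed.

Lemma continuous_glue (g h : R -> M) (a : R) : continuous g -> continuous h -> g a = h a ->
  continuous (fun t => if t <= a then g t else h t).
Proof.
move=> cg ch gh t; have [ta|at_|tE] := ltgtP t a.
- have n : \forall u \near t, g u = if u <= a then g u else h u.
    by apply: filterS (open_nbhs_nbhs (conj (@open_lt _ a) ta)) => u /ltW ->.
  rewrite /continuous_at /= (ltW ta) => A gA; have nA : \forall u \near t, A (g u) := cg t A gA.
  by apply: filterS2 n nA => u e; rewrite e.
- have n : \forall u \near t, h u = if u <= a then g u else h u.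
    by apply: filterS (open_nbhs_nbhs (conj (@open_gt _ a) at_)) => u /=; rewrite ltNge => /negbTE ->.
  rewrite /continuous_at /= leNgt at_ => A hA; have nA : \forall u \near t, A (h u) := ch t A hA.
  by apply: filterS2 n nA => u e; rewrite e.
- rewrite /continuous_at /= tE lexx => A nA; have nA' := nA; rewrite gh in nA'.
  have n1 : \forall u \near a, A (g u) := cg a A nA.
  have n2 : \forall u \near a, A (h u) := ch a A nA'.
  by apply: filterS2 n1 n2 => u ? ? /=; case: ifP.
Qed.

(** Paths and homotopies are taken continuous on the whole line and plane, so that no subspace
    topology occurs; only their values over the unit interval count. [path_clip] and [null_clip]
    supply them. *)
Hypothesis pathM : forall p q, exists g : R -> M, [/\ continuous g, g 0 = p & g 1 = q].
Hypothesis nullM : forall p (g : R -> M), continuous g -> g 0 = p -> g 1 = p ->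
  exists H : R * R -> M, [/\ continuous H, forall t, I t -> H (0, t) = g t,
    forall t, I t -> H (1, t) = p & forall s, I s -> H (s, 0) = p /\ H (s, 1) = p].

(** The null homotopy lifts to the square. It is constant on three sides, so the lifting is constant
    on them and takes the same value at the two ends of the fourth, which is the loop. *)
Lemma loop_lift p (g : R -> M) (sg : R -> Y) : continuous g -> g 0 = p -> g 1 = p -> lifts I g sg -> sg 1 = sg 0.
Proof.
move=> cg g0 g1 L; have [H [cH H0 H1 Hs]] := nullM cg g0 g1.
have I0 : I 0 by rewrite /I /= lexx ler01.
have I1 : I 1 by rewrite /I /= lexx ler01.
have E0 : E p (sg 0) by rewrite -g0; exact: lifts_fibre L I0.
have [|sq Lq q0] := @liftable_square H cH (0, 0) (sg 0) (conj I0 I0).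
  by rewrite H0 // g0.
have side (a b c d : R) : (forall t, I t -> I (a + t * b)) -> (forall t, I t -> I (c + t * d)) ->
    lifts I (fun t => H (a + t * b, c + t * d)) (fun t => sq (a + t * b, c + t * d)).
  move=> h1 h2; apply: (lifts_comp (@continuous_affine2 a b c d) _ Lq) => t It.
  by split; [exact: h1 | exact: h2].
have csd (a b c d : R) : (forall t, I t -> I (a + t * b)) -> (forall t, I t -> I (c + t * d)) ->
    (forall t, I t -> H (a + t * b, c + t * d) = p) ->
    sq (a + b, c + d) = sq (a, c).
  move=> h1 h2 h; have L1 := side a b c d h1 h2.
  have cc : continuous (fun t : R => H (a + t * b, c + t * d)).
    by move=> t; apply: continuous_comp; [exact: continuous_affine2 | exact: cH].
  have Ep : E p (sq (a, c)).
    have := lifts_fibre L1 I0; rewrite !mul0r !addr0.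
    by have := h 0 I0; rewrite !mul0r !addr0 => ->.
  have := lifts_uniq_seg cc ler01 L1 (lifts_const h Ep).
  by rewrite !mul0r !addr0 !mul1r; exact.
have i0 t : I t -> I (0 + t * 0) by rewrite mulr0 addr0.
have i1 t : I t -> I (1 + t * 0) by rewrite mulr0 addr0.
have it t : I t -> I (0 + t * 1) by rewrite mulr1 add0r.
have e1 : sq (1, 0) = sq (0, 0).
  have := csd 0 1 0 0 it i0; rewrite add0r addr0; apply=> t It.
  by have [] := Hs (0 + t * 1) (it t It); rewrite mulr0 addr0.
have e2 : sq (1, 1) = sq (1, 0).
  have := csd 1 0 0 1 i1 it; rewrite add0r addr0; apply=> t It.
  by rewrite mulr0 addr0 H1 //; exact: it.
have e3 : sq (1, 1) = sq (0, 1).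
  have := csd 0 1 1 0 it i1; rewrite add0r addr0; apply=> t It.
  by have [] := Hs (0 + t * 1) (it t It); rewrite mulr0 addr0.
have Lg : lifts I g (fun t => sq (0 + t * 0, 0 + t * 1)).
  apply: lifts_congr (side 0 0 0 1 i0 it) => t It.
  by rewrite mulr0 addr0 mulr1 add0r H0.
have := lifts_uniq_seg cg ler01 L Lg.
rewrite !mulr0 !mul0r !addr0 !add0r mulr1 => -> //.
by rewrite -e3 e2 e1 q0.
Qed.

(** The first path followed by the reverse of the second is a loop, whose lifting closes up by
    [loop_lift]; its value at the midpoint is the endpoint of both liftings. *)
Lemma end_uniq p q y (g1 g2 : R -> M) (sg1 sg2 : R -> Y) : continuous g1 -> continuous g2 ->
  g1 0 = p -> g2 0 = p -> g1 1 = q -> g2 1 = q -> lifts I g1 sg1 -> lifts I g2 sg2 ->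
  sg1 0 = y -> sg2 0 = y -> sg1 1 = sg2 1.
Proof.
move=> c1 c2 g10 g20 g11 g21 L1 L2 s1 s2.
pose g t := if t <= 2^-1 then g1 (0 + t * 2) else g2 (2 + t * - 2).
have h2 : 2^-1 * 2 = 1 :> R by rewrite mulVf // pnatr_eq0.
have cg : continuous g.
  apply: (@continuous_glue (fun t => g1 (0 + t * 2)) (fun t => g2 (2 + t * - 2))).
  - by move=> t; apply: continuous_comp; [exact: continuous_affine | exact: c1].
  - by move=> t; apply: continuous_comp; [exact: continuous_affine | exact: c2].
  - by rewrite mulrN h2 add0r g11 (_ : 2 - 1 = 1) ?g21 //; lra.
have g0 : g 0 = p.
  by rewrite /g invr_ge0 ler0n mul0r addr0.
have g_1 : g 1 = p.
  rewrite /g ifN ?mul1r ?subrr // -ltNge invf_lt1 // ltr1n //.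
have Ey : E (g 0) y.
  by rewrite g0 -g10 -s1; apply: lifts_fibre L1 _; rewrite /I /= lexx ler01.
have [sg L sg0] := path_lift cg Ey.
have sgl := loop_lift cg g0 g_1 L.
have La (a b : R) : (forall t, I t -> I (a + t * b)) ->
    lifts I (fun t => g (a + t * b)) (fun t => sg (a + t * b)).
  by move=> h; apply: (lifts_comp (@continuous_affine a b) _ L) => t It; exact: h.
have A1 : lifts I g1 (fun t => sg (0 + t * 2^-1)).
  apply: lifts_congr (La 0 2^-1 _) => t; rewrite /I /= => /andP[t0 t1]; last by apply/andP; split; lra.
  by rewrite /g ifT; [congr g1 | ]; lra.
have A2 : lifts I g2 (fun t => sg (1 + t * - 2^-1)).
  apply: lifts_congr (La 1 (- 2^-1) _) => t; rewrite /I /= => /andP[t0 t1]; last by apply/andP; split; lra.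
  have [->|tn1] := eqVneq t 1.
    by rewrite g21 -g11 /g ifT; [congr g1|]; lra.
  have t1' : t < 1 by rewrite lt_neqAle tn1.
  by rewrite /g ifN; [congr g2 | rewrite -ltNge]; lra.
have E1 : sg1 1 = sg (2^-1).
  have := lifts_uniq_seg c1 ler01 L1 A1.
  by rewrite mul0r addr0 mul1r add0r sg0 s1; exact.
have E2 : sg2 1 = sg (2^-1).
  have := lifts_uniq_seg c2 ler01 L2 A2.
  rewrite mul0r addr0 mul1r sgl sg0 s2 => /(_ erefl) ->; congr sg; lra.
by rewrite E1 E2.
Qed.

(** The value at [q] is the endpoint of the lifting of any path from [p0] to [q]. Near [q] the path
    is prolonged inside an evenly covered neighbourhood, which shows that these endpoints form a
    local section. *)
Theorem monodromy p0 y0 : E p0 y0 -> exists2 s : M -> Y, s p0 = y0 &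
  forall q, exists U s', [/\ S U s', U q & \forall q' \near q, s q' = s' q'].
Proof.
move=> E0.
pose ends q y := exists (g : R -> M) (sg : R -> Y), [/\ continuous g, g 0 = p0, g 1 = q & lifts I g sg] /\
  sg 0 = y0 /\ sg 1 = y.
have endsP q : exists y, ends q y.
  have [g [cg g0 g1]] := pathM p0 q.
  have [|sg L s0] := path_lift cg (y := y0); first by rewrite g0.
  by exists (sg 1), g, sg.
have endsU q y y' : ends q y -> ends q y' -> y = y'.
  move=> [g [sg [[cg g0 g1 L] [s0 <-]]]] [g' [sg' [[cg' g0' g1' L'] [s0' <-]]]].
  exact: (end_uniq cg cg' g0 g0' g1 g1' L L' s0 s0').
pose s q := projT1 (cid (endsP q)).
have sP q : ends q (s q) by rewrite /s; case: (cid (endsP q)).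
have I0 : I 0 by rewrite /I /= lexx ler01.
have I1 : I 1 by rewrite /I /= lexx ler01.
exists s.
  apply: endsU (sP p0) _; exists (fun=> p0), (fun=> y0); split=> //; split=> //.
  - by move=> t; exact: cvg_cst.
  - exact: lifts_const E0.
move=> q; have [U [oU Uq Uex _ Upath]] := S_cover q.
have [g [sg [[cg g0 g1 L] [s0 s1]]]] := sP q.
have Eq : E q (s q) by rewrite -s1 -g1; exact: lifts_fibre L I1.
have [s' SUs' s'q] := Uex q (s q) Uq Eq.
exists U, s'; split=> //.
apply: filterS (open_nbhs_nbhs (conj oU Uq)) => q' Uq'.
have [c [cc cU c0 c1]] := Upath q q' Uq Uq'.
apply: endsU (sP q') _.
pose g' t := if t <= 2^-1 then g (0 + t * 2) else c (- 1 + t * 2).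
have h2 : 2^-1 * 2 = 1 :> R by rewrite mulVf // pnatr_eq0.
have cg' : continuous g'.
  apply: (@continuous_glue (fun t => g (0 + t * 2)) (fun t => c (- 1 + t * 2))).
  - by move=> t; apply: continuous_comp; [exact: continuous_affine | exact: cg].
  - by move=> t; apply: continuous_comp; [exact: continuous_affine | exact: cc].
  - by rewrite h2 add0r addNr g1 c0.
have g'0 : g' 0 = p0 by rewrite /g' invr_ge0 ler0n mul0r addr0.
have g'1 : g' 1 = q'.
  rewrite /g' ifN; first by rewrite mul1r (_ : - 1 + 2 = 1) //; lra.
  by rewrite -ltNge invf_lt1 // ltr1n.
have [|sg' L' s'0] := path_lift cg' (y := y0); first by rewrite g'0.
have La (a b : R) : (forall t, I t -> I (a + t * b)) ->
    lifts I (fun t => g' (a + t * b)) (fun t => sg' (a + t * b)).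
  by move=> h; apply: (lifts_comp (@continuous_affine a b) _ L') => t It; exact: h.
have A1 : lifts I g (fun t => sg' (0 + t * 2^-1)).
  apply: lifts_congr (La 0 2^-1 _) => t; rewrite /I /= => /andP[t0 t1]; last by apply/andP; split; lra.
  by rewrite /g' ifT; [congr g | ]; lra.
have A2 : lifts I c (fun t => sg' (2^-1 + t * 2^-1)).
  apply: lifts_congr (La 2^-1 2^-1 _) => t; rewrite /I /= => /andP[t0 t1]; last by apply/andP; split; lra.
  have [->|tn0] := eqVneq t 0.
    by rewrite c0 -g1 /g' ifT; [congr g|]; lra.
  have t0' : 0 < t by rewrite lt_neqAle eq_sym tn0.
  by rewrite /g' ifN; [congr c | rewrite -ltNge]; lra.
have E1 : sg' (2^-1) = s q.
  have := lifts_uniq_seg cg ler01 L A1.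
  by rewrite mul0r addr0 mul1r add0r s'0 s0 s1 => /(_ erefl).
have Lc : lifts I c (s' \o c) by apply: lifts_section SUs' _ => t _; exact: cU.
exists g', sg'; split=> //; split=> //.
have := lifts_uniq_seg cc ler01 A2 Lc.
rewrite /= mul0r addr0 E1 c0 s'q c1 mul1r => /(_ erefl) <-; congr sg'; lra.
Qed.

End Monodromy.

(** * Tensors *)

Section TensorAlgebra.
Context {R : realType}.
Implicit Types n m p k : nat.

Lemma pull_mul m n p k (A : 'M[R]_(m, n)) (B : 'M[R]_(n, p)) (t : tens R p k) :
  pull A (pull B t) = pull (A *m B) t.
Proof.
apply/ffunP => i; rewrite !ffunE.
under eq_bigr do rewrite ffunE mulr_suml.
rewrite exchange_big; apply: eq_bigr => l _ /=.
under [in RHS]eq_bigr do rewrite mxE.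
rewrite bigA_distr_bigA mulr_sumr /=; apply: eq_bigr => j _.
by rewrite big_split /= -mulrA; congr (_ * _); rewrite mulrC.
Qed.

Lemma pull1 n k (t : tens R n k) : pull 1%:M t = t.
Proof.
apply/ffunP => i; rewrite ffunE (bigD1 i) //= [X in _ + X]big1 => [|j ji].
  by rewrite addr0 big1 ?mulr1 // => a _; rewrite mxE eqxx.
have [a ia] : exists a, i a != j a.
  by apply/existsP; rewrite -negb_forall; apply: contra ji => /forallP h; apply/eqP/ffunP => a; apply/esym/eqP.
by rewrite (bigD1 a) //= mxE (negbTE ia) mul0r mulr0.
Qed.

Lemma pullD m n k (A : 'M[R]_(m, n)) (t s : tens R n k) : pull A (t + s) = pull A t + pull A s.
Proof.
apply/ffunP => i; rewrite !ffunE -big_split; apply: eq_bigr => j _.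
by rewrite ffunE mulrDl.
Qed.

Lemma pullZ m n k (A : 'M[R]_(m, n)) a (t : tens R n k) : pull A (a *: t) = a *: pull A t.
Proof.
apply/ffunP => i; rewrite !ffunE [RHS]mulr_sumr; apply: eq_bigr => j _.
by rewrite ffunE -mulrA.
Qed.

Lemma pull0 m n k (A : 'M[R]_(m, n)) : pull A (0 : tens R n k) = 0.
Proof. by apply/ffunP => i; rewrite !ffunE big1 // => j _; rewrite ffunE mul0r. Qed.

Lemma pull_inj m k (A : 'M[R]_m) : A \in unitmx -> injective (pull A : tens R m k -> tens R m k).
Proof. by move=> uA t s e; rewrite -(pull1 t) -(pull1 s) -(mulVmx uA) -!pull_mul e. Qed.

(* The derivative of [pull A t] in the direction B of the matrix A. *)
Definition dpull m n k (A B : 'M[R]_(m, n)) (t : tens R n k) : tens R m k :=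
  [ffun i : {ffun 'I_k -> 'I_m} => \sum_(j : {ffun 'I_k -> 'I_n}) t j *
    \sum_(a < k) B (i a) (j a) * \prod_(b < k | b != a) A (i b) (j b)].

Lemma dpullD m n k (A B C : 'M[R]_(m, n)) (t : tens R n k) :
  dpull A (B + C) t = dpull A B t + dpull A C t.
Proof.
apply/ffunP => i; rewrite !ffunE -big_split; apply: eq_bigr => j _ /=.
rewrite -mulrDr -big_split; congr (_ * _); apply: eq_bigr => a _.
by rewrite mxE mulrDl.
Qed.

Lemma dpullN m n k (A B : 'M[R]_(m, n)) (t : tens R n k) : dpull A (- B) t = - dpull A B t.
Proof.
apply/ffunP => i; rewrite !ffunE -sumrN; apply: eq_bigr => j _ /=.
rewrite -mulrN -sumrN; congr (_ * _); apply: eq_bigr => a _.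
by rewrite mxE mulNr.
Qed.

Lemma subst_ixE n k (j : {ffun 'I_k -> 'I_n}) a l b :
  subst_ix j a l b = if b == a then l else j b.
Proof. by rewrite ffunE. Qed.

(** The infinitesimal form of [pull_mul] in the left factor; [dpull_mulr] is the one in the right
    factor. Together they give the covariance of [dact] and the derivative of a parallel tensor
    evaluated on moving frames. *)
Lemma dpull_mull m n k (A : 'M[R]_(m, n)) (B : 'M[R]_m) (t : tens R n k) :
  dpull A (B *m A) t = dact B (pull A t).
Proof.
apply/ffunP => i; rewrite !ffunE.
under eq_bigr do rewrite mulr_sumr.
rewrite exchange_big; apply: eq_bigr => a _ /=.
under [in RHS]eq_bigr do rewrite ffunE mulr_sumr.
rewrite exchange_big; apply: eq_bigr => j _ /=.
rewrite mxE mulr_suml mulr_sumr; apply: eq_bigr => l _.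
rewrite [in RHS](bigD1 a) //= subst_ixE eqxx.
have -> : \prod_(b < k | b != a) A (subst_ix i a l b) (j b) =
          \prod_(b < k | b != a) A (i b) (j b).
  by apply: eq_bigr => b ba; rewrite subst_ixE (negbTE ba).
by ring.
Qed.

(** Exchanging the index at place [a] with the free index is an involution of the set of summation
    indices. *)
Lemma subst_swap n k (a : 'I_k) (F : {ffun 'I_k -> 'I_n} -> 'I_n -> R) :
  \sum_j \sum_l F j l = \sum_j \sum_l F (subst_ix j a l) (j a).
Proof.
rewrite !pair_big /=.
pose h (jl : {ffun 'I_k -> 'I_n} * 'I_n) := (subst_ix jl.1 a jl.2, jl.1 a).
have hK : involutive h.
  move=> [j l]; rewrite /h /= subst_ixE eqxx; congr (_, _).
  by apply/ffunP => b; rewrite !subst_ixE; case: eqP => // ->.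
by rewrite (reindex_inj (inv_inj hK)).
Qed.

Lemma dpull_mulr m n k (A : 'M[R]_(m, n)) (C : 'M[R]_n) (t : tens R n k) :
  dpull A (A *m C) t = pull A (dact C t).
Proof.
apply/ffunP => i; rewrite !ffunE.
under eq_bigr do rewrite mulr_sumr.
under [in RHS]eq_bigr do rewrite ffunE mulr_suml.
rewrite exchange_big [in RHS]exchange_big; apply: eq_bigr => a _ /=.
under [in RHS]eq_bigr do rewrite mulr_suml.
rewrite [RHS](subst_swap a).
apply: eq_bigr => j _; rewrite mxE mulr_suml mulr_sumr; apply: eq_bigr => l _.
rewrite subst_ixE eqxx.
have -> : subst_ix (subst_ix j a l) a (j a) = j.
  by apply/ffunP => b; rewrite !subst_ixE; case: eqP => // ->.
rewrite [in RHS](bigD1 a) //= subst_ixE eqxx.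
have -> : \prod_(b < k | b != a) A (i b) (subst_ix j a l b) =
          \prod_(b < k | b != a) A (i b) (j b).
  by apply: eq_bigr => b ba; rewrite subst_ixE (negbTE ba).
by ring.
Qed.

Lemma dactZ n k (A : 'M[R]_n) a (t : tens R n k) : dact A (a *: t) = a *: dact A t.
Proof.
apply/ffunP => i; rewrite !ffunE [RHS]mulr_sumr; apply: eq_bigr => b _ /=.
by rewrite mulr_sumr; apply: eq_bigr => l _; rewrite ffunE mulrCA.
Qed.

Lemma dactDl n k (A B : 'M[R]_n) (t : tens R n k) : dact (A + B) t = dact A t + dact B t.
Proof.
apply/ffunP => i; rewrite !ffunE -big_split; apply: eq_bigr => a _ /=.
by rewrite -big_split; apply: eq_bigr => l _; rewrite mxE mulrDl.
Qed.

Lemma dactZl n k x (A : 'M[R]_n) (t : tens R n k) : dact (x *: A) t = x *: dact A t.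
Proof.
apply/ffunP => i; rewrite !ffunE [RHS]mulr_sumr; apply: eq_bigr => a _ /=.
by rewrite mulr_sumr; apply: eq_bigr => l _; rewrite mxE mulrA.
Qed.

Lemma dact_suml n k (I : Type) (r : seq I) (A : I -> 'M[R]_n) (t : tens R n k) :
  dact (\sum_(i <- r) A i) t = \sum_(i <- r) dact (A i) t.
Proof.
elim/big_ind2 : _ => [|A1 t1 A2 t2 <- <-|//]; last by rewrite dactDl.
by rewrite -[0 : 'M[R]_n](scale0r 0) dactZl scale0r.
Qed.

Lemma dact_pull n k (A : 'M[R]_n) (B : 'M[R]_n) (t : tens R n k) : A \in unitmx ->
  dact (A *m B *m invmx A) (pull A t) = pull A (dact B t).
Proof. by move=> uA; rewrite -dpull_mull mulmxKV // dpull_mulr. Qed.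

Lemma sum_ffunS n k (F : {ffun 'I_k.+1 -> 'I_n} -> R) (icons : 'I_n -> {ffun 'I_k -> 'I_n} -> {ffun 'I_k.+1 -> 'I_n}) :
  (forall l j, icons l j = [ffun a => if unlift ord0 a is Some b then j b else l]) ->
  \sum_j F j = \sum_l \sum_j F (icons l j).
Proof.
move=> icE; rewrite pair_big /=.
rewrite (reindex (fun lj : 'I_n * {ffun 'I_k -> 'I_n} => icons lj.1 lj.2)) //=.
exists (fun j : {ffun 'I_k.+1 -> 'I_n} => (j ord0, [ffun b => j (lift ord0 b)])) => [[l j] _|j _] /=.
  rewrite icE ffunE unlift_none; congr (_, _).
  by apply/ffunP => b; rewrite !ffunE liftK.
by rewrite icE; apply/ffunP => a; rewrite ffunE; case: unliftP => [b ->|->]; rewrite ?ffunE.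
Qed.

Definition icons n k (l : 'I_n) (j : {ffun 'I_k -> 'I_n}) : {ffun 'I_k.+1 -> 'I_n} :=
  [ffun a => if unlift ord0 a is Some b then j b else l].

Lemma icons0 n k (l : 'I_n) (j : {ffun 'I_k -> 'I_n}) : icons l j ord0 = l.
Proof. by rewrite ffunE unlift_none. Qed.

Lemma iconsS n k (l : 'I_n) (j : {ffun 'I_k -> 'I_n}) b : icons l j (lift ord0 b) = j b.
Proof. by rewrite ffunE liftK. Qed.

(** The interior product with [v], which fills the first slot. *)
Definition ins n k (v : 'rV[R]_n) (t : tens R n k.+1) : tens R n k :=
  [ffun j => \sum_l v 0 l * t (icons l j)].

Lemma insE n k l (t : tens R n k.+1) (j : {ffun 'I_k -> 'I_n}) :
  ins (delta_mx 0 l) t j = t (icons l j).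
Proof.
rewrite ffunE (bigD1 l) //= big1 ?addr0 => [|i il]; first by rewrite !mxE !eqxx mul1r.
by rewrite mxE (negbTE il) andbF mul0r.
Qed.

Lemma ins_sum n k (v : 'rV[R]_n) (t : tens R n k.+1) :
  ins v t = \sum_l v 0 l *: ins (delta_mx 0 l) t.
Proof.
apply/ffunP => j; rewrite sum_ffunE ffunE; apply: eq_bigr => l _.
by rewrite !ffunE; congr (_ * _); rewrite -insE ffunE.
Qed.

Lemma pull_ins m n k (A : 'M[R]_(m, n)) (v : 'rV[R]_m) (t : tens R n k.+1) :
  pull A (ins (v *m A) t) = ins v (pull A t).
Proof.
apply/ffunP => i; rewrite !ffunE.
transitivity (\sum_l \sum_p \sum_j v 0 l * (t (icons p j) * (A l p * \prod_a A (i a) (j a)))).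
  under eq_bigr do rewrite ffunE mulr_suml.
  rewrite exchange_big /= [RHS]exchange_big /=; apply: eq_bigr => p _.
  rewrite [RHS]exchange_big /=; apply: eq_bigr => j _.
  by rewrite mxE !mulr_suml; apply: eq_bigr => l _; ring.
apply: eq_bigr => l _; rewrite ffunE (@sum_ffunS _ _ _ (@icons n k)) // mulr_sumr.
apply: eq_bigr => p _; rewrite mulr_sumr; apply: eq_bigr => j _.
rewrite big_ord_recl !icons0; congr (_ * (_ * (_ * _))).
by apply: eq_bigr => a _; rewrite !iconsS.
Qed.

Lemma dact_ins n k (A : 'M[R]_n) (v : 'rV[R]_n) (t : tens R n k.+1) :
  dact A (ins v t) = ins v (dact A t) - ins (v *m A) t.
Proof.
apply/eqP; rewrite eq_sym subr_eq; apply/eqP/ffunP => i; rewrite !ffunE.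
under eq_bigr => l _ do rewrite ffunE big_ord_recl mulrDr.
rewrite big_split /= addrC; congr (_ + _).
  under eq_bigr => l _ do rewrite mulr_sumr.
  rewrite exchange_big /=; apply: eq_bigr => a _.
  under eq_bigr => l _ do rewrite mulr_sumr.
  rewrite exchange_big /=; apply: eq_bigr => p _; rewrite ffunE mulr_sumr.
  apply: eq_bigr => l _; rewrite iconsS mulrCA; congr (_ * (_ * t _)).
  apply/ffunP => b; rewrite !ffunE; case: unliftP => [b' ->|->].
    by rewrite (inj_eq lift_inj) ffunE.
  by [].
under eq_bigr => l _ do rewrite mulr_sumr.
rewrite exchange_big /=; apply: eq_bigr => p _; rewrite mxE mulr_suml.
apply: eq_bigr => l _; rewrite icons0 mulrA; congr (_ * t _).
by apply/ffunP => b; rewrite !ffunE; case: unliftP => [b' ->|->].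
Qed.

(** The inner product of covariant tensors. As covectors are paired, [g] is to be the inverse of a
    Gram matrix. All components are summed, so for forms of degree [k] the usual inner product is
    multiplied by k!. *)
Definition ip n k (g : 'M[R]_n) (t s : tens R n k) : R := \sum_i t i * pull g s i.

Lemma pull_adj m n k (A : 'M[R]_(m, n)) (t : tens R n k) (s : tens R m k) :
  \sum_i pull A t i * s i = \sum_j t j * pull A^T s j.
Proof.
under eq_bigr do rewrite ffunE mulr_suml.
rewrite exchange_big /=; apply: eq_bigr => j _; rewrite ffunE mulr_sumr.
apply: eq_bigr => i _; rewrite -mulrA; congr (_ * _); rewrite mulrC; congr (_ * _).
by apply: eq_bigr => a _; rewrite mxE.
Qed.

Lemma dact_adj n k (A : 'M[R]_n) (t s : tens R n k) :
  \sum_i dact A t i * s i = \sum_j t j * dact A^T s j.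
Proof.
under eq_bigr do rewrite ffunE mulr_suml.
under [in RHS]eq_bigr do rewrite ffunE mulr_sumr.
rewrite exchange_big [in RHS]exchange_big /=; apply: eq_bigr => a _.
under eq_bigr do rewrite mulr_suml.
under [in RHS]eq_bigr do rewrite mulr_sumr.
rewrite [RHS](subst_swap a); apply: eq_bigr => j _; apply: eq_bigr => l _.
rewrite mxE subst_ixE eqxx.
have -> : subst_ix (subst_ix j a l) a (j a) = j.
  by apply/ffunP => b; rewrite !subst_ixE; case: eqP => // ->.
by ring.
Qed.

Lemma ip_pull m n k (A : 'M[R]_(m, n)) (g : 'M[R]_m) (t s : tens R n k) :
  ip g (pull A t) (pull A s) = ip (A^T *m g *m A) t s.
Proof. by rewrite /ip pull_adj !pull_mul. Qed.

Lemma ipDr n k (g : 'M[R]_n) (t s u : tens R n k) : ip g t (s + u) = ip g t s + ip g t u.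
Proof. by rewrite /ip pullD -big_split; apply: eq_bigr => i _; rewrite ffunE mulrDr. Qed.

Lemma ipZr n k (g : 'M[R]_n) (t s : tens R n k) a : ip g t (a *: s) = a * ip g t s.
Proof. by rewrite /ip pullZ mulr_sumr; apply: eq_bigr => i _; rewrite ffunE mulrCA. Qed.

Lemma ipDl n k (g : 'M[R]_n) (t s u : tens R n k) : ip g (s + u) t = ip g s t + ip g u t.
Proof. by rewrite /ip -big_split; apply: eq_bigr => i _; rewrite ffunE mulrDl. Qed.

Lemma ipZl n k (g : 'M[R]_n) (t s : tens R n k) a : ip g (a *: s) t = a * ip g s t.
Proof. by rewrite /ip mulr_sumr; apply: eq_bigr => i _; rewrite ffunE mulrA. Qed.

Lemma ip1 n k (t s : tens R n k) : ip 1%:M t s = \sum_i t i * s i.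
Proof. by rewrite /ip pull1. Qed.

Section Derivatives.
Context {V : normedModType R}.
Variables (x v : V).

Lemma is_derive_sumr (I : finType) (f : I -> V -> R) (f' : I -> R) :
  (forall i, is_derive x v (f i) (f' i)) ->
  is_derive x v (fun y => \sum_i f i y) (\sum_i f' i).
Proof.
move=> H; rewrite (_ : (fun y => _) = \sum_(i < #|I|) f (enum_val i)); last first.
  apply/funext => y; rewrite fct_sumE (reindex (enum_val (A := I))) //=.
  by apply: onW_bij; exact: enum_val_bij.
rewrite (reindex (enum_val (A := I))) /=; last by apply: onW_bij; exact: enum_val_bij.
by apply: is_derive_sum => i; exact: H.
Qed.

Lemma is_derive_mulr (f g : V -> R) (f' g' : R) : is_derive x v f f' -> is_derive x v g g' ->
  is_derive x v (fun y => f y * g y) (f x * g' + f' * g x).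
Proof.
move=> df dg; apply: is_derive_eq (is_deriveM df dg) _.
by congr (_ + _); exact: mulrC.
Qed.

Lemma is_derive_prodr k (f : 'I_k -> V -> R) (f' : 'I_k -> R) :
  (forall i, is_derive x v (f i) (f' i)) ->
  is_derive x v (fun y => \prod_i f i y) (\sum_i f' i * \prod_(j | j != i) f j x).
Proof.
elim: k f f' => [|k IH] f f' H.
  rewrite big_ord0 (_ : (fun y => _) = cst 1); first exact: is_derive_cst.
  by apply/funext => y; rewrite big_ord0.
rewrite (_ : (fun y => _) = fun y => f ord0 y * \prod_i f (lift ord0 i) y); last first.
  by apply/funext => y; rewrite big_ord_recl.
apply: is_derive_eq (is_derive_mulr (H ord0) (IH _ _ (fun i => H (lift ord0 i)))) _.
rewrite big_ord_recl addrC; congr (_ + _).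
  congr (_ * _); rewrite [RHS]big_mkcond big_ord_recl /= mul1r.
  by apply: eq_bigr => i _.
rewrite mulr_sumr; apply: eq_bigr => i _.
rewrite [in RHS]big_mkcond [in RHS]big_ord_recl /= mulrCA; congr (_ * (_ * _)).
by rewrite big_mkcond; apply: eq_bigr => j _; rewrite (inj_eq lift_inj).
Qed.

Lemma is_derive_pull m n k (A : V -> 'M[R]_(m, n)) (A' : 'M[R]_(m, n))
    (t : V -> tens R n k) (t' : tens R n k) i :
  (forall a b, is_derive x v (fun y => A y a b) (A' a b)) ->
  (forall j, is_derive x v (fun y => t y j) (t' j)) ->
  is_derive x v (fun y => pull (A y) (t y) i)
    ((pull (A x) t' + dpull (A x) A' (t x)) i).
Proof.
move=> dA dt.
rewrite (_ : (fun y => _) = fun y => \sum_j t y j * \prod_a A y (i a) (j a)); last first.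
  by apply/funext => y; rewrite ffunE.
rewrite !ffunE -big_split /=; apply: is_derive_sumr => j.
rewrite addrC; apply: is_derive_eq (is_derive_mulr (dt j) (is_derive_prodr (fun a => dA (i a) (j a)))) _.
by [].
Qed.

(* A tensor that is parallel for the matrix C of the connection form, evaluated
   on frame vectors with connection matrix B. *)
Lemma is_derive_pull_conn m n k (A : V -> 'M[R]_(m, n)) (B : 'M[R]_m) (C : 'M[R]_n)
    (t : V -> tens R n k) i :
  (forall a b, is_derive x v (fun y => A y a b) ((B *m A x - A x *m C) a b)) ->
  (forall j, is_derive x v (fun y => t y j) (dact C (t x) j)) ->
  is_derive x v (fun y => pull (A y) (t y) i) (dact B (pull (A x) (t x)) i).
Proof.
move=> dA dt; apply: is_derive_eq (is_derive_pull i dA dt) _.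
by rewrite dpullD dpullN dpull_mull dpull_mulr addrC subrK.
Qed.

(** The assumption on [g] says that the inverse metric is parallel for the connection matrix [C].
    The connection terms then cancel, and only the covariant derivatives [t'] and [s'] remain. *)
Lemma is_derive_ip n k (g : V -> 'M[R]_n) (C : 'M[R]_n) (t s : V -> tens R n k)
    (t' s' : tens R n k) :
  (forall a b, is_derive x v (fun y => g y a b) ((- (C^T *m g x + g x *m C)) a b)) ->
  (forall j, is_derive x v (fun y => t y j) ((dact C (t x) + t') j)) ->
  (forall j, is_derive x v (fun y => s y j) ((dact C (s x) + s') j)) ->
  is_derive x v (fun y => ip (g y) (t y) (s y)) (ip (g x) t' (s x) + ip (g x) (t x) s').
Proof.
move=> dg dt ds.
apply: is_derive_eq (is_derive_sumr (fun i => is_derive_mulr (dt i) (is_derive_pull i dg ds))) _.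
under eq_bigr => i _ do rewrite [(_ + t') _]ffunE mulrDl addrA.
rewrite big_split /= -/(ip (g x) t' (s x)) addrC; congr (_ + _).
rewrite big_split /= dact_adj addrC /ip -big_split; apply: eq_bigr => i _ /=.
rewrite -mulrDr; congr (_ * _).
rewrite dpullN dpullD dpull_mull dpull_mulr pullD !ffunE; ring.
Qed.

End Derivatives.

End TensorAlgebra.

(** * Metric connections with skew torsion *)

Section MatrixDerivatives.
Context {R : realType} {W : normedModType R}.
Variables (x v : W).

Lemma is_derive_mulmx m n p (A : W -> 'M[R]_(m, n)) (B : W -> 'M[R]_(n, p)) A' B' :
  is_derive x v A A' -> is_derive x v B B' ->
  is_derive x v (fun y => A y *m B y) (A' *m B x + A x *m B').
Proof.
move=> /is_derive_mxP dA /is_derive_mxP dB; apply/is_derive_mxP => i j.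
rewrite (_ : (fun y => _) = fun y => \sum_l A y i l * B y l j); last first.
  by apply/funext => y; rewrite mxE.
apply: is_derive_eq (is_derive_sumr (fun l => is_derive_mulr (dA i l) (dB l j))) _.
by rewrite !mxE big_split addrC.
Qed.

Lemma is_derive_trmx m n (A : W -> 'M[R]_(m, n)) A' :
  is_derive x v A A' -> is_derive x v (fun y => (A y)^T) A'^T.
Proof.
move=> /is_derive_mxP dA; apply/is_derive_mxP => i j; rewrite mxE.
rewrite (_ : (fun y => _) = fun y => A y j i); first exact: dA.
by apply/funext => y; rewrite mxE.
Qed.

Lemma is_derive_uniq (V : normedModType R) (f : W -> V) a b :
  is_derive x v f a -> is_derive x v f b -> a = b.
Proof. by move=> [_ <-] [_ <-]. Qed.

Lemma is_derive_invmx n (g : W -> 'M[R]_n) g' h' :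
  (\forall y \near x, g y \in unitmx) -> is_derive x v g g' ->
  is_derive x v (fun y => invmx (g y)) h' -> h' = - (invmx (g x) *m g' *m invmx (g x)).
Proof.
move=> gU dg dh; have gx := nbhs_singleton gU.
have d1 : is_derive x v (fun y => g y *m invmx (g y)) 0.
  apply/is_derive_mxP => i j; rewrite mxE.
  have : is_derive x v (fun=> (1%:M : 'M[R]_n) i j) 0 by exact: is_derive_cst.
  by apply: near_eq_is_derive; apply: filterS gU => y gy; rewrite mulmxV.
have /(congr1 (mulmx (invmx (g x)))) := is_derive_uniq (is_derive_mulmx dg dh) d1.
rewrite mulmx0 mulmxDr !mulmxA mulVmx // mul1mx => /eqP.
by rewrite addrC addr_eq0 => /eqP.
Qed.

End MatrixDerivatives.

Section Alternating3.
Context {R : realType} {n : nat}.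

Lemma ix3_tens (t : tens R n 3) (i j l : 'I_n) (s : 'S_3) :
  Defs.alternating t -> t [ffun a => ix3 i j l (s a)] = (-1) ^+ s * t (ix3 i j l).
Proof. by move=> h; rewrite h. Qed.

Lemma ix3E (i j l : 'I_n) : ix3 i j l = icons i (icons j (icons l (ffun0 (card_ord 0)))).
Proof.
apply/ffunP => a; rewrite !ffunE.
case: unliftP => [b ->|->] //; rewrite ffunE.
case: unliftP => [c ->|->] //; rewrite ffunE.
by case: unliftP => [d _|->] //; case: d.
Qed.

Lemma alt_swap (t : tens R n 3) (i j l : 'I_n) : Defs.alternating t ->
  t (ix3 i j l) = - t (ix3 j i l) /\ t (ix3 i j l) = - t (ix3 i l j).
Proof.
move=> h; split; [have := ix3_tens j i l (tperm (inord 0) (inord 1)) h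
  |have := ix3_tens i l j (tperm (inord 1) (inord 2)) h];
  rewrite odd_tperm -val_eqE /= !inordK // expr1 mulN1r => <-; congr (t _);
  apply/ffunP => a; rewrite !ffunE; case: tpermP => [->|->|]; rewrite /= ?inordK //;
  case: a => -[|[|[|//]]] ia h0 h1 //=;
  by [case: h0; apply/val_inj; rewrite /= inordK|case: h1; apply/val_inj; rewrite /= inordK].
Qed.

Lemma alt12 (t : tens R n 3) (i j l : 'I_n) : Defs.alternating t -> t (ix3 i j l) = - t (ix3 j i l).
Proof. by move/(alt_swap i j l) => []. Qed.

Lemma alt23 (t : tens R n 3) (i j l : 'I_n) : Defs.alternating t -> t (ix3 i j l) = - t (ix3 i l j).
Proof. by move/(alt_swap i j l) => []. Qed.

End Alternating3.

Section Koszul.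
Context {R : realType} {n : nat}.
Variables (g : 'M[R]_n) (dg : 'I_n -> 'M[R]_n) (T : tens R n 3).
Hypotheses (gU : g \in unitmx) (gT : g^T = g) (dgT : forall i, (dg i)^T = dg i).
Hypothesis aT : Defs.alternating T.

(** The formula of [skew_connection] at one point: [dg i] stands for the partial derivatives of the
    Gram matrix. In this form it also applies to the slice, whose metric is an induced one. *)
Definition koszul (i : 'I_n) : 'M[R]_n := \matrix_(j, l) (2^-1 * \sum_(m < n)
    (dg i j m + dg j i m - dg m i j + T (ix3 i j m)) * invmx g m l).

Lemma koszul_mul i j l : (koszul i *m g) j l =
  2^-1 * (dg i j l + dg j i l - dg l i j + T (ix3 i j l)).
Proof.
pose W : 'M[R]_n := \matrix_(j, m) (dg i j m + dg j i m - dg m i j + T (ix3 i j m)).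
have -> : koszul i = 2^-1 *: (W *m invmx g).
  apply/matrixP => a b; rewrite !mxE; congr (_ * _).
  by apply: eq_bigr => m _; rewrite mxE.
by rewrite -scalemxAl mulmxKV // !mxE.
Qed.

Let dgC i j l : dg i j l = dg i l j.
Proof. by rewrite -[in RHS]dgT mxE. Qed.

Lemma koszul_metric i : dg i = koszul i *m g + g *m (koszul i)^T.
Proof.
have -> : g *m (koszul i)^T = (koszul i *m g)^T by rewrite trmx_mul gT.
apply/matrixP => j l; rewrite [RHS]mxE [X in _ = _ + X]mxE !koszul_mul.
rewrite (alt23 i l j aT) (dgC i l j) (dgC j i l) (dgC l i j); by field.
Qed.

Lemma koszul_torsion i j l :
  (koszul i *m g) j l - (koszul j *m g) i l = T (ix3 i j l).
Proof.
rewrite !koszul_mul (alt12 j i l aT) (dgC l i j); by field.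
Qed.

(* A metric connection is determined by its torsion, here a 3-form. *)
Lemma koszul_uniq (w : 'I_n -> 'M[R]_n) :
  (forall i, dg i = w i *m g + g *m (w i)^T) ->
  (forall i j l, (w i *m g) j l - (w j *m g) i l = T (ix3 i j l)) ->
  forall i, w i = koszul i.
Proof.
move=> wg wT i; apply: (can_inj (mulmxK gU)).
apply/matrixP => j l; rewrite koszul_mul.
have e a b c : dg a b c = (w a *m g) b c + (w a *m g) c b.
  rewrite wg mxE; congr (_ + _); rewrite -[in LHS]gT -trmx_mul mxE.
  by [].
have t1 := wT i j l; have t2 := wT i l j; have t3 := wT j l i.
rewrite (alt23 i l j aT) in t2; rewrite (alt23 j l i aT) (alt12 j i l aT) opprK in t3.
by rewrite !e; lra.
Qed.

End Koszul.

(** * Charts and their transition maps *)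

Section Charts.
Context {R : realType} {n : nat}.
Variable M : rmfd R n.
Hypothesis hM : smooth_manifold M.
Implicit Types (c d : chart M) (p : M).

Lemma chart_open c : open (chart_dom c).
Proof. by case: hM => _ _ _ /(_ c)[]. Qed.

Lemma codom_open c : open (chart_codom c).
Proof. by case: hM => _ _ _ /(_ c)[]. Qed.

Lemma chart_at p : exists c, chart_dom c p.
Proof. by case: hM => _ _ + _ _; exact. Qed.

Lemma chart_mapK c p : chart_dom c p -> chart_inv c (chart_map c p) = p.
Proof. by case: hM => _ _ _ /(_ c)[_ _ _ _ + _]; exact. Qed.

Lemma chart_map_codom c p : chart_dom c p -> chart_codom c (chart_map c p).
Proof. by move=> cp; exists p. Qed.

Lemma chart_inv_dom c x : chart_codom c x -> chart_dom c (chart_inv c x).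
Proof. by move=> [p cp <-]; rewrite chart_mapK. Qed.

Lemma chart_invK c x : chart_codom c x -> chart_map c (chart_inv c x) = x.
Proof. by move=> [p cp <-]; rewrite chart_mapK. Qed.

Lemma chart_map_cont c p : chart_dom c p -> {for p, continuous (chart_map c)}.
Proof. by move=> cp; case: hM => _ _ _ /(_ c)[_ _ h _ _] _; apply: h; rewrite inE. Qed.

Lemma chart_inv_cont c x : chart_codom c x -> {for x, continuous (chart_inv c)}.
Proof. by move=> cx; case: hM => _ _ _ /(_ c)[_ _ _ h _] _; apply: h; rewrite inE. Qed.

Definition overlap c d : set 'rV[R]_n := [set x | chart_codom c x /\ chart_dom d (chart_inv c x)].

Lemma overlapE c d : overlap c d = chart_map c @` (chart_dom c `&` chart_dom d).
Proof.
apply/seteqP; split=> [x [cx dx]|x [p [cp dp] <-]].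
  exists (chart_inv c x); last exact: chart_invK.
  by split => //; exact: chart_inv_dom.
by split; [exact: chart_map_codom | rewrite chart_mapK].
Qed.

Lemma overlap_open c d : open (overlap c d).
Proof.
apply: open_setI_preimage; [exact: codom_open | exact: chart_open|].
exact: chart_inv_cont.
Qed.

Lemma overlap_map c d p : chart_dom c p -> chart_dom d p -> overlap c d (chart_map c p).
Proof. by move=> cp dp; split; [exact: chart_map_codom | rewrite chart_mapK]. Qed.

Lemma transition_smooth c d : smooth_on (overlap c d) (chart_map d \o chart_inv c).
Proof. by rewrite overlapE; case: hM. Qed.

Lemma jac_smooth c d : smooth_on (overlap c d) (fun x => jac c d (chart_inv c x)).
Proof.
have := smooth_on_jacobian (@overlap_open c d) (@transition_smooth c d).
apply: (smooth_on_ext (@overlap_open c d)) => x [cx _].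
by rewrite /jac chart_invK.
Qed.

Lemma transition_diff c d p : chart_dom c p -> chart_dom d p ->
  differentiable (chart_map d \o chart_inv c) (chart_map c p).
Proof.
move=> cp dp; exact: smooth_on_diff (@transition_smooth c d) (overlap_map cp dp).
Qed.

Lemma jac_id c p : chart_dom c p -> jac c c p = 1%:M.
Proof.
move=> cp; rewrite /jac (@near_eq_jacobian _ _ _ id); last by [].
  by have := jacobian_linear (1%:M : 'M[R]_n) (chart_map c p); rewrite (_ : mulmxr _ = id) //;
    apply/funext => y; rewrite /= mulmx1.
have := open_nbhs_nbhs (conj (@codom_open c) (chart_map_codom cp)).
by apply: filterS => y cy /=; rewrite chart_invK.
Qed.

Lemma jac_mul c d e p : chart_dom c p -> chart_dom d p -> chart_dom e p ->
  jac c d p *m jac d e p = jac c e p.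
Proof.
move=> cp dp ep; rewrite /jac.
have d1 := transition_diff cp dp; have d2 := transition_diff dp ep.
have mE : (chart_map d \o chart_inv c) (chart_map c p) = chart_map d p.
  by rewrite /= chart_mapK.
rewrite -(jacobian_comp_at mE d1 d2); apply/esym/near_eq_jacobian.
  have := open_nbhs_nbhs (conj (@overlap_open c d) (overlap_map cp dp)).
  by apply: filterS => y [cy dy] /=; rewrite chart_mapK.
by apply: differentiable_comp; [exact: d1 | rewrite mE; exact: d2].
Qed.

Lemma jac_unit c d p : chart_dom c p -> chart_dom d p -> jac c d p \in unitmx.
Proof.
by move=> cp dp; exact: (proj1 (mulmx1_unit (etrans (jac_mul cp dp cp) (jac_id cp)))).
Qed.

End Charts.

Lemma is_derive_lineP {R : realType} (W V : normedModType R) (f : W -> V) (x v : W) l :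
  is_derive x v f l <-> is_derive (0 : R) 1 (fun t : R => f (x + t *: v)) l.
Proof.
have e : (fun h : R => h^-1 *: ((f \o shift x) (h *: v) - f x)) =
  (fun h : R => h^-1 *: (((fun t : R => f (x + t *: v)) \o shift 0) (h *: 1) - f (x + 0 *: v))).
  apply/funext => h /=; rewrite scale0r !addr0.
  by rewrite (_ : h *: (1 : R) = h) ?[x + _]addrC // /GRing.scale /= mulr1.
by split=> -[d0 d1]; split; move: d0 d1; rewrite /derivable /derive e.
Qed.

Lemma is_derive_compV {R : realType} (W V U : normedModType R) (g : W -> V) (f : V -> U) x v l :
  differentiable f (g x) -> is_derive x v g l -> is_derive x v (f \o g) ('d f (g x) l).
Proof.
move=> df /is_derive_lineP dg; apply/is_derive_lineP.
have := @is_derive_comp R V U (fun t : R => g (x + t *: v)) f 0 l.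
by rewrite scale0r addr0; apply.
Qed.

Lemma is_derive0_cstR {R : realType} (g : R -> R) :
  (forall t : R, is_derive t 1 g 0) -> forall s t : R, g s = g t.
Proof.
move=> dg s t.
have h : forall t : R, is_derive t 1 (fun s => const_mx (g s) : 'M[R]_1) 0.
  move=> u; apply/is_derive_mxP => i j; rewrite mxE.
  rewrite (_ : (fun s => _) = g); first exact: dg.
  by apply/funext => y; rewrite mxE.
by have /matrixP/(_ 0 0) := is_derive0_cst h s t; rewrite !mxE.
Qed.

Lemma mxnorm_sq_eq0 {R : realType} (m n : nat) (g : 'M[R]_n) (Z : 'M[R]_(m, n)) :
  (forall v : 'rV[R]_n, v != 0 -> 0 < (v *m g *m v^T) 0 0) -> Z *m g *m Z^T = 0 -> Z = 0.
Proof.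
move=> gp Z0; apply/row_matrixP => i; rewrite row0; apply/eqP/negPn/negP => /gp.
rewrite -row_mul tr_row.
have -> : (row i (Z *m g) *m col i Z^T) 0 0 = (Z *m g *m Z^T) i i.
  by rewrite !mxE; apply: eq_bigr => a _; rewrite !mxE.
by rewrite Z0 mxE ltxx.
Qed.

(** * The connection of a Riemannian manifold along curves *)

Section Riemannian.
Context {R : realType} {n : nat}.
Variables (M : rmfd R n) (T : tensor_field M 3).
Hypotheses (hR : riemannian M) (hT : is_form T).
Implicit Types (c d : chart M) (p : M).

Let hM : smooth_manifold M. Proof. by case: hR. Qed.

Lemma metric_sym c p : chart_dom c p -> (metric c p)^T = metric c p.
Proof. by case: hR => _ [h _ _ _]; exact: h. Qed.

Lemma metric_pos c p (v : 'rV[R]_n) : chart_dom c p -> v != 0 ->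
  0 < (v *m metric c p *m v^T) 0 0.
Proof. by case: hR => _ [_ h _ _]; exact: h. Qed.

Lemma metric_jac c d p : chart_dom c p -> chart_dom d p ->
  metric c p = jac c d p *m metric d p *m (jac c d p)^T.
Proof. by case: hR => _ [_ _ h _]; exact: h. Qed.

Lemma metric_smooth c : smooth_on (chart_codom c) (metric c \o chart_inv c).
Proof. by case: hR => _ [_ _ _ h]; exact: h. Qed.

Lemma metric_unit c p : chart_dom c p -> metric c p \in unitmx.
Proof.
move=> cp; rewrite -row_free_unit -kermx_eq0; apply/eqP.
apply: (@mxnorm_sq_eq0 _ _ _ (metric c p)).
  by move=> v v0; exact: metric_pos.
by rewrite mulmx_ker mul0mx.
Qed.

Lemma metric_eq0 m c p (Z : 'M[R]_(m, n)) : chart_dom c p ->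
  Z *m metric c p *m Z^T = 0 -> Z = 0.
Proof.
by move=> cp; apply: mxnorm_sq_eq0 => v v0; exact: metric_pos.
Qed.

Lemma metric_diff c p : chart_dom c p ->
  differentiable (metric c \o chart_inv c) (chart_map c p).
Proof. by move=> cp; exact: smooth_on_diff (@metric_smooth c) (chart_map_codom cp). Qed.

(** The connection matrix in the direction [w]: a vector field with components y has covariant
    derivative y' + y [cn c p w] along a curve of velocity [w]. *)
Definition cn c p (w : 'rV[R]_n) : 'M[R]_n := \sum_i w 0 i *: skew_connection T c p i.

Lemma cn_linear c p a u w : cn c p (a *: u + w) = a *: cn c p u + cn c p w.
Proof.
rewrite /cn scaler_sumr -big_split; apply: eq_bigr => i _.
by rewrite !mxE scalerDl scalerA.
Qed.

Lemma cn_delta c p i : cn c p (delta_mx 0 i) = skew_connection T c p i.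
Proof.
rewrite /cn (bigD1 i) //= big1 ?addr0 ?mxE ?eqxx ?scale1r // => j ji.
by rewrite !mxE eqxx (negbTE ji) scale0r.
Qed.

Lemma partial_derive (V : normedModType R) c i (F : M -> V) p :
  derivable (F \o chart_inv c) (chart_map c p) (delta_mx 0 i) ->
  is_derive (chart_map c p) (delta_mx 0 i) (F \o chart_inv c) (partial c i F p).
Proof. by move=> h; split. Qed.

Lemma skew_connection_koszul c p i : chart_dom c p ->
  skew_connection T c p i =
  koszul (metric c p) (fun i => partial c i (metric c) p) (T c p) i.
Proof.
move=> cp; apply/matrixP => j l; rewrite !mxE; congr (_ * _); apply: eq_bigr => m _.
have e a b b' : partial c a (fun q => metric c q b b') p = (partial c a (metric c) p) b b'.
  have /is_derive_mxP/(_ b b')[_ <-] := partial_derive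
    (@diff_derivable _ _ _ _ _ (delta_mx 0 a) (metric_diff cp)).
  by [].
by rewrite !e.
Qed.

Lemma tr_partial_metric c p i : chart_dom c p ->
  (partial c i (metric c) p)^T = partial c i (metric c) p.
Proof.
move=> cp; have h := partial_derive (@diff_derivable _ _ _ _ _ (delta_mx 0 i) (metric_diff cp)).
have h2 := is_derive_trmx h.
apply: (is_derive_uniq h2); apply: near_eq_is_derive h.
have := open_nbhs_nbhs (conj (@codom_open _ _ _ hM c) (chart_map_codom cp)).
by apply: filterS => y cy /=; rewrite metric_sym //; exact: chart_inv_dom.
Qed.

Let aT c p : chart_dom c p -> Defs.alternating (T c p).
Proof. by case: hT => _ _; exact. Qed.

Lemma conn_metric c p i : chart_dom c p ->
  partial c i (metric c) p = skew_connection T c p i *m metric c p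
     + metric c p *m (skew_connection T c p i)^T.
Proof.
move=> cp; rewrite (skew_connection_koszul i cp); apply: koszul_metric.
- exact: metric_unit.
- exact: metric_sym.
- by move=> j; exact: tr_partial_metric.
- exact: aT.
Qed.

Lemma conn_torsion c p i j l : chart_dom c p ->
  (skew_connection T c p i *m metric c p) j l - (skew_connection T c p j *m metric c p) i l
  = T c p (ix3 i j l).
Proof.
move=> cp; rewrite (skew_connection_koszul i cp) (skew_connection_koszul j cp).
apply: koszul_torsion; [exact: metric_unit | by move=> k; exact: tr_partial_metric | exact: aT].
Qed.

Lemma cn_torsion c p (u w : 'rV[R]_n) l : chart_dom c p ->
  (w *m cn c p u *m metric c p - u *m cn c p w *m metric c p) 0 l =
  \sum_i \sum_j u 0 i * w 0 j * T c p (ix3 i j l).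
Proof.
move=> cp.
have e (a b : 'rV[R]_n) : (a *m cn c p b *m metric c p) 0 l =
    \sum_i \sum_j b 0 i * a 0 j * (skew_connection T c p i *m metric c p) j l.
  rewrite /cn mulmx_sumr mulmx_suml summxE; apply: eq_bigr => i _.
  rewrite -scalemxAr -scalemxAl mxE -mulmxA mxE mulr_sumr; apply: eq_bigr => j _.
  by rewrite mulrA.
rewrite mxE [X in _ + X]mxE !e [X in _ - X]exchange_big -sumrB; apply: eq_bigr => i _.
rewrite -sumrB; apply: eq_bigr => j _.
by rewrite -(conn_torsion i j l cp) mulrBr; congr (_ - _ * _); rewrite mulrC.
Qed.

(** The difference of the two sides, lowered with the metric, is the torsion [T] evaluated on [u]
    and [w]. This symmetry turns the variational equation of the flow of a field annihilating [T]
    into an equation between covariant derivatives. *)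
Lemma cn_swap c p (u w : 'rV[R]_n) : chart_dom c p -> ins u (T c p) = 0 ->
  w *m cn c p u = u *m cn c p w.
Proof.
move=> cp u0; apply: (can_inj (mulmxK (metric_unit cp))).
apply/eqP; rewrite -subr_eq0; apply/eqP/rowP => l; rewrite cn_torsion // [RHS]mxE.
rewrite exchange_big big1 // => j _.
have := congr1 (fun t : tens R n 2 => t (icons j (icons l (ffun0 (card_ord 0))))) u0.
rewrite [LHS]ffunE [RHS]ffunE => h.
transitivity (w 0 j * \sum_i u 0 i * T c p (icons i (icons j (icons l (ffun0 (card_ord 0)))))).
  by rewrite mulr_sumr; apply: eq_bigr => i _; rewrite ix3E; ring.
by rewrite h mulr0.
Qed.

Section Along.
Context {W : normedModType R}.
Variables (x v : W) (g : W -> M) (c : chart M) (w : 'rV[R]_n).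
Hypotheses (gx : {for x, continuous g}) (cg : chart_dom c (g x)).
Hypothesis dg : is_derive x v (chart_map c \o g) w.

Lemma near_chart : \forall y \near x, chart_dom c (g y).
Proof. exact: gx _ (open_nbhs_nbhs (conj (chart_open hM c) cg)). Qed.

Lemma is_derive_along (V : normedModType R) (F : M -> V) :
  differentiable (F \o chart_inv c) (chart_map c (g x)) ->
  is_derive x v (F \o g) (\sum_i w 0 i *: partial c i F (g x)).
Proof.
move=> dF; have := is_derive_compV (g := chart_map c \o g) dF dg.
rewrite (diff_partial w dF); apply: near_eq_is_derive.
by apply: filterS near_chart => y cy /=; rewrite (chart_mapK hM cy).
Qed.

Lemma is_derive_chart d : chart_dom d (g x) ->
  is_derive x v (chart_map d \o g) (w *m jac c d (g x)).
Proof.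
move=> dgx; have dT := transition_diff hM cg dgx.
have := is_derive_compV (g := chart_map c \o g) dT dg.
rewrite (diff_jacobian (chart_map d \o chart_inv c) (chart_map c (g x)) w).
apply: near_eq_is_derive.
by apply: filterS near_chart => y cy /=; rewrite (chart_mapK hM cy).
Qed.

Lemma metric_along : is_derive x v (fun y => metric c (g y))
  (cn c (g x) w *m metric c (g x) + metric c (g x) *m (cn c (g x) w)^T).
Proof.
apply: is_derive_eq (is_derive_along (metric_diff cg)) _.
rewrite /cn mulmx_suml linear_sum mulmx_sumr -big_split; apply: eq_bigr => i _ /=.
by rewrite conn_metric // scalerDr linearZ /= -scalemxAl -scalemxAr.
Qed.

Lemma tensor_along k (t : tensor_field M k) j :
  smooth_on (chart_codom c) (fun x => t c (chart_inv c x) j : R) ->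
  parallel_tensor (skew_connection T) t ->
  is_derive x v (fun y => t c (g y) j) (dact (cn c (g x) w) (t c (g x)) j).
Proof.
move=> st pt.
have dF := smooth_on_diff st (chart_map_codom cg).
apply: is_derive_eq (@is_derive_along _ (fun y => t c y j : R) dF) _.
have -> : dact (cn c (g x) w) (t c (g x)) j =
    \sum_i w 0 i *: dact (skew_connection T c (g x) i) (t c (g x)) j.
  rewrite /cn dact_suml sum_ffunE; apply: eq_bigr => i _.
  by rewrite dactZl ffunE.
apply: eq_bigr => i _; congr (_ *: _).
have := congr1 (fun t : tens R n k => t j) (pt c (g x) i cg).
by rewrite /nabla !ffunE => /eqP; rewrite subr_eq0 => /eqP.
Qed.

End Along.

Lemma along_cst (g : R -> M) (q : chart M -> R -> R) : continuous g ->
  (forall c d t, chart_dom c (g t) -> chart_dom d (g t) -> q c t = q d t) ->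
  (forall c (t : R), chart_dom c (g t) -> is_derive t 1 (q c) 0) ->
  forall c d s t, chart_dom c (g s) -> chart_dom d (g t) -> q c s = q d t.
Proof.
move=> cg qd dq c d s t cs dt.
have [ch chP] := @choice _ _ _ (fun t => chart_at hM (g t)).
have h : forall t : R, is_derive t 1 (fun u => q (ch u) u) 0.
  move=> u; apply: near_eq_is_derive (dq (ch u) u (chP u)).
  by apply: filterS (near_chart (cg u) (chP u)) => y cy; exact: qd.
by rewrite (qd c (ch s)) // (is_derive0_cstR h s t); apply: qd.
Qed.

(** Parallel transport of any number [m] of vectors, the rows of [Z]. In contrast to
    [parallel_along], the velocity is given by an existential, so that it can be read off from
    whatever equation the curve satisfies. *)
Definition par_along m (g : R -> M) (Z : chart M -> R -> 'M[R]_(m, n)) :=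
  (forall c d t, chart_dom c (g t) -> chart_dom d (g t) ->
     Z d t = Z c t *m jac c d (g t)) /\
  (forall c (t : R), chart_dom c (g t) -> exists2 w,
     is_derive t 1 (chart_map c \o g) w &
     is_derive t 1 (Z c) (- (Z c t *m cn c (g t) w))).

Section ParallelAlong.
Variables (m : nat) (g : R -> M) (Z : chart M -> R -> 'M[R]_(m, n)).
Hypotheses (cg : continuous g) (pZ : par_along g Z).

Lemma par_metric c d s t : chart_dom c (g s) -> chart_dom d (g t) ->
  Z c s *m metric c (g s) *m (Z c s)^T = Z d t *m metric d (g t) *m (Z d t)^T.
Proof.
move=> cs dt; apply/matrixP => i j.
apply: (along_cst (q := fun c t => (Z c t *m metric c (g t) *m (Z c t)^T) i j)) cs dt => //.
  move=> c' d' u cu du; rewrite (pZ.1 c' d' u) //.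
  by rewrite (metric_jac cu du) trmx_mul !mulmxA.
move=> c' u cu; have [w dw dZ] := pZ.2 c' u cu.
have dm := metric_along (@cg u) cu dw.
have /is_derive_mxP/(_ i j) := is_derive_mulmx (is_derive_mulmx dZ dm) (is_derive_trmx dZ).
move/is_derive_eq; apply; set G := cn _ _ _; set g0 := metric _ _; set z := Z _ _.
rewrite linearN /= trmx_mul mulmxN mulNmx !mulmxDr !mulmxDl mulNmx !mulmxA.
by rewrite addKr subrr mxE.
Qed.

Lemma par_pull k (t : tensor_field M k) :
  (forall c d p, chart_dom c p -> chart_dom d p -> t c p = pull (jac c d p) (t d p)) ->
  (forall c j, smooth_on (chart_codom c) (fun x => t c (chart_inv c x) j : R)) ->
  parallel_tensor (skew_connection T) t ->
  forall c d s u, chart_dom c (g s) -> chart_dom d (g u) ->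
  pull (Z c s) (t c (g s)) = pull (Z d u) (t d (g u)).
Proof.
move=> tj st pt c d s u cs du; apply/ffunP => i.
apply: (along_cst (q := fun c s => pull (Z c s) (t c (g s)) i)) cs du => //.
  by move=> c' d' r cr dr; rewrite (pZ.1 c' d' r) // (tj c' d') // pull_mul.
move=> c' r cr; have [w dw dZ] := pZ.2 c' r cr.
have h1 a b : is_derive r 1 (fun y => Z c' y a b) ((0 *m Z c' r - Z c' r *m cn c' (g r) w) a b).
  by rewrite mul0mx sub0r; move: dZ => /is_derive_mxP.
have h2 j := tensor_along (@cg r) cr dw (st c' j) pt.
apply: is_derive_eq (is_derive_pull_conn i h1 h2) _.
rewrite (_ : dact 0 _ = 0) ?ffunE //.
by rewrite -(scale0r (0 : 'M[R]_m)) dactZl scale0r.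
Qed.

Lemma par_eq0 c d s t : chart_dom c (g s) -> chart_dom d (g t) ->
  Z c s = 0 -> Z d t = 0.
Proof.
move=> cs dt Z0; apply: (metric_eq0 dt).
by rewrite -(par_metric cs dt) Z0 !mul0mx.
Qed.

End ParallelAlong.

Lemma par_along_sub m (g : R -> M) (Z Z' : chart M -> R -> 'M[R]_(m, n)) :
  par_along g Z -> par_along g Z' -> par_along g (fun c t => Z c t - Z' c t).
Proof.
move=> [j1 d1] [j2 d2]; split=> [c d t ct dt|c t ct].
  by rewrite (j1 c d) // (j2 c d) // mulmxBl.
have [w dw dZ] := d1 c t ct; have [w' dw' dZ'] := d2 c t ct.
exists w => //; rewrite -(is_derive_uniq dw dw') in dZ'.
have /is_derive_eq := is_deriveB dZ dZ'; apply.
by rewrite mulmxBl opprB opprK addrC.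
Qed.

End Riemannian.

(** * Parallel frames and their flows *)

Lemma locally_constant {R : realType} (P : R -> Prop) :
  (forall t : R, exists2 e : R, 0 < e & forall u v : R, `|u - t| < e -> `|v - t| < e -> P u -> P v) ->
  forall s t : R, P s -> P t.
Proof.
move=> H s t Ps; have [st|/ltW ts] := leP s t.
  apply: (real_induction st _ Ps) => r _; have [e e0 he] := H r.
  by exists e => // u v _ _; exact: he.
apply: contrapT => nPt; apply: (real_induction (P := fun r => ~ P r) ts _ nPt) => // r _.
have [e e0 he] := H r; exists e => // u v _ _ ue ve nPu Pv; apply: nPu.
exact: he Pv.
Qed.

Lemma near_real {R : realType} (t : R) (P : R -> Prop) : (\forall u \near t, P u) ->
  exists2 e : R, 0 < e & forall u : R, `|u - t| < e -> P u.
Proof.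
move=> /nbhs_ballP[e /= e0 he]; exists e => // u ue; apply: he.
by rewrite -ball_normE /ball_ /= distrC.
Qed.

Section ParallelFrame.
Context {R : realType} {n k : nat}.
Variables (M : rmfd R n) (T : tensor_field M 3).
Hypotheses (hR : riemannian M) (hT : is_form T).
Variable V : chart M -> M -> 'M[R]_(k, n).
Implicit Types (c d : chart M) (p q : M) (s : 'rV[R]_k).

Definition parallel_frame :=
  [/\ forall c d p, chart_dom c p -> chart_dom d p -> V d p = V c p *m jac c d p,
      forall c, smooth_on (chart_codom c) (V c \o chart_inv c),
      forall c p, chart_dom c p -> V c p *m metric c p *m (V c p)^T = 1%:M,
      forall c p i, chart_dom c p -> partial c i (V c) p = - (V c p *m skew_connection T c p i) &
      forall c p s, chart_dom c p -> ins (s *m V c p) (T c p) = 0].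

Hypothesis hV : parallel_frame.

Let hM : smooth_manifold M. Proof. by case: hR. Qed.
Let Vj c d p : chart_dom c p -> chart_dom d p -> V d p = V c p *m jac c d p.
Proof. by case: hV => h _ _ _ _; exact: h. Qed.
Let Vs c : smooth_on (chart_codom c) (V c \o chart_inv c).
Proof. by case: hV. Qed.
Let VT c p s : chart_dom c p -> ins (s *m V c p) (T c p) = 0.
Proof. by case: hV => _ _ _ _ h; exact: h. Qed.

Lemma frame_along {W : normedModType R} (x v : W) (g : W -> M) c w :
  {for x, continuous g} -> chart_dom c (g x) -> is_derive x v (chart_map c \o g) w ->
  is_derive x v (fun y => V c (g y)) (- (V c (g x) *m cn T c (g x) w)).
Proof.
move=> gx cg dg.
apply: is_derive_eq (is_derive_along hR gx cg dg (smooth_on_diff (@Vs c) (chart_map_codom cg))) _.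
rewrite /cn mulmx_sumr -sumrN; apply: eq_bigr => i _.
by case: hV => _ _ _ -> // _; rewrite scalerN -scalemxAr.
Qed.

Definition icurve s (g : R -> M) := continuous g /\
  forall c (t : R), chart_dom c (g t) -> is_derive t 1 (chart_map c \o g) (s *m V c (g t)).

Lemma geodesic_par (g : R -> M) : geodesic g -> par_along T g (fun c t => velocity c g t).
Proof.
move=> [cg dg].
have dv c (t : R) : chart_dom c (g t) -> is_derive t 1 (chart_map c \o g) (velocity c g t).
  by move=> ct; have [h _] := dg c t ct; split; [exact: h | rewrite /velocity derive1E].
split=> [c d t ct dt|c t ct].
  have := is_derive_chart hR (@cg t) ct (dv c t ct) dt.
  by apply: is_derive_uniq; exact: dv.
exists (velocity c g t); first exact: dv.
have [_] := dg c t ct; move/is_derive_eq; apply; congr (- _).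
set w := velocity c g t.
transitivity (w *m \sum_i w 0 i *: levi_civita c (g t) i).
  by rewrite mulmx_sumr; apply: eq_bigr => i _; rewrite -scalemxAr.
have gU := metric_unit hR ct.
apply: (can_inj (mulmxK gU)); apply/rowP => l.
have e (G : 'I_n -> 'M[R]_n) : (w *m (\sum_i w 0 i *: G i) *m metric c (g t)) 0 l =
    \sum_i \sum_j w 0 i * w 0 j * (G i *m metric c (g t)) j l.
  rewrite mulmx_sumr mulmx_suml summxE; apply: eq_bigr => i _.
  rewrite -scalemxAr -scalemxAl mxE -mulmxA mxE mulr_sumr; apply: eq_bigr => j _.
  by rewrite mulrA.
rewrite /cn !e.
have aT : Defs.alternating (T c (g t)) by case: hT => _ _; exact.
have a0 : Defs.alternating (0 : tens R n 3) by move=> u j; rewrite !ffunE mulr0.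
have sym i : (partial c i (metric c) (g t))^T = partial c i (metric c) (g t).
  exact: tr_partial_metric.
have -> : (\sum_i \sum_j w 0 i * w 0 j * (skew_connection T c (g t) i *m metric c (g t)) j l)
  = (\sum_i \sum_j (w 0 i * w 0 j * (levi_civita c (g t) i *m metric c (g t)) j l +
       2^-1 * (w 0 i * w 0 j * T c (g t) (ix3 i j l)))).
  apply: eq_bigr => i _; apply: eq_bigr => j _.
  rewrite /levi_civita (skew_connection_koszul T hR i ct).
  rewrite (skew_connection_koszul (fun _ _ => 0) hR i ct) !koszul_mul // ffunE addr0.
  by ring.
under [RHS]eq_bigr => i _ do rewrite big_split /=.
rewrite big_split /=; apply/eqP; rewrite -subr_eq0 opprD addNKr oppr_eq0.
under eq_bigr => i _ do rewrite -mulr_sumr.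
rewrite -mulr_sumr mulf_eq0 invr_eq0 pnatr_eq0 /=; apply/eqP.
set S := \sum_i _.
(* The torsion enters the geodesic equation only through T(w, w, .), which vanishes by skew
   symmetry. *)
have : S = - S.
  rewrite {1}/S exchange_big -sumrN; apply: eq_bigr => i _.
  rewrite -sumrN; apply: eq_bigr => j _.
  by rewrite (alt12 j i l aT); ring.
by lra.
Qed.

Lemma icurve_par s (g : R -> M) : continuous g ->
  (forall c (t : R), chart_dom c (g t) -> exists w, is_derive t 1 (chart_map c \o g) w) ->
  par_along T g (fun c t => s *m V c (g t)).
Proof.
move=> cg dg; split=> [c d t ct dt|c t ct]; first by rewrite (Vj ct dt) mulmxA.
have [w dw] := dg c t ct; exists w => //.
have dV := frame_along (@cg t) ct dw.
have := is_derive_mulmx (is_derive_cst s t 1) dV.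
by move/is_derive_eq; apply; rewrite mul0mx add0r mulmxN mulmxA.
Qed.

Hypothesis hC : geodesically_complete M.

(* The connections with torsion T and with torsion 0 have the same geodesics, so
   the geodesics with initial velocity s V are the integral curves of s V. *)
Lemma icurve_ex s p : exists g, icurve s g /\ g 0 = p.
Proof.
have [c cp] := chart_at hM p; have [g [gg g0 v0]] := hC (s *m V c p) cp.
exists g; split=> //; have [cg dg] := gg.
have dv e (t : R) : chart_dom e (g t) -> is_derive t 1 (chart_map e \o g) (velocity e g t).
  by move=> ct; have [h _] := dg e t ct; split; [exact: h | rewrite /velocity derive1E].
split=> // d t dt.
have p1 := geodesic_par gg.
have p2 := icurve_par s cg (fun c t h => ex_intro _ _ (dv c t h)).
have cg0 : chart_dom c (g 0) by rewrite g0.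
have := par_eq0 hR hT cg (par_along_sub p1 p2) cg0 dt.
rewrite g0 v0 subrr => /(_ erefl)/eqP; rewrite subr_eq0 => /eqP <-.
exact: dv.
Qed.

Lemma icurve_uniq s (g g' : R -> M) : icurve s g -> icurve s g' -> g 0 = g' 0 ->
  forall t, g t = g' t.
Proof.
move=> [cg dg] [cg' dg'] g0 t; apply: (@locally_constant _ (fun t => g t = g' t) _ 0 t g0) => {}t.
(* Agreement is shown to be locally constant: points where the curves differ have disjoint
   neighbourhoods because [M] is Hausdorff, and near a point where they agree the Gronwall estimate
   applies in a chart. *)
have [E|NE] := pselect (g t = g' t); last first.
  have hH : hausdorff_space M by case: hM.
  have := hH; rewrite open_hausdorff => /(_ _ _ (introN eqP NE))[[A B] /=].
  rewrite !inE => -[At Bt] [oA oB /eqP AB].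
  have [e1 e10 h1] := near_real (@cg t _ (open_nbhs_nbhs (conj oA At))).
  have [e2 e20 h2] := near_real (@cg' t _ (open_nbhs_nbhs (conj oB Bt))).
  exists (Num.min e1 e2); first by rewrite lt_min e10.
  move=> u v; rewrite !lt_min => /andP[u1 u2] _ uu.
  have : (A `&` B) (g u) by split; [exact: h1 | rewrite uu; exact: h2].
  by rewrite (eqP AB).
have [c ct] := chart_at hM (g t).
have ct' : chart_dom c (g' t) by rewrite -E.
set x := chart_map c (g t).
have [r r0 rA] := open_cball (@codom_open _ _ _ hM c) (chart_map_codom ct).
pose f y := s *m V c (chart_inv c y).
have sf : smooth_on (chart_codom c) f.
  apply: (smooth_on_mulmx (@codom_open _ _ _ hM c)); last exact: Vs.
  exact: smooth_on_cst.
have [L L0 hL] := smooth_lipschitz rA sf.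
have nr (h : R -> M) : continuous h -> h t = g t ->
    exists2 e : R, 0 < e & forall u : R, `|u - t| < e ->
       chart_dom c (h u) /\ `|chart_map c (h u) - x| <= r.
  move=> ch ht; apply: near_real.
  have hd : chart_dom c (h t) by rewrite ht.
  have o1 : open [set q | chart_dom c q /\ [set y | `|y - x| < r] (chart_map c q)].
    apply: open_setI_preimage; [exact: chart_open hM c| exact: oball_open|].
    by move=> q cq; exact: chart_map_cont.
  have : [set q | chart_dom c q /\ [set y | `|y - x| < r] (chart_map c q)] (h t).
    by split => //=; rewrite ht subrr normr0.
  move=> ot; have hh : \forall u \near t, [set q | chart_dom c q /\ [set y | `|y - x| < r] (chart_map c q)] (h u).
    exact: ch t _ (open_nbhs_nbhs (conj o1 ot)).
  by apply: filterS hh => u [/= uc /ltW ur].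
have [e1 e10 h1] := nr g cg erefl; have [e2 e20 h2] := nr g' cg' (esym E).
have e0 : 0 < Num.min e1 e2 by rewrite lt_min e10.
exists (Num.min e1 e2) => // u v ue ve _.
have [K K1 hK] := @gronwall_rV R n L (Num.min e1 e2) L0.
pose w t' := chart_map c (g (t + t')) - chart_map c (g' (t + t')).
pose dw t' := s *m V c (g (t + t')) - s *m V c (g' (t + t')).
have mem t' : `|t'| < Num.min e1 e2 -> `|t + t' - t| < e1 /\ `|t + t' - t| < e2.
  by rewrite lt_min addrC addKr => /andP.
have sh (h : R -> M) (t' : R) l : is_derive (t + t') 1 (chart_map c \o h) l ->
    is_derive t' 1 (fun t' => chart_map c (h (t + t'))) l.
  move/is_derive_lineP => d1; apply/is_derive_lineP.
  move: d1; congr (is_derive _ _ _ _); apply/funext => z /=.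
  by rewrite addrA.
have := hK w dw 0 (lexx _).
have a1 : forall t' : R, `|t'| < Num.min e1 e2 -> is_derive t' 1 w (dw t').
  move=> t' /mem[m1 m2]; apply: is_deriveB; apply: sh.
    by apply: dg; exact: (h1 _ m1).1.
  by apply: dg'; exact: (h2 _ m2).1.
have a2 : forall t' : R, `|t'| < Num.min e1 e2 -> `|dw t'| <= L * `|w t'| + 0.
  move=> t' /mem[m1 m2]; rewrite addr0.
  have [k1 l1] := h1 _ m1; have [k2 l2] := h2 _ m2.
  have := hL _ _ l2 l1; by rewrite /f !(chart_mapK hM).
move=> /(_ a1 a2) hw.
have /hw : `|v - t| < Num.min e1 e2 by [].
have -> : w 0 = 0 by rewrite /w addr0 E subrr.
rewrite normr0 addr0 mulr0 normr_le0 subr_eq0 addrC subrK => /eqP cE.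
move: ve; rewrite lt_min => /andP[/h1[k1 _] /h2[k2 _]].
by rewrite -(chart_mapK hM k1) cE (chart_mapK hM k2).
Qed.

Lemma icurve_scale (a : R) s g : icurve s g -> icurve (a *: s) (fun t => g (a * t)).
Proof.
move=> [cg dg]; split=> [t|c t ct].
  apply: (@continuous_comp _ _ _ (fun t => a * t) g); last exact: cg.
  by apply: continuousM; [exact: cvg_cst | exact: cvg_id].
have d1 := dg c _ ct.
have df : differentiable (chart_map c \o g) (a * t).
  by apply/derivable1_diffP; case: d1.
have da : is_derive t 1 (fun t : R => a * t) a.
  have := is_deriveM (is_derive_cst a t 1) (is_derive_id t 1).
  move/is_derive_eq; apply; rewrite scaler0 addr0 /GRing.scale /= mulr1.
  by [].
have := is_derive_compV (g := fun t : R => a * t) df da.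
move/is_derive_eq; apply.
have e : 'd (chart_map c \o g) (a * t) a = a *: 'd (chart_map c \o g) (a * t) 1.
  by rewrite -linearZ /= /GRing.scale /= mulr1.
rewrite e -(deriveE _ df) -scalemxAl; congr (_ *: _).
by case: d1.
Qed.

Lemma icurve_shift (a : R) s g : icurve s g -> icurve s (fun t => g (a + t)).
Proof.
move=> [cg dg]; split=> [t|c t ct].
  apply: (@continuous_comp _ _ _ (fun t => a + t) g); last exact: cg.
  by apply: continuousD; [exact: cvg_cst | exact: cvg_id].
move: (dg c _ ct) => /is_derive_lineP d1; apply/is_derive_lineP.
move: d1; congr (is_derive _ _ _ _); apply/funext => z /=.
by rewrite addrA.
Qed.

Definition flow s p : R -> M := xget (fun=> p) [set g | icurve s g /\ g 0 = p].

Lemma flowP s p : icurve s (flow s p) /\ flow s p 0 = p.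
Proof. by rewrite /flow; case: xgetP => [g -> //|/(_ _) h]; have [g /h] := icurve_ex s p. Qed.

(** The time is absorbed into [s], so that one map of the pair [(s, p)] contains all flows for all
    times. *)
Definition psi s p := flow s p 1.

Lemma psi_icurve s g (a : R) : icurve s g -> psi (a *: s) (g 0) = g a.
Proof.
move=> hg; have [h h0] := flowP (a *: s) (g 0).
have := icurve_uniq h (icurve_scale a hg) _ 1.
by rewrite mulr1; apply; rewrite mulr0.
Qed.

Lemma psi_flow s p (a : R) : psi (a *: s) p = flow s p a.
Proof. by have [h h0] := flowP s p; rewrite -(psi_icurve a h) h0. Qed.

Lemma psiD s p (a b : R) : psi ((a + b) *: s) p = psi (b *: s) (psi (a *: s) p).
Proof.
rewrite !psi_flow; have [h h0] := flowP s p.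
by rewrite -(psi_flow _ (flow s p a)) -[in RHS](addr0 a) (psi_icurve b (icurve_shift a h)).
Qed.

Lemma psi0 p : psi 0 p = p.
Proof. by have [_ h0] := flowP 0 p; rewrite -[in LHS](scale0r (0 : 'rV[R]_k)) psi_flow h0. Qed.

Lemma psiN s p : psi (- s) (psi s p) = p.
Proof.
have := psiD s p 1 (-1).
by rewrite subrr scale0r psi0 scaleN1r scale1r => <-.
Qed.

End ParallelFrame.

Section SmoothAt.
Context {R : realType} {n : nat}.
Variable M : rmfd R n.
Hypothesis hM : smooth_manifold M.

Definition smooth_at m (P : 'rV[R]_m -> M) (y0 : 'rV[R]_m) (c : chart M) :=
  exists U, [/\ open U, U y0, forall y, U y -> chart_dom c (P y) &
                smooth_on U (chart_map c \o P)].

Lemma smooth_at_cont m (P : 'rV[R]_m -> M) y0 c : smooth_at P y0 c ->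
  {for y0, continuous P}.
Proof.
move=> [U [oU Uy cU sP]].
have c1 : {for y0, continuous (chart_map c \o P)}.
  by apply: differentiable_continuous; exact: smooth_on_diff sP Uy.
have c2 : {for y0, continuous (chart_inv c \o (chart_map c \o P))}.
  apply: continuous_comp; first exact: c1.
  apply: (chart_inv_cont hM); apply: chart_map_codom; exact: cU.
rewrite /prop_for /continuous_at.
have e : \forall y \near y0, P y = (chart_inv c \o (chart_map c \o P)) y.
  apply: filterS (open_nbhs_nbhs (conj oU Uy)) => y Uy' /=.
  by rewrite (chart_mapK hM) //; exact: cU.
have -> : P y0 = (chart_inv c \o (chart_map c \o P)) y0 by rewrite [LHS](nbhs_singleton e).
move=> A nA.
have hA : \forall y \near y0, A ((chart_inv c \o (chart_map c \o P)) y) := c2 A nA.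
suff : \forall y \near y0, A (P y) by [].
by apply: filterS (filterI e hA) => y [-> //].
Qed.

Lemma smooth_at_chart m (P : 'rV[R]_m -> M) y0 c d : smooth_at P y0 c ->
  chart_dom d (P y0) -> smooth_at P y0 d.
Proof.
move=> [U [oU Uy cU sP]] dP.
have cP y : U y -> {for y, continuous P}.
  by move=> Uy'; apply: (@smooth_at_cont _ P y c); exists U.
pose W := [set y | U y /\ chart_dom d (P y)].
have oW : open W by apply: open_setI_preimage => //; exact: chart_open.
exists W; split=> // [y []//|].
have oO := @overlap_open _ _ _ hM c d.
have := smooth_on_comp oW oO _ (smooth_on_sub _ sP) (@transition_smooth _ _ _ hM c d).
have h1 y : W y -> overlap c d ((chart_map c \o P) y).
  by move=> [Uy' dy]; apply: (overlap_map hM) => //; exact: cU.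
have h2 : W `<=` U by move=> y [].
move=> /(_ h1 h2); apply: smooth_on_ext => // y [Uy' _] /=.
by rewrite (chart_mapK hM) //; exact: cU.
Qed.

Lemma smooth_at_ext m (P Q : 'rV[R]_m -> M) y0 c U : open U -> U y0 ->
  (forall y, U y -> P y = Q y) -> smooth_at P y0 c -> smooth_at Q y0 c.
Proof.
move=> oU Uy e [W [oW Wy cW sP]]; exists (U `&` W); split.
- exact: openI.
- by split.
- by move=> y [Uy' Wy']; rewrite -e //; exact: cW.
have oI := openI oU oW.
apply: (smooth_on_ext oI) (smooth_on_sub _ sP) => [y [Uy' _]|y []//] /=.
by rewrite e.
Qed.

End SmoothAt.

(** * Smoothness of the global flows *)

Section FlowSmooth.
Context {R : realType} {n k : nat}.
Variables (M : rmfd R n) (T : tensor_field M 3).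
Hypotheses (hR : riemannian M) (hT : is_form T).
Variable V : chart M -> M -> 'M[R]_(k, n).
Implicit Types (c d : chart M) (p q : M) (s : 'rV[R]_k).
Hypotheses (hV : parallel_frame T V) (hC : geodesically_complete M).

Let hM : smooth_manifold M. Proof. by case: hR. Qed.
Let Vs c : smooth_on (chart_codom c) (V c \o chart_inv c).
Proof. by case: hV. Qed.

(** A curve of speed at most [B] that starts in the half ball cannot leave the ball before time r /
    (2B). The speed bound is only known inside the chart, so this is a continuation argument. *)
Lemma icurve_stay_pos c x0 (r B : R) s g : 0 < r -> 0 <= B ->
  (forall x, `|x - x0| <= r -> chart_codom c x /\ `|s *m V c (chart_inv c x)| <= B) ->
  icurve V s g -> chart_dom c (g 0) -> `|chart_map c (g 0) - x0| < r / 2 ->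
  forall t, 0 <= t -> B * t < r / 2 -> chart_dom c (g t) /\ `|chart_map c (g t) - x0| < r.
Proof.
move=> r0 B0 hB [cg dg] c0 x0r b b0 Bb.
pose N := [set q | chart_dom c q /\ [set y | `|y - x0| < r] (chart_map c q)].
have oN : open N.
  apply: open_setI_preimage; [exact: chart_open hM c| exact: oball_open|].
  by move=> q cq; exact: chart_map_cont.
suff : forall u, 0 <= u <= b -> N (g u) by apply; rewrite b0 lexx.
apply: (@real_induction _ (fun t => forall u, 0 <= u <= t -> N (g u)) 0 b b0); last first.
  move=> u /andP[u0 u1]; have -> : u = 0 by lra.
  by split => //=; apply: lt_trans x0r _; lra.
move=> t /andP[t0 tb].
have nearN u : N (g u) -> exists2 e : R, 0 < e & forall v : R, `|v - u| < e -> N (g v).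
  by move=> Nu; apply: near_real; exact: (@cg u _ (open_nbhs_nbhs (conj oN Nu))).
have [Pt|] := pselect (forall u, 0 <= u <= t -> N (g u)).
  have [e e0 he] := nearN t (Pt t (introT andP (conj t0 (lexx t)))).
  exists e => // u v _ _ _ ve _ w /andP[w0 wv].
  have [wt|tw] := leP w t; first by apply: Pt; rewrite w0.
  apply: he; apply: le_lt_trans ve; rewrite !ger0_norm ?subr_ge0 //; try lra.
move=> nP; have /existsNP[u /not_implyP[/andP[u0 ut] nu]] := nP.
have [utl|tu] := ltP u t.
  exists (t - u); first by rewrite subr_gt0.
  move=> v w _ _ vt _ Pv; exfalso; apply: nu; apply: Pv; rewrite u0 /=.
  move: vt; rewrite ltr_norml => /andP[]; lra.
have {tu ut} ut : u = t by apply/eqP; rewrite eq_le ut.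
subst u.
have [[w /andP[w0 wt] nw]|allN] := pselect (exists2 w, 0 <= w < t & ~ N (g w)).
  exists (t - w); first by rewrite subr_gt0.
  move=> v z _ _ vt _ Pv; exfalso; apply: nw; apply: Pv; rewrite w0 /=.
  move: vt; rewrite ltr_norml => /andP[]; lra.
have {}allN w : 0 <= w < t -> N (g w) by move=> h; apply: contrapT => h'; apply: allN; exists w.
exfalso; apply: nu.
have [t00|tpos] := eqVneq t 0.
  by rewrite t00; split => //=; apply: lt_trans x0r _; lra.
have {tpos} tpos : 0 < t by rewrite lt_neqAle eq_sym tpos.
pose r' := `|chart_map c (g 0) - x0| + B * t.
have Bt : B * t <= B * b by apply: ler_wpM2l.
have r'r : r' < r by rewrite /r'; lra.
(* The curve could leave the chart domain at time [t] itself. It stays in the image of a smaller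
   closed ball before [t]; this image is compact, hence closed in the Hausdorff space [M], and so
   contains [g t]. *)
pose K := chart_inv c @` [set x : 'rV[R]_n | `|x - x0| <= r'].
have clK : closed K.
  apply: compact_closed; first by case: hM.
  apply: continuous_compact; last exact: cball_compact.
  apply: continuous_in_subspaceT => x; rewrite inE /= => xr.
  apply: (chart_inv_cont hM); apply: (hB x _).1; exact: le_trans xr (ltW r'r).
have inK w : 0 <= w < t -> K (g w).
  move=> /andP[w0 wt].
  have Nw : N (g w) by apply: allN; rewrite w0.
  exists (chart_map c (g w)); last by rewrite (chart_mapK hM) //; case: Nw.
  have : `|chart_map c (g w) - chart_map c (g 0)| <= B * (w - 0).
    apply: (@mx_MVT _ _ _ (chart_map c \o g) (fun t => s *m V c (g t))) => // v;
      rewrite in_itv /= => /andP[v0 vw].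
      have Nv : N (g v) by apply: allN; rewrite v0 /=; lra.
      by apply: dg; case: Nv.
    have [cv vr] : N (g v) by apply: allN; rewrite v0 /=; lra.
    rewrite -[g v](chart_mapK hM cv); apply: (hB _ _).2; exact: ltW vr.
  rewrite subr0 => h /=.
  rewrite -(subrKA (chart_map c (g 0))) /r'.
  have : B * w <= B * t by apply: ler_wpM2l => //; exact: ltW.
  by have := ler_normD (chart_map c (g w) - chart_map c (g 0)) (chart_map c (g 0) - x0); lra.
have [x /= xr xE] : K (g t).
  apply: contrapT => nK; have oK := closed_openC clK.
  have [e e0 he] := near_real (@cg t _ (open_nbhs_nbhs (conj oK nK))).
  pose w := t - Num.min (e / 2) t.
  have m1 : Num.min (e / 2) t <= e / 2 by rewrite ge_min lexx.
  have m2 : Num.min (e / 2) t <= t by rewrite ge_min lexx orbT.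
  have m0 : 0 < Num.min (e / 2) t by rewrite lt_min tpos andbT divr_gt0.
  apply: (he w); last by apply: inK; rewrite /w; apply/andP; split; lra.
  rewrite /w addrAC subrr sub0r normrN gtr0_norm //; lra.
have xc : chart_codom c x by apply: (hB x _).1; exact: le_trans xr (ltW r'r).
rewrite -xE; split; first exact: chart_inv_dom.
by rewrite /= (chart_invK hM) //; exact: le_lt_trans xr r'r.
Qed.

Lemma icurve_stay c x0 (r B : R) s g : 0 < r -> 0 <= B ->
  (forall x, `|x - x0| <= r -> chart_codom c x /\ `|s *m V c (chart_inv c x)| <= B) ->
  icurve V s g -> chart_dom c (g 0) -> `|chart_map c (g 0) - x0| < r / 2 ->
  forall t, B * `|t| < r / 2 -> chart_dom c (g t) /\ `|chart_map c (g t) - x0| < r.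
Proof.
move=> r0 B0 hB hg c0 x0r t Bt; have [t0|t0] := leP 0 t.
  by apply: (icurve_stay_pos r0 B0 hB hg) => //; rewrite -(ger0_norm t0).
have hB' x : `|x - x0| <= r -> chart_codom c x /\ `|(-1 *: s) *m V c (chart_inv c x)| <= B.
  by move=> /hB[xc xB]; split => //; rewrite -scalemxAl scaleN1r normrN.
have h := icurve_stay_pos r0 B0 hB' (icurve_scale (-1) hg).
rewrite mulr0 in h; have := h c0 x0r (- t); rewrite mulN1r opprK; apply.
  by rewrite oppr_ge0 ltW.
by rewrite -(ltr0_norm t0).
Qed.

(** To obtain smoothness jointly in [s] and [p], the coefficient [s] is made part of the initial
    value: the field [W] on pairs (s, x) does not move [s], and [flow_ck] applies to it. *)
Lemma psi_local p0 : exists2 e : R, 0 < e & exists2 N : set M, open N /\ N p0 &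
  forall m (L : 'rV[R]_m -> 'rV[R]_k) (P : 'rV[R]_m -> M) y0 U d, open U -> U y0 ->
    smooth_on U L -> smooth_at P y0 d -> `|L y0| < e -> N (P y0) ->
    exists c, smooth_at (fun y => psi V (L y) (P y)) y0 c.
Proof.
have [c cp] := chart_at hM p0; pose x0 := chart_map c p0.
have [r r0 rA] := open_cball (@codom_open _ _ _ hM c) (chart_map_codom cp).
pose A := [set y : 'rV[R]_(k + n) | chart_codom c (rsubmx y)].
have oA : open A.
  have -> : A = [set y : 'rV[R]_(k + n) | setT y /\ chart_codom c (rsubmx y)].
    by apply/seteqP; split => y //= [].
  apply: open_setI_preimage; [exact: openT | exact: codom_open hM c |].
  by move=> y _; exact: rsubmx_continuous.
pose W (y : 'rV[R]_(k + n)) : 'rV[R]_(k + n) :=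
  row_mx 0 (lsubmx y *m V c (chart_inv c (rsubmx y))).
have sW : smooth_on A W.
  apply: (smooth_on_row_mx oA); first exact: smooth_on_cst.
  apply: (smooth_on_mulmx oA).
    exact: (smooth_on_linear oA (lsubmx : {linear 'rV[R]_(k + n) -> 'rV[R]_k})).
  apply: (smooth_on_comp (f := (rsubmx : 'rV[R]_(k + n) -> 'rV[R]_n)) (g := V c \o chart_inv c)
     oA (@codom_open _ _ _ hM c)) => //.
  exact: (smooth_on_linear oA (rsubmx : {linear 'rV[R]_(k + n) -> 'rV[R]_n})).
pose a : 'rV[R]_(k + n) := row_mx 0 x0.
have ra y : `|y - a| <= r -> A y.
  move=> yr; apply: rA; apply: le_trans yr.
  by have := rsubmx_norm_le (y - a); rewrite linearB /= row_mxKr.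
have [B B0 hB] := cball_bounded ra sW.
(* A time during which curves from the half ball stay in the chart; adding 1 to [B] avoids a
   division by zero and makes the bound [BE] strict. *)
pose E := r / (2 * (B + 1)).
have B1 : 0 < B + 1 by rewrite ltr_wpDl.
have E0 : 0 < E by rewrite divr_gt0 // mulr_gt0.
have BE : B * E < r / 2.
  rewrite /E; have -> : B * (r / (2 * (B + 1))) = (r / 2) * (B / (B + 1)) by field; rewrite gt_eqF.
  by rewrite gtr_pMr ?divr_gt0 // ltr_pdivrMr // mul1r ltrDl.
pose O := [set y : 'rV[R]_(k + n) | `|y - a| < r / 2].
have oO : open O by exact: oball_open.
pose phi (t : R) (y : 'rV[R]_(k + n)) : 'rV[R]_(k + n) :=
  row_mx (lsubmx y) (chart_map c (flow V (lsubmx y) (chart_inv c (rsubmx y)) t)).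
have Osub y : O y -> [/\ `|lsubmx y| < r / 2, `|rsubmx y - x0| < r / 2 & chart_codom c (rsubmx y)].
  move=> yO; have h1 : `|lsubmx y| < r / 2.
    have := lsubmx_norm_le (y - a); rewrite linearB /= row_mxKl subr0 => h; exact: le_lt_trans h yO.
  have h2 : `|rsubmx y - x0| < r / 2.
    have := rsubmx_norm_le (y - a); rewrite linearB /= row_mxKr => h; exact: le_lt_trans h yO.
  split=> //; apply: rA; rewrite -/x0; lra.
have fl y : O y -> let s := lsubmx y in let g := flow V s (chart_inv c (rsubmx y)) in
    [/\ icurve V s g, g 0 = chart_inv c (rsubmx y) &
     forall t : R, `|t| < E -> chart_dom c (g t) /\ `|chart_map c (g t) - x0| < r].
  move=> yO s g; have [s2 x2 xc] := Osub y yO.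
  have [hg g0] := flowP hR hT hV hC s (chart_inv c (rsubmx y)); split=> // t tE.
  apply: (icurve_stay r0 B0 _ hg).
  - move=> x xr; split; first exact: rA.
    have h : `|row_mx s x - a| <= r.
      rewrite -[row_mx _ _ - _]hsubmxK linearB /= linearB /= !row_mxKl !row_mxKr subr0.
      by apply: row_mx_norm_le => //; lra.
    have := hB _ h; rewrite /W row_mxKl row_mxKr => h2; apply: le_trans h2.
    by have := rsubmx_norm_le (row_mx (0 : 'rV[R]_k) (s *m V c (chart_inv c x))); rewrite row_mxKr.
  - by rewrite g0; exact: chart_inv_dom.
  - by rewrite g0 (chart_invK hM).
  - by apply: le_lt_trans BE; apply: ler_wpM2l => //; exact: ltW.
have sphi (t : R) : `|t| < E -> smooth_on O (phi t).
  move=> tE; apply/smooth_onP => k'.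
  apply: (@flow_ck R k' _ A a r E W O phi) => //.
  - move=> y yO; have [_ g0 _] := fl y yO; have [_ _ xc] := Osub y yO.
    by rewrite /phi g0 (chart_invK hM) // hsubmxK.
  - move=> y u yO uE; have [_ _ /(_ u uE)[_ ur]] := fl y yO; have [s2 _ _] := Osub y yO.
    rewrite -[phi u y - _]hsubmxK linearB /= linearB /= !row_mxKl !row_mxKr subr0.
    by apply: row_mx_norm_le; [lra | exact: ltW].
  move=> y u yO uE; have [[cg dg] _ /(_ u uE)[uc _]] := fl y yO.
  rewrite /W /phi row_mxKl row_mxKr (chart_mapK hM uc).
  have := is_derive_row_mx (is_derive_cst (lsubmx y) u 1) (dg c u uc).
  by [].
(* [psi] is a flow at time 1, but the local flow is only controlled before time [E]. Flowing for
   time [t0] with coefficient [s / t0] gives the same point, at the price of a bound on [s]. *)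
pose t0 := E / 2.
have t00 : 0 < t0 by rewrite divr_gt0.
have t0E : `|t0| < E by rewrite gtr0_norm // /t0; lra.
exists (t0 * (r / 2)); first by rewrite mulr_gt0 // divr_gt0.
exists [set q | chart_dom c q /\ [set y | `|y - x0| < r / 2] (chart_map c q)].
  split; last by split => //=; rewrite subrr normr0 divr_gt0.
  apply: open_setI_preimage; [exact: chart_open hM c| exact: oball_open|].
  by move=> q cq; exact: chart_map_cont.
move=> m L P y0 U d oU Uy sL sP Le [cP Pr]; exists c.
have [U' [oU' U'y cU' sP']] := smooth_at_chart hM sP cP.
have oI := openI oU oU'.
pose G (y : 'rV[R]_m) : 'rV[R]_(k + n) := row_mx (t0^-1 *: L y) (chart_map c (P y)).
have sG : smooth_on (U `&` U') G.
  apply: (smooth_on_row_mx oI); last by apply: smooth_on_sub sP' => y [].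
  apply: (smooth_on_scalemx oI); first exact: smooth_on_cst.
  by apply: smooth_on_sub sL => y [].
have GO : O (G y0).
  rewrite /O /= -[G y0 - a]hsubmxK linearB /= linearB /= !row_mxKl !row_mxKr subr0.
  set b := Num.max `|t0^-1 *: L y0| `|chart_map c (P y0) - x0|.
  apply: (@le_lt_trans _ _ b).
    by apply: row_mx_norm_le; rewrite le_max lexx ?orbT.
  rewrite /b gt_max Pr andbT normrZ gtr0_norm ?invr_gt0 //.
  by rewrite mulrC ltr_pdivrMr // mulrC.
pose O' := [set y | (U `&` U') y /\ O (G y)].
have oO' : open O'.
  apply: open_setI_preimage => // y yI; apply: differentiable_continuous.
  exact: smooth_on_diff sG yI.
have eq y : O' y -> psi V (L y) (P y) = flow V (t0^-1 *: L y) (P y) t0.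
  move=> _; rewrite -(psi_flow hR hT hV hC) scalerA divff ?scale1r // gt_eqF //.
exists O'; split=> //.
  move=> y yO'; rewrite (eq y yO'); have [[_ /cU' yc] yO] := yO'.
  have [_ _ /(_ _ t0E)] := fl _ yO.
  by rewrite row_mxKl row_mxKr (chart_mapK hM yc) => -[].
have := smooth_on_comp oO' oO _ (smooth_on_sub _ sG) (sphi _ t0E).
have h1 y : O' y -> O (G y) by case.
have h2 : O' `<=` U `&` U' by move=> y [].
move=> /(_ h1 h2) sc.
have := smooth_on_comp oO' openT _ sc
  (smooth_on_linear openT (rsubmx : {linear 'rV[R]_(k + n) -> 'rV[R]_n})).
move=> /(_ (fun _ _ => I)).
apply: (smooth_on_ext oO') => y yO' /=.
have [[_ /cU' yc] yO] := yO'.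
by rewrite /phi row_mxKr row_mxKl row_mxKr (chart_mapK hM yc) -eq.
Qed.

(** The coefficient is reached in small steps along [v *: L y] with [v] from 0 to 1. By [psiD] each
    step is a flow with a small coefficient, to which [psi_local] applies, and smoothness propagates
    along the line. *)
Lemma psi_smooth m (L : 'rV[R]_m -> 'rV[R]_k) (P : 'rV[R]_m -> M) y0 U d c :
  open U -> U y0 -> smooth_on U L -> smooth_at P y0 d ->
  chart_dom c (psi V (L y0) (P y0)) ->
  smooth_at (fun y => psi V (L y) (P y)) y0 c.
Proof.
move=> oU Uy sL sP cc.
suff : exists c, smooth_at (fun y => psi V (1 *: L y) (P y)) y0 c.
  move=> [c' h]; apply: (smooth_at_chart hM (c := c')) => //.
  by apply: smooth_at_ext openT _ _ h => // y _; rewrite scale1r.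
apply: (@locally_constant _ (fun v => exists c, smooth_at (fun y => psi V (v *: L y) (P y)) y0 c) _ 0).
  move=> v; have [e e0 [N [oN Nq] hN]] := psi_local (psi V (v *: L y0) (P y0)).
  have nN : \forall u \near v, N (psi V (u *: L y0) (P y0)).
    have [[cf _] _] := flowP hR hT hV hC (L y0) (P y0).
    rewrite (psi_flow hR hT hV hC) in Nq.
    have := @cf v _ (open_nbhs_nbhs (conj oN Nq)).
    have e' : (fun u => psi V (u *: L y0) (P y0)) = flow V (L y0) (P y0).
      by apply/funext => u; rewrite (psi_flow hR hT hV hC).
    by rewrite -e'.
  have [e1 e10 h1] := near_real nN.
  have l1 : 0 < `|L y0| + 1 by rewrite ltr_wpDl.
  pose e2 := e / (2 * (`|L y0| + 1)).
  have e20 : 0 < e2 by rewrite divr_gt0 // mulr_gt0.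
  exists (Num.min e1 e2); first by rewrite lt_min e10.
  move=> u w; rewrite !lt_min => /andP[u1 u2] /andP[_ w2] [c' hu].
  have oU' := oU.
  have sL' (b : R) : smooth_on U (fun y => b *: L y).
    by apply: (smooth_on_scalemx oU); first exact: smooth_on_cst.
  have := hN m (fun y => (w - u) *: L y) (fun y => psi V (u *: L y) (P y)) y0 U c' oU Uy (sL' _) hu.
  have lt : `|(w - u) *: L y0| < e.
    rewrite normrZ; have wu : `|w - u| <= 2 * e2.
      rewrite (_ : w - u = (w - v) - (u - v)); last by ring.
      by have := ler_normB (w - v) (u - v); lra.
    apply: (@le_lt_trans _ _ (2 * e2 * `|L y0|)); first by apply: ler_wpM2r.
    rewrite /e2; have -> : 2 * (e / (2 * (`|L y0| + 1))) * `|L y0| = e * (`|L y0| / (`|L y0| + 1)).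
      by field; rewrite gt_eqF.
    by rewrite gtr_pMr // ltr_pdivrMr // mul1r ltrDl.
  move=> /(_ lt (h1 u u1)) [c2 h2]; exists c2.
  apply: smooth_at_ext openT _ _ h2 => // y _.
  by rewrite -(psiD hR hT hV hC) addrC subrK.
exists d; apply: smooth_at_ext openT _ _ sP => // y _.
by rewrite scale0r (psi0 hR hT hV hC).
Qed.

End FlowSmooth.

Lemma derive_partial {R : realType} (n : nat) (U : normedModType R) (f : 'rV[R]_n -> U) (x v : 'rV[R]_n) :
  differentiable f x -> 'D_v f x = \sum_j v 0 j *: 'D_(delta_mx 0 j) f x.
Proof. by move=> df; have e := deriveE v df; rewrite (etrans e (diff_partial v df)). Qed.

(** Symmetry of second derivatives in arbitrary directions, in the form needed for a flow: the
    derivative along the time direction is known explicitly, and its variation is the time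
    derivative of the variation. *)
Lemma young_is_derive {R : realType} (n m : nat) (A : set 'rV[R]_n) (f : 'rV[R]_n -> 'rV[R]_m)
    (x u w : 'rV[R]_n) (fu : 'rV[R]_n -> 'rV[R]_m) X :
  open A -> smooth_on A f -> A x -> (forall y, A y -> is_derive y u f (fu y)) ->
  is_derive x w fu X -> is_derive x u ('D_w f) X.
Proof.
move=> oA sf Ax dfu dX.
have nA := open_nbhs_nbhs (conj oA Ax).
have scal (h : 'rV[R]_n -> R) : smooth_on A h ->
    is_derive x u ('D_w h) ('D_w ('D_u h) x).
  move=> sh.
  have sp i := smooth_on_partial i sh.
  have e (v : 'rV[R]_n) : \forall y \near x, \sum_j v 0 j *: 'D_(delta_mx 0 j) h y = 'D_v h y.
    apply: filterS nA => y Ay.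
    exact: esym (derive_partial v (smooth_on_diff sh Ay)).
  have ds (v v' : 'rV[R]_n) : is_derive x v' (fun y => \sum_j v 0 j *: 'D_(delta_mx 0 j) h y)
      (\sum_j v 0 j *: \sum_i v' 0 i *: 'D_(delta_mx 0 i) ('D_(delta_mx 0 j) h) x).
    apply: is_derive_sumr => j.
    have dj := smooth_on_diff (sp j) Ax.
    have d1 : is_derive x v' ('D_(delta_mx 0 j) h) ('D_v' ('D_(delta_mx 0 j) h) x).
      by split => //; exact: diff_derivable.
    rewrite -(derive_partial v' dj); exact: is_deriveZ.
  have d1 := near_eq_is_derive (e w) (ds w u).
  have d2 := near_eq_is_derive (e u) (ds u w).
  have e2 : 'D_w ('D_u h) x = \sum_j u 0 j *: \sum_i w 0 i *: 'D_(delta_mx 0 i) ('D_(delta_mx 0 j) h) x.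
    by case: d2.
  rewrite e2; apply: is_derive_eq d1 _.
  under eq_bigr => j _ do rewrite scaler_sumr.
  under [RHS]eq_bigr => j _ do rewrite scaler_sumr.
  rewrite exchange_big; apply: eq_bigr => i _; apply: eq_bigr => j _.
  rewrite (young i j oA sh Ax) !scalerA; congr (_ *: _); exact: mulrC.
have comp y v i l : derivable f y v -> is_derive y v f l ->
    is_derive y v (fun z => f z i.1 i.2) (l i.1 i.2).
  by move=> _ /is_derive_mxP; exact.
apply/is_derive_mxP => i j.
have sij : smooth_on A (fun y => f y i j : R) by have /(smooth_on_mxP oA) := sf.
have := scal _ sij.
have -> : 'D_w ('D_u (fun y => f y i j)) x = X i j.
  have /is_derive_mxP/(_ i j) d := dX.
  have d' : is_derive x w ('D_u (fun y => f y i j)) (X i j).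
    apply: near_eq_is_derive d; apply: filterS nA => y Ay.
    by have /is_derive_mxP/(_ i j)[_ ->] := dfu y Ay.
  by case: d'.
apply: near_eq_is_derive; apply: filterS nA => y Ay.
have d : is_derive y w f ('D_w f y).
  by split => //; apply: diff_derivable; exact: smooth_on_diff sf Ay.
by have /is_derive_mxP/(_ i j)[_ ->] := d.
Qed.

Lemma is_derive_aff {R : realType} (U : normedModType R) (a v : U) :
  is_derive (0 : R) 1 (fun t : R => a + t *: v) v.
Proof. by have /is_derive_lineP := is_derive_id a v. Qed.

(** * The differential of the flows *)

Section FlowDiff.
Context {R : realType} {n k : nat}.
Variables (M : rmfd R n) (T : tensor_field M 3).
Hypotheses (hR : riemannian M) (hT : is_form T).
Variable V : chart M -> M -> 'M[R]_(k, n).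
Implicit Types (c d e : chart M) (p q : M) (s : 'rV[R]_k).
Hypotheses (hV : parallel_frame T V) (hC : geodesically_complete M).

Let hM : smooth_manifold M. Proof. by case: hR. Qed.
Let Vj c d p : chart_dom c p -> chart_dom d p -> V d p = V c p *m jac c d p.
Proof. by case: hV => h _ _ _ _; exact: h. Qed.
Let VT c p s : chart_dom c p -> ins (s *m V c p) (T c p) = 0.
Proof. by case: hV => _ _ _ _ h; exact: h. Qed.

Section AtPoint.
Variables (c : chart M) (p0 : M) (s0 : 'rV[R]_k).
Hypothesis cp0 : chart_dom c p0.

(** The flow as a function of time, coefficient and coordinates of the initial point. The curve [zt]
    lets the time run with the other arguments fixed, and [u0] is the direction of time. *)
Let Th (z : 'rV[R]_(1 + (k + n))) : M :=
  psi V (z 0 (lshift (k + n) 0) *: lsubmx (rsubmx z)) (chart_inv c (rsubmx (rsubmx z))).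
Let zt (t : R) : 'rV[R]_(1 + (k + n)) := row_mx (const_mx t) (row_mx s0 (chart_map c p0)).
Let u0 : 'rV[R]_(1 + (k + n)) := row_mx (const_mx 1) 0.

Let Tzt t : Th (zt t) = flow V s0 p0 t.
Proof.
rewrite /Th /zt row_mxKr row_mxKl row_mxKr row_mxEl mxE (chart_mapK hM cp0).
exact: (psi_flow hR hT hV hC).
Qed.

Let Th_smooth z e : chart_codom c (rsubmx (rsubmx z)) -> chart_dom e (Th z) -> smooth_at Th z e.
Proof.
move=> cz ez.
pose Lr : {linear 'rV[R]_(1 + (k + n)) -> 'rV[R]_n} := (rsubmx \o rsubmx).
pose Ll : {linear 'rV[R]_(1 + (k + n)) -> 'rV[R]_k} := (lsubmx \o rsubmx).
have sr := smooth_on_linear (A := setT) openT Lr.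
have sl := smooth_on_linear (A := setT) openT Ll.
have sL : smooth_on setT (fun z : 'rV[R]_(1 + (k + n)) => z 0 (lshift (k + n) 0) *: lsubmx (rsubmx z)).
  apply: (smooth_on_scalemx openT); [exact: (smooth_on_coord openT) | exact: sl].
apply: (psi_smooth hR hT hV hC (d := c) openT I sL) => //.
pose A := [set z : 'rV[R]_(1 + (k + n)) | setT z /\ chart_codom c (rsubmx (rsubmx z))].
have oA : open A.
  apply: open_setI_preimage; [exact: openT | exact: codom_open hM c |].
  by move=> y _; apply: differentiable_continuous; exact: smooth_on_diff sr I.
exists A; split=> //; first by move=> y [_]; exact: chart_inv_dom.
apply: (smooth_on_ext oA) (smooth_on_sub (@subsetT _ A) sr) => y [_ cy] /=.
by rewrite (chart_invK hM).
Qed.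

Let czt t : chart_codom c (rsubmx (rsubmx (zt t))).
Proof. by rewrite /zt !row_mxKr; exact: chart_map_codom. Qed.

(** The variations of the flow: the first [k] rows are derivatives with respect to the coefficient,
    the last [n] with respect to the initial point. *)
Let Z e (t : R) : 'M[R]_(k + n, n) :=
  \matrix_(i, j) ('D_(row_mx 0 (delta_mx 0 i)) (chart_map e \o Th) (zt t)) 0 j.

Let dTh e t : chart_dom e (Th (zt t)) -> differentiable (chart_map e \o Th) (zt t).
Proof.
move=> et; have [Q [oQ Qz _ sQ]] := Th_smooth (czt t) et.
exact: smooth_on_diff sQ Qz.
Qed.

Let ZE e t (v : 'rV[R]_(k + n)) : chart_dom e (Th (zt t)) ->
  is_derive (zt t) (row_mx 0 v) (chart_map e \o Th) (v *m Z e t).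
Proof.
move=> et; have df := dTh et.
split; first exact: diff_derivable.
have E w := deriveE w df.
apply: (etrans (E _)).
have e1 : row_mx 0 v = \sum_i v 0 i *: row_mx (0 : 'rV[R]_1) (delta_mx 0 i : 'rV[R]_(k + n)).
  rewrite {1}(row_sum_delta v); apply/rowP => j; rewrite summxE !mxE.
  case: fintype.split_ordP => a ->; last by rewrite summxE; apply: eq_bigr => i _; rewrite [RHS]mxE row_mxEr mxE.
  by rewrite mxE big1 // => i _; rewrite mxE row_mxEl mxE mulr0.
rewrite e1 linear_sum; apply/rowP => j; rewrite summxE mxE; apply: eq_bigr => i _ /=.
rewrite linearZ mxE; congr (_ * _); rewrite [RHS]mxE; congr (fun_of_matrix _ 0 j).
exact: esym (E _).
Qed.

Let dTh0 e z : chart_codom c (rsubmx (rsubmx z)) -> chart_dom e (Th z) ->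
  is_derive z u0 (chart_map e \o Th) (lsubmx (rsubmx z) *m V e (Th z)).
Proof.
move=> cz ez; apply/is_derive_lineP.
set s := lsubmx (rsubmx z); set q := chart_inv c (rsubmx (rsubmx z)).
have [hf f0] := flowP hR hT hV hC s q.
have hf' := icurve_shift (z 0 (lshift (k + n) 0)) hf.
have e0 : Th z = flow V s q (z 0 (lshift (k + n) 0) + 0).
  by rewrite addr0 /Th -/s -/q (psi_flow hR hT hV hC).
have := hf'.2 e 0; rewrite -e0 => /(_ ez).
congr (is_derive _ _ _ _); apply/funext => t /=; congr (chart_map e _).
rewrite -(psi_flow hR hT hV hC) /Th; congr (psi V (_ *: _) (chart_inv c _)).
- by rewrite !mxE; case: fintype.split_ordP => a //; rewrite ord1 => _; rewrite mxE mulr1.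
- by rewrite linearD linearZ /= row_mxKr scaler0 addr0.
- by rewrite linearD linearZ /= row_mxKr scaler0 addr0.
Qed.

(** The variational equation. Interchanging derivatives gives the derivative of [s V] in the
    direction of the variation; as [V] is parallel and annihilates the torsion, [cn_swap] rewrites
    it so that the covariant derivative of [Z] along the flow is [(V, 0)]. *)
Let dZ e (t : R) : chart_dom e (Th (zt t)) ->
  is_derive t 1 (Z e)
    (col_mx (V e (Th (zt t))) 0 - Z e t *m cn T e (Th (zt t)) (s0 *m V e (Th (zt t)))).
Proof.
move=> et; have [Q [oQ Qz Qe sQ]] := Th_smooth (czt t) et.
set q := Th (zt t).
apply/is_derive_mxP => i j.
rewrite (_ : (fun r : R => Z e r i j) =
   fun r : R => ('D_(row_mx 0 (delta_mx 0 i)) (chart_map e \o Th) (zt r)) 0 j); last first.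
  by apply/funext => r; rewrite mxE.
pose rr : {linear 'rV[R]_(1 + (k + n)) -> 'rV[R]_n} := (rsubmx \o rsubmx).
pose Q' := [set z | Q z /\ chart_codom c (rsubmx (rsubmx z))].
have oQ' : open Q'.
  apply: open_setI_preimage; [exact: oQ | exact: codom_open hM c |].
  move=> y _; apply: differentiable_continuous.
  exact: smooth_on_diff (smooth_on_linear (A := setT) openT rr) I.
have sQ' : smooth_on Q' (chart_map e \o Th) by apply: smooth_on_sub sQ => y [].
have d0 y : Q' y -> is_derive y u0 (chart_map e \o Th) (lsubmx (rsubmx y) *m V e (Th y)).
  by move=> [Qy cy]; apply: dTh0 => //; exact: Qe.
set w : 'rV[R]_(1 + (k + n)) := row_mx 0 (delta_mx 0 i).
have cT : {for zt t, continuous Th} := smooth_at_cont hM (Th_smooth (czt t) et).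
have dV := frame_along hR hV cT et (ZE (delta_mx 0 i) et).
pose ll : {linear 'rV[R]_(1 + (k + n)) -> 'rV[R]_k} := (lsubmx \o rsubmx).
have dl : is_derive (zt t) w (fun z => lsubmx (rsubmx z)) (lsubmx (delta_mx 0 i : 'rV[R]_(k + n))).
  apply/is_derive_lineP; have -> : (fun t0 : R => lsubmx (rsubmx (zt t + t0 *: w))) =
      (fun t0 : R => s0 + t0 *: lsubmx (delta_mx 0 i : 'rV[R]_(k + n))).
    apply/funext => r; rewrite linearD linearZ /= linearD linearZ /= /zt /w !row_mxKr row_mxKl.
    by [].
  have := is_derive_aff s0 (lsubmx (delta_mx 0 i : 'rV[R]_(k + n))).
  by [].
have dX := is_derive_mulmx dl dV.
have := young_is_derive oQ' sQ' (conj Qz (czt t)) d0 dX.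
move=> /is_derive_lineP/is_derive_mxP/(_ 0 j) h.
apply/is_derive_lineP; move: h.
rewrite (_ : (fun r : R => ('D_w (chart_map e \o Th) (zt t + r *: u0)) 0 j) =
    fun r : R => ('D_w (chart_map e \o Th) (zt (t + r *: 1))) 0 j); last first.
  apply/funext => r; congr (fun_of_matrix ('D_w _ _) 0 j).
  rewrite /zt /u0 scale_row_mx add_row_mx scaler0 addr0; congr row_mx.
  by apply/rowP => a; rewrite !mxE.
move/is_derive_eq; apply.
have es : lsubmx (rsubmx (zt t)) = s0 by rewrite /zt row_mxKr row_mxKl.
rewrite es -/q.
have sw := cn_swap hR hT (u := s0 *m V e q) (delta_mx 0 i *m Z e t) et (VT s0 et).
rewrite mulmxN mulmxA -sw !mxE; congr (_ - _); last first.
  by apply: eq_bigr => a _; rewrite -rowE mxE.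
case: fintype.split_ordP => a ->.
  rewrite (bigD1 a) //= big1 ?addr0 => [|b ba].
    by rewrite !mxE !eqxx mul1r.
  by rewrite !mxE eqxx (inj_eq (@lshift_inj _ _)) (negbTE ba) mul0r.
by rewrite [RHS]mxE big1 // => b _; rewrite !mxE eqxx eq_lrshift mul0r.
Qed.

Let cflow : continuous (flow V s0 p0).
Proof. by have [[]] := flowP hR hT hV hC s0 p0. Qed.

Let dflow e (t : R) : chart_dom e (flow V s0 p0 t) ->
  is_derive t 1 (chart_map e \o flow V s0 p0) (s0 *m V e (flow V s0 p0 t)).
Proof. by have [[_ h] _] := flowP hR hT hV hC s0 p0; exact: h. Qed.

(** The covariant derivative [(V, 0)] of [Z] is itself parallel, so subtracting [t] times it leaves
    a parallel family. *)
Let Um e (t : R) : 'M[R]_(k + n, n) := Z e t - t *: col_mx (V e (flow V s0 p0 t)) 0.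

Let par_U : par_along T (flow V s0 p0) Um.
Proof.
split=> [d e t dt et|e t et].
  have dt' : chart_dom d (Th (zt t)) by rewrite Tzt.
  have et' : chart_dom e (Th (zt t)) by rewrite Tzt.
  have ZJ : Z e t = Z d t *m jac d e (flow V s0 p0 t).
    apply/row_matrixP => i; rewrite row_mul ![row i (Z _ _)]rowE.
    have cT : {for zt t, continuous Th} := smooth_at_cont hM (Th_smooth (czt t) dt').
    have := is_derive_chart hR cT dt' (ZE (delta_mx 0 i) dt') et'.
    by rewrite Tzt; apply: is_derive_uniq; exact: ZE.
  rewrite /Um ZJ (Vj dt et) mulmxBl; congr (_ - _).
  by rewrite -scalemxAl mul_col_mx mul0mx.
have et' : chart_dom e (Th (zt t)) by rewrite Tzt.
exists (s0 *m V e (flow V s0 p0 t)); first exact: dflow.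
have d1 := dZ et'; rewrite Tzt in d1.
have dV := frame_along hR hV (@cflow t) et (dflow et).
have d2 : is_derive t 1 (fun t => t *: col_mx (V e (flow V s0 p0 t)) (0 : 'M[R]_(n, n)))
    (col_mx (V e (flow V s0 p0 t)) 0 +
     t *: col_mx (- (V e (flow V s0 p0 t) *m cn T e (flow V s0 p0 t) (s0 *m V e (flow V s0 p0 t)))) 0).
  apply/is_derive_mxP => i j.
  move: dV => /is_derive_mxP dV.
  rewrite (_ : (fun r : R => _) = fun r : R => r * (col_mx (V e (flow V s0 p0 r)) (0 : 'M[R]_(n, n))) i j); last first.
    by apply/funext => r; rewrite mxE.
  have dc : is_derive t 1 (fun r : R => (col_mx (V e (flow V s0 p0 r)) (0 : 'M[R]_(n, n))) i j)
     (col_mx (- (V e (flow V s0 p0 t) *m cn T e (flow V s0 p0 t) (s0 *m V e (flow V s0 p0 t)))) (0 : 'M[R]_(n, n)) i j).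
    rewrite mxE; rewrite (_ : (fun r : R => _) = fun r : R => match fintype.split i with
       | inl i1 => V e (flow V s0 p0 r) i1 j | inr i2 => (0 : 'M[R]_(n, n)) i2 j end); last first.
      by apply/funext => r; rewrite mxE.
    by case: fintype.split => a; [exact: dV | rewrite mxE; exact: is_derive_cst].
  apply: is_derive_eq (is_derive_mulr (is_derive_id t 1) dc) _.
  by rewrite [RHS]mxE [RHS]addrC mul1r; congr (_ + _); rewrite [RHS]mxE.
apply: is_derive_eq (is_deriveB d1 d2) _.
rewrite /Um mulmxBl -scalemxAl mul_col_mx mul0mx.
have -> : col_mx (- (V e (flow V s0 p0 t) *m cn T e (flow V s0 p0 t) (s0 *m V e (flow V s0 p0 t)))) (0 : 'M[R]_(n, n))
   = - col_mx (V e (flow V s0 p0 t) *m cn T e (flow V s0 p0 t) (s0 *m V e (flow V s0 p0 t))) 0.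
  by rewrite opp_col_mx oppr0.
rewrite scalerN; set A := col_mx _ _; set B := _ *m _; set C := _ *: _.
by move: (A) (B) (C) => a b c'; apply/matrixP => i j; rewrite !mxE; ring.
Qed.

Let U0 : Um c 0 = col_mx 0 1%:M.
Proof.
have c0' : chart_dom c (Th (zt 0)) by rewrite Tzt; have [_ ->] := flowP hR hT hV hC s0 p0.
rewrite /Um scale0r subr0; apply/row_matrixP => i; rewrite rowE.
have d1 := ZE (delta_mx 0 i) c0'.
suff d2 : is_derive (zt 0) (row_mx 0 (delta_mx 0 i)) (chart_map c \o Th) (row i (col_mx (0 : 'M[R]_(k, n)) 1%:M)).
  exact: is_derive_uniq d1 d2.
apply/is_derive_lineP.
have key : \forall t \near (0 : R), chart_map c p0 + t *: rsubmx (delta_mx 0 i : 'rV[R]_(k + n)) =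
   (chart_map c \o Th) (zt 0 + t *: row_mx 0 (delta_mx 0 i)).
  have : \forall t \near (0 : R), chart_codom c (chart_map c p0 + t *: rsubmx (delta_mx 0 i : 'rV[R]_(k + n))).
    have h := is_derive_aff (chart_map c p0) (rsubmx (delta_mx 0 i : 'rV[R]_(k + n))).
    have ch : {for (0 : R), continuous (fun t : R => chart_map c p0 + t *: rsubmx (delta_mx 0 i : 'rV[R]_(k + n)))}.
      by apply: differentiable_continuous; apply/derivable1_diffP; case: h.
    apply: ch; apply: open_nbhs_nbhs; split; first exact: codom_open hM c.
    by rewrite scale0r addr0; exact: chart_map_codom.
  apply: filterS => t ct; rewrite /= /Th.
  have -> : (zt 0 + t *: row_mx 0 (delta_mx 0 i)) 0 (lshift (k + n) 0) = 0.
    by rewrite mxE [X in _ + X]mxE !row_mxEl !mxE mulr0 addr0.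
  rewrite scale0r (psi0 hR hT hV hC) linearD linearZ /= linearD linearZ /= /zt !row_mxKr.
  by rewrite (chart_invK hM).
apply: near_eq_is_derive key _.
have := is_derive_aff (chart_map c p0) (rsubmx (delta_mx 0 i : 'rV[R]_(k + n))).
move/is_derive_eq; apply.
rewrite rowE -[delta_mx 0 i in RHS]hsubmxK mul_row_col mulmx0 mulmx1 add0r.
by [].
Qed.

(* A is the differential of psi: along the flow it solves the same equation as
   parallel transport, because T vanishes on V. *)
Lemma psi_diff e : chart_dom e (psi V s0 p0) -> exists A : 'M[R]_n,
  [/\ A *m metric e (psi V s0 p0) *m A^T = metric c p0,
      V c p0 *m A = V e (psi V s0 p0),
      forall j (t : tensor_field M j),
        (forall c d p, chart_dom c p -> chart_dom d p -> t c p = pull (jac c d p) (t d p)) ->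
        (forall c i, smooth_on (chart_codom c) (fun x => t c (chart_inv c x) i : R)) ->
        parallel_tensor (skew_connection T) t ->
        pull A (t e (psi V s0 p0)) = t c p0 &
      forall (W : normedModType R) (y v : W) (L : W -> 'rV[R]_k) (P : W -> M) l w,
        L y = s0 -> P y = p0 -> {for y, continuous P} -> is_derive y v L l ->
        is_derive y v (chart_map c \o P) w ->
        is_derive y v (fun y => chart_map e (psi V (L y) (P y)))
          (l *m V e (psi V s0 p0) + w *m A)].
Proof.
rewrite -[psi _ _ _]/(flow V s0 p0 1) => e1.
have c0 : chart_dom c (flow V s0 p0 0) by have [_ ->] := flowP hR hT hV hC s0 p0.
have E0 : flow V s0 p0 0 = p0 by have [_ ->] := flowP hR hT hV hC s0 p0.
have sub m (K : 'M[R]_(m, k + n)) : par_along T (flow V s0 p0) (fun e t => K *m Um e t).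
  split=> [d d' t dt dt'|d t dt]; first by rewrite (par_U.1 d d') // mulmxA.
  have [w dw dU] := par_U.2 d t dt; exists w => //.
  have := is_derive_mulmx (is_derive_cst K t 1) dU.
  by move/is_derive_eq; apply; rewrite mul0mx add0r mulmxN mulmxA.
have parA := sub n (row_mx 0 1%:M).
(* The rows for the coefficient vanish at time 0, hence always: at time 1 the derivative of the flow
   with respect to [s] is exactly [V]. *)
have usub0 : usubmx (Um e 1) = 0.
  have parB := sub k (row_mx 1%:M 0).
  have := par_eq0 hR hT cflow parB c0 e1.
  rewrite U0 mul_row_col mulmx0 mul0mx addr0 => /(_ erefl).
  by rewrite -{1}(vsubmxK (Um e 1)) mul_row_col mul1mx mul0mx addr0.
pose A := dsubmx (Um e 1).
have AE : row_mx 0 1%:M *m Um e 1 = A.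
  by rewrite -{1}(vsubmxK (Um e 1)) mul_row_col mul1mx mul0mx add0r.
have A0 : row_mx 0 1%:M *m Um c 0 = 1%:M.
  by rewrite U0 mul_row_col mulmx0 mul1mx add0r.
exists A; split.
- by have := par_metric hR hT cflow parA e1 c0; rewrite AE A0 mul1mx trmx1 mulmx1 E0.
- have parV : par_along T (flow V s0 p0) (fun e t => V e (flow V s0 p0 t)).
    split=> [d d' t dt dt'|d t dt]; first exact: Vj.
    by exists (s0 *m V d (flow V s0 p0 t)); [exact: dflow | have := frame_along hR hV (@cflow t) dt (dflow dt)].
  have parC := par_along_sub (sub k (V c p0 *m row_mx 0 1%:M)) parV.
  have := par_eq0 hR hT cflow parC c0 e1.
  rewrite -!mulmxA AE A0 E0 mulmx1 subrr => /(_ erefl)/eqP.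
  by rewrite subr_eq0 => /eqP.
- move=> j t tj st pt.
  have := par_pull hR cflow parA tj st pt e1 c0.
  by rewrite AE A0 pull1 E0.
move=> W y v L P l w Ly Py cP dL dP.
have e1' : chart_dom e (Th (zt 1)) by rewrite Tzt.
have df := dTh e1'.
pose G (y : W) : 'rV[R]_(1 + (k + n)) := row_mx (const_mx 1) (row_mx (L y) (chart_map c (P y))).
have Gy : G y = zt 1 by rewrite /G /zt Ly Py.
have dG : is_derive y v G (row_mx 0 (row_mx l w)).
  apply/is_derive_mxP => i j; rewrite ord1.
  move: dL dP => /is_derive_mxP dL /is_derive_mxP dP.
  rewrite mxE; rewrite (_ : (fun r : W => _) = fun r : W => match fintype.split j with
       | inl j1 => 1 | inr j2 => row_mx (L r) (chart_map c (P r)) 0 j2 end); last first.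
    by apply/funext => r; rewrite mxE; case: fintype.split => // a; rewrite mxE.
  case: fintype.split => a; first by rewrite mxE; exact: is_derive_cst.
  rewrite mxE; rewrite (_ : (fun r : W => _) = fun r : W => match fintype.split a with
       | inl j1 => L r 0 j1 | inr j2 => chart_map c (P r) 0 j2 end); last first.
    by apply/funext => r; rewrite mxE.
  by case: fintype.split => b; [exact: dL | exact: dP].
rewrite -Gy in df.
have := is_derive_compV df dG.
have eq : 'd (chart_map e \o Th) (G y) (row_mx 0 (row_mx l w)) = l *m V e (flow V s0 p0 1) + w *m A.
  have [_ E] := ZE (row_mx l w) e1'.
  have e2 := deriveE (row_mx 0 (row_mx l w)) df.
  rewrite -e2 Gy E.
  have -> : Z e 1 = Um e 1 + col_mx (V e (flow V s0 p0 1)) 0 by rewrite /Um scale1r subrK.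
  rewrite -(vsubmxK (Um e 1)) usub0 -/A add_col_mx add0r addr0 mul_row_col.
  by [].
rewrite eq; apply: near_eq_is_derive.
have cc : chart_dom c (P y) by rewrite Py.
apply: filterS (near_chart hR cP cc) => z cz /=.
rewrite /Th /G row_mxKr row_mxKl row_mxKr row_mxEl mxE scale1r (chart_mapK hM cz).
by [].
Qed.

End AtPoint.
End FlowDiff.

(** * Closed forms *)

Section Clip.
Context {R : realType}.

(** The retraction of the line onto the unit interval, by which maps on the interval or the square
    are extended continuously. *)
Definition clip (t : R) : R := Num.max 0 (Num.min 1 t).

Lemma clip_itv t : 0 <= clip t <= 1.
Proof. by rewrite /clip le_max lexx /= ge_max ler01 ge_min lexx. Qed.

Lemma clip_id t : 0 <= t <= 1 -> clip t = t.
Proof. by move=> /andP[t0 t1]; rewrite /clip (min_idPr t1) (max_idPr t0). Qed.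

Lemma clip_continuous : continuous clip.
Proof.
move=> t; apply: (@continuous_max R R (fun=> 0) (fun t => Num.min 1 t)); first exact: cvg_cst.
by apply: (@continuous_min R R (fun=> 1) id); [exact: cvg_cst | exact: cvg_id].
Qed.

Lemma continuous_within_comp (S X Y : topologicalType) (A : set X) (f : X -> Y) (h : S -> X) :
  {within A, continuous f} -> continuous h -> (forall s, A (h s)) -> continuous (f \o h).
Proof.
move=> /subspace_continuousP cf ch hA s B nB.
have h1 : \forall x \near h s, A x -> B (f x) := cf (h s) (hA s) B nB.
have h2 : \forall u \near s, A (h u) -> B (f (h u)) := ch s _ h1.
suff : \forall u \near s, B ((f \o h) u) by [].
by apply: filterS h2 => u /(_ (hA u)).
Qed.

Lemma antiderivative (f : R -> R) : continuous f ->
  exists H : R -> R, forall t : R, 0 <= t <= 1 -> is_derive t 1 H (f t).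
Proof.
move=> cf; exists (fun x => (\int[@lebesgue_measure R]_(t in `[-1, x]) (f t))%R) => t /andP[t0 t1].
(* The integral starts at -1 and integrability is taken up to 2, so that every point of the unit
   interval is interior. *)
have h0 : @integrable _ (measurableTypeR R) R lebesgue_measure `[-1, 2%R]%classic (EFin \o f).
  apply: continuous_compact_integrable; first exact: segment_compact.
  by apply: continuous_subspaceT.
have t2 : t < 2 by apply: le_lt_trans t1 _; rewrite ltr1n.
have tm : -1 < t by apply: lt_le_trans t0; rewrite ltrN10.
have [d1 d2] := continuous_FTC1_closed t2 h0 tm (cf t).
split; [exact: d1 | rewrite -derive1E; exact: d2].
Qed.

Lemma antiderivative_rV k (f : R -> 'rV[R]_k) : continuous f ->
  exists2 H : R -> 'rV[R]_k, H 0 = 0 & forall t : R, 0 <= t <= 1 -> is_derive t 1 H (f t).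
Proof.
move=> cf.
have h i : exists H : R -> R, forall t : R, 0 <= t <= 1 -> is_derive t 1 H (f t 0 i).
  apply: antiderivative => t.
  apply: (@continuous_comp _ _ _ f (fun M : 'rV[R]_k => M 0 i)); first exact: cf.
  exact: coord_continuous.
have [H hH] := choice h.
exists (fun t => \row_i (H i t - H i 0)); first by apply/rowP => i; rewrite !mxE subrr.
move=> t t01; apply/is_derive_mxP => i j; rewrite ord1.
rewrite (_ : (fun s => _) = fun s => H j s - H j 0); last by apply/funext => s; rewrite mxE.
have := is_deriveB (hH j t t01) (is_derive_cst (H j 0) t 1).
by rewrite subr0.
Qed.

Lemma mulmx_norm2 m n p (A : 'M[R]_(m, n)) (B : 'M[R]_(n, p)) :
  `|A *m B| <= n%:R * (`|A| * `|B|).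
Proof.
apply/mx_norm_leP => [|i j]; first by rewrite !mulr_ge0.
rewrite mxE; apply: le_trans (ler_norm_sum _ _ _) _.
rewrite (_ : n%:R * _ = \sum_(l < n) `|A| * `|B|); last first.
  by rewrite sumr_const card_ord mulr_natl.
by apply: ler_sum => l _; rewrite normrM ler_pM // mx_norm_entry.
Qed.

Lemma smooth_on_primitive n k (A : set 'rV[R]_n) (h : 'rV[R]_n -> 'rV[R]_k) (al : 'rV[R]_n -> 'M[R]_(n, k)) :
  open A -> smooth_on A al -> (forall x v, A x -> is_derive x v h (v *m al x)) ->
  (forall x, A x -> differentiable h x) -> smooth_on A h.
Proof.
move=> oA sal dh df; apply/smooth_onP => -[|r] //=; split => // i.
have sr : smooth_on A (fun x => (delta_mx 0 i : 'rV[R]_n) *m al x).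
  by apply: (smooth_on_mulmx oA _ sal); exact: smooth_on_cst.
have := (smooth_onP _ _).1 sr r.
by apply: (ck_ext oA) => x Ax; have [_ ->] := dh x (delta_mx 0 i) Ax.
Qed.

(** The primitive is the integral of [al] along the segment from the centre. Instead of
    differentiating under the integral sign, the indefinite integrals for [x] and [x + xi] are
    compared as functions of the upper limit. *)
Lemma poincare n k (A : set 'rV[R]_n) (al : 'rV[R]_n -> 'M[R]_(n, k)) (a : 'rV[R]_n) (r : R) :
  open A -> 0 < r -> (forall y, `|y - a| <= r -> A y) -> smooth_on A al ->
  (forall x i j, A x -> delta_mx 0 j *m 'D_(delta_mx 0 i) al x = delta_mx 0 i *m 'D_(delta_mx 0 j) al x :> 'rV_k) ->
  exists2 h : 'rV[R]_n -> 'rV[R]_k, smooth_on [set x : 'rV[R]_n | `|x - a| < r] h &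
    forall x v, `|x - a| < r -> is_derive x v h (v *m al x).
Proof.
move=> oA r0 rA sal cl.
have clD x u v : A x -> u *m 'd al x v = v *m 'd al x u.
  move=> Ax; have dal := smooth_on_diff sal Ax.
  rewrite (diff_partial v dal) (diff_partial u dal) !mulmx_sumr.
  rewrite {1}(row_sum_delta u) {2}(row_sum_delta v).
  under eq_bigr do rewrite mulmx_suml.
  under [RHS]eq_bigr do rewrite mulmx_suml.
  rewrite exchange_big; apply: eq_bigr => j _; apply: eq_bigr => i _.
  by rewrite -!scalemxAl -!scalemxAr cl // !scalerA mulrC.
have inA x t : `|x - a| <= r -> 0 <= t <= 1 -> `|a + t *: (x - a) - a| <= r.
  move=> xr /andP[t0 t1]; rewrite addrC addKr normrZ ger0_norm //.
  by apply: le_trans xr; rewrite ler_piMl.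
(* Clipping keeps the argument of [al] on the segment, where it is smooth, and makes the integrand
   continuous on the whole line. *)
pose phi x (t : R) := (x - a) *m al (a + clip t *: (x - a)).
have dal x : `|x - a| <= r -> differentiable al x by move=> /rA; exact: smooth_on_diff.
have cphi x : `|x - a| <= r -> continuous (phi x).
  move=> xr t.
  have sx : smooth_on A (fun y => (x - a) *m al y).
    by apply: (smooth_on_mulmx oA _ sal); exact: smooth_on_cst.
  apply: (@continuous_comp _ _ _ (fun t => a + clip t *: (x - a)) (fun y => (x - a) *m al y)).
    apply: (@continuous_comp _ _ _ clip (fun t => a + t *: (x - a))); first exact: clip_continuous.
    by apply: cvgD; [exact: cvg_cst | apply: cvgZr_tmp; exact: cvg_id].
  apply: differentiable_continuous; apply: (smooth_on_diff sx).
  by apply: rA; apply: inA => //; exact: clip_itv.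
have /choice[H hH] : forall x, exists Hx : R -> 'rV[R]_k, `|x - a| <= r ->
    Hx 0 = 0 /\ forall t : R, 0 <= t <= 1 -> is_derive t 1 Hx (phi x t).
  move=> x; have [xr|nx] := pselect (`|x - a| <= r); last by exists (fun=> 0).
  by have [Hx h1 h2] := antiderivative_rV (cphi x xr); exists Hx.
pose h x := H x 1.
have [C C0 hC] := smooth_quadratic rA sal.
have [L L0 hL] := smooth_lipschitz rA sal.
have quad x xi : `|x - a| <= r -> `|x + xi - a| <= r ->
    `|h (x + xi) - h x - xi *m al x| <= (n%:R * (r * C) + n%:R * L) * `|xi| ^+ 2.
  move=> xr xxr; set w := x - a.
  have [H0 dH] := hH x xr; have [H0' dH'] := hH (x + xi) xxr.
  (* By closedness the first order part of the difference of the integrands is the derivative of [t]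
     times [xi *m al] along the segment. After its subtraction the derivative of [E] is quadratic in
     [xi], and so is E 1 - E 0. *)
  pose E t := H (x + xi) t - H x t - t *: (xi *m al (a + t *: w)).
  pose dE t := (w + xi) *m al (a + t *: (w + xi)) - w *m al (a + t *: w)
     - (xi *m al (a + t *: w) + t *: (xi *m 'd al (a + t *: w) w)).
  have ddE (t : R) : 0 <= t <= 1 -> is_derive t 1 E (dE t).
    move=> t01; have xt := inA x t xr t01.
    have dl : is_derive t 1 (fun t => al (a + t *: w)) ('d al (a + t *: w) w).
      have df := dal _ xt; have := is_derive_line (v := w) df.
      by rewrite (deriveE w df).
    have dm := is_derive_mulmx (is_derive_cst xi t 1) dl.
    have dz : is_derive t 1 (fun t => t *: (xi *m al (a + t *: w)))
        (xi *m al (a + t *: w) + t *: (xi *m 'd al (a + t *: w) w)).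
      apply/is_derive_mxP => i j; move: dm => /is_derive_mxP/(_ i j) dm.
      rewrite (_ : (fun s => _) = fun s => s * (xi *m al (a + s *: w)) i j); last first.
        by apply/funext => s; rewrite mxE.
      apply: is_derive_eq (is_derive_mulr (is_derive_id t 1) dm) _.
      by rewrite mul0mx add0r [RHS]mxE [RHS]addrC mul1r; congr (_ + _); rewrite [RHS]mxE.
    have := is_deriveB (is_deriveB (dH' t t01) (dH t t01)) dz.
    by rewrite /phi (clip_id t01) /dE /w (addrAC x).
  have bE (t : R) : 0 <= t <= 1 -> `|dE t| <= (n%:R * (r * C) + n%:R * L) * `|xi| ^+ 2.
    move=> t01; have xt := inA x t xr t01; have xt' := inA (x + xi) t xxr t01.
    have tn : 0 <= t by case/andP: t01.
    have e1 : x + xi - a = w + xi by rewrite /w addrAC.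
    rewrite e1 in xt'.
    set y := a + t *: w; set y' := a + t *: (w + xi).
    have yy : y' - y = t *: xi.
      by rewrite /y /y' scalerDr addrA [_ + t *: xi]addrC addrK.
    have tx : `|t *: xi| <= `|xi|.
      by rewrite normrZ ger0_norm // ler_piMl //; case/andP: t01.
    have -> : dE t = w *m (al y' - al y - 'd al y (y' - y)) + xi *m (al y' - al y).
      rewrite yy linearZ /= !mulmxBr /dE -/y -/y' mulmxDl -scalemxAr.
      rewrite (clD _ xi w (rA _ xt)).
      set p1 := w *m al y'; set p2 := xi *m al y'; set p3 := w *m al y.
      set p4 := xi *m al y; set p5 := t *: _.
      move: (p1) (p2) (p3) (p4) (p5) => a1 a2 a3 a4 a5.
      by apply/matrixP => i j; rewrite !mxE; ring.
    apply: le_trans (ler_normD _ _) _; rewrite mulrDl; apply: lerD.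
      apply: le_trans (mulmx_norm2 _ _) _; rewrite -!mulrA; apply: ler_wpM2l => //.
      apply: ler_pM => //; apply: le_trans (hC _ _ xt xt') _; apply: ler_wpM2l => //.
      by rewrite yy; apply: lerXn2r; rewrite ?nnegrE.
    apply: le_trans (mulmx_norm2 _ _) _; rewrite -!mulrA; apply: ler_wpM2l => //.
    apply: le_trans (ler_wpM2l (normr_ge0 _) (hL _ _ xt xt')) _.
    rewrite yy mulrCA expr2; apply: ler_wpM2l => //; apply: ler_wpM2l => //.
  have := mx_MVT01 ddE bE.
  have e1 : a + 1 *: w = x by rewrite scale1r /w addrC subrK.
  by rewrite /E H0 H0' e1 !scale0r !subr0 scale1r.
have nearx x : `|x - a| < r -> \forall xi \near (0 : 'rV[R]_n), `|x + xi - a| <= r.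
  move=> xr; apply/nbhs_ballP; exists (r - `|x - a|) => /=; first by rewrite subr_gt0.
  move=> xi; rewrite -ball_normE /ball_ /= sub0r normrN => xb.
  by rewrite addrAC; apply: le_trans (ler_normD _ _) _; rewrite -lerBrDl ltW.
have isd x : `|x - a| < r -> is_diff x h (mulmxr (al x)).
  move=> xr; apply: (@is_diff_quad _ _ _ _ _ (mulmxr (al x)) (n%:R * (r * C) + n%:R * L)).
    exact: mulmxr_continuous.
  by apply: filterS (nearx x xr) => xi xir; exact: quad (ltW xr) xir.
have isd' x v : `|x - a| < r -> is_derive x v h (v *m al x).
  move=> /isd[df dE]; split; first exact: diff_derivable.
  by have e := deriveE v df; rewrite e dE.
exists h => //; apply: (@smooth_on_primitive _ _ _ _ al).
- exact: oball_open.
- by apply: smooth_on_sub sal => x /= /ltW; exact: rA.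
- by move=> x /isd[].
Qed.

End Clip.

Section ChartBall.
Context {R : realType} {n : nat} {M : rmfd R n}.
Hypothesis hM : smooth_manifold M.

Definition chart_ball (c : chart M) (a : 'rV[R]_n) (r : R) : set M :=
  [set q | chart_dom c q /\ `|chart_map c q - a| < r].

Lemma chart_ball_open c a r : open (chart_ball c a r).
Proof.
have oB : open [set x : 'rV[R]_n | `|x - a| < r] by apply: oball_open.
have h : open (chart_dom c `&` chart_map c @^-1` [set x : 'rV[R]_n | `|x - a| < r]).
  have oD : open (chart_dom c) := @chart_open _ _ _ hM c.
  exact: (open_setI_preimage oD oB (fun q cq => chart_map_cont hM cq)).
exact: h.
Qed.

Lemma ball_segment (a x y : 'rV[R]_n) (r t : R) : `|x - a| < r -> `|y - a| < r -> 0 <= t <= 1 ->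
  `|x + t *: (y - x) - a| < r.
Proof.
move=> xr yr /andP[t0 t1].
have -> : x + t *: (y - x) - a = (1 - t) *: (x - a) + t *: (y - a).
  by apply/matrixP => i j; rewrite !mxE; ring.
apply: le_lt_trans (ler_normD _ _) _; rewrite !normrZ (ger0_norm t0) ger0_norm ?subr_ge0 //.
have [->|tn] := eqVneq t 0; first by rewrite subr0 mul0r addr0 mul1r.
have tp : 0 < t by rewrite lt_neqAle eq_sym tn.
have h1 : (1 - t) * `|x - a| <= (1 - t) * r by apply: ler_wpM2l; [rewrite subr_ge0 | exact: ltW].
have h2 : t * `|y - a| < t * r by rewrite ltr_pM2l.
move: h1 h2; move: `|x - a| `|y - a| => X Y; lra.
Qed.

Lemma chart_ball_path c a r : (forall x, `|x - a| < r -> chart_codom c x) ->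
  forall q q', chart_ball c a r q -> chart_ball c a r q' -> exists g : R -> M,
    [/\ continuous g, forall t, chart_ball c a r (g t), g 0 = q & g 1 = q'].
Proof.
move=> rA q q' [cq qr] [cq' q'r].
pose x := chart_map c q; pose y := chart_map c q'.
exists (fun t => chart_inv c (x + clip t *: (y - x))); split.
- move=> t.
  apply: (@continuous_comp _ _ _ (fun t => x + clip t *: (y - x)) (chart_inv c)).
    apply: (@continuous_comp _ _ _ clip (fun t => x + t *: (y - x))); first exact: clip_continuous.
    by apply: cvgD; [exact: cvg_cst | apply: cvgZr_tmp; exact: cvg_id].
  apply: (chart_inv_cont hM); apply: rA; exact: ball_segment qr q'r (clip_itv t).
- move=> t; have tr := ball_segment qr q'r (clip_itv t).
  by split; [exact: chart_inv_dom (rA _ tr) | rewrite /= (chart_invK hM (rA _ tr))].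
- by rewrite clip_id ?lexx ?ler01 // scale0r addr0 (chart_mapK hM).
- by rewrite clip_id ?lexx ?ler01 // scale1r addrC subrK (chart_mapK hM).
Qed.

Lemma chart_ball_sub (c : chart M) p (P : 'rV[R]_n -> Prop) : chart_dom c p ->
  (\forall x \near chart_map c p, P x) ->
  exists2 r, 0 < r & forall x, `|x - chart_map c p| < r -> chart_codom c x /\ P x.
Proof.
move=> cp nP.
have : \forall x \near chart_map c p, chart_codom c x /\ P x.
  have := open_nbhs_nbhs (conj (@codom_open _ _ _ hM c) (chart_map_codom cp)).
  by move=> h; exact: filterI h nP.
move=> /nbhs_ballP[r /= r0 rP]; exists r => // x xr; apply: rP.
by rewrite -ball_normE /ball_ /= distrC.
Qed.

Lemma chart_ball_in (c : chart M) p r : chart_dom c p -> 0 < r -> chart_ball c (chart_map c p) r p.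
Proof. by move=> cp r0; split=> //; rewrite subrr normr0. Qed.

End ChartBall.

(** * Global primitives of closed forms *)

Section Primitive.
Context {R : realType} {n k : nat}.
Variable M : rmfd R n.
Hypotheses (hM : smooth_manifold M) (hsc : simply_connected M).
Variable al : chart M -> M -> 'M[R]_(n, k).
Implicit Types (c d : chart M) (p q : M).
Hypotheses
  (alj : forall c d p, chart_dom c p -> chart_dom d p -> al c p = jac c d p *m al d p)
  (als : forall c, smooth_on (chart_codom c) (al c \o chart_inv c))
  (alc : forall c p i j, chart_dom c p ->
     delta_mx 0 j *m partial c i (al c) p = delta_mx 0 i *m partial c j (al c) p :> 'rV_k).

Lemma path_clip p q : exists g : R -> M, [/\ continuous g, g 0 = p & g 1 = q].
Proof.
have [/(_ p q)[g [cg g0 g1]] _] := hsc; exists (g \o clip); split.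
- apply: continuous_within_comp cg clip_continuous _ => s /=.
  by rewrite in_itv /=; exact: clip_itv.
- by rewrite /= clip_id ?lexx ?ler01.
- by rewrite /= clip_id ?lexx ?ler01.
Qed.

Lemma null_clip p (g : R -> M) : continuous g -> g 0 = p -> g 1 = p ->
  exists H : R * R -> M,
    [/\ continuous H, forall t : R, [set t0 | 0 <= t0 <= 1] t -> H (0, t) = g t,
        forall t : R, [set t0 | 0 <= t0 <= 1] t -> H (1, t) = p &
        forall s : R, [set t | 0 <= t <= 1] s -> H (s, 0) = p /\ H (s, 1) = p].
Proof.
move=> cg g0 g1; have [_ /(_ p g)] := hsc.
have cg' : {within `[0, 1], continuous g} by apply: continuous_subspaceT.
move=> /(_ cg' g0 g1)[H [cH H0 H1 Hs]].
exists (H \o (fun x => (clip x.1, clip x.2))); split.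
- apply: continuous_within_comp cH _ _ => [x|x].
    have c1 : {for x, continuous (fun x : R * R => clip x.1)}.
      apply: (@continuous_comp _ _ _ fst clip); first exact: cvg_fst.
      exact: clip_continuous.
    have c2 : {for x, continuous (fun x : R * R => clip x.2)}.
      apply: (@continuous_comp _ _ _ snd clip); first exact: cvg_snd.
      exact: clip_continuous.
    exact: (cvg_pair c1 c2).
  by split; rewrite /= in_itv /=; exact: clip_itv.
- move=> t /= t01; rewrite !clip_id ?lexx ?ler01 //; apply: H0.
  by rewrite in_itv.
- move=> t /= t01; rewrite !clip_id ?lexx ?ler01 //; apply: H1.
  by rewrite in_itv.
- move=> s /= s01; rewrite !clip_id ?lexx ?ler01 //; apply: Hs.
  by rewrite in_itv.
Qed.

Definition primitive_at (F : M -> 'rV[R]_k) p c :=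
  differentiable (F \o chart_inv c) (chart_map c p) /\
  forall v, is_derive (chart_map c p) v (F \o chart_inv c) (v *m al c p).

Let primitive_chart (F : M -> 'rV[R]_k) p c d : chart_dom c p -> chart_dom d p ->
  primitive_at F p c -> primitive_at F p d.
Proof.
move=> cp dp [df dv].
have dT := transition_diff hM dp cp.
have E : \forall y \near chart_map d p,
    ((F \o chart_inv c) \o (chart_map c \o chart_inv d)) y = (F \o chart_inv d) y.
  have := open_nbhs_nbhs (conj (@overlap_open _ _ _ hM d c) (overlap_map hM dp cp)).
  by apply: filterS => y [dy cy] /=; rewrite (chart_mapK hM cy).
have df' : differentiable (F \o chart_inv c) ((chart_map c \o chart_inv d) (chart_map d p)).
  by rewrite /= (chart_mapK hM dp).
have dc : differentiable ((F \o chart_inv c) \o (chart_map c \o chart_inv d)) (chart_map d p).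
  by apply: differentiable_comp; [exact: dT | exact: df'].
split; first by have [] := near_eq_diff E dc.
move=> v; apply: near_eq_is_derive E _.
have d1 : is_derive (chart_map d p) v (chart_map c \o chart_inv d) (v *m jac d c p).
  split; first by exact: diff_derivable.
  have e := deriveE v dT.
  exact: etrans e (diff_jacobian _ _ _).
have := is_derive_compV df' d1; move/is_derive_eq; apply.
rewrite /= (chart_mapK hM dp) (alj dp cp) mulmxA.
have e := deriveE (v *m jac d c p) df.
have [_ e2] := dv (v *m jac d c p).
exact: etrans (esym e) e2.
Qed.

Let sect (U : set M) (F : M -> 'rV[R]_k) := open U /\ forall p c, U p -> chart_dom c p -> primitive_at F p c.

Let uniq_ball c a r F F' : (forall x, `|x - a| < r -> chart_codom c x) ->
  (forall p, chart_ball c a r p -> primitive_at F p c) ->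
  (forall p, chart_ball c a r p -> primitive_at F' p c) ->
  forall p q, chart_ball c a r p -> chart_ball c a r q -> F p = F' p -> F q = F' q.
Proof.
move=> rA hF hF' p q [cp pr] [cq qr] E.
pose x := chart_map c p; pose y := chart_map c q.
pose D (t : R) := F (chart_inv c (x + t *: (y - x))) - F' (chart_inv c (x + t *: (y - x))).
have dD (t : R) : 0 <= t <= 1 -> is_derive t 1 D 0.
  move=> t01; have tr := ball_segment pr qr t01.
  pose z := x + t *: (y - x).
  have zin : chart_ball c a r (chart_inv c z).
    by split; [exact: chart_inv_dom (rA _ tr) | rewrite /= (chart_invK hM (rA _ tr))].
  have zE : chart_map c (chart_inv c z) = z := chart_invK hM (rA _ tr).
  have [d1 v1] := hF _ zin; have [d2 v2] := hF' _ zin.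
  move: d1 v1 d2 v2; rewrite zE => d1 v1 d2 v2.
  have l1 := is_derive_line (v := y - x) d1; have l2 := is_derive_line (v := y - x) d2.
  have := is_deriveB l1 l2; move/is_derive_eq; apply.
  have [_ e1] := v1 (y - x); have [_ e2] := v2 (y - x).
  by rewrite -/z e1 e2 subrr.
have := @mx_MVT01 _ _ _ D (fun=> 0) 0 dD.
rewrite normr0 => /(_ (fun _ _ => lexx _)).
rewrite normr_le0 subr_eq0 => /eqP; rewrite /D scale0r addr0 scale1r [x + (y - x)]addrC subrK.
rewrite /x /y (chart_mapK hM cp) (chart_mapK hM cq) E subrr => /eqP.
by rewrite subr_eq0 => /eqP.
Qed.

Let sect_uniq U F U' F' p : sect U F -> sect U' F' -> U p -> U' p -> F p = F' p ->
  \forall q \near p, F q = F' q.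
Proof.
move=> [oU hF] [oU' hF'] Up Up' E.
have [c cp] := chart_at hM p.
pose W := [set x | chart_codom c x /\ (U `&` U') (chart_inv c x)].
have oW : open W.
  apply: open_setI_preimage; [exact: codom_open hM c | exact: openI oU oU' |].
  by move=> x cx; exact: (chart_inv_cont hM).
have Wp : W (chart_map c p).
  by split; [exact: chart_map_codom | rewrite (chart_mapK hM cp)].
have [r r0 rW] := open_cball oW Wp.
have inW q : chart_ball c (chart_map c p) r q -> U q /\ U' q.
  by move=> [cq /ltW/rW[_]]; rewrite (chart_mapK hM cq).
have pin : chart_ball c (chart_map c p) r p by split => //=; rewrite subrr normr0.
have := open_nbhs_nbhs (conj (@chart_ball_open _ _ _ hM c (chart_map c p) r) pin).
apply: filterS => q qin.
apply: (uniq_ball _ _ _ pin qin E).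
- by move=> x /ltW/rW[].
- by move=> q' qin'; apply: hF; [case: (inW _ qin') | case: qin'].
- by move=> q' qin'; apply: hF'; [case: (inW _ qin') | case: qin'].
Qed.

Lemma global_primitive p0 : exists2 F : M -> 'rV[R]_k, F p0 = 0 &
  (forall c, smooth_on (chart_codom c) (F \o chart_inv c)) /\
  forall c p v, chart_dom c p -> is_derive (chart_map c p) v (F \o chart_inv c) (v *m al c p).
Proof.
have [F F0 hF] : exists2 F : M -> 'rV[R]_k, F p0 = 0 &
    forall q, exists U F', [/\ sect U F', U q & \forall p \near q, F p = F' p].
  (* The covering is the product with R^k, in which the local primitives are the sections; every
     value is allowed in every fibre, since adding a constant to a primitive gives another. *)
  apply: (@monodromy R M _ (fun _ _ => True) sect) => //.
  - move=> p; have [c cp] := chart_at hM p.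
    have [r r0 rA] := open_cball (@codom_open _ _ _ hM c) (chart_map_codom cp).
    have [h sh dh] : exists2 h : 'rV[R]_n -> 'rV[R]_k,
        smooth_on [set x : 'rV[R]_n | `|x - chart_map c p| < r] h &
        forall x v, `|x - chart_map c p| < r -> is_derive x v h (v *m (al c \o chart_inv c) x).
      apply: (poincare (@codom_open _ _ _ hM c) r0 rA (@als c)) => x i j cx.
      have := alc i j (chart_inv_dom hM cx).
      by rewrite /partial (chart_invK hM cx).
    have rA' x : `|x - chart_map c p| < r -> chart_codom c x by move=> /ltW/rA.
    exists (chart_ball c (chart_map c p) r); split.
    + exact: chart_ball_open.
    + by split => //=; rewrite subrr normr0.
    + move=> q y [cq qr] _.
      exists (fun q' => h (chart_map c q') - h (chart_map c q) + y); last first.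
        by rewrite subrr add0r.
      split; first exact: chart_ball_open.
      move=> q' d [cq' q'r] dq'.
      apply: (primitive_chart cq' dq').
      have E : \forall x \near chart_map c q', h x - h (chart_map c q) + y =
         ((fun q' => h (chart_map c q') - h (chart_map c q) + y) \o chart_inv c) x.
        have := open_nbhs_nbhs (conj (@oball_open _ _ (chart_map c p) r) q'r).
        by apply: filterS => x /= /rA' cx; rewrite (chart_invK hM cx).
      have dfh : differentiable (fun x => h x - h (chart_map c q) + y) (chart_map c q').
        have d0 := smooth_on_diff sh q'r.
        by apply: differentiableD => //; apply: differentiableB.
      split; first by have [] := near_eq_diff E dfh.
      move=> v; apply: near_eq_is_derive E _.
      have := dh _ v q'r; rewrite /= (chart_mapK hM cq') => d0.
      have := is_deriveD (is_deriveB d0 (is_derive_cst (h (chart_map c q)) (chart_map c q') v))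
        (is_derive_cst y (chart_map c q') v).
      by rewrite subr0 addr0.
    + move=> F F' [_ hF] [_ hF'] q q' qin q'in.
      apply: (uniq_ball rA') => // s sin; [apply: hF => // | apply: hF' => //]; by case: sin.
    + exact: chart_ball_path.
  - exact: path_clip.
  - exact: null_clip.
exists F => //.
have prim c p : chart_dom c p -> primitive_at F p c.
  move=> cp; have [U [F' [[_ hF'] Up E]]] := hF p.
  have [d1 v1] := hF' p c Up cp.
  have E' : \forall x \near chart_map c p, (F' \o chart_inv c) x = (F \o chart_inv c) x.
    have cc := chart_inv_cont hM (chart_map_codom cp).
    have E2 : \forall q \near chart_inv c (chart_map c p), F q = F' q by rewrite (chart_mapK hM cp).
    have E3 : \forall x \near chart_map c p, F (chart_inv c x) = F' (chart_inv c x) := cc _ E2.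
    by apply: filterS E3 => x /= ->.
  split; first by have [] := near_eq_diff E' d1.
  by move=> v; apply: near_eq_is_derive E' _.
split=> [c|c p v cp]; last by have [_] := prim c p cp; exact.
apply: (smooth_on_primitive (@codom_open _ _ _ hM c) (@als c)).
  move=> x v cx; have [_ /(_ v)] := prim c _ (chart_inv_dom hM cx).
  by rewrite (chart_invK hM cx).
by move=> x cx; have [] := prim c _ (chart_inv_dom hM cx); rewrite (chart_invK hM cx).
Qed.

End Primitive.

(** Because of the left inverse [v], the kernel of [al] has dimension [m]. A basis of it together
    with [v] is an invertible matrix, and the first block of its inverse is [K]. Used to complete
    the coframe to local coordinates. *)
Lemma complement_mx {R : realType} (m k : nat) (al : 'M[R]_(m + k, k)) (v : 'M[R]_(k, m + k)) :
  v *m al = 1%:M -> exists K : 'M[R]_(m + k, m), row_mx K al \in unitmx.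
Proof.
move=> va.
have rk : \rank al = k.
  apply/eqP; rewrite eqn_leq rank_leq_col /=.
  by have := mxrankM_maxr v al; rewrite va mxrank1.
have e : \rank (kermx al) = m by rewrite mxrank_ker rk addnK.
have [S0 S0a S0f] : exists2 S0 : 'M[R]_(m, m + k), S0 *m al = 0 & row_free S0.
  have h1 : row_base (kermx al) *m al = 0.
    by apply/sub_kermxP; rewrite eq_row_base.
  have h2 := row_base_free (kermx al).
  by move: (row_base _) h1 h2; rewrite e => S0 h1 h2; exists S0.
pose B := col_mx S0 v.
have BU : B \in unitmx.
  rewrite -row_free_unit -kermx_eq0; apply/eqP/row_matrixP => i; rewrite row0.
  set x := row i _; have xB : x *m B = 0 by rewrite /x -row_mul mulmx_ker row0.
  rewrite -(hsubmxK x) mul_row_col in xB.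
  have x2 : rsubmx x = 0.
    have := congr1 (mulmx^~ al) xB.
    by rewrite mulmxDl -!mulmxA S0a va mulmx0 add0r mulmx1 mul0mx.
  rewrite x2 mul0mx addr0 in xB.
  have x1 : lsubmx x = 0 by apply: (row_free_inj S0f); rewrite xB mul0mx.
  by rewrite -(hsubmxK x) x1 x2 row_mx0.
exists (lsubmx (invmx B)).
have B1 : B *m invmx B = 1%:M by exact: mulmxV.
rewrite -(hsubmxK (invmx B)) mul_mx_row mul_col_mx in B1.
have : B *m row_mx (lsubmx (invmx B)) al = 1%:M.
  rewrite mul_mx_row [B *m al]mul_col_mx S0a va.
  rewrite -[1%:M in RHS]submxK; rewrite scalar_mx_block block_mxKul block_mxKur block_mxKdl block_mxKdr.
  rewrite block_mxEh; congr row_mx.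
  have := congr1 lsubmx B1; rewrite row_mxKl scalar_mx_block block_mxEh row_mxKl.
  by rewrite -mul_col_mx.
by case/mulmx1_unit.
Qed.

Lemma gram_change {R : realType} (m n : nat) (S S' : 'M[R]_(m, n)) (J g g' : 'M[R]_n) (j : 'M[R]_m) :
  S *m J = j *m S' -> g = J *m g' *m J^T -> S *m g *m S^T = j *m (S' *m g' *m S'^T) *m j^T.
Proof.
move=> e ->; rewrite !mulmxA e -!mulmxA; congr (_ *m (_ *m (_ *m _))).
by rewrite -trmx_mul e trmx_mul.
Qed.

Lemma continuous_initial (S : choiceType) (X Y : topologicalType) (f : S -> X)
    (g : Y -> initial_topology f) : continuous (f \o g) -> continuous g.
Proof.
move=> /continuousP c; apply/continuousP => A [B oB <-].
exact: c.
Qed.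

Lemma initial_hausdorff (S : choiceType) (X : topologicalType) (f : S -> X) :
  injective f -> hausdorff_space X -> hausdorff_space (initial_topology f).
Proof.
move=> fi hX; rewrite open_hausdorff => x y xy.
have fxy : f x != f y by apply: contra_neq xy; exact: fi.
move: hX; rewrite open_hausdorff => /(_ _ _ fxy)[[A B] /= [xA yB] [oA oB AB]].
exists (f @^-1` A, f @^-1` B) => /=.
  by move: xA yB; rewrite !inE.
split; [by exists A | by exists B |].
by rewrite -preimage_setI (eqP AB) preimage_set0.
Qed.

Lemma initial_second_countable (S : choiceType) (X : topologicalType) (f : S -> X) :
  @second_countable X -> @second_countable (initial_topology f).
Proof.
move=> [B cB [oB bB]]; exists [set f @^-1` U | U in B].
  exact: card_le_trans (card_image_le _ _) cB.
split=> [_ [U BU <-]|x A].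
  by exists U => //; exact: oB.
rewrite nbhsE => -[C [[D oD <-] Dx] CA].
have := bB (f x) D; rewrite nbhsE => /(_ _)[]; first by exists D.
move=> U [BU Ux] UD; exists (f @^-1` U); first by split => //; exists U.
by move=> y Uy; apply: CA; exact: UD.
Qed.

(** * Splitting off a parallel frame *)

Section Slice.
Context {R : realType} {m k : nat}.
Local Notation n := (m + k)%N.
Variables (M : rmfd R n) (T : tensor_field M 3).
Hypotheses (hR : riemannian M) (hT : is_form T).
Variable V : chart M -> M -> 'M[R]_(k, n).
Implicit Types (c e : chart M) (p q : M) (s : 'rV[R]_k).
Hypotheses (hV : parallel_frame T V) (hC : geodesically_complete M).

Let hM : smooth_manifold M. Proof. by case: hR. Qed.
Let Vj c e p : chart_dom c p -> chart_dom e p -> V e p = V c p *m jac c e p.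
Proof. by case: hV => h _ _ _ _; exact: h. Qed.
Let Vs c : smooth_on (chart_codom c) (V c \o chart_inv c).
Proof. by case: hV. Qed.
Let Vo c p : chart_dom c p -> V c p *m metric c p *m (V c p)^T = 1%:M.
Proof. by case: hV => _ _ h _ _; exact: h. Qed.
Let VT c p s : chart_dom c p -> ins (s *m V c p) (T c p) = 0.
Proof. by case: hV => _ _ _ _ h; exact: h. Qed.

(** The columns are the metric duals of the fields in the rows of [V]. *)
Definition coframe c p : 'M[R]_(n, k) := metric c p *m (V c p)^T.

Lemma coframe_jac c e p : chart_dom c p -> chart_dom e p ->
  coframe c p = jac c e p *m coframe e p.
Proof.
move=> cp ep; rewrite /coframe (metric_jac hR cp ep) -!mulmxA; congr (_ *m (_ *m _)).
by rewrite (Vj cp ep) trmx_mul.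
Qed.

Lemma coframe_smooth c : smooth_on (chart_codom c) (coframe c \o chart_inv c).
Proof.
have oA := @codom_open _ _ _ hM c.
exact: (smooth_on_mulmx oA (@metric_smooth _ _ _ hR c) (smooth_on_trmx oA (@Vs c))).
Qed.

(** The metric duals are parallel for the connection with torsion, so their exterior derivatives are
    the contractions of [T] with the fields, which vanish. *)
Lemma coframe_closed c p i j : chart_dom c p ->
  delta_mx 0 j *m partial c i (coframe c) p = delta_mx 0 i *m partial c j (coframe c) p :> 'rV_k.
Proof.
move=> cp.
have dp a : partial c a (coframe c) p = skew_connection T c p a *m coframe c p.
  have dm := partial_derive (@diff_derivable _ _ _ _ _ (delta_mx 0 a) (metric_diff hR cp)).
  have dV := partial_derive (@diff_derivable _ _ _ _ _ (delta_mx 0 a)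
    (smooth_on_diff (@Vs c) (chart_map_codom cp))).
  have [_ E] := is_derive_mulmx dm (is_derive_trmx dV).
  rewrite /partial (_ : (coframe c \o chart_inv c) = fun y => (metric c \o chart_inv c) y *m ((V c \o chart_inv c) y)^T) // E /=.
  rewrite (chart_mapK hM cp) (conn_metric hR hT a cp).
  case: hV => _ _ _ -> // _.
  by rewrite linearN /= trmx_mul mulmxN mulmxDl -!mulmxA addrK.
rewrite !dp -!rowE; apply/rowP => b; rewrite ![row _ _ 0 _]mxE.
apply/eqP; rewrite -subr_eq0; apply/eqP.
have e i' j' : (skew_connection T c p i' *m coframe c p) j' b =
    \sum_l V c p b l * (skew_connection T c p i' *m metric c p) j' l.
  by rewrite /coframe mulmxA mxE; apply: eq_bigr => l _; rewrite mulrC [_^T _ _]mxE.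
rewrite !e -sumrB.
under eq_bigr => l _ do rewrite -mulrBr (conn_torsion hR hT _ _ _ cp).
have := congr1 (fun t : tens R n 2 => t (icons i (icons j (ffun0 (card_ord 0))))) (VT (delta_mx 0 b) cp).
rewrite ffunE [RHS]ffunE => h; rewrite -[RHS]h; apply: eq_bigr => l _.
have aT : Defs.alternating (T c p) by case: hT => _ _; exact.
rewrite -rowE mxE (alt23 i j l aT) (alt12 i l j aT) opprK ix3E.
by [].
Qed.

Variable F : M -> 'rV[R]_k.
Hypothesis Fs : forall c, smooth_on (chart_codom c) (F \o chart_inv c).
Hypothesis dF : forall c p v, chart_dom c p ->
  is_derive (chart_map c p) v (F \o chart_inv c) (v *m coframe c p).

Lemma F_along {W : normedModType R} (x v : W) (g : W -> M) c w :
  {for x, continuous g} -> chart_dom c (g x) -> is_derive x v (chart_map c \o g) w ->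
  is_derive x v (F \o g) (w *m coframe c (g x)).
Proof.
move=> gx cg dg; have dFc := smooth_on_diff (@Fs c) (chart_map_codom cg).
apply: is_derive_eq (is_derive_along hR gx cg dg dFc) _.
rewrite [w in RHS]row_sum_delta mulmx_suml; apply: eq_bigr => i _.
by have [_ e] := dF (delta_mx 0 i) cg; rewrite /partial e -scalemxAl.
Qed.

Lemma F_psi s p : F (psi V s p) = F p + s.
Proof.
have [[cf df] f0] := flowP hR hT hV hC s p.
have h (t : R) : is_derive t 1 (fun t => F (flow V s p t) - t *: s) 0.
  have [c ct] := chart_at hM (flow V s p t).
  have d1 := F_along (@cf t) ct (df c t ct).
  have d2 : is_derive t 1 (fun t : R => t *: s) s.
    apply/is_derive_mxP => i j.
    rewrite (_ : (fun r : R => _) = fun r : R => r * s i j); last first.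
      by apply/funext => r; rewrite mxE.
    apply: is_derive_eq (is_derive_mulr (is_derive_id t 1) (is_derive_cst (s i j) t 1)) _.
    by rewrite mulr0 add0r mul1r.
  have := is_deriveB d1 d2; move/is_derive_eq; apply.
  by rewrite /coframe mulmxA -2!(mulmxA s) Vo // mulmx1 subrr.
have := is_derive0_cst h 1 0.
rewrite scale1r scale0r subr0 f0 => /eqP; rewrite subr_eq => /eqP.
by [].
Qed.

Lemma F_cont : continuous F.
Proof.
move=> p; have [c cp] := chart_at hM p.
have c1 : {for chart_map c p, continuous (F \o chart_inv c)}.
  by apply: differentiable_continuous; exact: smooth_on_diff (@Fs c) (chart_map_codom cp).
have c2 : {for p, continuous ((F \o chart_inv c) \o chart_map c)}.
  by apply: continuous_comp; [exact: (chart_map_cont hM) | exact: c1].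
have E : \forall q \near p, ((F \o chart_inv c) \o chart_map c) q = F q.
  apply: filterS (open_nbhs_nbhs (conj (@chart_open _ _ _ hM c) cp)) => q cq /=.
  by rewrite (chart_mapK hM cq).
move=> A nA.
have hA : \forall q \near p, A (((F \o chart_inv c) \o chart_map c) q).
  by apply: c2; rewrite /= (chart_mapK hM cp).
suff : \forall q \near p, A (F q) by [].
by apply: filterS (filterI E hA) => q [<-].
Qed.

Definition slice_pt : topologicalType := set_type [set p : M | F p = 0].
Definition inc (x : slice_pt) : M := set_val x.

Lemma inc_F x : F (inc x) = 0.
Proof. by have := set_valP x. Qed.

Lemma inc_inj : injective inc.
Proof. by move=> x y; exact: val_inj. Qed.

Lemma inc_cont : continuous inc.
Proof. exact: initial_continuous. Qed.

Fact retract_subproof p : psi V (- F p) p \in [set p : M | F p = 0].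
Proof. by rewrite inE /= F_psi subrr. Qed.

(** By [F_psi] the flow with coefficient [s] adds [s] to [F], so the coefficient [- F p] leads to
    the zero level. *)
Definition retract p : slice_pt := exist _ (psi V (- F p) p) (retract_subproof p).

Lemma inc_retract p : inc (retract p) = psi V (- F p) p.
Proof. by []. Qed.

Lemma inc_retract0 p : F p = 0 -> inc (retract p) = p.
Proof. by move=> h; rewrite inc_retract h oppr0 (psi0 hR hT hV hC). Qed.

Lemma smooth_at_chart_inv c x : chart_codom c x -> smooth_at (chart_inv c) x c.
Proof.
move=> cx; have oA := @codom_open _ _ _ hM c.
exists (chart_codom c); split=> //; first by move=> y; exact: (chart_inv_dom hM).
apply: (smooth_on_ext oA) (smooth_on_id oA) => y cy /=.
by rewrite (chart_invK hM).
Qed.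

Lemma psi_chart_smooth j (L : 'rV[R]_j -> 'rV[R]_k) (P : 'rV[R]_j -> M) y0 U c e :
  open U -> U y0 -> smooth_on U L -> smooth_at P y0 c -> chart_dom e (psi V (L y0) (P y0)) ->
  smooth_at (fun y => psi V (L y) (P y)) y0 e.
Proof. exact: (psi_smooth hR hT hV hC). Qed.

Lemma retract_smooth c x e : chart_codom c x -> chart_dom e (inc (retract (chart_inv c x))) ->
  smooth_at (inc \o retract \o chart_inv c) x e.
Proof.
move=> cx ex; have oA := @codom_open _ _ _ hM c.
have sN : smooth_on (chart_codom c) (fun y => - F (chart_inv c y)).
  exact: (smooth_on_oppmx oA (@Fs c)).
exact: (psi_chart_smooth oA cx sN (smooth_at_chart_inv cx)).
Qed.

Lemma retract_cont : continuous retract.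
Proof.
apply: continuous_initial => p.
have [c cp] := chart_at hM p; have [e ep] := chart_at hM (inc (retract p)).
have h : smooth_at (inc \o retract \o chart_inv c) (chart_map c p) e.
  by apply: retract_smooth; [exact: chart_map_codom | rewrite (chart_mapK hM cp)].
have c2 : {for p, continuous ((inc \o retract \o chart_inv c) \o chart_map c)}.
  have h2 := smooth_at_cont hM h.
  apply: (@continuous_comp _ _ _ (chart_map c) (inc \o retract \o chart_inv c)); last exact: h2.
  exact: (chart_map_cont hM).
have E : \forall q \near p, ((inc \o retract \o chart_inv c) \o chart_map c) q = (inc \o retract) q.
  apply: filterS (open_nbhs_nbhs (conj (@chart_open _ _ _ hM c) cp)) => q cq /=.
  by rewrite (chart_mapK hM cq).
move=> A nA.
have hA : \forall q \near p, A (((inc \o retract \o chart_inv c) \o chart_map c) q).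
  by apply: c2; rewrite /= (chart_mapK hM cp).
suff : \forall q \near p, A ((inc \o retract) q) by [].
by apply: filterS (filterI E hA) => q [<-].
Qed.

(* Charts of the level set: [sG] inverts [x |-> (x K, F x)] locally. *)
Definition slice_coord c (K : 'M[R]_(n, m)) (x : 'rV[R]_n) : 'rV[R]_n :=
  row_mx (x *m K) (F (chart_inv c x)).

Record slice_chart := SliceChart {
  amb : chart M;
  sK : 'M[R]_(n, m);
  sU : set 'rV[R]_n;
  sW : set 'rV[R]_n;
  sG : 'rV[R]_n -> 'rV[R]_n;
  s_oU : open sU;
  s_UA : forall x, sU x -> chart_codom amb x;
  s_oW : open sW;
  s_UW : forall x, sU x -> sW (slice_coord amb sK x) /\ sG (slice_coord amb sK x) = x;
  s_WU : forall y, sW y -> sU (sG y) /\ slice_coord amb sK (sG y) = y;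
  s_smooth : smooth_on sW sG
}.

Lemma slice_coord_smooth c K : smooth_on (chart_codom c) (slice_coord c K).
Proof.
have oA := @codom_open _ _ _ hM c.
apply: (smooth_on_row_mx oA); last exact: Fs.
by apply: (smooth_on_mulmx oA); [exact: smooth_on_id | exact: smooth_on_cst].
Qed.

Lemma slice_coord_diff c K x v : chart_codom c x ->
  is_derive x v (slice_coord c K) (v *m row_mx K (coframe c (chart_inv c x))).
Proof.
move=> cx; have d1 := dF v (chart_inv_dom hM cx); rewrite (chart_invK hM cx) in d1.
have d2 : is_derive x v (fun x : 'rV[R]_n => x *m K) (v *m K).
  have := is_derive_mulmx (is_derive_id x v) (is_derive_cst K x v).
  by move/is_derive_eq; apply; rewrite mulmx0 addr0.
rewrite mul_mx_row; apply/is_derive_mxP => i j.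
move: d1 d2 => /is_derive_mxP d1 /is_derive_mxP d2.
rewrite mxE (_ : (fun y => _) = fun y : 'rV[R]_n => match fintype.split j with
  | inl a => (y *m K) i a | inr b => (F \o chart_inv c) y i b end); last first.
  by apply/funext => y; rewrite mxE.
by case: fintype.split => a; [exact: d2 | exact: d1].
Qed.

Lemma slice_chart_ex (x : slice_pt) : exists d : slice_chart,
  chart_dom (amb d) (inc x) /\ sU d (chart_map (amb d) (inc x)).
Proof.
have [c cx] := chart_at hM (inc x); have cy := chart_map_codom cx.
have oA := @codom_open _ _ _ hM c.
(* [K] completes the coframe at this point, so the jacobian of [slice_coord] is invertible there and
   the inverse function theorem provides the chart. *)
have [K KU] := complement_mx (etrans (mulmxA _ _ _) (Vo cx)).
have sP := slice_coord_smooth K.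
have JU : jacobian (slice_coord c K) (chart_map c (inc x)) \in unitmx.
  rewrite (_ : jacobian _ _ = row_mx K (coframe c (inc x))) //.
  apply/row_matrixP => i; rewrite !rowE.
  have df := smooth_on_diff (@sP c) cy.
  have [_ e1] := slice_coord_diff K (delta_mx 0 i) cy.
  rewrite -[inc x in RHS](chart_mapK hM cx) -e1.
  have e2 := deriveE (delta_mx 0 i) df.
  by rewrite e2; exact: esym (diff_jacobian _ _ _).
have [U [W [G [[oU UA Ux oW] [h1 h2 sG]]]]] := inverse_function oA (@sP c) cy JU.
by exists (SliceChart oU UA oW h1 h2 sG).
Qed.

Definition sI (d : slice_chart) (u : 'rV[R]_m) : 'rV[R]_n := sG d (row_mx u 0).
Definition slice_dom (d : slice_chart) : set slice_pt :=
  [set x | chart_dom (amb d) (inc x) /\ sU d (chart_map (amb d) (inc x))].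
Definition slice_map (d : slice_chart) (x : slice_pt) : 'rV[R]_m :=
  chart_map (amb d) (inc x) *m sK d.
(** The retraction makes the value a point of the level set for every argument; on the image of the
    chart it acts as the identity. *)
Definition slice_inv (d : slice_chart) (u : 'rV[R]_m) : slice_pt :=
  retract (chart_inv (amb d) (sI d u)).
(** The differential of the inclusion in coordinates: its rows are the coordinate fields of the
    slice, expressed in the ambient chart. *)
Definition sigma (d : slice_chart) (x : slice_pt) : 'M[R]_(m, n) :=
  jacobian (sI d) (slice_map d x).

Definition slice : rmfd R m := @RMfd R m slice_pt slice_chart slice_dom slice_map slice_inv
  (fun d x => sigma d x *m metric (amb d) (inc x) *m (sigma d x)^T).

Implicit Types (d : slice_chart) (x y : slice_pt) (u : 'rV[R]_m).

Definition sO d : set 'rV[R]_m := [set u | sW d (row_mx u 0)].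

Lemma sO_open d : open (sO d).
Proof.
have -> : sO d = [set u | setT u /\ sW d (u *m row_mx 1%:M 0)].
  apply/seteqP; split=> u; rewrite /sO /= mul_mx_row mulmx1 mulmx0; first by [].
  by case.
apply: open_setI_preimage; [exact: openT | exact: s_oW |].
by move=> u _; exact: mulmxr_continuous.
Qed.

Lemma slice_mapE d x : slice_dom d x ->
  sO d (slice_map d x) /\ sI d (slice_map d x) = chart_map (amb d) (inc x).
Proof.
move=> [cx Ux]; have [h1 h2] := s_UW Ux.
have e : slice_coord (amb d) (sK d) (chart_map (amb d) (inc x)) = row_mx (slice_map d x) 0.
  by rewrite /slice_coord (chart_mapK hM cx) inc_F.
by rewrite e in h1 h2.
Qed.

Lemma sI_props d u : sO d u -> [/\ sU d (sI d u), chart_codom (amb d) (sI d u),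
  F (chart_inv (amb d) (sI d u)) = 0 & sI d u *m sK d = u].
Proof.
move=> /s_WU[h1 h2]; have := h2; rewrite /slice_coord => /eq_row_mx[e1 e2].
by split=> //; exact: s_UA h1.
Qed.

Lemma inc_slice_inv d u : sO d u -> inc (slice_inv d u) = chart_inv (amb d) (sI d u).
Proof. by move=> /sI_props[_ _ h _]; exact: inc_retract0. Qed.

Lemma slice_inv_dom d u : sO d u -> slice_dom d (slice_inv d u) /\ slice_map d (slice_inv d u) = u.
Proof.
move=> uO; have [h1 h2 h3 h4] := sI_props uO.
rewrite /slice_dom /slice_map /= inc_slice_inv // (chart_invK hM h2); split => //; split => //.
exact: chart_inv_dom.
Qed.

Lemma slice_mapK d x : slice_dom d x -> slice_inv d (slice_map d x) = x.
Proof.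
move=> dx; have [h1 h2] := slice_mapE dx; apply: inc_inj.
by rewrite inc_slice_inv // h2 (chart_mapK hM); case: dx.
Qed.

Lemma slice_codomE d : @chart_codom _ _ slice d = sO d.
Proof.
apply/seteqP; split=> [u [x dx <-]|u uO]; first exact: (slice_mapE dx).1.
by exists (slice_inv d u); have [] := slice_inv_dom uO.
Qed.

Lemma slice_dom_open d : open (slice_dom d).
Proof.
pose A := [set p | chart_dom (amb d) p /\ sU d (chart_map (amb d) p)].
have oA : open A.
  apply: open_setI_preimage; [exact: chart_open hM (amb d) | exact: s_oU |].
  by move=> p cp; exact: (chart_map_cont hM).
have /continuousP/(_ A oA) := inc_cont.
by [].
Qed.

Lemma slice_map_cont d x : slice_dom d x -> {for x, continuous (slice_map d)}.
Proof.
move=> [cx _].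
apply: (@continuous_comp _ _ _ (chart_map (amb d) \o inc) (mulmxr (sK d))); last exact: mulmxr_continuous.
by apply: continuous_comp; [exact: inc_cont | exact: (chart_map_cont hM)].
Qed.

Lemma sI_smooth d : smooth_on (sO d) (sI d).
Proof.
have oO := @sO_open d.
have sr : smooth_on (sO d) (fun u : 'rV[R]_m => row_mx u (0 : 'rV[R]_k)).
  by apply: (smooth_on_row_mx oO); [exact: smooth_on_id | exact: smooth_on_cst].
have h u : sO d u -> sW d (row_mx u 0) by [].
have sG' : smooth_on (sW d) (sG d) by apply: s_smooth.
have oW' : open (sW d) by apply: s_oW.
have h2 := smooth_on_comp oO oW' h sr sG'.
by apply: (smooth_on_ext oO) h2 => u _.
Qed.

Lemma slice_inv_cont d u : sO d u -> {for u, continuous (slice_inv d)}.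
Proof.
move=> uO; apply: (@continuous_comp _ _ _ (chart_inv (amb d) \o sI d) retract); last exact: retract_cont.
apply: continuous_comp.
  by apply: differentiable_continuous; exact: smooth_on_diff (@sI_smooth d) uO.
by apply: (chart_inv_cont hM); have [] := sI_props uO.
Qed.

Lemma sO_overlap_open d d' : open [set u | sO d u /\ slice_dom d' (slice_inv d u)].
Proof.
apply: open_setI_preimage; [exact: sO_open | exact: slice_dom_open |].
by move=> u; exact: slice_inv_cont.
Qed.

Lemma slice_overlapE d d' : slice_map d @` (slice_dom d `&` slice_dom d') =
  [set u | sO d u /\ slice_dom d' (slice_inv d u)].
Proof.
apply/seteqP; split=> [u [x [dx d'x] <-]|u [uO ud]].
  by split; [exact: (slice_mapE dx).1 | rewrite slice_mapK].
by have [h1 h2] := slice_inv_dom uO; exists (slice_inv d u).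
Qed.

Lemma slice_transition d d' : smooth_on [set u | sO d u /\ slice_dom d' (slice_inv d u)]
  (slice_map d' \o slice_inv d).
Proof.
set B := [set u | _]; have oB : open B := @sO_overlap_open d d'.
have sB : B `<=` sO d by move=> u [].
have oV := @overlap_open _ _ _ hM (amb d) (amb d').
have h : smooth_on B ((chart_map (amb d') \o chart_inv (amb d)) \o sI d).
  apply: (smooth_on_comp oB oV); last exact: (@transition_smooth _ _ _ hM).
    move=> u [uO [du _]]; rewrite inc_slice_inv // in du.
    by split => //; have [] := sI_props uO.
  exact: smooth_on_sub sB (@sI_smooth d).
have := smooth_on_mulmx oB h (@smooth_on_cst _ _ B _ (sK d')).
apply: (smooth_on_ext oB) => u [uO _] /=.
by rewrite /slice_map inc_slice_inv.
Qed.

Lemma slice_smooth_manifold : smooth_manifold slice.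
Proof.
split.
- by apply: initial_hausdorff; [exact: val_inj | case: hM].
- by apply: initial_second_countable; case: hM.
- by move=> x; have [d h] := slice_chart_ex x; exists d.
- move=> d; split.
  + exact: slice_dom_open.
  + by rewrite slice_codomE; exact: sO_open.
  + by move=> x; rewrite inE => dx; exact: slice_map_cont.
  + by move=> u; rewrite inE slice_codomE; exact: slice_inv_cont.
  + by move=> x; exact: slice_mapK.
- by move=> d d'; rewrite /= slice_overlapE; exact: slice_transition.
Qed.

Lemma sigma_diff d x : slice_dom d x -> differentiable (sI d) (slice_map d x).
Proof. by move=> dx; exact: smooth_on_diff (@sI_smooth d) (slice_mapE dx).1. Qed.

Lemma is_derive_sigma d x v : slice_dom d x ->
  is_derive (slice_map d x) v (chart_map (amb d) \o (inc \o slice_inv d)) (v *m sigma d x).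
Proof.
move=> dx; have [xO xE] := slice_mapE dx.
have df := sigma_diff dx.
have d1 : is_derive (slice_map d x) v (sI d) (v *m sigma d x).
  split; first exact: diff_derivable.
  have e := deriveE v df.
  exact: etrans e (diff_jacobian _ _ _).
apply: near_eq_is_derive d1.
apply: filterS (open_nbhs_nbhs (conj (@sO_open d) xO)) => u uO /=.
by rewrite inc_slice_inv // (chart_invK hM) //; have [] := sI_props uO.
Qed.

Lemma sigma_coord d x : slice_dom d x ->
  sigma d x *m sK d = 1%:M /\ sigma d x *m coframe (amb d) (inc x) = 0.
Proof.
move=> dx; have [xO xE] := slice_mapE dx; have [cx Ux] := dx.
have df := sigma_diff dx.
have E (v : 'rV[R]_m) : v *m sigma d x *m row_mx (sK d) (coframe (amb d) (inc x)) = row_mx v 0.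
  have d1 : is_derive (slice_map d x) v (sI d) (v *m sigma d x).
    split; first exact: diff_derivable.
    have e := deriveE v df.
    exact: etrans e (diff_jacobian _ _ _).
  have sP := @slice_coord_smooth (amb d) (sK d).
  have cy : chart_codom (amb d) (sI d (slice_map d x)) by rewrite xE; exact: chart_map_codom.
  have d2 := is_derive_compV (smooth_on_diff sP cy) d1.
  have e2 := deriveE (v *m sigma d x) (smooth_on_diff sP cy).
  have [_ e3] := slice_coord_diff (sK d) (v *m sigma d x) cy.
  have e4 : 'd (slice_coord (amb d) (sK d)) (sI d (slice_map d x)) (v *m sigma d x) =
      v *m sigma d x *m row_mx (sK d) (coframe (amb d) (inc x)).
    apply: (etrans (esym e2)); apply: (etrans e3).
    by rewrite xE (chart_mapK hM cx).
  rewrite e4 in d2.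
  have d3 : is_derive (slice_map d x) v (fun u => row_mx u 0) (row_mx v (0 : 'rV[R]_k)).
    apply/is_derive_mxP => i j.
    rewrite mxE (_ : (fun z : 'rV[R]_m => _) = fun z : 'rV[R]_m => match fintype.split j with
      | inl a => z i a | inr b => 0 end); last first.
      by apply/funext => z; rewrite mxE; case: fintype.split => // a; rewrite mxE.
    case: fintype.split => a; last by rewrite mxE; exact: is_derive_cst.
    by have /is_derive_mxP := is_derive_id (slice_map d x) v.
  apply: (is_derive_uniq d2); apply: near_eq_is_derive d3.
  apply: filterS (open_nbhs_nbhs (conj (@sO_open d) xO)) => u uO /=.
  by have [_ ->] := s_WU uO.
have : sigma d x *m row_mx (sK d) (coframe (amb d) (inc x)) = row_mx 1%:M 0.
  apply/row_matrixP => i; rewrite row_row_mx row1 row0 -E.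
  by rewrite -rowE row_mul.
by rewrite mul_mx_row => /eq_row_mx.
Qed.

Lemma inc_slice_inv_cont d x : slice_dom d x -> {for slice_map d x, continuous (inc \o slice_inv d)}.
Proof.
move=> dx; apply: continuous_comp; last exact: inc_cont.
by apply: slice_inv_cont; exact: (slice_mapE dx).1.
Qed.

Lemma sigma_jac d d' x : slice_dom d x -> slice_dom d' x ->
  sigma d x *m jac (amb d) (amb d') (inc x) = @jac _ _ slice d d' x *m sigma d' x.
Proof.
move=> dx d'x; have [cx _] := dx; have [c'x _] := d'x; have [xO xE] := slice_mapE dx.
have hX := slice_smooth_manifold.
apply/row_matrixP => i; rewrite !row_mul ![row i _]rowE.
have ix : (inc \o slice_inv d) (slice_map d x) = inc x by rewrite /= slice_mapK.
have cx0 : chart_dom (amb d) ((inc \o slice_inv d) (slice_map d x)) by rewrite ix.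
have c'x0 : chart_dom (amb d') ((inc \o slice_inv d) (slice_map d x)) by rewrite ix.
have d1 := is_derive_chart hR (inc_slice_inv_cont dx) cx0 (is_derive_sigma (delta_mx 0 i) dx) c'x0.
rewrite ix in d1; apply: (is_derive_uniq d1).
have dT := @transition_diff _ _ _ hX d d' x dx d'x.
have d2 : is_derive (slice_map d x) (delta_mx 0 i) (slice_map d' \o slice_inv d)
    (delta_mx 0 i *m @jac _ _ slice d d' x).
  split; first exact: diff_derivable.
  have e := deriveE (delta_mx 0 i) dT.
  exact: etrans e (diff_jacobian _ _ _).
have df' : differentiable (sI d') ((slice_map d' \o slice_inv d) (slice_map d x)).
  by rewrite /= slice_mapK //; exact: sigma_diff.
have d3 := is_derive_compV df' d2.
have e3 : 'd (sI d') ((slice_map d' \o slice_inv d) (slice_map d x)) (delta_mx 0 i *m @jac _ _ slice d d' x)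
   = delta_mx 0 i *m @jac _ _ slice d d' x *m sigma d' x.
  apply: (etrans (diff_jacobian _ _ _)).
  by rewrite /sigma /= slice_mapK.
rewrite e3 in d3; apply: near_eq_is_derive d3.
have B : [set u | sO d u /\ slice_dom d' (slice_inv d u)] (slice_map d x) by split => //; rewrite slice_mapK.
apply: filterS (open_nbhs_nbhs (conj (@sO_overlap_open d d') B)) => u [uO u'] /=.
by have [_ ->] := slice_mapE u'.
Qed.

Lemma sigma_smooth d : smooth_on (sO d) (fun u => sigma d (slice_inv d u)).
Proof.
have oO := @sO_open d.
apply: (smooth_on_ext oO) (smooth_on_jacobian oO (@sI_smooth d)) => u uO.
by rewrite /sigma; have [_ ->] := slice_inv_dom uO.
Qed.

Lemma smooth_inc a b d (H : M -> 'M[R]_(a, b)) : smooth_on (chart_codom (amb d)) (H \o chart_inv (amb d)) ->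
  smooth_on (sO d) (fun u => H (inc (slice_inv d u))).
Proof.
move=> sH; have oO := @sO_open d.
have := smooth_on_comp oO (@codom_open _ _ _ hM (amb d)) _ (@sI_smooth d) sH.
have h u : sO d u -> chart_codom (amb d) (sI d u) by move=> /sI_props[].
move=> /(_ h); apply: (smooth_on_ext oO) => u uO /=.
by rewrite inc_slice_inv.
Qed.

Lemma slice_riemannian : riemannian slice.
Proof.
split; first exact: slice_smooth_manifold.
split.
- move=> d x [cx _] /=.
  by rewrite !trmx_mul trmxK (metric_sym hR cx) mulmxA.
- move=> d x v dx v0 /=; have [cx _] := dx.
  rewrite !mulmxA -(mulmxA (v *m sigma d x *m _)) -trmx_mul.
  apply: (metric_pos hR cx); apply: contra_neq v0 => vs.
  have [e _] := sigma_coord dx.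
  by rewrite -[v]mulmx1 -e mulmxA vs mul0mx.
- move=> d d' x dx d'x /=; have [cx _] := dx; have [c'x _] := d'x.
  exact: gram_change (sigma_jac dx d'x) (metric_jac hR cx c'x).
- move=> d; rewrite slice_codomE; have oO := @sO_open d.
  have sg := @sigma_smooth d.
  have sm := smooth_inc (@metric_smooth _ _ _ hR (amb d)).
  have h := smooth_on_mulmx oO (smooth_on_mulmx oO sg sm) (smooth_on_trmx oO sg).
  by apply: (smooth_on_ext oO) h => u _.
Qed.

End Slice.

Lemma pull_alternating {R : realType} (m n k : nat) (A : 'M[R]_(m, n)) (t : tens R n k) :
  Defs.alternating t -> Defs.alternating (pull A t).
Proof.
move=> at_ s j; rewrite !ffunE mulr_sumr.
rewrite (reindex (fun i : {ffun 'I_k -> 'I_n} => [ffun a => i (s a)])) /=; last first.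
  exists (fun i : {ffun 'I_k -> 'I_n} => [ffun a => i ((s^-1)%g a)]) => i _.
    by apply/ffunP => a; rewrite !ffunE permKV.
  by apply/ffunP => a; rewrite !ffunE permK.
apply: eq_bigr => i _; rewrite at_ -mulrA; congr (_ * (_ * _)).
rewrite [RHS](reindex_inj (@perm_inj _ s)) /=.
by apply: eq_bigr => a _; rewrite !ffunE.
Qed.

Lemma pull_tens0 {R : realType} (m n : nat) (A : 'M[R]_(m, n)) (t : tens R n 0) i :
  pull A t i = t (ffun0 (card_ord 0)).
Proof.
rewrite ffunE (bigD1 (ffun0 (card_ord 0))) //= big_ord0 mulr1 big1 ?addr0 // => j /eqP[].
by apply/ffunP => -[].
Qed.

Lemma pull_ix3 {R : realType} (m n : nat) (A : 'M[R]_(m, n)) (t : tens R n 3) i j l :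
  pull A t (ix3 i j l) =
  \sum_c (\sum_a \sum_b (row i A) 0 a * (row j A) 0 b * t (ix3 a b c)) * A l c.
Proof.
rewrite ix3E -[LHS]insE -[LHS]insE -[LHS]insE -!pull_ins pull_tens0 -!rowE ffunE.
apply: eq_bigr => c _; rewrite mxE mulrC; congr (_ * _).
rewrite ffunE exchange_big; apply: eq_bigr => b _; rewrite ffunE mulr_sumr.
by apply: eq_bigr => a _; rewrite ix3E; ring.
Qed.

Lemma pull_change {R : realType} (m n k : nat) (S S' : 'M[R]_(m, n)) (J : 'M[R]_n) (j : 'M[R]_m)
    (t : tens R n k) : S *m J = j *m S' -> pull S (pull J t) = pull j (pull S' t).
Proof. by rewrite !pull_mul => ->. Qed.

Lemma mulmx_unit_eq0 {R : realType} (m n : nat) (B : 'M[R]_n) (A : 'M[R]_(m, n)) :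
  B \in unitmx -> A *m B = 0 -> A = 0.
Proof. by move=> BU e; rewrite -(mulmxK BU A) e mul0mx. Qed.

Lemma gram_derive {R : realType} (m n : nat) (D S : 'M[R]_(m, n)) (G g : 'M[R]_n) :
  (D *m g + S *m (G *m g + g *m G^T)) *m S^T + S *m g *m D^T =
  (D + S *m G) *m g *m S^T + S *m g *m (D + S *m G)^T.
Proof.
rewrite [(D + _)^T]linearD /= trmx_mul !mulmxDl !mulmxDr !mulmxDl !mulmxA.
by rewrite -!addrA; congr (_ + (_ + _)); rewrite addrC.
Qed.

Lemma mulmx_row_entry {R : realType} (a b c d : nat) (A : 'M[R]_(a, b)) (B : 'M[R]_(b, c)) (C : 'M[R]_(c, d)) i l :
  (A *m B *m C) i l = (row i A *m B *m C) 0 l.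
Proof. by rewrite -!row_mul [RHS]mxE. Qed.

(** * Restriction of tensors and of the connection to the slice *)

Section SliceTensors.
Context {R : realType} {m k : nat}.
Local Notation n := (m + k)%N.
Variables (M : rmfd R n) (T : tensor_field M 3).
Hypotheses (hR : riemannian M) (hT : is_form T).
Variable V : chart M -> M -> 'M[R]_(k, n).
Implicit Types (c e : chart M) (p q : M) (s : 'rV[R]_k).
Hypotheses (hV : parallel_frame T V) (hC : geodesically_complete M).
Variable F : M -> 'rV[R]_k.
Hypothesis Fs : forall c, smooth_on (chart_codom c) (F \o chart_inv c).
Hypothesis dF : forall c p v, chart_dom c p ->
  is_derive (chart_map c p) v (F \o chart_inv c) (v *m coframe V c p).

Let hM : smooth_manifold M. Proof. by case: hR. Qed.
Let Vs c : smooth_on (chart_codom c) (V c \o chart_inv c).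
Proof. by case: hV. Qed.
Let Vo c p : chart_dom c p -> V c p *m metric c p *m (V c p)^T = 1%:M.
Proof. by case: hV => _ _ h _ _; exact: h. Qed.

Local Notation X := (slice hR hT hV hC Fs dF).
Let oO (d : chart X) : open (sO d). Proof. exact: sO_open. Qed.
Let hX : riemannian X := slice_riemannian hR hT hV hC Fs dF.

Definition restrict j (t : tensor_field M j) : tensor_field X j :=
  fun d x => pull (sigma d x) (t (amb d) (inc x)).

Section Restrict.
Variables (j : nat) (t : tensor_field M j).
Hypothesis tf : is_form t.

Lemma restrict_form : is_form (restrict t).
Proof.
have [tj ts ta] := tf; split.
- move=> d d' x dx d'x; have [cx _] := dx; have [c'x _] := d'x.
  apply: (eq_trans (congr1 (pull (sigma d x)) (tj _ _ _ cx c'x))).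
  exact: pull_change (sigma_jac hR hT hV hC Fs dF dx d'x).
- move=> d i; rewrite slice_codomE.
  have /(smooth_on_mxP (@oO d)) sg := @sigma_smooth _ _ _ _ _ hR hT _ hV hC _ Fs dF d.
  have st l : smooth_on (sO d) (fun u => t (amb d) (inc (slice_inv hR hT hV hC Fs dF d u)) l : R).
    have h : smooth_on (chart_codom (amb d)) ((fun p => t (amb d) p l *: (1%:M : 'M[R]_1)) \o chart_inv (amb d)).
      have oA := @codom_open _ _ _ hM (amb d).
      by apply: (smooth_on_scalemx oA (ts (amb d) l)); exact: smooth_on_cst.
    have /(smooth_on_mxP (@oO d))/(_ 0 0) := smooth_inc hR hT hV hC Fs dF h.
    by apply: (smooth_on_ext (@oO d)) => u _; rewrite !mxE mulr1.
  have h : smooth_on (sO d) (fun u => \sum_(l : {ffun 'I_j -> 'I_n})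
      t (amb d) (inc (slice_inv hR hT hV hC Fs dF d u)) l *
      \prod_(a < j) sigma d (slice_inv hR hT hV hC Fs dF d u) (i a) (l a) : R).
    apply: (smooth_on_sum (@oO d)) => l _; apply: (smooth_onM (@oO d)) => //.
    by apply: (smooth_on_prod (@oO d)) => a _; exact: sg.
  by apply: (smooth_on_ext (@oO d)) h => u _; rewrite /restrict ffunE.
- by move=> d x [cx _]; apply: pull_alternating; exact: ta.
Qed.

End Restrict.

Lemma slice_frame_gram d (x : X) : chart_dom d x ->
  col_mx (sigma d x) (V (amb d) (inc x)) *m metric (amb d) (inc x) *m
    (col_mx (sigma d x) (V (amb d) (inc x)))^T = block_mx (metric d x) 0 0 1%:M.
Proof.
move=> dx; have [cx _] := dx.
have [_ s0] := sigma_coord hR Fs dF dx.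
rewrite tr_col_mx mul_col_mx mul_col_row (Vo cx).
have s0' : sigma d x *m metric (amb d) (inc x) *m (V (amb d) (inc x))^T = 0.
  by rewrite -mulmxA.
rewrite s0'; congr block_mx.
by apply: trmx_inj; rewrite trmx0 !trmx_mul trmxK (metric_sym hR cx) mulmxA s0'.
Qed.

Lemma slice_frame_unit d (x : X) : chart_dom d x ->
  col_mx (sigma d x) (V (amb d) (inc x)) \in unitmx.
Proof.
move=> dx; have := slice_frame_gram dx.
set S := col_mx _ _; rewrite -mulmxA => E.
have gU := metric_unit hX dx.
have : S *m (metric (amb d) (inc x) *m S^T *m block_mx (invmx (metric d x)) 0 0 1%:M) = 1%:M.
  rewrite mulmxA E mulmx_block !mulmx0 !mul0mx !addr0 !add0r mulmx1 mulmxV //.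
  by rewrite -scalar_mx_block.
by case/mulmx1_unit.
Qed.

Let sg d (u : 'rV[R]_m) : 'M[R]_(m, n) := sigma d (slice_inv hR hT hV hC Fs dF d u).
Let TX := restrict T.

Let dsg d (x : X) i : chart_dom d x ->
  is_derive (slice_map d x) (delta_mx 0 i) (sg d) (partial d i (fun x : X => sigma d x) x).
Proof.
move=> dx; have [xO _] := slice_mapE hR dx.
have df := smooth_on_diff (@sigma_smooth _ _ _ _ _ hR hT _ hV hC _ Fs dF d) xO.
by split; [exact: diff_derivable | ].
Qed.

(** The ambient covariant derivative of the coordinate fields of the slice in the direction of the
    coordinate [i]. *)
Let N d (x : X) i := partial d i (fun x : X => sigma d x) x
   + sigma d x *m cn T (amb d) (inc x) (row i (sigma d x)).

Section AtPoint.
Variables (d : chart X) (x : X).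
Hypothesis dx : chart_dom d x.
Let cx : chart_dom (amb d) (inc x). Proof. by case: dx. Qed.
Let g := metric (amb d) (inc x).
Let G i := cn T (amb d) (inc x) (row i (sigma d x)).
Let io u : M := inc (slice_inv hR hT hV hC Fs dF d u).
Let iox : io (slice_map d x) = inc x.
Proof. by rewrite /io (slice_mapK hR hT hV hC Fs dF dx). Qed.
Let iocx : chart_dom (amb d) (io (slice_map d x)). Proof. by rewrite iox. Qed.
Let io_cont : {for slice_map d x, continuous io}.
Proof. exact: (@inc_slice_inv_cont _ _ _ _ _ hR hT _ hV hC _ Fs dF d x dx). Qed.
Let dio i : is_derive (slice_map d x) (delta_mx 0 i) (chart_map (amb d) \o io) (row i (sigma d x)).
Proof. by rewrite rowE; exact: (is_derive_sigma hR hT hV hC Fs dF (delta_mx 0 i) dx). Qed.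

Let dmet i : is_derive (slice_map d x) (delta_mx 0 i) (fun u => metric (amb d) (io u)) (G i *m g + g *m (G i)^T).
Proof.
have := metric_along hR hT io_cont iocx (dio i).
by rewrite iox.
Qed.

Let sgx : sg d (slice_map d x) = sigma d x.
Proof. by rewrite /sg (slice_mapK hR hT hV hC Fs dF dx). Qed.

(** Covariant differentiation of [sigma *m coframe = 0], in which the coframe is parallel: the slice
    is totally geodesic for the connection with torsion. *)
Lemma N_coframe i : N d x i *m coframe V (amb d) (inc x) = 0.
Proof.
have dV := frame_along hR hV io_cont iocx (dio i); rewrite iox in dV.
have d1 := is_derive_mulmx (dsg i dx) (is_derive_mulmx (dmet i) (is_derive_trmx dV)).
have d0 : is_derive (slice_map d x) (delta_mx 0 i) (fun u => sg d u *m (metric (amb d) (io u) *m (V (amb d) (io u))^T)) 0.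
  have [xO _] := slice_mapE hR dx.
  have E : \forall u \near slice_map d x, 0 = sg d u *m (metric (amb d) (io u) *m (V (amb d) (io u))^T).
    apply: filterS (open_nbhs_nbhs (conj (@oO d) xO)) => u uO.
    have [ud _] := slice_inv_dom hR hT hV hC Fs dF uO.
    by have [_ <-] := sigma_coord hR Fs dF ud.
  exact: near_eq_is_derive E (is_derive_cst _ _ _).
have := is_derive_uniq d1 d0.
rewrite sgx iox /N /coframe -/g -/(G i) => e; rewrite -[RHS]e.
rewrite mulmxDl; congr (_ + _).
rewrite -mulmxA; congr (_ *m _).
by rewrite linearN /= trmx_mul mulmxN mulmxDl -!mulmxA addrK.
Qed.

Let w i := N d x i *m g *m (sigma d x)^T *m invmx (metric d x).

Lemma N_sigma i : N d x i = w i *m sigma d x.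
Proof.
have gU := metric_unit hX dx.
apply/eqP; rewrite -subr_eq0; apply/eqP.
set E := _ - _.
have [_ s0] := sigma_coord hR Fs dF dx.
have SU := slice_frame_unit dx.
have e1 : E *m g *m (sigma d x)^T = 0.
  rewrite /E !mulmxBl -2!(mulmxA (w i)) -/(metric d x).
  have -> : w i *m (sigma d x *m g *m (sigma d x)^T) = N d x i *m g *m (sigma d x)^T.
    exact: (mulmxKV gU).
  by rewrite subrr.
have e2 : E *m g *m (V (amb d) (inc x))^T = 0.
  rewrite -mulmxA -/(coframe V (amb d) (inc x)) /E mulmxBl N_coframe -mulmxA s0 mulmx0.
  by rewrite subrr.
have : E *m g *m (col_mx (sigma d x) (V (amb d) (inc x)))^T = 0.
  by rewrite tr_col_mx mul_mx_row e1 e2 row_mx0.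
have SU' : (col_mx (sigma d x) (V (amb d) (inc x)))^T \in unitmx by rewrite unitmx_tr.
move/(mulmx_unit_eq0 SU'); exact: mulmx_unit_eq0 (metric_unit hR cx).
Qed.

Let sym2 i j : row j (partial d i (fun x : X => sigma d x) x) = row i (partial d j (fun x : X => sigma d x) x).
Proof.
have [xO _] := slice_mapE hR dx.
have sI' := @sI_smooth _ _ _ _ F d.
have dI u v : sO d u -> is_derive u v (sI d) (v *m sg d u).
  move=> uO; have df := smooth_on_diff sI' uO.
  split; first exact: diff_derivable.
  apply: (etrans (deriveE v df)); apply: (etrans (diff_jacobian _ _ _)).
  by rewrite /sg /sigma; have [_ ->] := slice_inv_dom hR hT hV hC Fs dF uO.
have row_d a b : is_derive (slice_map d x) (delta_mx 0 a) (fun u => (delta_mx 0 b : 'rV[R]_m) *m sg d u)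
     (row b (partial d a (fun x : X => sigma d x) x)).
  have := is_derive_mulmx (is_derive_cst (delta_mx 0 b : 'rV[R]_m) (slice_map d x) (delta_mx 0 a)) (dsg a dx).
  by move/is_derive_eq; apply; rewrite mul0mx add0r -rowE.
have h := young_is_derive (@oO d) sI' xO (fun u uO => dI u (delta_mx 0 j) uO) (row_d i j).
have E : \forall u \near slice_map d x, 'D_(delta_mx 0 i) (sI d) u = (delta_mx 0 i : 'rV[R]_m) *m sg d u.
  by apply: filterS (open_nbhs_nbhs (conj (@oO d) xO)) => u uO; have [_ ->] := dI u (delta_mx 0 i) uO.
exact: is_derive_uniq (near_eq_is_derive E h) (row_d j i).
Qed.

(** By [N_sigma] the ambient connection induces one on the slice without a normal part. It is
    metric, and since second derivatives of the inclusion commute its torsion is the restriction of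
    [T]; [koszul_uniq] identifies it. *)
Lemma slice_connection i : skew_connection TX d x i = w i.
Proof.
have gU := metric_unit hX dx.
have aX : Defs.alternating (TX d x) by have [_ _ h] := restrict_form hT; exact: h.
rewrite (skew_connection_koszul TX hX i dx).
apply/esym; apply: koszul_uniq.
- exact: gU.
- by have := metric_sym hX dx.
- exact: aX.
- move=> a.
  have d1 := is_derive_mulmx (is_derive_mulmx (dsg a dx) (dmet a)) (is_derive_trmx (dsg a dx)).
  have [_ E] := d1; rewrite sgx iox -/g in E.
  apply: (etrans E).
  have -> : w a *m metric d x = N d x a *m g *m (sigma d x)^T by exact: (mulmxKV gU).
  have -> : metric d x *m (w a)^T = sigma d x *m g *m (N d x a)^T.
    rewrite N_sigma; apply: (etrans _ (congr1 (mulmx _) (esym (trmx_mul (w a) (sigma d x))))).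
    exact: esym (mulmxA (sigma d x *m g) (sigma d x)^T (w a)^T).
  exact: gram_derive.
- move=> a b l.
  have e a' b' : (w a' *m metric d x) b' l = (row b' (N d x a') *m g *m (sigma d x)^T) 0 l.
    apply: (etrans (congr1 (fun A : 'M[R]_m => A b' l) (mulmxKV gU _))); exact: mulmx_row_entry.
  rewrite !e {e}.
  have e1 : row b (N d x a) *m g *m (sigma d x)^T - row a (N d x b) *m g *m (sigma d x)^T =
     (row b (sigma d x) *m G a *m g - row a (sigma d x) *m G b *m g) *m (sigma d x)^T.
    rewrite /N !linearD /= (sym2 a b) -!mulmxBl; congr (_ *m _).
    by rewrite opprD addrACA subrr add0r !row_mul.
  have := congr1 (fun A : 'rV[R]_m => A 0 l) e1; rewrite [LHS]mxE [X in _ + X]mxE => ->.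
  rewrite mxE /TX /restrict pull_ix3; apply: eq_bigr => c _.
  by rewrite [_^T _ _]mxE (cn_torsion hR hT _ _ _ cx).
Qed.

Lemma slice_gauss i : partial d i (fun x : X => sigma d x) x =
  skew_connection TX d x i *m sigma d x - sigma d x *m cn T (amb d) (inc x) (row i (sigma d x)).
Proof. by rewrite slice_connection -N_sigma /N addrK. Qed.

Lemma restrict_nabla j (t : tensor_field M j) i :
  (forall c l, smooth_on (chart_codom c) (fun x => t c (chart_inv c x) l : R)) ->
  parallel_tensor (skew_connection T) t -> nabla (skew_connection TX) (restrict t) d x i = 0.
Proof.
move=> ts tp; apply/ffunP => l; rewrite !ffunE; apply/eqP; rewrite subr_eq0; apply/eqP.
have h1 a b : is_derive (slice_map d x) (delta_mx 0 i) (fun u => sg d u a b)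
    ((skew_connection TX d x i *m sg d (slice_map d x) - sg d (slice_map d x) *m G i) a b).
  by rewrite sgx -slice_gauss; have /is_derive_mxP := dsg i dx.
have h2 l' : is_derive (slice_map d x) (delta_mx 0 i) (fun u => t (amb d) (io u) l')
    (dact (G i) (t (amb d) (io (slice_map d x))) l').
  have := tensor_along hR io_cont iocx (dio i) (ts (amb d) l') tp.
  by rewrite iox.
have [_ E] := is_derive_pull_conn l h1 h2.
apply: (etrans E).
by rewrite sgx iox ffunE.
Qed.

End AtPoint.
End SliceTensors.

Lemma smooth_on_local {R : realType} (n : nat) (W : normedModType R) (A : set 'rV[R]_n) (f : 'rV[R]_n -> W) :
  (forall x, A x -> exists2 U, U x & smooth_on U f) -> smooth_on A f.
Proof. by move=> h s x /h[U Ux sU]; exact: sU. Qed.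

(** * The isometry with the product *)

Section Splitting.
Context {R : realType} {m k : nat}.
Local Notation n := (m + k)%N.
Variables (M : rmfd R n) (T : tensor_field M 3).
Hypotheses (hR : riemannian M) (hT : is_form T).
Variable V : chart M -> M -> 'M[R]_(k, n).
Implicit Types (c e : chart M) (p q : M) (s : 'rV[R]_k).
Hypotheses (hV : parallel_frame T V) (hC : geodesically_complete M).
Variable F : M -> 'rV[R]_k.
Hypothesis Fs : forall c, smooth_on (chart_codom c) (F \o chart_inv c).
Hypothesis dF : forall c p v, chart_dom c p ->
  is_derive (chart_map c p) v (F \o chart_inv c) (v *m coframe V c p).

Let hM : smooth_manifold M. Proof. by case: hR. Qed.

Local Notation X := (slice hR hT hV hC Fs dF).
Let oO (d : chart X) : open (sO d). Proof. exact: sO_open. Qed.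
Let hX : riemannian X := slice_riemannian hR hT hV hC Fs dF.
Let rho := retract hR hT hV hC Fs dF.
Local Notation E2 := (product X (euclidean k)).

Definition split_map (p : M) : E2 := (rho p, F p).
Definition split_inv (z : E2) : M := psi V (z.2 : 'rV[R]_k) (inc (z.1 : X)).

Lemma split_mapK : cancel split_map split_inv.
Proof.
move=> p; rewrite /split_inv /split_map /= inc_retract.
by have := psiN hR hT hV hC (- F p) p; rewrite opprK.
Qed.

Lemma split_invK : cancel split_inv split_map.
Proof.
move=> [x s]; rewrite /split_map /split_inv /=.
have Fx : F (psi V s (inc x)) = s by rewrite (F_psi hR hT hV hC Fs dF) inc_F add0r.
congr (_, _); last exact: Fx.
by apply: inc_inj; rewrite /rho inc_retract Fx (psiN hR hT hV hC).
Qed.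

Let rho_smooth c x e : chart_codom c x -> chart_dom e (inc (rho (chart_inv c x))) ->
  smooth_at (fun y => inc (rho (chart_inv c y))) x e.
Proof. exact: (@retract_smooth _ _ _ _ _ hR hT _ hV hC _ Fs dF). Qed.

Lemma split_map_smooth : smooth_map split_map.
Proof.
split.
  move=> p; have c1 := @retract_cont _ _ _ _ _ hR hT _ hV hC _ Fs dF p.
  have c2 := @F_cont _ _ _ _ hR _ Fs p.
  exact: (cvg_pair c1 c2).
move=> c [d []]; apply: smooth_on_local => x [p [cp [/= [ap Up] _]] <-].
have cx := chart_map_codom cp.
have ex : chart_dom (amb d) (inc (rho (chart_inv c (chart_map c p)))).
  by rewrite (chart_mapK hM cp).
have [U [oU Ux Ud sU]] := rho_smooth cx ex.
pose B := U `&` chart_codom c.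
have oB : open B by apply: openI oU _; exact: codom_open hM c.
exists B; first by split.
have h1 : smooth_on B (fun y => chart_map (amb d) (inc (rho (chart_inv c y))) *m sK d).
  apply: (smooth_on_mulmx oB); last exact: smooth_on_cst.
  by apply: smooth_on_sub sU => y [].
have h2 : smooth_on B (F \o chart_inv c) by apply: smooth_on_sub (@Fs c) => y [].
have h := smooth_on_row_mx oB h1 h2.
by apply: (smooth_on_ext oB) h => y _.
Qed.

Let inc_smooth j (L : {linear 'rV[R]_j -> 'rV[R]_m}) d z : sO d (L z) ->
  smooth_at (fun z => inc (slice_inv hR hT hV hC Fs dF d (L z))) z (amb d).
Proof.
move=> zO.
pose B := [set z | setT z /\ sO d (L z)].
have sL := smooth_on_linear (A := setT) openT L.
have oB : open B.
  apply: open_setI_preimage; [exact: openT | exact: oO |].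
  by move=> y _; apply: differentiable_continuous; exact: smooth_on_diff sL I.
have incE y : B y -> inc (slice_inv hR hT hV hC Fs dF d (L y)) = chart_inv (amb d) (sI d (L y)).
  by move=> [_ yO]; exact: inc_slice_inv.
exists B; split=> //.
  move=> y By; rewrite incE //; apply: (chart_inv_dom hM).
  by case: By => _ /sI_props[].
have sI' := @sI_smooth _ _ _ _ F d.
have h y : B y -> sO d (L y) by case.
have := smooth_on_comp oB (@oO d) h (smooth_on_sub (@subsetT _ B) sL) sI'.
apply: (smooth_on_ext oB) => y By /=; rewrite incE // (chart_invK hM) //.
by case: By => _ /sI_props[].
Qed.

Let split_inv_smooth_at (d : chart X) z e : sO d (lsubmx z) ->
  chart_dom e (psi V (rsubmx z) (inc (slice_inv hR hT hV hC Fs dF d (lsubmx z)))) ->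
  smooth_at (fun z : 'rV[R]_(m + k) =>
     psi V (rsubmx z) (inc (slice_inv hR hT hV hC Fs dF d (lsubmx z)))) z e.
Proof.
move=> zO ez.
have sr := smooth_on_linear (A := setT) openT (rsubmx : {linear 'rV[R]_(m + k) -> 'rV[R]_k}).
have h := inc_smooth (L := lsubmx : {linear 'rV[R]_(m + k) -> 'rV[R]_m}) zO.
exact: (psi_chart_smooth hR hT hV hC openT I sr h ez).
Qed.

Lemma split_inv_smooth : smooth_map split_inv.
Proof.
split.
  move=> [x s].
  have [d dx] := slice_chart_ex hR hV Fs dF x.
  have [e ez] := chart_at hM (psi V s (inc x)).
  have [xO _] := slice_mapE hR dx.
  pose z0 : 'rV[R]_(m + k) := row_mx (slice_map d x) s.
  pose Psi (z : 'rV[R]_(m + k)) := psi V (rsubmx z) (inc (slice_inv hR hT hV hC Fs dF d (lsubmx z))).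
  have h : smooth_at Psi z0 e.
    by apply: split_inv_smooth_at; rewrite /z0 row_mxKl // row_mxKr (slice_mapK hR hT hV hC Fs dF dx).
  have c1 := smooth_at_cont hM h.
  pose co (w : E2) : 'rV[R]_(m + k) := slice_map d w.1 *m row_mx 1%:M 0 + (w.2 : 'rV[R]_k) *m row_mx 0 1%:M.
  have coE (w : E2) : co w = row_mx (slice_map d w.1) w.2.
    by rewrite /co !mul_mx_row !mulmx0 !mulmx1 add_row_mx addr0 add0r.
  have c2 : {for ((x, s) : E2), continuous co}.
    apply: cvgD.
      apply: (@continuous_comp _ _ _ (fun w : E2 => slice_map d w.1) (mulmxr (row_mx 1%:M 0))).
        apply: (@continuous_comp _ _ _ (fst : E2 -> X) (slice_map d)); first exact: cvg_fst.
        exact: slice_map_cont.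
      exact: mulmxr_continuous.
    apply: (@continuous_comp _ _ _ (fun w : E2 => w.2 : 'rV[R]_k) (mulmxr (row_mx 0 1%:M))).
      exact: cvg_snd.
    exact: mulmxr_continuous.
  have c3 : {for ((x, s) : E2), continuous (Psi \o co)}.
    by apply: continuous_comp; [exact: c2 | rewrite coE; exact: c1].
  have EE : \forall w \near ((x, s) : E2), (Psi \o co) w = split_inv w.
    have od : \forall w \near ((x, s) : E2), slice_dom d w.1.
      have o1 := slice_dom_open hR d.
      have c0 : {for ((x, s) : E2), continuous (fst : E2 -> X)} by exact: cvg_fst.
      exact: c0 _ (open_nbhs_nbhs (conj o1 dx)).
    apply: filterS od => w dw; rewrite /= coE /Psi row_mxKr row_mxKl.
    by rewrite (slice_mapK hR hT hV hC Fs dF dw).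
  move=> A nA.
  have hA : \forall w \near ((x, s) : E2), A ((Psi \o co) w).
    by apply: c3; rewrite (nbhs_singleton EE).
  suff : \forall w \near ((x, s) : E2), A (split_inv w) by [].
  by apply: filterS (filterI EE hA) => w [<-].
move=> [d []] e; apply: smooth_on_local => z [[x s] [[/= dx _] ex] <-].
have [xO _] := slice_mapE hR dx.
have h : smooth_at (fun z : 'rV[R]_(m + k) =>
     psi V (rsubmx z) (inc (slice_inv hR hT hV hC Fs dF d (lsubmx z)))) (row_mx (slice_map d x) s) e.
  by apply: split_inv_smooth_at; rewrite row_mxKl // row_mxKr (slice_mapK hR hT hV hC Fs dF dx).
have [U [oU Uz _ sU]] := h.
by exists U.
Qed.

(** [A] is the differential of the flow that carries [p] to the slice. In the differential of the
    retraction, the dependence of the coefficient [- F p] on [p] contributes minus the component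
    along [V]; the second component of [split_map] restores it, so the two together amount to
    [A]. *)
Lemma split_map_diff c p (d : chart X) : chart_dom c p -> slice_dom d (rho p) ->
  exists A : 'M[R]_n,
  [/\ dmap split_map c ((d, tt) : chart E2) p *m
        col_mx (sigma d (rho p)) (V (amb d) (inc (rho p))) = A,
      A *m metric (amb d) (inc (rho p)) *m A^T = metric c p &
      forall j (t : tensor_field M j), is_form t ->
        parallel_tensor (skew_connection T) t ->
        pull A (t (amb d) (inc (rho p))) = t c p].
Proof.
move=> cp dx; have [ax _] := dx.
have [A [A1 A2 A3 A4]] := psi_diff hR hT hV hC cp ax.
exists A; split=> //; last by move=> j t [tj ts _] tp; exact: A3.
have cx := chart_map_codom cp.
have cinv : {for chart_map c p, continuous (chart_inv c)} := chart_inv_cont hM cx.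
set x0 := chart_map c p.
have oC := @codom_open _ _ _ hM c.
have dfs : differentiable (chart_map ((d, tt) : chart E2) \o split_map \o chart_inv c) x0.
  have [_ /(_ c (d, tt)) sf] := split_map_smooth.
  by apply: (smooth_on_diff sf); exists p.
have dI (v : 'rV[R]_n) : is_derive x0 v (chart_map c \o chart_inv c) v.
  have E : \forall y \near x0, y = (chart_map c \o chart_inv c) y.
    by apply: filterS (open_nbhs_nbhs (conj oC cx)) => y cy /=; rewrite (chart_invK hM cy).
  exact: near_eq_is_derive E (is_derive_id x0 v).
have key (v : 'rV[R]_n) : v *m dmap split_map c ((d, tt) : chart E2) p *m
    col_mx (sigma d (rho p)) (V (amb d) (inc (rho p))) = v *m A.
  have dL : is_derive x0 v (fun y => - F (chart_inv c y)) (- (v *m coframe V c p)).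
    exact: is_deriveN (dF v cp).
  have h := A4 _ x0 v _ _ _ _ (congr1 (fun q => - F q) (chart_mapK hM cp)) (chart_mapK hM cp) cinv dL (dI v).
  pose D := 'd (chart_map ((d, tt) : chart E2) \o split_map \o chart_inv c) x0 v.
  have dD : is_derive x0 v (chart_map ((d, tt) : chart E2) \o split_map \o chart_inv c) D.
    split; first exact: diff_derivable.
    exact: deriveE v dfs.
  have DE : D = v *m dmap split_map c ((d, tt) : chart E2) p by exact: diff_jacobian.
  rewrite -DE -(hsubmxK D) mul_row_col.
  have dr : rsubmx D = v *m coframe V c p.
    have dr1 : is_derive x0 v (F \o chart_inv c) (rsubmx D).
      apply/is_derive_mxP => i j; rewrite mxE.
      have /is_derive_mxP/(_ i (rshift m j)) := dD.
      congr (is_derive _ _ _ _); apply/funext => y /=.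
      by rewrite ord1 row_mxEr.
    exact: is_derive_uniq dr1 (dF v cp).
  have dl : is_derive x0 v (slice_map d \o rho \o chart_inv c) (lsubmx D).
    apply/is_derive_mxP => i j; rewrite mxE.
    have /is_derive_mxP/(_ i (lshift k j)) := dD.
    congr (is_derive _ _ _ _); apply/funext => y /=.
    by rewrite ord1 row_mxEl.
  have df : differentiable (sI d) ((slice_map d \o rho \o chart_inv c) x0).
    by rewrite /= (chart_mapK hM cp); exact: (sigma_diff hR dx).
  have dcomp := is_derive_compV df dl.
  have e1 : 'd (sI d) ((slice_map d \o rho \o chart_inv c) x0) (lsubmx D) = lsubmx D *m sigma d (rho p).
    apply: (etrans (diff_jacobian _ _ _)).
    by rewrite /sigma /= (chart_mapK hM cp).
  rewrite e1 in dcomp.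
  have E : \forall y \near x0, (sI d \o (slice_map d \o rho \o chart_inv c)) y =
      chart_map (amb d) (psi V (- F (chart_inv c y)) (chart_inv c y)).
    have nd : \forall q \near p, slice_dom d (rho q).
      have o1 := slice_dom_open hR d.
      exact: (@retract_cont _ _ _ _ _ hR hT _ hV hC _ Fs dF p _ (open_nbhs_nbhs (conj o1 dx))).
    have nd' : \forall y \near x0, slice_dom d (rho (chart_inv c y)).
      have nq : \forall q \near chart_inv c x0, slice_dom d (rho q) by rewrite /x0 (chart_mapK hM cp).
      exact: cinv _ nq.
    apply: filterS nd' => y dy /=.
    by have [_ ->] := slice_mapE hR dy.
  have := is_derive_uniq (near_eq_is_derive E dcomp) h.
  change (psi V (- F p) p) with (inc (rho p)) => ->; rewrite dr.
  by rewrite mulNmx addrAC addNr add0r.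
by apply/row_matrixP => i; rewrite !rowE -key mulmxA.
Qed.

Lemma split_map_isometry : riemannian_isometry split_map.
Proof.
split; first exact: split_map_smooth.
  exists split_inv; split; [exact: split_mapK | exact: split_invK | exact: split_inv_smooth].
move=> c [d []] p cp [/= dx _].
have [A [A1 A2 _]] := split_map_diff cp dx.
rewrite -A2 -A1.
have g := @slice_frame_gram _ _ _ _ _ hR hT _ hV hC _ Fs dF d (rho p) dx.
set D := dmap _ _ _ _; set S := col_mx _ _ in g *.
rewrite trmx_mul !mulmxA -(mulmxA D) -(mulmxA D) g.
by [].
Qed.

Local Notation TX := ((fun (d : chart X) (x : X) => pull (sigma d x) (T (amb d) (inc x))) : tensor_field X 3).

(* A frame of the slice transported by its connection, completed by [V], is
   transported by the ambient connection. *)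
Lemma slice_transport j (t : tensor_field M j) (g : R -> X) (P : chart X -> R -> 'M[R]_m) :
  is_form t -> parallel_tensor (skew_connection T) t -> continuous g ->
  par_along TX g P ->
  forall (d e : chart X) u v, slice_dom d (g u) -> slice_dom e (g v) ->
  pull (col_mx (P d u *m sigma d (g u)) (V (amb d) (inc (g u)))) (t (amb d) (inc (g u))) =
  pull (col_mx (P e v *m sigma e (g v)) (V (amb e) (inc (g v)))) (t (amb e) (inc (g v))).
Proof.
move=> [tj ts _] tp cg [Pj dP] d e u v du ev; apply/ffunP => i.
have hXm : smooth_manifold X by case: hX.
apply: (along_cst hX cg (q := fun (d : chart X) u => pull (col_mx (P d u *m sigma d (g u)) (V (amb d) (inc (g u))))
    (t (amb d) (inc (g u))) i)) du ev => [c d' r cr dr|c r cr].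
  have [ac _] := cr; have [ad _] := dr.
  rewrite (tj _ _ _ ac ad) pull_mul; congr (pull _ _ i).
  rewrite mul_col_mx -mulmxA (sigma_jac hR hT hV hC Fs dF cr dr) mulmxA (Pj _ _ _ cr dr).
  by have [hj _ _ _ _] := hV; rewrite (hj _ _ _ ac ad).
have [w dw dPc] := dP c r cr.
have [ac _] := cr.
pose ig (y : R) : M := inc (g y).
have cig : continuous ig.
  by move=> y; apply: (@continuous_comp _ _ _ g (fun x : X => inc x)); [exact: cg | exact: inc_cont].
have xO := (slice_mapE hR cr).1.
have mat a b (H : X -> 'M[R]_(a, b)) : differentiable (H \o slice_inv hR hT hV hC Fs dF c) (slice_map c (g r)) ->
    is_derive r 1 (H \o g) (\sum_i w 0 i *: partial c i H (g r)).
  by move=> dH; exact: (is_derive_along hX (@cg r) cr dw dH).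
have ds := mat _ _ (fun x => sigma c x) (smooth_on_diff (@sigma_smooth _ _ _ _ _ hR hT _ hV hC _ Fs dF c) xO).
have dch : is_derive r 1 (chart_map (amb c) \o ig) (w *m sigma c (g r)).
  have dI : differentiable ((fun x : X => chart_map (amb c) (inc x)) \o slice_inv hR hT hV hC Fs dF c) (slice_map c (g r)).
    have E : \forall z \near slice_map c (g r), sI c z = ((fun x : X => chart_map (amb c) (inc x)) \o slice_inv hR hT hV hC Fs dF c) z.
      apply: filterS (open_nbhs_nbhs (conj (@oO c) xO)) => z zO /=.
      rewrite (inc_slice_inv hR hT hV hC Fs dF zO) (chart_invK hM) //.
      by have [] := sI_props zO.
    by have [] := near_eq_diff E (sigma_diff hR cr).
  have h := mat _ _ (fun x : X => chart_map (amb c) (inc x)) dI.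
  apply: is_derive_eq h _.
  rewrite [w in RHS]row_sum_delta mulmx_suml; apply: eq_bigr => a _.
  have [_ h] := is_derive_sigma hR hT hV hC Fs dF (delta_mx 0 a) cr.
  by rewrite -scalemxAl -h.
set q := inc (g r); set C := cn T (amb c) q (w *m sigma c (g r)).
have dV := frame_along hR hV (@cig r) ac dch.
have gauss : \sum_i w 0 i *: partial c i (fun x : X => sigma c x) (g r) =
    cn TX c (g r) w *m sigma c (g r) - sigma c (g r) *m C.
  rewrite /C (_ : cn T (amb c) q (w *m sigma c (g r)) = \sum_i w 0 i *: cn T (amb c) q (row i (sigma c (g r)))).
    rewrite [cn TX c _ _]/cn mulmx_suml mulmx_sumr -sumrB; apply: eq_bigr => a _.
    rewrite (@slice_gauss _ _ _ _ _ hR hT _ hV hC _ Fs dF c (g r) cr).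
    by rewrite scalerBr -scalemxAl -scalemxAr.
  rewrite {1}[w]row_sum_delta mulmx_suml.
  have lin (I : Type) (s : seq I) (h : I -> R) (y : I -> 'rV[R]_n) :
      cn T (amb c) q (\sum_(i <- s) h i *: y i) = \sum_(i <- s) h i *: cn T (amb c) q (y i).
    elim: s => [|a s IH]; last by rewrite !big_cons cn_linear IH.
    rewrite !big_nil /cn big1 // => b _; by rewrite mxE scale0r.
  under eq_bigr => a _ do rewrite -scalemxAl -rowE.
  exact: lin.
rewrite gauss in ds.
have dPs := is_derive_mulmx dPc ds.
have eqd : - (P c r *m cn TX c (g r) w) *m sigma c (g r) +
    P c r *m (cn TX c (g r) w *m sigma c (g r) - sigma c (g r) *m C) = - (P c r *m sigma c (g r) *m C).
  by rewrite mulNmx mulmxBr !mulmxA addrA addNr add0r.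
rewrite eqd in dPs.
pose Z y := col_mx (P c y *m sigma c (g y)) (V (amb c) (inc (g y))).
have h1 a b : is_derive r 1 (fun y => Z y a b) ((0 *m Z r - Z r *m C) a b).
  have -> : 0 *m Z r - Z r *m C = col_mx (- (P c r *m sigma c (g r) *m C)) (- (V (amb c) q *m C)).
    by rewrite mul0mx sub0r /Z mul_col_mx opp_col_mx.
  move: dPs dV => /is_derive_mxP dPs /is_derive_mxP dV.
  rewrite mxE (_ : (fun y => _) = fun y : R => match fintype.split a with
    | inl a1 => (P c y *m sigma c (g y)) a1 b | inr a2 => V (amb c) (inc (g y)) a2 b end); last first.
    by apply/funext => y; rewrite mxE.
  by case: fintype.split => a1; [exact: dPs | exact: dV].
have h2 l := tensor_along hR (@cig r) ac dch (ts (amb c) l) tp.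
apply: is_derive_eq (is_derive_pull_conn i h1 h2) _.
rewrite (_ : dact 0 _ = 0) ?ffunE //.
by rewrite -(scale0r (0 : 'M[R]_(m + k))) dactZl scale0r.
Qed.

End Splitting.

(** Collects what is used of the slice and hides its construction: [i] is the inclusion, [a] assigns
    to a chart of [X] a chart of [M], and the rows of [S] are the coordinate fields of [X]. The last
    three clauses concern restriction, the differential of the isometry, and transport of frames
    completed by [V]. *)
Theorem splitting {R : realType} (m k : nat) (M : rmfd R (m + k)) (T : tensor_field M 3)
    (V : chart M -> M -> 'M[R]_(k, m + k)) (p0 : M) :
  riemannian M -> is_form T -> parallel_frame T V -> geodesically_complete M ->
  simply_connected M ->
  exists (X : rmfd R m) (a : chart X -> chart M) (i : X -> M)
    (S : chart X -> X -> 'M[R]_(m, m + k)) (f : M -> product X (euclidean k)),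
  [/\ riemannian X /\ riemannian_isometry f,
      forall d x, chart_dom d x -> [/\ chart_dom (a d) (i x),
        metric d x = S d x *m metric (a d) (i x) *m (S d x)^T &
        S d x *m metric (a d) (i x) *m (V (a d) (i x))^T = 0],
      forall j (t : tensor_field M j), is_form t ->
        is_form (fun (d : chart X) (x : X) => pull (S d x) (t (a d) (i x)) : tens R m j) /\
        (parallel_tensor (skew_connection T) t ->
         parallel_tensor (skew_connection (fun (d : chart X) (x : X) => pull (S d x) (T (a d) (i x)) : tens R m 3))
          (fun (d : chart X) (x : X) => pull (S d x) (t (a d) (i x)) : tens R m j)),
      forall c p (d : chart X), chart_dom c p -> chart_dom d (f p).1 ->
        exists A : 'M[R]_(m + k),
        [/\ dmap f c ((d, tt) : chart (product X (euclidean k))) p *m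
              col_mx (S d (f p).1) (V (a d) (i (f p).1)) = A,
            A *m metric (a d) (i (f p).1) *m A^T = metric c p &
            forall j (t : tensor_field M j), is_form t ->
              parallel_tensor (skew_connection T) t ->
              pull A (t (a d) (i (f p).1)) = t c p] &
      forall j (t : tensor_field M j) (g : R -> X) (P : chart X -> R -> 'M[R]_m),
        is_form t -> parallel_tensor (skew_connection T) t -> continuous g ->
        par_along (fun (d : chart X) (x : X) => pull (S d x) (T (a d) (i x)) : tens R m 3) g P ->
        forall (d e : chart X) u v, chart_dom d (g u) -> chart_dom e (g v) ->
        pull (col_mx (P d u *m S d (g u)) (V (a d) (i (g u)))) (t (a d) (i (g u))) =
        pull (col_mx (P e v *m S e (g v)) (V (a e) (i (g v)))) (t (a e) (i (g v)))].
Proof.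
move=> hR hT hV hC hS; have hM : smooth_manifold M by case: hR.
have [F _ [Fs dF]] := global_primitive hM hS (coframe_jac hR hV) (coframe_smooth hR hV)
  (coframe_closed hR hT hV) p0.
pose X := slice hR hT hV hC Fs dF.
exists X, (fun d : chart X => amb d), (fun x : X => inc x), (fun (d : chart X) (x : X) => sigma d x),
  (split_map hR hT hV hC Fs dF); split.
- by split; [exact: slice_riemannian | exact: split_map_isometry].
- move=> d x dx; split; [by case: dx | by [] |].
  by have [_ h] := sigma_coord hR Fs dF dx; rewrite -mulmxA; exact: h.
- move=> j t tf; split; first exact: (@restrict_form _ _ _ _ _ hR hT _ hV hC _ Fs dF j t tf).
  move=> tp d x l dx; have [_ ts _] := tf.
  exact: (@restrict_nabla _ _ _ _ _ hR hT _ hV hC _ Fs dF d x dx j t l ts tp).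
- move=> c p d cp dx; exact: (@split_map_diff _ _ _ _ _ hR hT _ hV hC _ Fs dF c p d cp dx).
- move=> j t g P; exact: slice_transport.
Qed.

(** * Parallel contractions *)

Section Contractions.
Context {R : realType}.

(** For the torsion this is Q as a bilinear form, with [g] the inverse of the Gram matrix; [qendo]
    raises an index to make it an endomorphism. *)
Definition qmx n k (g : 'M[R]_n) (t : tens R n k.+1) : 'M[R]_n :=
  \matrix_(i, j) ip g (ins (delta_mx 0 i) t) (ins (delta_mx 0 j) t).

(** The covector obtained by contracting [t] with all slots of [f] except the first. *)
Definition cvec n k (g : 'M[R]_n) (t : tens R n k) (f : tens R n k.+1) : 'rV[R]_n :=
  \row_l ip g t (ins (delta_mx 0 l) f).

Lemma ip_sumr n k (g : 'M[R]_n) (I : finType) (t : tens R n k) (h : I -> R) (s : I -> tens R n k) :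
  ip g t (\sum_i h i *: s i) = \sum_i h i * ip g t (s i).
Proof.
elim/big_rec2: _ => [|i a b _ <-]; last by rewrite ipDr ipZr.
by rewrite -(scale0r (0 : tens R n k)) ipZr mul0r.
Qed.

Lemma ip_suml n k (g : 'M[R]_n) (I : finType) (t : tens R n k) (h : I -> R) (s : I -> tens R n k) :
  ip g (\sum_i h i *: s i) t = \sum_i h i * ip g (s i) t.
Proof.
elim/big_rec2: _ => [|i a b _ <-]; last by rewrite ipDl ipZl.
by rewrite -(scale0r (0 : tens R n k)) ipZl mul0r.
Qed.

Lemma qmx_pull m n k (A : 'M[R]_(m, n)) (g : 'M[R]_m) (t : tens R n k.+1) :
  qmx g (pull A t) = A *m qmx (A^T *m g *m A) t *m A^T.
Proof.
apply/matrixP => i j; rewrite mxE -!pull_ins ip_pull -!rowE.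
rewrite (ins_sum (row i A)) ip_suml mxE.
under [RHS]eq_bigr => a _ do rewrite mxE mulr_suml.
rewrite [RHS]exchange_big; apply: eq_bigr => a _ /=.
rewrite (ins_sum (row j A)) ip_sumr mulr_sumr; apply: eq_bigr => b _.
by rewrite !mxE; ring.
Qed.

Lemma cvec_pull m n k (A : 'M[R]_(m, n)) (g : 'M[R]_m) (t : tens R n k) (f : tens R n k.+1) :
  cvec g (pull A t) (pull A f) = cvec (A^T *m g *m A) t f *m A^T.
Proof.
apply/rowP => l; rewrite mxE -!pull_ins ip_pull -!rowE mxE.
rewrite (ins_sum (row l A)) ip_sumr; apply: eq_bigr => a _.
by rewrite !mxE mulrC.
Qed.

Context {V : normedModType R}.
Variables (x v : V).

Lemma is_derive_ins n k (C : 'M[R]_n) (t : V -> tens R n k.+1) (w : 'rV[R]_n) :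
  (forall j, is_derive x v (fun y => t y j) (dact C (t x) j)) ->
  forall j, is_derive x v (fun y => ins w (t y) j) ((dact C (ins w (t x)) + ins (w *m C) (t x)) j).
Proof.
move=> dt j; rewrite dact_ins subrK.
rewrite (_ : (fun y => _) = fun y => \sum_l w 0 l * t y (icons l j)); last first.
  by apply/funext => y; rewrite ffunE.
have h l := is_derive_mulr (is_derive_cst (w 0 l) x v) (dt (icons l j)).
apply: is_derive_eq (is_derive_sumr h) _.
by rewrite ffunE; apply: eq_bigr => l _; rewrite mul0r addr0.
Qed.

Variables (n : nat) (g : V -> 'M[R]_n) (C : 'M[R]_n).
Hypothesis dg : forall a b, is_derive x v (fun y => g y a b) ((- (C^T *m g x + g x *m C)) a b).

Lemma is_derive_qmx k (t : V -> tens R n k.+1) :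
  (forall j, is_derive x v (fun y => t y j) (dact C (t x) j)) ->
  is_derive x v (fun y => qmx (g y) (t y)) (C *m qmx (g x) (t x) + qmx (g x) (t x) *m C^T).
Proof.
move=> dt; apply/is_derive_mxP => i j.
rewrite (_ : (fun y => _) = fun y => ip (g y) (ins (delta_mx 0 i) (t y)) (ins (delta_mx 0 j) (t y))); last first.
  by apply/funext => y; rewrite mxE.
have di := is_derive_ins (delta_mx 0 i) dt; have dj := is_derive_ins (delta_mx 0 j) dt.
apply: is_derive_eq (is_derive_ip dg di dj) _.
rewrite -!rowE !(ins_sum (row _ C)) ip_suml ip_sumr !mxE; congr (_ + _).
  by apply: eq_bigr => l _; rewrite !mxE.
by apply: eq_bigr => l _; rewrite !mxE mulrC.
Qed.

Lemma is_derive_cvec k (t : V -> tens R n k) (f : V -> tens R n k.+1) :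
  (forall j, is_derive x v (fun y => t y j) (dact C (t x) j)) ->
  (forall j, is_derive x v (fun y => f y j) (dact C (f x) j)) ->
  is_derive x v (fun y => cvec (g y) (t y) (f y)) (cvec (g x) (t x) (f x) *m C^T).
Proof.
move=> dt df; apply/is_derive_mxP => i j.
rewrite (_ : (fun y => _) = fun y => ip (g y) (t y) (ins (delta_mx 0 j) (f y))); last first.
  by apply/funext => y; rewrite mxE.
have dt' l : is_derive x v (fun y => t y l) ((dact C (t x) + 0) l) by rewrite addr0.
have dj := is_derive_ins (delta_mx 0 j) df.
apply: is_derive_eq (is_derive_ip dg dt' dj) _.
rewrite -(scale0r (0 : tens R n k)) ipZl mul0r add0r -!rowE !(ins_sum (row _ C)) ip_sumr !mxE.
by apply: eq_bigr => l _; rewrite !mxE mulrC.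
Qed.

End Contractions.

Section SmoothTensors.
Context {R : realType} {N : nat}.
Variable A : set 'rV[R]_N.
Hypothesis oA : open A.

Lemma smooth_on_pull m n k (B : 'rV[R]_N -> 'M[R]_(m, n)) (t : 'rV[R]_N -> tens R n k) :
  smooth_on A B -> (forall j, smooth_on A (fun x => t x j : R)) ->
  forall i, smooth_on A (fun x => pull (B x) (t x) i : R).
Proof.
move=> /(smooth_on_mxP oA) sB st i.
have h : smooth_on A (fun x => \sum_(j : {ffun 'I_k -> 'I_n}) t x j * \prod_(a < k) B x (i a) (j a) : R).
  apply: (smooth_on_sum oA) => j _; apply: (smooth_onM oA) => //.
  by apply: (smooth_on_prod oA) => a _; exact: sB.
by apply: (smooth_on_ext oA) h => x _; rewrite ffunE.
Qed.

Lemma smooth_on_ip n k (g : 'rV[R]_N -> 'M[R]_n) (t s : 'rV[R]_N -> tens R n k) :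
  smooth_on A g -> (forall j, smooth_on A (fun x => t x j : R)) ->
  (forall j, smooth_on A (fun x => s x j : R)) -> smooth_on A (fun x => ip (g x) (t x) (s x) : R).
Proof.
move=> sg st ss; apply: (smooth_on_sum oA) => j _; apply: (smooth_onM oA) => //.
exact: smooth_on_pull.
Qed.

Lemma smooth_on_ins n k (w : 'rV[R]_N -> 'rV[R]_n) (t : 'rV[R]_N -> tens R n k.+1) :
  smooth_on A w -> (forall j, smooth_on A (fun x => t x j : R)) ->
  forall j, smooth_on A (fun x => ins (w x) (t x) j : R).
Proof.
move=> /(smooth_on_mxP oA) sw st j.
have h : smooth_on A (fun x => \sum_l w x 0 l * t x (icons l j) : R).
  by apply: (smooth_on_sum oA) => l _; apply: (smooth_onM oA).
by apply: (smooth_on_ext oA) h => x _; rewrite ffunE.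
Qed.

Lemma smooth_on_qmx n k (g : 'rV[R]_N -> 'M[R]_n) (t : 'rV[R]_N -> tens R n k.+1) :
  smooth_on A g -> (forall j, smooth_on A (fun x => t x j : R)) ->
  smooth_on A (fun x => qmx (g x) (t x)).
Proof.
move=> sg st; apply/(smooth_on_mxP oA) => i j.
have h : smooth_on A (fun x => ip (g x) (ins (delta_mx 0 i) (t x)) (ins (delta_mx 0 j) (t x)) : R).
  by apply: smooth_on_ip => // l; apply: smooth_on_ins => //; exact: smooth_on_cst.
by apply: (smooth_on_ext oA) h => x _; rewrite mxE.
Qed.

Lemma smooth_on_cvec n k (g : 'rV[R]_N -> 'M[R]_n) (t : 'rV[R]_N -> tens R n k)
    (f : 'rV[R]_N -> tens R n k.+1) :
  smooth_on A g -> (forall j, smooth_on A (fun x => t x j : R)) ->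
  (forall j, smooth_on A (fun x => f x j : R)) -> smooth_on A (fun x => cvec (g x) (t x) (f x)).
Proof.
move=> sg st sf; apply/(smooth_on_mxP oA) => i j.
have h : smooth_on A (fun x => ip (g x) (t x) (ins (delta_mx 0 j) (f x)) : R).
  by apply: smooth_on_ip => // l; apply: smooth_on_ins => //; exact: smooth_on_cst.
by apply: (smooth_on_ext oA) h => x _; rewrite mxE.
Qed.

End SmoothTensors.

Section ParallelFields.
Context {R : realType} {n : nat}.
Variables (M : rmfd R n) (T : tensor_field M 3).
Hypotheses (hR : riemannian M) (hT : is_form T).
Implicit Types (c d : chart M) (p : M).

Let hM : smooth_manifold M. Proof. by case: hR. Qed.
Let oC c : open (chart_codom c). Proof. exact: codom_open hM c. Qed.

Definition parallel_endo (A : endo_field M) :=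
  [/\ forall c d p, chart_dom c p -> chart_dom d p -> A c p *m jac c d p = jac c d p *m A d p,
      forall c, smooth_on (chart_codom c) (A c \o chart_inv c) &
      forall c p i, chart_dom c p -> partial c i (A c) p =
        skew_connection T c p i *m A c p - A c p *m skew_connection T c p i].

Definition parallel_vec (y : chart M -> M -> 'rV[R]_n) :=
  [/\ forall c d p, chart_dom c p -> chart_dom d p -> y d p = y c p *m jac c d p,
      forall c, smooth_on (chart_codom c) (y c \o chart_inv c) &
      forall c p i, chart_dom c p -> partial c i (y c) p = - (y c p *m skew_connection T c p i)].

Definition parallel_form k (t : tensor_field M k) :=
  is_form t /\ parallel_tensor (skew_connection T) t.

Lemma is_derive_partial a b c (H : M -> 'M[R]_(a, b)) p i : chart_dom c p ->
  smooth_on (chart_codom c) (H \o chart_inv c) ->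
  is_derive (chart_map c p) (delta_mx 0 i) (H \o chart_inv c) (partial c i H p).
Proof.
move=> cp sH; have df := smooth_on_diff sH (chart_map_codom cp).
by split; [exact: diff_derivable |].
Qed.

Section At.
Variables (c : chart M) (p : M) (i : 'I_n).
Hypothesis cp : chart_dom c p.
Let C := skew_connection T c p i.
Let x := chart_map c p.

Let ci : {for x, continuous (chart_inv c)}.
Proof. exact: chart_inv_cont hM _ _ (chart_map_codom cp). Qed.
Let cpi : chart_dom c (chart_inv c x).
Proof. by rewrite (chart_mapK hM cp). Qed.
Let did : is_derive x (delta_mx 0 i) (chart_map c \o chart_inv c) (delta_mx 0 i).
Proof.
have E : \forall y \near x, y = (chart_map c \o chart_inv c) y.
  by apply: filterS (open_nbhs_nbhs (conj (@oC c) (chart_map_codom cp))) => y cy /=; rewrite (chart_invK hM cy).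
exact: near_eq_is_derive E (is_derive_id x _).
Qed.

Lemma metric_par : is_derive x (delta_mx 0 i) (metric c \o chart_inv c) (C *m metric c p + metric c p *m C^T).
Proof.
have := metric_along hR hT ci cpi did.
by rewrite cn_delta (chart_mapK hM cp).
Qed.

Lemma ginv_smooth d : smooth_on (chart_codom d) (fun y => invmx (metric d (chart_inv d y))).
Proof.
apply: (smooth_on_invmx (@oC d)) (@metric_smooth _ _ _ hR d) => y dy.
by apply: metric_unit hR _ _ _; exact: chart_inv_dom.
Qed.

Lemma ginv_par : is_derive x (delta_mx 0 i) (fun y => invmx (metric c (chart_inv c y)))
  (- (C^T *m invmx (metric c p) + invmx (metric c p) *m C)).
Proof.
have df := smooth_on_diff (@ginv_smooth c) (chart_map_codom cp).
have d1 : is_derive x (delta_mx 0 i) (fun y => invmx (metric c (chart_inv c y)))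
   ('D_(delta_mx 0 i) (fun y => invmx (metric c (chart_inv c y))) x).
  by split => //; exact: diff_derivable.
have gU := metric_unit hR cp.
have nU : \forall y \near x, metric c (chart_inv c y) \in unitmx.
  apply: filterS (open_nbhs_nbhs (conj (@oC c) (chart_map_codom cp))) => y cy.
  by apply: metric_unit hR _ _ _; exact: chart_inv_dom.
apply: is_derive_eq (d1) _.
rewrite (is_derive_invmx nU metric_par d1) /= (chart_mapK hM cp); congr (- _).
rewrite mulmxDr mulmxDl addrC; congr (_ + _).
  by rewrite !mulmxA mulVmx // mul1mx.
by rewrite -!mulmxA mulmxV // mulmx1.
Qed.

Lemma form_par k (t : tensor_field M k) : parallel_form t ->
  forall j, is_derive x (delta_mx 0 i) (fun y => t c (chart_inv c y) j) (dact C (t c p) j).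
Proof.
move=> [[_ ts _] tp] j; have := tensor_along hR ci cpi did (ts c j) tp.
by rewrite cn_delta (chart_mapK hM cp).
Qed.

End At.

Lemma ginv_jac c d p : chart_dom c p -> chart_dom d p ->
  (jac c d p)^T *m invmx (metric c p) *m jac c d p = invmx (metric d p).
Proof.
move=> cp dp; rewrite (metric_jac hR cp dp).
have JU := jac_unit hM cp dp; have gU := metric_unit hR dp.
set J := jac c d p in JU *; set g := metric d p in gU *.
have e : J *m g *m J^T *m (invmx J^T *m invmx g *m invmx J) = 1%:M.
  have JT : J^T \in unitmx by rewrite unitmx_tr.
  by rewrite !mulmxA (mulmxK JT) (mulmxK gU) (mulmxV JU).
have u : J *m g *m J^T \in unitmx by rewrite !unitmx_mul unitmx_tr JU gU.
have -> : invmx (J *m g *m J^T) = invmx J^T *m invmx g *m invmx J.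
  by apply: (can_inj (mulKmx u)); rewrite mulmxV.
by rewrite !mulmxA mulmxV ?unitmx_tr // mul1mx mulmxKV.
Qed.

Definition qendo k (t : tensor_field M k.+1) : endo_field M :=
  fun c p => qmx (invmx (metric c p)) (t c p) *m invmx (metric c p).

Lemma qendo_par k (t : tensor_field M k.+1) : parallel_form t -> parallel_endo (qendo t).
Proof.
move=> tp; have [[tj ts _] _] := tp; split.
- move=> c d p cp dp; rewrite /qendo (tj c d p cp dp) qmx_pull (ginv_jac cp dp).
  have JU := jac_unit hM cp dp.
  rewrite -!mulmxA; congr (_ *m (_ *m _)); rewrite mulmxA.
  exact: ginv_jac.
- move=> c; have sg := @ginv_smooth c.
  have h := smooth_on_mulmx (@oC c) (smooth_on_qmx (@oC c) sg (ts c)) sg.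
  by apply: (smooth_on_ext (@oC c)) h => y _.
- move=> c p i cp.
  have dg := ginv_par i cp.
  have dq := @is_derive_qmx R _ (chart_map c p) (delta_mx 0 i) n
     (fun y => invmx (metric c (chart_inv c y))) (skew_connection T c p i) _ k (fun y => t c (chart_inv c y)) _.
  cbv beta in dq; rewrite (chart_mapK hM cp) in dq.
  have := is_derive_mulmx (dq ((is_derive_mxP _ _ _ _).1 dg) (form_par i cp tp)) dg.
  case=> _; cbv beta; rewrite (chart_mapK hM cp) => E; apply: (etrans E).
  rewrite /qendo mulmxDl mulmxN mulmxDr opprD !mulmxA addrA.
  by rewrite -[X in X - _]addrA subrr addr0.
Qed.

Lemma endo_pull_par k (t : tensor_field M k) (A : endo_field M) :
  parallel_form t -> parallel_endo A -> parallel_form (fun c p => pull (A c p) (t c p)).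
Proof.
move=> tp [Aj As Ap]; have [[tj ts ta] _] := tp; split; first split.
- move=> c d p cp dp; rewrite (tj c d p cp dp) !pull_mul.
  by congr (pull _ _); exact: Aj.
- by move=> c j; apply: (smooth_on_pull (@oC c)) => //; exact: As.
- by move=> c p cp; apply: pull_alternating; exact: ta.
- move=> c p i cp; apply/ffunP => j; rewrite !ffunE; apply/eqP; rewrite subr_eq0; apply/eqP.
  have dA := is_derive_partial i cp (@As c); rewrite (Ap c p i cp) in dA.
  have dA' a b : is_derive (chart_map c p) (delta_mx 0 i) (fun y => A c (chart_inv c y) a b)
     ((skew_connection T c p i *m A c (chart_inv c (chart_map c p)) -
       A c (chart_inv c (chart_map c p)) *m skew_connection T c p i) a b).
    by rewrite (chart_mapK hM cp); have /is_derive_mxP := dA.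
  have dt l : is_derive (chart_map c p) (delta_mx 0 i) (fun y => t c (chart_inv c y) l)
     (dact (skew_connection T c p i) (t c (chart_inv c (chart_map c p))) l).
    by rewrite (chart_mapK hM cp); exact: form_par.
  have [_ E] := is_derive_pull_conn j dA' dt; apply: (etrans E).
  by rewrite (chart_mapK hM cp) ffunE.
Qed.

Definition cfield k (t : tensor_field M k) (f : tensor_field M k.+1) : chart M -> M -> 'rV[R]_n :=
  fun c p => cvec (invmx (metric c p)) (t c p) (f c p) *m invmx (metric c p).

Lemma cfield_par k (t : tensor_field M k) (f : tensor_field M k.+1) :
  parallel_form t -> parallel_form f -> parallel_vec (cfield t f).
Proof.
move=> tp fp; have [[tj ts _] _] := tp; have [[fj fs _] _] := fp; split.
- move=> c d p cp dp; rewrite /cfield (tj c d p cp dp) (fj c d p cp dp) cvec_pull (ginv_jac cp dp).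
  by rewrite -!mulmxA; congr (_ *m _); rewrite mulmxA (ginv_jac cp dp).
- move=> c; have sg := @ginv_smooth c.
  have h := smooth_on_mulmx (@oC c) (smooth_on_cvec (@oC c) sg (ts c) (fs c)) sg.
  by apply: (smooth_on_ext (@oC c)) h => y _.
- move=> c p i cp.
  have dg := ginv_par i cp.
  have dq := @is_derive_cvec R _ (chart_map c p) (delta_mx 0 i) n
     (fun y => invmx (metric c (chart_inv c y))) (skew_connection T c p i) _ k
     (fun y => t c (chart_inv c y)) (fun y => f c (chart_inv c y)).
  cbv beta in dq; rewrite (chart_mapK hM cp) in dq.
  have := is_derive_mulmx (dq ((is_derive_mxP _ _ _ _).1 dg) (form_par i cp tp) (form_par i cp fp)) dg.
  case=> _; cbv beta; rewrite (chart_mapK hM cp) => E; apply: (etrans E).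
  by rewrite /cfield mulmxN mulmxDr opprD !mulmxA addrA subrr add0r.
Qed.

End ParallelFields.

(** * The model torsion *)

(* Components of forms on R^8 are integers; they are tabulated by functions of
   the list of indices, and the finitely many identities between them are
   checked by computation. *)
Section Tables.
Context {R : realType}.

(** Laplace expansion along the first row over the integers. The test for zero skips the minors of
    zero entries, which keeps the evaluation of these sparse determinants short. *)
Fixpoint ldet (n : nat) (f : nat -> nat -> int) : int :=
  if n is m.+1 then
    foldr (fun j s => (if f 0%N j == 0 then 0
      else (-1) ^+ j * f 0%N j * ldet m (fun a b => f a.+1 (bump j b))) + s) 0 (iota 0 n)
  else 1.

Lemma foldr_ord n (F : nat -> int) :
  foldr (fun j s => F j + s) 0 (iota 0 n) = \sum_(j < n) F j.
Proof.
rewrite -(big_mkord xpredT) /index_iota subn0.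
by elim: (iota 0 n) => [|a s IH] /=; rewrite ?big_nil // big_cons IH.
Qed.

Lemma ldetS n (f : nat -> nat -> int) : ldet n.+1 f = \sum_(j < n.+1)
  (if f 0%N j == 0 then 0 else (-1) ^+ j * f 0%N j * ldet n (fun a b => f a.+1 (bump j b))).
Proof.
exact: (foldr_ord n.+1 (fun j => if f 0%N j == 0 then 0
  else (-1) ^+ j * f 0%N j * ldet n (fun a b => f a.+1 (bump j b)))).
Qed.

Lemma ldetE n (f : nat -> nat -> int) : \det (\matrix_(a < n, b < n) (f a b)%:~R : 'M[R]_n) = (ldet n f)%:~R.
Proof.
elim: n f => [|n IH] f; first by rewrite det_mx00.
rewrite ldetS (expand_det_row _ ord0) rmorph_sum.
apply: eq_bigr => j _; rewrite mxE /cofactor.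
have -> : row' ord0 (col' j (\matrix_(a < n.+1, b < n.+1) (f a b)%:~R : 'M[R]_n.+1)) =
    \matrix_(a < n, b < n) (f a.+1 (bump j b))%:~R.
  by apply/matrixP => a b; rewrite !mxE.
rewrite (IH (fun a b => f a.+1 (bump j b))) add0n -[nat_of_ord ord0]/0%N /=.
case: eqP => [->|_]; first by rewrite mul0r.
by rewrite !rmorphM /= rmorphXn /= rmorphN1 mulrCA mulrA.
Qed.

Definition ixs k (j : {ffun 'I_k -> 'I_8}) : seq nat := [seq val (j a) | a <- enum 'I_k].

Lemma nth_ixs k (j : {ffun 'I_k -> 'I_8}) (a : 'I_k) : nth 0%N (ixs j) a = j a.
Proof. by rewrite /ixs (nth_map a) ?size_enum_ord // nth_ord_enum. Qed.

Lemma ixs_icons k (l : 'I_8) (j : {ffun 'I_k -> 'I_8}) : ixs (icons l j) = val l :: ixs j.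
Proof.
rewrite /ixs enum_ordSl /= icons0; congr (_ :: _); rewrite -map_comp.
by apply: eq_map => a /=; rewrite iconsS.
Qed.

Lemma ixs0 (j : {ffun 'I_0 -> 'I_8}) : ixs j = [::].
Proof. by rewrite /ixs; case: (enum 'I_0) => [//|[]]. Qed.

(** The lists contain indices counted from 0, as in the ordinals, whereas the index lists of [eform]
    count from 1. *)
Definition rep k (t : tens R 8 k) (f : seq nat -> int) := forall j, t j = (f (ixs j))%:~R.

Lemma repD k (t s : tens R 8 k) f g : rep t f -> rep s g -> rep (t + s) (fun i => f i + g i).
Proof. by move=> h h' j; rewrite ffunE h h' rmorphD. Qed.

Lemma repN k (t : tens R 8 k) f : rep t f -> rep (- t) (fun i => - f i).
Proof. by move=> h j; rewrite ffunE h rmorphN. Qed.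

Lemma repZ k (t : tens R 8 k) f (a : int) : rep t f -> rep (a%:~R *: t) (fun i => a * f i).
Proof. by move=> h j; rewrite ffunE h rmorphM. Qed.

Definition efZ (s i : seq nat) : int :=
  ldet (size s) (fun a b => ((nth 0%N i a).+1 == nth 0%N s b)%:R).

Lemma rep_eform s : rep (eform R s) (efZ s).
Proof.
move=> j; rewrite ffunE /efZ -ldetE; congr (\det _); apply/matrixP => a b.
by rewrite !mxE nth_ixs; case: eqP.
Qed.

(** The sign of the concatenation of [s] and [i] as a determinant; the predecessor converts [s],
    which counts from 1. *)
Definition hodgeZ (s i : seq nat) : int :=
  ldet 8 (fun a b => ((if (a < 4)%N then (nth 0%N s a).-1 else nth 0%N i (a - 4)) == b)%:R).

Lemma det_col_mx_perm m k (A : 'M[R]_(m, m + k)) (B : 'M[R]_(k, m + k)) (p : 'S_m) :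
  \det (col_mx (row_perm p A) B) = (-1) ^+ p * \det (col_mx A B).
Proof.
have -> : col_mx (row_perm p A) B = block_mx (perm_mx p) 0 0 1%:M *m col_mx A B.
  by rewrite mul_block_col !mul0mx mul1mx add0r addr0 row_permE.
by rewrite det_mulmx det_ublock det1 mulr1 det_perm.
Qed.

(** Only the permutations of the four indices contribute to the sum in [hodge]. Each contributes the
    same determinant, as its sign occurs twice, and their number cancels the factor 1 / 4!. *)
Lemma hodge_e4 (a b c d : nat) : all (fun x => (0 < x <= 8)%N) [:: a; b; c; d] ->
  rep (hodge (e4 R a b c d)) (hodgeZ [:: a; b; c; d]).
Proof.
move=> hs j; set s := [:: a; b; c; d].
pose i0 : {ffun 'I_4 -> 'I_8} := [ffun x : 'I_4 => inord (nth 0%N s x).-1].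
have i0E (x : 'I_4) : (i0 x).+1 = nth 0%N s x.
  have : nth 0%N s x \in s by apply: mem_nth; case: x.
  move=> /(allP hs)/andP[x0 x8]; rewrite ffunE inordK prednK //.
pose D (i : {ffun 'I_4 -> 'I_8}) : R := \det (col_mx (ix_mx R i) (ix_mx R j) : 'M[R]_8).
have Dperm (p : 'S_4) : D [ffun x => i0 (p x)] = (-1) ^+ p * D i0.
  rewrite /D; have -> : ix_mx R [ffun x => i0 (p x)] = row_perm p (ix_mx R i0).
    by apply/matrixP => x y; rewrite !mxE ffunE.
  exact: (@det_col_mx_perm 4 4 (ix_mx R i0) (ix_mx R j) p).
have -> : hodge (e4 R a b c d) j = D i0.
  rewrite ffunE.
  have -> : \sum_(i : {ffun 'I_4 -> 'I_8}) e4 R a b c d i * D i = (4`!)%:R * D i0.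
    transitivity (\sum_(i : {ffun 'I_4 -> 'I_8}) \sum_(p : 'S_4)
        (-1) ^+ p * ((i == [ffun x => i0 (p x)])%:R * D i)).
      apply: eq_bigr => i _; rewrite ffunE /determinant mulr_suml; apply: eq_bigr => p _.
      rewrite -mulrA; congr (_ * (_ * _)).
      have [->|ne] := eqVneq i [ffun x => i0 (p x)].
        by rewrite big1 // => x _; rewrite mxE ffunE i0E eqxx.
      have [x xi] : exists x, i x != i0 (p x).
        apply/existsP; apply: contra_neqT ne; rewrite negb_exists => /forallP h.
        by apply/ffunP => x; rewrite ffunE; apply/eqP; move: (h x); rewrite negbK.
      rewrite (bigD1 x) //= mxE -i0E eqSS (_ : (i x == i0 (p x) :> nat) = false) ?mul0r //.
      by apply/negbTE; move: xi; rewrite -val_eqE.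
    rewrite exchange_big /=.
    transitivity (\sum_(p : 'S_4) D i0).
      apply: eq_bigr => p _; rewrite (bigD1 [ffun x => i0 (p x)]) //= big1 => [|i ne].
        by rewrite eqxx mul1r addr0 Dperm mulrA -signr_addb addbb mul1r.
      by rewrite (negbTE ne) mul0r mulr0.
    by rewrite sumr_const [RHS]mulr_natl; congr (_ *+ _); exact: card_Sn.
  by rewrite mulrA mulVf ?mul1r // pnatr_eq0.
rewrite /D /hodgeZ -ldetE; congr (\det _); apply/matrixP => x y.
rewrite mxE [RHS]mxE; case: fintype.splitP => z xz; rewrite mxE xz.
  rewrite ltn_ord -i0E /= eq_sym -val_eqE eq_sym.
  by case: eqP.
rewrite ltnNge leq_addr /= addKn nth_ixs -val_eqE.
by case: eqP.
Qed.

Definition sumI (f : nat -> int) : int := foldr (fun j s => f j + s) 0 (iota 0 8).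

Lemma sumIE (f : nat -> int) : \sum_(j < 8) ((f j)%:~R : R) = (sumI f)%:~R.
Proof. by rewrite /sumI foldr_ord rmorph_sum. Qed.

Fixpoint sumk (k : nat) (g : seq nat -> int) : int :=
  if k is k'.+1 then sumI (fun l => sumk k' (fun s => g (l :: s))) else g [::].

Lemma sumkE k (g : seq nat -> int) :
  \sum_(j : {ffun 'I_k -> 'I_8}) ((g (ixs j))%:~R : R) = (sumk k g)%:~R.
Proof.
elim: k g => [|k IH] g /=.
  rewrite (bigD1 (ffun0 (card_ord 0))) //= big1 ?addr0 ?ixs0 // => j /eqP[].
  by apply/ffunP => -[].
rewrite (@sum_ffunS _ 8 k _ (@icons 8 k)) //.
rewrite -sumIE; apply: eq_bigr => l _; rewrite -IH.
by apply: eq_bigr => j _; rewrite ixs_icons.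
Qed.

Lemma rep_ins k (t : tens R 8 k.+1) f (l : 'I_8) : rep t f ->
  rep (ins (delta_mx 0 l) t) (fun s => f (val l :: s)).
Proof. by move=> h j; rewrite insE h ixs_icons. Qed.

Lemma rep_ip k (t s : tens R 8 k) f g : rep t f -> rep s g ->
  ip 1%:M t s = (sumk k (fun i => f i * g i))%:~R.
Proof.
by move=> h h'; rewrite ip1 -sumkE; apply: eq_bigr => j _; rewrite h h' rmorphM.
Qed.

Definition pull1Z (A : nat -> nat -> int) (f : seq nat -> int) : seq nat -> int :=
  fun s => if s is [:: i; j; k] then
    sumI (fun a => if A i a == 0 then 0 else A i a *
      sumI (fun b => if A j b == 0 then 0 else A j b *
        sumI (fun c => if A k c == 0 then 0 else A k c * f [:: a; b; c]))) else 0.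

Lemma rep_pull (A : nat -> nat -> int) (t : tens R 8 3) f : rep t f ->
  rep (pull (\matrix_(i, j) (A i j)%:~R) t) (pull1Z A f).
Proof.
move=> h j.
have [a [b [c ->]]] : exists a b c, j = ix3 a b c.
  exists (j (inord 0)), (j (inord 1)), (j (inord 2)); apply/ffunP => x; rewrite ffunE.
  case: x => -[|[|[|//]]] ix /=; congr (j _); apply/val_inj; rewrite /= inordK //.
rewrite ix3E -[LHS]insE -[LHS]insE -[LHS]insE -!pull_ins !ixs_icons ixs0 /=.
set B := \matrix_(_, _) _.
rewrite [LHS]ffunE (bigD1 (ffun0 (card_ord 0))) //= big_ord0 mulr1 [X in _ + X]big1 ?addr0; last first.
  by move=> i /eqP[]; apply/ffunP => -[].
have z (x y : int) : (if x == 0 then 0 else x * y) = x * y by case: eqP => [->|//]; rewrite mul0r.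
rewrite -!rowE -[sumI _]/(sumI (fun a0 => _)).
rewrite [LHS]ffunE.
transitivity (\sum_(c0 < 8) \sum_(b0 < 8) \sum_(a0 < 8) (A c c0)%:~R * ((A b b0)%:~R * ((A a a0)%:~R * (f [:: val a0; val b0; val c0])%:~R)) : R).
  apply: eq_bigr => c0 _; rewrite mxE mxE [ins _ _ _]ffunE mulr_sumr; apply: eq_bigr => b0 _.
  rewrite mxE mxE [ins _ _ _]ffunE !mulr_sumr; apply: eq_bigr => a0 _.
  by rewrite mxE mxE h !ixs_icons ixs0.
rewrite exchange_big /=; under eq_bigr => b0 _ do rewrite exchange_big /=.
rewrite exchange_big /=.
apply: (etrans _ (sumIE _)); apply: eq_bigr => a0 _.
rewrite z rmorphM /= -sumIE mulr_sumr; apply: eq_bigr => b0 _.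
rewrite z rmorphM /= -sumIE !mulr_sumr; apply: eq_bigr => c0 _.
by rewrite z rmorphM /=; ring.
Qed.

Definition dactT (k : nat) (B : nat -> nat -> int) (f : seq nat -> int) : seq nat -> int :=
  fun s => foldr (fun a x => sumI (fun l => if B (nth 0%N s a) l == 0 then 0 else
    B (nth 0%N s a) l * f (set_nth 0%N s a l)) + x) 0 (iota 0 k).

Lemma rep_dact k (B : nat -> nat -> int) (t : tens R 8 k) f : rep t f ->
  rep (dact (\matrix_(i, j) (B i j)%:~R) t) (dactT k B f).
Proof.
move=> h j; rewrite ffunE /dactT foldr_ord rmorph_sum; apply: eq_bigr => a _.
rewrite /= -sumIE; apply: eq_bigr => l _.
have z (x y : int) : (if x == 0 then 0 else x * y) = x * y by case: eqP => [->|//]; rewrite mul0r.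
rewrite z rmorphM mxE h !nth_ixs; congr (_ * (f _)%:~R).
have sz (i : {ffun 'I_k -> 'I_8}) : size (ixs i) = k by rewrite size_map size_enum_ord.
apply: (@eq_from_nth _ 0%N) => [|b].
  by rewrite size_set_nth !sz (maxn_idPr _).
rewrite sz => bk; rewrite nth_set_nth /= (nth_ixs _ (Ordinal bk)) (nth_ixs j (Ordinal bk)) ffunE.
by rewrite -val_eqE /=; case: eqP.
Qed.

Fixpoint lists (k : nat) : seq (seq nat) :=
  if k is k'.+1 then [seq l :: s | l <- iota 0 8, s <- lists k'] else [:: [::]].

Lemma mem_lists k (j : {ffun 'I_k -> 'I_8}) : ixs j \in lists k.
Proof.
have mem_l (s : seq nat) : all (fun x => x < 8)%N s -> s \in lists (size s).
  elim: s => [|x s IH] //; move=> /andP[x8 /IH h]; apply/allpairsP; exists (x, s); split=> //.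
  by rewrite mem_iota.
have : all (fun x => x < 8)%N (ixs j) by apply/allP => x /mapP[a _ ->]; exact: ltn_ord.
by move=> /mem_l; rewrite size_map size_enum_ord.
Qed.

Lemma rep_eq k (t s : tens R 8 k) f g : rep t f -> rep s g ->
  all (fun i => f i == g i) (lists k) -> t = s.
Proof. by move=> h h' /allP e; apply/ffunP => j; rewrite h h' (eqP (e _ (mem_lists j))). Qed.

Lemma rep0 k : rep (0 : tens R 8 k) (fun _ => 0).
Proof. by move=> j; rewrite ffunE. Qed.

(** Stores all components in a tree, so that the determinants behind them are evaluated once and
    later computations only look values up. *)
Fixpoint tabulate (k : nat) (f : seq nat -> int) : GenTree.tree int :=
  if k is k'.+1 then GenTree.Node 0 [seq tabulate k' (fun s => f (l :: s)) | l <- iota 0 8]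
  else GenTree.Leaf (f [::]).

Fixpoint look (t : GenTree.tree int) (s : seq nat) {struct s} : int :=
  match t, s with
  | GenTree.Leaf x, [::] => x
  | GenTree.Node _ ts, l :: s' => look (nth (GenTree.Leaf 0) ts l) s'
  | _, _ => 0
  end.

Lemma rep_look k (t : tens R 8 k) f T : rep t f -> tabulate k f = T -> rep t (look T).
Proof.
move=> h <- j; rewrite h; congr (_%:~R); elim: k {t h} f j => [|k IH] f j; first by rewrite ixs0.
have -> : j = icons (j ord0) [ffun a => j (lift ord0 a)].
  apply/ffunP => x; case: (unliftP ord0 x) => [y ->|->]; rewrite ?iconsS ?icons0 //.
  by rewrite ffunE.
move: (j ord0) [ffun a => _] => l i; rewrite ixs_icons.
rewrite -[look _ _]/(look (nth (GenTree.Leaf 0) [seq tabulate k (fun s => f (l :: s)) | l <- iota 0 8] l) (ixs i)).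
by rewrite (nth_map 0%N) ?size_iota // nth_iota // add0n (IH (fun s => f (val l :: s))).
Qed.

End Tables.

(** * The form [Phi0], the torsion of type II and their contractions *)

Section Model.
Context {R : realType}.
Implicit Types a b : R.

Definition PhiF (s : seq nat) : int :=
  let phi (u : seq nat) := efZ u s in
  let hod (u : seq nat) := hodgeZ u s in
  let f (e : seq nat -> int) :=
    (e [:: 1; 2; 7; 8] + e [:: 3; 4; 7; 8] + e [:: 5; 6; 7; 8])
    + (e [:: 2; 4; 6; 8] - e [:: 2; 3; 5; 8] - e [:: 1; 4; 5; 8] - e [:: 1; 3; 6; 8]) in
  f phi + f hod.

Lemma hodgeD (t s : tens R 8 4) : hodge (t + s) = hodge t + hodge s.
Proof.
apply/ffunP => j; rewrite !ffunE -mulrDr; congr (_ * _); rewrite -big_split /=.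
by apply: eq_bigr => i _; rewrite ffunE mulrDl.
Qed.

Lemma hodgeN (t : tens R 8 4) : hodge (- t) = - hodge t.
Proof.
apply/ffunP => j; rewrite !ffunE -mulrN; congr (_ * _); rewrite -sumrN.
by apply: eq_bigr => i _; rewrite ffunE mulNr.
Qed.

Definition PhiT := Eval vm_compute in tabulate 4 PhiF.
Definition PhiZ := look PhiT.

Lemma rep_Phi0 : rep (Phi0 R) PhiZ.
Proof.
suff h : rep (Phi0 R) PhiF by apply: rep_look h _; vm_compute.
have e (a b c d : nat) : rep (e4 R a b c d) (efZ [:: a; b; c; d]) by exact: (@rep_eform R [:: a; b; c; d]).
rewrite /Phi0 /phi0 !(hodgeD, hodgeN); apply: repD.
  by do ![apply: repD | apply: repN | exact: e].
by do ![apply: repD | apply: repN | exact: hodge_e4].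
Qed.

Definition D1Z s : int := efZ [:: 2; 4; 6] s - efZ [:: 1; 4; 5] s.
Definition D2Z s : int := - efZ [:: 2; 3; 5] s - efZ [:: 1; 3; 6] s.
Definition D3Z s : int := - efZ [:: 1; 3; 5] s + efZ [:: 2; 4; 5] s.
Definition D4Z s : int := efZ [:: 1; 4; 6] s + efZ [:: 2; 3; 6] s.
Definition D5Z s : int := efZ [:: 1; 2; 3] s - efZ [:: 3; 5; 6] s.

Definition X1 : tens R 8 3 := D3 R + D4 R.
Definition X2 : tens R 8 3 := 2 *: D1 R + 5 *: D2 R + 3 *: D5 R.
Definition X3 : tens R 8 3 := D1 R - D2 R - 2 *: D5 R.
Definition X1T := Eval vm_compute in tabulate 3 (fun s => D3Z s + D4Z s).
Definition X2T := Eval vm_compute in tabulate 3 (fun s => 2 * D1Z s + 5 * D2Z s + 3 * D5Z s).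
Definition X3T := Eval vm_compute in tabulate 3 (fun s => D1Z s - D2Z s - 2 * D5Z s).
Definition X1Z := look X1T.
Definition X2Z := look X2T.
Definition X3Z := look X3T.

Lemma rep_D : [/\ rep (D1 R) D1Z, rep (D2 R) D2Z, rep (D3 R) D3Z, rep (D4 R) D4Z & rep (D5 R) D5Z].
Proof.
have e (a b c : nat) : rep (e3 R a b c) (efZ [:: a; b; c]) by exact: (@rep_eform R [:: a; b; c]).
by split; do ![apply: repD | apply: repN | exact: e].
Qed.

Lemma rep_X : [/\ rep X1 X1Z, rep X2 X2Z & rep X3 X3Z].
Proof.
have [h1 h2 h3 h4 h5] := rep_D; split.
- by apply: rep_look (repD h3 h4) _; vm_compute.
- by apply: rep_look (repD (repD (repZ (2 : int) h1) (repZ (5 : int) h2)) (repZ (3 : int) h5)) _; vm_compute.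
- by apply: rep_look (repD (repD h1 (repN h2)) (repN (repZ (2 : int) h5))) _; vm_compute.
Qed.

Lemma torsion_IIE a1 a2 b : torsion_II a1 a2 b = a1 *: X1 + a2 *: X2 + b *: X3.
Proof. by []. Qed.

Lemma insD n k (v : 'rV[R]_n) (t s : tens R n k.+1) : ins v (t + s) = ins v t + ins v s.
Proof.
apply/ffunP => j; rewrite !ffunE -big_split /=; apply: eq_bigr => l _.
by rewrite ffunE mulrDr.
Qed.

Lemma insZ n k (v : 'rV[R]_n) c (t : tens R n k.+1) : ins v (c *: t) = c *: ins v t.
Proof.
apply/ffunP => j; rewrite !ffunE scaler_sumr; apply: eq_bigr => l _.
by rewrite ffunE mulrCA.
Qed.

Lemma cvecD n k (g : 'M[R]_n) (t s : tens R n k) (f : tens R n k.+1) :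
  cvec g (t + s) f = cvec g t f + cvec g s f.
Proof. by apply/rowP => l; rewrite !mxE ipDl. Qed.

Lemma cvecZ n k (g : 'M[R]_n) c (t : tens R n k) (f : tens R n k.+1) :
  cvec g (c *: t) f = c *: cvec g t f.
Proof. by apply/rowP => l; rewrite !mxE ipZl. Qed.

Definition i7 : 'I_8 := Ordinal (isT : 6 < 8)%N.
Definition i8 : 'I_8 := Ordinal (isT : 7 < 8)%N.

Lemma ins_torsion_II a1 a2 b (l : 'I_8) : (6 <= l)%N -> ins (delta_mx 0 l) (torsion_II a1 a2 b) = 0.
Proof.
move=> l6; rewrite torsion_IIE !insD !insZ; have [h1 h2 h3] := rep_X.
have z (t : tens R 8 3) f : rep t f ->
    all (fun s => (f (6%N :: s) == 0) && (f (7%N :: s) == 0)) (lists 2) -> ins (delta_mx 0 l) t = 0.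
  move=> h /allP e; apply: (@rep_eq R 2 _ 0 _ _ (rep_ins l h) (@rep0 R 2)); apply/allP => s /e /andP[e6 e7].
  by case: l l6 => -[|[|[|[|[|[|[|[|//]]]]]]]].
have -> : ins (delta_mx 0 l) X1 = 0 by apply: z h1 _; vm_compute.
have -> : ins (delta_mx 0 l) X2 = 0 by apply: z h2 _; vm_compute.
have -> : ins (delta_mx 0 l) X3 = 0 by apply: z h3 _; vm_compute.
by rewrite !scaler0 !addr0.
Qed.

Lemma cvec_rep k (t : tens R 8 k) f s g (h : nat -> int) : rep t f -> rep s g ->
  all (fun l => sumk k (fun i => f i * g (l :: i)) == h l) (iota 0 8) ->
  cvec 1%:M t s = \row_l (h l)%:~R.
Proof.
move=> tf sg /allP e; apply/rowP => l; rewrite !mxE (rep_ip tf (rep_ins l sg)).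
by rewrite (eqP (e l _)) // mem_iota /= ltn_ord.
Qed.

(** Each component is counted 3! times: 24 is 6 * 4, from the four terms of [D3 + D4], and 84 is 6 *
    (2 * 2 + 5 * 2), from [2 *: D1 + 5 *: D2]. In the part with coefficient [b] the contributions of
    [D1] and [D2] cancel. *)
Lemma cvec_torsion_II a1 a2 b : cvec 1%:M (torsion_II a1 a2 b) (Phi0 R) =
  (24 * a1) *: delta_mx 0 i7 - (84 * a2) *: delta_mx 0 i8.
Proof.
have [h1 h2 h3] := rep_X; rewrite torsion_IIE !cvecD !cvecZ.
rewrite (cvec_rep (h := fun l => if l == 6%N then 24 else 0) h1 rep_Phi0); last by vm_compute.
rewrite (cvec_rep (h := fun l => if l == 7%N then - 84%:Z else 0) h2 rep_Phi0); last by vm_compute.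
rewrite (cvec_rep (h := fun l => 0) h3 rep_Phi0); last by vm_compute.
apply/rowP => l; rewrite !mxE /= -!val_eqE /=.
by case: eqP => [->|_]; case: eqP => [?|_] //=; ring.
Qed.

Definition tab (s : seq (seq int)) (i j : nat) : int := nth 0 (nth [::] s i) j.

(** Half of [NX] and half of [NZ] are complementary orthogonal projectors of rank 3 on span(e_1,
    ..., e_6), and half of [NY] is a symmetric involution exchanging their images. By
    [qmx_torsion_II], Q is thus three copies of the matrix with diagonal [qx], [qz] and off-diagonal
    entry [qy]. *)
Definition NX : nat -> nat -> int := tab
 [:: [:: 1; 0; 0; 0; - 1%:Z]; [:: 0; 1; 0; 0; 0; 1]; [:: 0; 0; 2]; [::];
     [:: - 1%:Z; 0; 0; 0; 1]; [:: 0; 1; 0; 0; 0; 1]].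
Definition NY : nat -> nat -> int := tab
 [:: [:: 0; 0; 0; 0; 0; - 2%:Z]; [:: 0; 0; 0; 0; - 2%:Z]; [:: 0; 0; 0; 2]; [:: 0; 0; 2];
     [:: 0; - 2%:Z]; [:: - 2%:Z]].
Definition NZ : nat -> nat -> int := tab
 [:: [:: 1; 0; 0; 0; 1]; [:: 0; 1; 0; 0; 0; - 1%:Z]; [::]; [:: 0; 0; 0; 2];
     [:: 1; 0; 0; 0; 1]; [:: 0; - 1%:Z; 0; 0; 0; 1]].

Definition qx a1 a2 b : R := 4 * (a1 ^+ 2 + (5 * a2 - b) ^+ 2 + (3 * a2 - 2 * b) ^+ 2).
Definition qy a1 a2 b : R := 4 * a1 * (2 * b - 3 * a2).
Definition qz a1 a2 b : R := 4 * (a1 ^+ 2 + (2 * a2 + b) ^+ 2).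

Definition mxZ (f : nat -> nat -> int) : 'M[R]_8 := \matrix_(i, j) (f i j)%:~R.

Lemma qmx_torsion_II a1 a2 b : 2 *: qmx 1%:M (torsion_II a1 a2 b) =
  qx a1 a2 b *: mxZ NX + qy a1 a2 b *: mxZ NY + qz a1 a2 b *: mxZ NZ.
Proof.
have [h1 h2 h3] := rep_X.
pose q f g i j := sumk 2 (fun u => f (i :: u) * g (j :: u)).
have r (t s : tens R 8 3) f g : rep t f -> rep s g -> forall i j : 'I_8,
    ip 1%:M (ins (delta_mx 0 i) t) (ins (delta_mx 0 j) s) = (q f g i j)%:~R :> R.
  by move=> tf sg i j; exact: (@rep_ip R 2 _ _ _ _ (rep_ins i tf) (rep_ins j sg)).
have m8 (k : 'I_8) : val k \in iota 0 8 by rewrite mem_iota /= ltn_ord.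
(* One integer identity for each monomial a1^2, a1 a2, a1 b, a2^2, a2 b, b^2 of a quadratic form;
   those of the mixed monomials are divided by 2. *)
have h : all (fun i => all (fun j => 
     [&& q X1Z X1Z i j *+ 2 == NX i j *+ 4 + NZ i j *+ 4,
         (q X1Z X2Z i j + q X2Z X1Z i j) == - NY i j *+ 6,
         (q X1Z X3Z i j + q X3Z X1Z i j) == NY i j *+ 4,
         q X2Z X2Z i j *+ 2 == NX i j *+ 136 + NZ i j *+ 16 &
         ((q X2Z X3Z i j + q X3Z X2Z i j) == - NX i j *+ 44 + NZ i j *+ 8) &&
         (q X3Z X3Z i j *+ 2 == NX i j *+ 20 + NZ i j *+ 4)]) (iota 0 8)) (iota 0 8).
  by vm_compute.
apply/matrixP => i j; rewrite !mxE torsion_IIE !insD !insZ !(ipDl, ipDr, ipZl, ipZr).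
rewrite !(r _ _ _ _ h1 h1, r _ _ _ _ h1 h2, r _ _ _ _ h1 h3, r _ _ _ _ h2 h1, r _ _ _ _ h2 h2,
  r _ _ _ _ h2 h3, r _ _ _ _ h3 h1, r _ _ _ _ h3 h2, r _ _ _ _ h3 h3).
move/allP/(_ _ (m8 i))/allP/(_ _ (m8 j)): h => /and5P[/eqP e1 /eqP e2 /eqP e3 /eqP e4 /andP[/eqP e5 /eqP e6]].
have c (u v : int) : u = v -> u%:~R = v%:~R :> R by move=> ->.
move/c: e1; move/c: e2; move/c: e3; move/c: e4; move/c: e5; move/c: e6; clearbody q.
move: (NX _ _) (NY _ _) (NZ _ _) (q X1Z X1Z _ _) (q X1Z X2Z _ _) (q X1Z X3Z _ _) (q X2Z X1Z _ _)
  (q X2Z X2Z _ _) (q X2Z X3Z _ _) (q X3Z X1Z _ _) (q X3Z X2Z _ _) (q X3Z X3Z _ _).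
move=> nx ny nz q11 q12 q13 q21 q22 q23 q31 q32 q33.
rewrite !(rmorphD, rmorphN, rmorphMn) /=.
move: nx%:~R ny%:~R nz%:~R q11%:~R q12%:~R q13%:~R q21%:~R q22%:~R q23%:~R q31%:~R q32%:~R q33%:~R.
move=> {nx ny nz q11 q12 q13 q21 q22 q23 q31 q32 q33} nx ny nz q11 q12 q13 q21 q22 q23 q31 q32 q33.
move=> E6 E5 E4 E3 E2 E1.
have -> : q21 = - 6 * ny - q12 by lra.
have -> : q31 = 4 * ny - q13 by lra.
have -> : q32 = - 44 * nx + 8 * nz - q23 by lra.
have -> : q11 = 2 * nx + 2 * nz by lra.
have -> : q22 = 68 * nx + 8 * nz by lra.
have -> : q33 = 10 * nx + 2 * nz by lra.
by rewrite /qx /qy /qz; field.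
Qed.

Definition p78 : 'M[R]_8 := delta_mx i7 i7 + delta_mx i8 i8.

Lemma mxZ_mul f g h : all (fun i => all (fun j => sumI (fun l => f i l * g l j) == h i j) (iota 0 8)) (iota 0 8) ->
  mxZ f *m mxZ g = mxZ h.
Proof.
move=> e; apply/matrixP => i j; rewrite !mxE.
have m8 (k : 'I_8) : val k \in iota 0 8 by rewrite mem_iota /= ltn_ord.
transitivity (\sum_(l < 8) ((f i l * g l j)%:~R : R)).
  by apply: eq_bigr => l _; rewrite !mxE rmorphM.
apply: (etrans (sumIE (fun l => f i l * g l j))); congr (_%:~R).
exact/eqP/(allP (allP e _ (m8 i)) _ (m8 j)).
Qed.

Lemma p78E : p78 = mxZ (fun i j => ((i == j) && (6 <= i)%N)%:R).
Proof.
apply/matrixP => i j; rewrite !mxE -!val_eqE /=.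
by case: i => -[|[|[|[|[|[|[|[|//]]]]]]]] ?; case: j => -[|[|[|[|[|[|[|[|//]]]]]]]] ?; rewrite /= ?addr0 ?add0r.
Qed.

(* On the orthogonal complement of its kernel, Q has two eigenvalues, with sum s1
   and product s2. *)
Lemma kernel_projector a1 a2 b (Q := qmx 1%:M (torsion_II a1 a2 b))
    (s1 := qx a1 a2 b + qz a1 a2 b) (s2 := qx a1 a2 b * qz a1 a2 b - qy a1 a2 b ^+ 2) :
  Q *m Q - s1 *: Q + s2 *: 1%:M = s2 *: p78.
Proof.
have e : Q = 2^-1 *: (qx a1 a2 b *: mxZ NX + qy a1 a2 b *: mxZ NY + qz a1 a2 b *: mxZ NZ).
  by rewrite -qmx_torsion_II scalerA mulVf ?scale1r.
have e1 : (1%:M : 'M[R]_8) = mxZ (fun i j => (i == j)%:R).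
  by apply/matrixP => i j; rewrite !mxE -val_eqE; case: eqP.
rewrite /s1 /s2 e {e Q s1 s2}; move: (qx _ _ _) (qy _ _ _) (qz _ _ _) => x y z.
rewrite -scalemxAl -scalemxAr !mulmxDl !mulmxDr -!scalemxAl -!scalemxAr.
pose F (f g : nat -> nat -> int) i j := sumI (fun l => f i l * g l j).
have [XX ZZ YY] : [/\ mxZ NX *m mxZ NX = mxZ (fun i j => NX i j *+ 2),
    mxZ NZ *m mxZ NZ = mxZ (fun i j => NZ i j *+ 2)
  & mxZ NY *m mxZ NY = mxZ (fun i j => ((i == j) && (i < 6)%N)%:R *+ 4)].
  by split; apply: mxZ_mul; vm_compute.
(* Only the sum of the two products of each pair enters the square of Q. One product is therefore
   kept opaque and the other is expressed through it. *)
have [XY YX ZY YZ] : [/\ mxZ NX *m mxZ NY = mxZ (F NX NY),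
    mxZ NY *m mxZ NX = mxZ (fun i j => NY i j *+ 2 - F NX NY i j), mxZ NZ *m mxZ NY = mxZ (F NZ NY)
  & mxZ NY *m mxZ NZ = mxZ (fun i j => NY i j *+ 2 - F NZ NY i j)].
  by split; apply: mxZ_mul; vm_compute.
have [XZ ZX] : mxZ NX *m mxZ NZ = mxZ (F NX NZ) /\
    mxZ NZ *m mxZ NX = mxZ (fun i j => NX i j *+ 2 + NZ i j *+ 2 - ((i == j) && (i < 6)%N)%:R *+ 4 - F NX NZ i j).
  by split; apply: mxZ_mul; vm_compute.
move: (F NX NY) (F NZ NY) (F NX NZ) XY YX ZY YZ XZ ZX => fxy fzy fxz XY YX ZY YZ XZ ZX.
rewrite XX YY ZZ XY YX ZY YZ XZ ZX p78E e1.
apply/matrixP => i j; rewrite !mxE ltnNge.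
move: (NX _ _) (NY _ _) (NZ _ _) (fxy _ _) (fzy _ _) (fxz _ _) => nx ny nz exy ezy exz.
case: (i == j :> nat); case: (6 <= i)%N => /=;
  rewrite !(rmorphD, rmorphN, rmorphMn, rmorph0, rmorph1) /=; by field.
Qed.

End Model.

Section Model2.
Context {R : realType}.
Implicit Types a b : R.

Lemma pull_scale m n k (c : R) (A : 'M[R]_(m, n)) (t : tens R n k) :
  pull (c *: A) t = c ^+ k *: pull A t.
Proof.
apply/ffunP => j; rewrite !ffunE [RHS]mulr_sumr; apply: eq_bigr => l _ /=.
rewrite mulrCA; congr (_ * _).
under eq_bigr => x _ do rewrite mxE.
by rewrite big_split /= prodr_const card_ord.
Qed.

(** For [a1 = a2 = 0] the eigenvalues of Q are 20 b^2 and 4 b^2. As they differ, the pull-back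
    weighs the components of the torsion unequally, and the cancellation in its contraction with
    [Phi0] disappears. The factor is (2 b^2)^3 b times 10 * 12^3, the last number being computed. *)
Lemma cvec_pull_torsion_II b (t := torsion_II 0 0 b) :
  cvec 1%:M (pull (qmx 1%:M t) t) (Phi0 R) = (80 * 12 ^+ 3 * b ^+ 7) *: delta_mx 0 i8.
Proof.
have [_ _ h3] := @rep_X R.
have -> : qmx 1%:M t = (2 * b ^+ 2) *: mxZ (fun i j => NX i j *+ 5 + NZ i j).
  apply: (scalerI (a := 2)) => //; rewrite /t qmx_torsion_II.
  apply/matrixP => i j; rewrite !mxE /qx /qy /qz rmorphD rmorphMn /=.
  move: (NX _ _) (NY _ _) (NZ _ _) => nx ny nz; ring.
have -> : t = b *: X3 by rewrite /t torsion_IIE !scale0r !add0r.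
rewrite pull_scale pullZ !cvecZ.
rewrite (cvec_rep (h := fun l => if l == 7%N then 10 * 12 ^+ 3 else 0) (rep_pull (fun i j => NX i j *+ 5 + NZ i j) h3) rep_Phi0).
  apply/rowP => l; rewrite !mxE /= -!val_eqE /=.
  by case: eqP => _ /=; rewrite ?rmorphM ?rmorphXn /=; ring.
by vm_compute.
Qed.

(** Phi(e_7, e_8, ., .), which is Z = e_12 + e_34 + e_56, the model of the Kaehler form of [X]. *)
Definition Z2 : tens R 8 2 := ins (delta_mx 0 i8) (ins (delta_mx 0 i7) (Phi0 R)).
Definition Z2Z (s : seq nat) : int := PhiZ (6%N :: 7%N :: s).

Lemma rep_Z2 : rep Z2 Z2Z.
Proof. exact: (rep_ins i8 (rep_ins i7 (@rep_Phi0 R))). Qed.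

Lemma Phi0_77 : ins (delta_mx 0 i7) (ins (delta_mx 0 i7) (Phi0 R)) = 0.
Proof.
apply: (@rep_eq R 2 _ 0 _ _ (rep_ins i7 (rep_ins i7 (@rep_Phi0 R))) (@rep0 R 2)).
by vm_compute.
Qed.

Lemma Phi0_88 : ins (delta_mx 0 i8) (ins (delta_mx 0 i8) (Phi0 R)) = 0.
Proof.
apply: (@rep_eq R 2 _ 0 _ _ (rep_ins i8 (rep_ins i8 (@rep_Phi0 R))) (@rep0 R 2)).
by vm_compute.
Qed.

Lemma Phi0_78 : ins (delta_mx 0 i7) (ins (delta_mx 0 i8) (Phi0 R)) = - Z2.
Proof.
apply: (@rep_eq R 2 _ (- Z2) _ _ (rep_ins i7 (rep_ins i8 (@rep_Phi0 R))) (repN rep_Z2)).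
by vm_compute.
Qed.

(** The source of the trace condition of [GH_W3]: the torsion has no contraction with the Kaehler
    form. *)
Lemma cvec_Z2 a1 a2 b : cvec 1%:M Z2 (torsion_II a1 a2 b) = 0.
Proof.
have [h1 h2 h3] := @rep_X R; apply/rowP => l.
rewrite !mxE torsion_IIE !insD !insZ !(ipDr, ipZr).
have z (t : tens R 8 3) f : rep t f ->
    all (fun l => sumk 2 (fun u => Z2Z u * f (l :: u)) == 0) (iota 0 8) ->
    ip 1%:M Z2 (ins (delta_mx 0 l) t) = 0.
  move=> h /allP e; have E := @rep_ip R 2 _ _ _ _ rep_Z2 (rep_ins l h); apply: (etrans E).
  by rewrite (eqP (e l _)) // mem_iota /= ltn_ord.
have -> : ip 1%:M Z2 (ins (delta_mx 0 l) X1) = 0 by apply: z h1 _; vm_compute.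
have -> : ip 1%:M Z2 (ins (delta_mx 0 l) X2) = 0 by apply: z h2 _; vm_compute.
have -> : ip 1%:M Z2 (ins (delta_mx 0 l) X3) = 0 by apply: z h3 _; vm_compute.
by rewrite !mulr0 !addr0.
Qed.

Definition mx2 n (t : tens R n 2) : 'M[R]_n := \matrix_(i, j) t (ix2 i j).

Lemma ix2E n (i j : 'I_n) : ix2 i j = icons i (icons j (ffun0 (card_ord 0))).
Proof.
apply/ffunP => x; rewrite ffunE.
have [->|[y ->]] : x = ord0 \/ exists y : 'I_1, x = lift ord0 y.
- by case: (unliftP ord0 x) => [y ->|->]; [right; exists y | left].
- by rewrite icons0.
- by rewrite iconsS (ord1 y) icons0.
Qed.

Lemma rep_mx2 (t : tens R 8 2) f : rep t f -> mx2 t = mxZ (fun i j => f [:: i; j]).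
Proof. by move=> h; apply/matrixP => i j; rewrite !mxE h ix2E !ixs_icons ixs0. Qed.

Lemma Z2_sqr : mx2 Z2 *m mx2 Z2 = p78 - 1%:M.
Proof.
rewrite (rep_mx2 rep_Z2) (mxZ_mul (h := fun i j => - ((i == j) && (i < 6)%N)%:R)); last by vm_compute.
rewrite p78E; apply/matrixP => i j; rewrite !mxE -val_eqE ltnNge.
by case: (val i == val j); case: (6 <= i)%N; rewrite /= ?rmorphN ?rmorph0 ?rmorph1 ?subr0 ?subrr ?sub0r ?oppr0.
Qed.

Lemma Z2_78 : p78 *m mx2 Z2 = 0.
Proof.
rewrite (rep_mx2 rep_Z2) p78E (mxZ_mul (h := fun i j => 0)); last by vm_compute.
by apply/matrixP => i j; rewrite !mxE.
Qed.

Definition soZ (i j a b : nat) : int :=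
  ((a.+1 == i) && (b.+1 == j))%:R - ((a.+1 == j) && (b.+1 == i))%:R.

Lemma so_eE i j : so_e R i j = mxZ (soZ i j).
Proof.
by apply/matrixP => a b; rewrite !mxE /soZ rmorphB /=; case: (_ && _); case: (_ && _).
Qed.

Lemma mxZD f g : mxZ (fun i j => f i j + g i j) = mxZ f + mxZ g :> 'M[R]_8.
Proof. by apply/matrixP => i j; rewrite !mxE rmorphD. Qed.

Lemma mxZN f : mxZ (fun i j => - f i j) = - mxZ f :> 'M[R]_8.
Proof. by apply/matrixP => i j; rewrite !mxE rmorphN. Qed.

(* Elements of spin(7) that annihilate the degenerate torsion e_3 /\ (e_1 - e_5)
   /\ (e_2 + e_6); their common kernel is only a line. *)
Definition Bd : 'M[R]_8 := - so_e R 1 2 + so_e R 5 6.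
Definition Bb : 'M[R]_8 := so_e R 1 3 + so_e R 2 4 + so_e R 3 5 + so_e R 4 6.
Definition Be : 'M[R]_8 := - so_e R 1 3 + so_e R 1 7 - so_e R 3 5 + so_e R 5 7.
Definition BdZ (i j : nat) : int := - soZ 1 2 i j + soZ 5 6 i j.
Definition BbZ (i j : nat) : int := soZ 1 3 i j + soZ 2 4 i j + soZ 3 5 i j + soZ 4 6 i j.
Definition BeZ (i j : nat) : int := - soZ 1 3 i j + soZ 1 7 i j - soZ 3 5 i j + soZ 5 7 i j.

Lemma BE : [/\ Bd = mxZ BdZ, Bb = mxZ BbZ & Be = mxZ BeZ].
Proof. by rewrite /Bd /Bb /Be !so_eE; split; rewrite -?mxZN -?mxZD. Qed.

Lemma isotropy_degenerate a : 
  [/\ isotropy_algebra (torsion_II 0 a (- 2 * a)) Bd, isotropy_algebra (torsion_II 0 a (- 2 * a)) Bb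
    & isotropy_algebra (torsion_II 0 a (- 2 * a)) Be].
Proof.
have tE : torsion_II 0 a (- 2 * a) = a *: (X2 + (- 2%:Z)%:~R *: X3).
  rewrite torsion_IIE scale0r add0r [RHS]scalerDr scalerA; congr (_ + _ *: _).
  by rewrite rmorphN mulrC.
have [_ h2 h3] := @rep_X R; have [ed eb ee] := BE.
have h (B : 'M[R]_8) (BZ : nat -> nat -> int) : B = mxZ BZ ->
    all (fun i => all (fun j => BZ j i == - BZ i j) (iota 0 8)) (iota 0 8) ->
    all (fun i => dactT 4 BZ PhiZ i == 0) (lists 4) ->
    all (fun i => dactT 3 BZ (fun s => X2Z s + - 2%:Z * X3Z s) i == 0) (lists 3) ->
    isotropy_algebra (torsion_II 0 a (- 2 * a)) B.
  move=> e sk z4 z3; split; first split.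
    apply/matrixP => i j; rewrite e !mxE -rmorphN; congr (_%:~R).
    by apply/eqP/(allP (allP sk _ _)); rewrite mem_iota /= ltn_ord.
    rewrite e; exact: (@rep_eq R 4 _ 0 _ _ (rep_dact BZ (@rep_Phi0 R)) (@rep0 R 4) z4).
  rewrite tE dactZ e.
  have -> : dact (mxZ BZ) (X2 + (- 2%:Z)%:~R *: X3) = 0 :> tens R 8 3.
    exact: (@rep_eq R 3 _ 0 _ _ (rep_dact BZ (repD h2 (repZ (- 2%:Z) h3))) (@rep0 R 3) z3).
  by rewrite scaler0.
by split; [apply: h ed _ _ _|apply: h eb _ _ _|apply: h ee _ _ _]; vm_compute.
Qed.

(** A column with a single nonzero entry forces the corresponding component of [w] to vanish; such
    columns exist for the first seven components. *)
Lemma kernel_degenerate (w : 'rV[R]_8) : w *m Bd = 0 -> w *m Bb = 0 -> w *m Be = 0 ->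
  w = w 0 i8 *: delta_mx 0 i8.
Proof.
have [-> -> ->] := BE => ed eb ee.
have pk (BZ : nat -> nat -> int) (i j : 'I_8) c : c != 0 ->
    all (fun k => BZ k j == if k == i then c else 0) (iota 0 8) -> w *m mxZ BZ = 0 -> w 0 i = 0.
  move=> c0 /allP e /rowP/(_ j); rewrite !mxE (bigD1 i) //= big1 => [|k ki].
    rewrite mxE (eqP (e i _)) ?mem_iota ?ltn_ord // eqxx addr0 => /eqP.
    by rewrite mulf_eq0 intr_eq0 (negbTE c0) orbF => /eqP.
  rewrite mxE (eqP (e k _)) ?mem_iota ?ltn_ord // (_ : (k == i :> nat) = false) ?mulr0 //.
  exact: negbTE ki.
(* In the sum of [Bb] and [Be] the terms with e_13 and e_35 cancel, which isolates e_17 in the first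
   column. *)
have eS : w *m mxZ (fun i j => BbZ i j + BeZ i j) = 0 by rewrite mxZD mulmxDr eb ee addr0.
pose o k (h : (k < 8)%N) : 'I_8 := Ordinal h.
have [w0 w1] : w 0 (@o 0 isT) = 0 /\ w 0 (@o 1 isT) = 0.
  by split; [apply: (pk _ _ (@o 1 isT) (- 1%:Z)) ed|apply: (pk _ _ (@o 0 isT) 1) ed]; vm_compute.
have [w2 w3] : w 0 (@o 2 isT) = 0 /\ w 0 (@o 3 isT) = 0.
  by split; [apply: (pk _ _ (@o 0 isT) (- 1%:Z)) eb|apply: (pk _ _ (@o 1 isT) (- 1%:Z)) eb]; vm_compute.
have [w4 w5] : w 0 (@o 4 isT) = 0 /\ w 0 (@o 5 isT) = 0.
  by split; [apply: (pk _ _ (@o 5 isT) 1) ed|apply: (pk _ _ (@o 4 isT) (- 1%:Z)) ed]; vm_compute.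
have w6 : w 0 (@o 6 isT) = 0 by apply: (pk _ _ (@o 0 isT) (- 1%:Z)) eS; vm_compute.
apply/rowP => j; rewrite !mxE /= -val_eqE /=.
have [j7|j7] := eqVneq (val j) 7%N.
  by rewrite mulr1; congr (w _ _); exact: val_inj.
rewrite mulr0; case: j j7 => -[|[|[|[|[|[|[|[|//]]]]]]]] h j7;
  [rewrite -[RHS]w0|rewrite -[RHS]w1|rewrite -[RHS]w2|rewrite -[RHS]w3|rewrite -[RHS]w4
  |rewrite -[RHS]w5|rewrite -[RHS]w6|by []]; congr (w _ _); exact: val_inj.
Qed.

Lemma so_su_kernel (h : {vspace 'M[R]_8}) A : h = so3 R \/ h = su3 R -> A \in h ->
  forall l : 'I_8, (6 <= l)%N -> delta_mx 0 l *m A = 0 :> 'rV[R]_8.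
Proof.
have P (s : seq 'M[R]_8) : (forall B, B \in s -> forall l : 'I_8, (6 <= l)%N -> delta_mx 0 l *m B = 0 :> 'rV[R]_8) ->
    A \in span s -> forall l : 'I_8, (6 <= l)%N -> delta_mx 0 l *m A = 0 :> 'rV[R]_8.
  move=> k /(coord_span (X := in_tuple s)) -> l l6; rewrite mulmx_sumr big1 // => i _.
  by rewrite -scalemxAr (k _ (mem_nth 0 _)) ?scaler0 //; case: i.
have z (i j : nat) : (i < 7)%N -> (j < 7)%N -> forall l : 'I_8, (6 <= l)%N -> delta_mx 0 l *m so_e R i j = 0 :> 'rV[R]_8.
  move=> i7' j7 l l6; apply/rowP => k; rewrite -rowE !mxE.
  have -> : (l.+1 == i) = false by apply/negbTE; rewrite neq_ltn (leq_trans i7') ?orbT //.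
  have -> : (l.+1 == j) = false by apply/negbTE; rewrite neq_ltn (leq_trans j7) ?orbT //.
  by rewrite subr0.
move=> [->|->]; apply: P => B; rewrite !inE => hB l l6;
  repeat (move: hB => /orP[/eqP ->|hB]; first by
    rewrite ?(mulmxDr, mulmxN) !z ?oppr0 ?addr0);
  by rewrite (eqP hB) ?(mulmxDr, mulmxN) !z ?oppr0 ?addr0.
Qed.

End Model2.

(** * The kernel of the torsion *)

Section RankOne.
Context {R : realType} {n : nat}.
Implicit Types u y xi : 'rV[R]_n.

Definition dotr u y : R := \sum_i u 0 i * y 0 i.

Lemma mulmx_dotr u y : u *m y^T = (dotr u y)%:M.
Proof.
by apply/matrixP => i j; rewrite !ord1 !mxE; apply: eq_bigr => k _; rewrite mxE.
Qed.

Lemma dotrC u y : dotr u y = dotr y u.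
Proof. by apply: eq_bigr => i _; rewrite mulrC. Qed.

Lemma dotr_mulmx xi a (A : 'M[R]_n) : dotr xi (a *: (xi *m A)) = a * (xi *m A *m xi^T) 0 0.
Proof.
move: (xi *m A) => y; rewrite [(_ *m xi^T) 0 0]mxE mulr_sumr; apply: eq_bigr => i _.
by rewrite !mxE; ring.
Qed.

Lemma dotr_row xi u : xi *m (u^T *m u) = dotr xi u *: u.
Proof. by rewrite mulmxA mulmx_dotr mul_scalar_mx. Qed.

Lemma dotr_form xi u : (xi *m (u^T *m u) *m xi^T) 0 0 = dotr xi u ^+ 2.
Proof. by rewrite dotr_row -scalemxAl mxE mulmx_dotr mxE eqxx mulr1n dotrC expr2. Qed.

Lemma dotr_sqr u : 0 <= dotr u u.
Proof. by apply: sumr_ge0 => i _; rewrite -expr2 sqr_ge0. Qed.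

Lemma dotr_gt0 u : u != 0 -> 0 < dotr u u.
Proof.
move=> u0; rewrite lt_neqAle dotr_sqr andbT eq_sym; apply: contra_neq u0 => /eqP.
rewrite psumr_eq0 => [/allP h|i _]; last by rewrite -expr2 sqr_ge0.
apply/rowP => i; rewrite mxE; apply/eqP.
by have := h i (mem_index_enum i); rewrite -expr2 sqrf_eq0.
Qed.

Lemma scaled_tr_mul (a : R) u : (a *: u)^T *m (a *: u) = a ^+ 2 *: (u^T *m u).
Proof. by apply/matrixP => i j; rewrite !mxE !big_ord1 !mxE; ring. Qed.

Lemma rank_one_form u y xi : u^T *m u = y^T *m y -> dotr xi u ^+ 2 = dotr xi y ^+ 2.
Proof.
by move=> e; rewrite -!dotr_form e.
Qed.

Lemma rank_one_row u y xi : u^T *m u = y^T *m y -> dotr xi u *: u = dotr xi y *: y.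
Proof.
by move=> e; rewrite -!dotr_row e.
Qed.

Lemma rank_one_eq u y xi : u^T *m u = y^T *m y -> 0 < dotr xi u -> 0 < dotr xi y -> u = y.
Proof.
move=> e pu py; have /eqP := rank_one_form xi e.
rewrite eqrXn2 ?ltW // => /eqP E; have := rank_one_row xi e.
by rewrite E => /scalerI; apply; rewrite gt_eqF.
Qed.

Lemma rank_one_pm u y : u^T *m u = y^T *m y -> u = y \/ u = - y.
Proof.
move=> e; have [u0|u0] := eqVneq u 0.
  left; rewrite u0; have := rank_one_row y e; rewrite u0 scaler0 => /esym/eqP.
  rewrite scaler_eq0 => /orP[/eqP z|/eqP -> //].
  by have [->//|/dotr_gt0] := eqVneq y 0; rewrite z ltxx.
have u1 := dotr_gt0 u0.
have dN z : dotr u (- z) = - dotr u z by rewrite -sumrN; apply: eq_bigr => i _; rewrite mxE mulrN.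
have [y1|y1|y1] := ltgtP 0 (dotr u y).
- by left; exact: rank_one_eq e u1 y1.
- right; apply: (rank_one_eq (xi := u)) => //; last by rewrite dN oppr_gt0.
  by rewrite e -(scaleN1r y) scaled_tr_mul sqrrN expr1n scale1r.
- by have := rank_one_form u e; rewrite -y1 expr0n => /eqP; rewrite sqrf_eq0 gt_eqF.
Qed.

(** As xi B is (xi . u) u, this is the root [u] or [- u] whose product with [xi] is positive. It is
    a smooth expression in [B] as long as the quadratic form is positive at [xi]. *)
Lemma rank_one_section u xi (B := u^T *m u) : 0 < (xi *m B *m xi^T) 0 0 ->
  let y := (Num.sqrt ((xi *m B *m xi^T) 0 0))^-1 *: (xi *m B) in y^T *m y = B.
Proof.
rewrite /B dotr_form dotr_row => h.
rewrite /= scalerA scaled_tr_mul exprMn exprVn sqr_sqrtr ?ltW // mulVf ?scale1r //.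
by rewrite gt_eqF.
Qed.

Lemma dotr_continuous {X : topologicalType} xi (f : X -> 'rV[R]_n) (x : X) :
  {for x, continuous f} -> {for x, continuous (fun z => dotr xi (f z))}.
Proof.
move=> cf; rewrite /dotr; apply: cvg_big => [|i _].
  by move=> z; exact: add_continuous.
apply: cvgM; first exact: cvg_cst.
apply: (@continuous_comp _ _ _ f (fun y : 'rV[R]_n => y 0 i)) => //.
exact: coord_continuous.
Qed.

Lemma near_pos {X : topologicalType} (f : X -> R) (x : X) : {for x, continuous f} -> 0 < f x ->
  \forall y \near x, 0 < f y.
Proof.
move=> cf fx; have h : \forall t \near f x, 0 < t by exact: lt_nbhsr.
exact: cf _ h.
Qed.

Lemma near_eq_continuous {X Y : topologicalType} (f g : X -> Y) (x : X) :
  (\forall y \near x, f y = g y) -> {for x, continuous f} -> {for x, continuous g}.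
Proof.
move=> E cf; have cf' : f y @[y --> x] --> g x by rewrite -(nbhs_singleton E); exact: cf.
exact: cvg_trans (near_eq_cvg E) cf'.
Qed.

Lemma sign_clash (a b x y : R) : 0 < a * x -> 0 < a * y -> 0 < - b * x -> 0 < b * y -> False.
Proof.
move=> ax ay bx bY; have h := mulr_gt0 (mulr_gt0 ax ay) (mulr_gt0 bx bY).
have : 0 <= (a * b * x * y) ^+ 2 by exact: sqr_ge0.
have -> : (a * b * x * y) ^+ 2 = - (a * x * (a * y) * (- b * x * (b * y))) by ring.
by rewrite oppr_ge0 leNgt h.
Qed.

End RankOne.

(** * Global square roots of tensors of rank one *)

Section LineSection.
Context {R : realType} {n : nat} {M : rmfd R n}.
Hypotheses (hM : smooth_manifold M) (hsc : simply_connected M).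
Variable B : chart M -> M -> 'M[R]_n.
Hypothesis Bj : forall c d p, chart_dom c p -> chart_dom d p ->
  B d p = (jac c d p)^T *m B c p *m jac c d p.
Hypothesis Bs : forall c, smooth_on (chart_codom c) (B c \o chart_inv c).
Hypothesis Br : forall c p, chart_dom c p -> exists2 u : 'rV[R]_n, u != 0 & B c p = u^T *m u.

(** The fibres of the covering must lie in one fixed type. A vector at [q] is therefore represented
    by its components in a chosen chart at [q], and [loc] converts them to another chart. *)
Let ch (q : M) : chart M := sval (cid (chart_at hM q)).
Let chd q : chart_dom (ch q) q. Proof. exact: (svalP (cid (chart_at hM q))). Qed.

Let loc (s : M -> 'rV[R]_n) (c : chart M) (q : M) := s q *m jac (ch q) c q.
(** Local roots of [B], of which only continuity is asked; a continuous root coincides locally with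
    the smooth expression [sg]. *)
Let sect (U : set M) (s : M -> 'rV[R]_n) := open U /\ forall q c, U q -> chart_dom c q ->
  B c q = (loc s c q)^T *m loc s c q /\ {for q, continuous (loc s c)}.

Let locK s c q : chart_dom c q -> loc s c q *m jac c (ch q) q = s q.
Proof.
by move=> cq; rewrite /loc -mulmxA (jac_mul hM (chd q) cq (chd q)) (jac_id hM (chd q)) mulmx1.
Qed.

Let loc_change s c d q : chart_dom c q -> chart_dom d q -> loc s d q = loc s c q *m jac c d q.
Proof. by move=> cq dq; rewrite /loc -mulmxA (jac_mul hM (chd q) cq dq). Qed.

Let loc_ch s q : loc s (ch q) q = s q.
Proof. by rewrite /loc (jac_id hM (chd q)) mulmx1. Qed.

Let B_neq0 c q (y : 'rV[R]_n) : chart_dom c q -> B c q = y^T *m y -> y != 0.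
Proof.
move=> /(Br)[u u0 ->] e; apply: contra_neq u0 => y0.
have := rank_one_pm e; rewrite y0 oppr0; by case.
Qed.

Let sect_uniq U s U' s' p : sect U s -> sect U' s' -> U p -> U' p -> s p = s' p ->
  \forall q \near p, s q = s' q.
Proof.
move=> [oU hs] [oU' hs'] Up U'p E; set c := ch p.
have [e1 c1] := hs p c Up (chd p); have [e2 c2] := hs' p c U'p (chd p).
pose xi := s p; have xi0 : xi != 0 by apply: B_neq0 (chd p) _; rewrite e1 loc_ch.
have n1 : \forall q \near p, 0 < dotr xi (loc s c q).
  have p1 : 0 < dotr xi (loc s c p) by rewrite loc_ch; exact: dotr_gt0.
  have h := near_pos (dotr_continuous (xi := xi) c1) p1; exact: h.
have n2 : \forall q \near p, 0 < dotr xi (loc s' c q).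
  have p1 : 0 < dotr xi (loc s' c p) by rewrite loc_ch -E; exact: dotr_gt0.
  have h := near_pos (dotr_continuous (xi := xi) c2) p1; exact: h.
have nU := open_nbhs_nbhs (conj oU Up); have nU' := open_nbhs_nbhs (conj oU' U'p).
have nc := open_nbhs_nbhs (conj (@chart_open _ _ _ hM c) (chd p)).
near=> q.
have cq : chart_dom c q by near: q.
have Uq : U q by near: q; exact: nU.
have U'q : U' q by near: q; exact: nU'.
have [f1 _] := hs q c Uq cq; have [f2 _] := hs' q c U'q cq.
rewrite -(locK s cq) -(locK s' cq); congr (_ *m _).
apply: (@rank_one_eq _ _ _ _ xi); [by rewrite -f1 -f2 | by near: q | by near: q].
Unshelve. all: by end_near.
Qed.

Let form (xi : 'rV[R]_n) c q : R := (xi *m B c q *m xi^T) 0 0.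
Let sg (xi : 'rV[R]_n) c q : 'rV[R]_n := (Num.sqrt (form xi c q))^-1 *: (xi *m B c q).

Let sgE xi c q : chart_dom c q -> 0 < form xi c q -> (sg xi c q)^T *m sg xi c q = B c q.
Proof. by move=> /Br[u _ e]; rewrite /sg /form e; exact: rank_one_section. Qed.

Let form_smooth xi c : smooth_on (chart_codom c) (fun x => form xi c (chart_inv c x)).
Proof.
have oC := @codom_open _ _ _ hM c.
have h := smooth_on_mulmx oC (smooth_on_mulmx oC (smooth_on_cst xi) (@Bs c)) (smooth_on_cst xi^T).
exact: (smooth_on_mxP oC _).1 h 0 0.
Qed.

Let form_near xi c p : chart_dom c p -> 0 < form xi c p ->
  exists2 r, 0 < r & forall x, `|x - chart_map c p| < r ->
    chart_codom c x /\ 0 < form xi c (chart_inv c x).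
Proof.
move=> cp f0; apply: (chart_ball_sub hM cp).
have /differentiable_continuous := smooth_on_diff (@form_smooth xi c) (chart_map_codom cp).
move=> h; have : \forall t \near form xi c (chart_inv c (chart_map c p)), 0 < t.
  by apply: lt_nbhsr; rewrite (chart_mapK hM cp).
by move=> /h.
Qed.

Let sg_smooth xi c p r : (forall x, `|x - chart_map c p| < r ->
    chart_codom c x /\ 0 < form xi c (chart_inv c x)) ->
  smooth_on [set x | `|x - chart_map c p| < r] (fun x => sg xi c (chart_inv c x)).
Proof.
move=> rP; have oA := @oball_open _ _ (chart_map c p) r.
have sub : [set x | `|x - chart_map c p| < r] `<=` chart_codom c by move=> x /rP[].
apply: (smooth_on_scalemx oA); last first.
  have h := smooth_on_mulmx oA (smooth_on_cst xi) (smooth_on_sub sub (@Bs c)).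
  exact: h.
have fp x : `|x - chart_map c p| < r -> 0 < form xi c (chart_inv c x) by move=> /rP[].
apply: (smooth_onV oA) => [x /fp h|]; first by rewrite gt_eqF // sqrtr_gt0.
by apply: (smooth_on_sqrt oA) => //; exact: smooth_on_sub sub (@form_smooth xi c).
Qed.

Let form_loc xi s c q : B c q = (loc s c q)^T *m loc s c q -> form xi c q = dotr xi (loc s c q) ^+ 2.
Proof.
by move=> e; rewrite /form e dotr_form.
Qed.

Let sect_sg xi c p r e : (forall x, `|x - chart_map c p| < r ->
    chart_codom c x /\ 0 < form xi c (chart_inv c x)) -> e ^+ 2 = 1 ->
  sect (chart_ball c (chart_map c p) r) (fun q => e *: sg xi c q *m jac c (ch q) q).
Proof.
move=> rP e1; split; first exact: (chart_ball_open hM).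
move=> q d [cq qr] dq; have locE : forall q', chart_dom c q' -> chart_dom d q' ->
    loc (fun q => e *: sg xi c q *m jac c (ch q) q) d q' = e *: sg xi c q' *m jac c d q'.
  by move=> q' cq' dq'; rewrite /loc -mulmxA (jac_mul hM cq' (chd q') dq').
split.
  rewrite (locE q cq dq) (Bj cq dq) trmx_mul.
  have [_ fq] := rP _ qr; rewrite (chart_mapK hM cq) in fq.
  transitivity ((jac c d q)^T *m ((e *: sg xi c q)^T *m (e *: sg xi c q)) *m jac c d q).
    by rewrite scaled_tr_mul e1 scale1r sgE.
  by rewrite !mulmxA.
pose A := overlap c d `&` [set x | `|x - chart_map c p| < r].
have oA : open A by apply: openI; [exact: (overlap_open hM) | exact: oball_open].
have sF : smooth_on A (fun x => e *: sg xi c (chart_inv c x) *m jac c d (chart_inv c x)).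
  have h1 : smooth_on A (fun x => jac c d (chart_inv c x)).
    exact: smooth_on_sub (@subIsetl _ _ _) (@jac_smooth _ _ _ hM c d).
  have h2 : smooth_on A (fun x => sg xi c (chart_inv c x)).
    exact: smooth_on_sub (@subIsetr _ _ _) (sg_smooth rP).
  have h := smooth_on_mulmx oA (smooth_on_scalemx oA (smooth_on_cst e) h2) h1.
  exact: h.
have Aq : A (chart_map c q) by split=> //; exact: overlap_map.
have /differentiable_continuous cF := smooth_on_diff sF Aq.
have cq0 := chart_map_cont hM cq.
have cc : {for q, continuous ((fun x => e *: sg xi c (chart_inv c x) *m jac c d (chart_inv c x)) \o chart_map c)}.
  exact: continuous_comp cq0 cF.
have E : \forall q' \near q, ((fun x => e *: sg xi c (chart_inv c x) *m jac c d (chart_inv c x)) \o chart_map c) q' =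
    loc (fun q => e *: sg xi c q *m jac c (ch q) q) d q'.
  have nc := open_nbhs_nbhs (conj (@chart_open _ _ _ hM c) cq).
  have nd := open_nbhs_nbhs (conj (@chart_open _ _ _ hM d) dq).
  apply: filterS2 nc nd => q' cq' dq' /=; rewrite (chart_mapK hM cq').
  by rewrite (locE q' cq' dq').
exact: near_eq_continuous E cc.
Qed.

(** The roots [u] and [- u] form a double covering of [M], which has a global section by monodromy
    because [M] is simply connected. *)
Lemma line_section (p0 : M) : exists y : chart M -> M -> 'rV[R]_n,
  [/\ forall c d p, chart_dom c p -> chart_dom d p -> y d p = y c p *m jac c d p,
      forall c, smooth_on (chart_codom c) (y c \o chart_inv c) &
      forall c p, chart_dom c p -> (y c p)^T *m y c p = B c p].
Proof.
have [u0 _ B0] := Br (chd p0).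
have [s _ hs] : exists2 s : M -> 'rV[R]_n, s p0 = u0 &
    forall q, exists U s', [/\ sect U s', U q & \forall q' \near q, s q' = s' q'].
  apply: (@monodromy R M _ (fun q y => B (ch q) q = y^T *m y) sect) => //.
  - by move=> U s q [_ h] Uq; have [-> _] := h q (ch q) Uq (chd q); rewrite loc_ch.
  - move=> p; set c := ch p; have cp : chart_dom c p := chd p.
    have [xi xi0 Bxi] := Br cp.
    have f0 : 0 < form xi c p.
      by rewrite /form Bxi dotr_form exprn_gt0 //; exact: dotr_gt0.
    have [r r0 rP] := form_near cp f0.
    have rA x : `|x - chart_map c p| < r -> chart_codom c x by move=> /rP[].
    exists (chart_ball c (chart_map c p) r); split.
    + exact: chart_ball_open.
    + exact: chart_ball_in.
    + move=> q y [cq qr] By.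
      have [_ fq] := rP _ qr; rewrite (chart_mapK hM cq) in fq.
      pose z := y *m jac (ch q) c q.
      have zK : z *m jac c (ch q) q = y.
        by rewrite /z -mulmxA (jac_mul hM (chd q) cq (chd q)) (jac_id hM (chd q)) mulmx1.
      have zz : z^T *m z = (sg xi c q)^T *m sg xi c q.
        by rewrite (sgE cq fq) (Bj (chd q) cq) By /z trmx_mul -!mulmxA.
      have [e e1 ze] : exists2 e : R, e ^+ 2 = 1 & z = e *: sg xi c q.
        have [->|->] := rank_one_pm zz; first by exists 1; rewrite ?expr1n ?scale1r.
        by exists (- 1); rewrite ?sqrrN ?expr1n ?scaleN1r.
      exists (fun q => e *: sg xi c q *m jac c (ch q) q); last by rewrite -ze.
      exact: sect_sg.
    + move=> s s' [_ hs] [_ hs'] q q' Uq Uq' sq.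
      have [g [cg gU g0 g1]] := chart_ball_path hM rA Uq Uq'.
      have gc t : chart_dom c (g t) by have [] := gU t.
      (* The product with [xi] shows which root is taken. It does not vanish on the ball, since its
         square is the positive number [form], so along the path two roots cannot pass from equal to
         opposite. *)
      pose k (s : M -> 'rV[R]_n) t := dotr xi (loc s c (g t)).
      have kc s1 : (forall q c, chart_ball (ch p) (chart_map (ch p) p) r q -> chart_dom c q ->
          B c q = (loc s1 c q)^T *m loc s1 c q /\ {for q, continuous (loc s1 c)}) ->
          forall t, {for t, continuous (k s1)} /\ k s1 t != 0.
        move=> h t; have [Bt ct] := h (g t) c (gU t) (gc t); split.
          apply: (dotr_continuous (xi := xi) (f := fun t => loc s1 c (g t))).
          exact: (continuous_comp (cg t) ct).
        have [_ ft] := rP _ (gU t).2; rewrite (chart_mapK hM (gc t)) (form_loc xi Bt) in ft.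
        by apply: contraTneq ft; rewrite /k => ->; rewrite expr0n ltxx.
      have h1 := kc s hs; have h2 := kc s' hs'.
      pose P t := loc s c (g t) = loc s' c (g t).
      suff P1 : P 1.
        rewrite /P g1 in P1.
        exact: (etrans (esym (locK s Uq'.1)) (etrans (congr1 (mulmx ^~ _) P1) (locK s' Uq'.1))).
      apply: (locally_constant (P := P) _ (s := 0)); last by rewrite /P g0 /loc sq.
      move=> t; have [ct kt] := h1 t; have [ct' kt'] := h2 t.
      have sgn (f : R -> R) : {for t, continuous f} -> f t != 0 -> \forall u \near t, 0 < f u * f t.
        move=> cf ft; have cm : {for t, continuous (fun u => f u * f t)}.
          by apply: cvgM => //; exact: cvg_cst.
        have p1 : 0 < f t * f t by rewrite -expr2 exprn_even_gt0.
        have h := near_pos cm p1; exact: h.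
      have [e e0 he] := near_real (filterI (sgn _ ct kt) (sgn _ ct' kt')).
      exists e; first exact: e0.
      move=> a b ae be Pa; have [a1 a2] := he a ae; have [b1 b2] := he b be.
      have [Bb _] := hs (g b) c (gU b) (gc b); have [Bb' _] := hs' (g b) c (gU b) (gc b).
      have [//|E] := @rank_one_pm _ _ (loc s c (g b)) (loc s' c (g b)) (etrans (esym Bb) Bb').
      have kb : k s b = - k s' b by rewrite /k E -sumrN; apply: eq_bigr => i _; rewrite mxE mulrN.
      have ka : k s a = k s' a by rewrite /k Pa.
      exfalso; rewrite kb in b1; rewrite ka in a1.
      exact: sign_clash a1 a2 b1 b2.
    + exact: chart_ball_path.
  - exact: path_clip.
  - exact: null_clip.
have V c q : chart_dom c q -> B c q = (loc s c q)^T *m loc s c q /\ {for q, continuous (loc s c)}.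
  move=> cq; have [U [s' [[_ h] Uq E]]] := hs q; have [Bq cs] := h q c Uq cq.
  have E' : \forall q' \near q, loc s' c q' = loc s c q' by apply: filterS E => q' e; rewrite /loc e.
  have eq := nbhs_singleton E'; split; first by rewrite -eq.
  exact: near_eq_continuous E' cs.
exists (loc s); split.
- by move=> c d p; exact: loc_change.
- move=> c; apply: smooth_on_local => x cx; pose p := chart_inv c x.
  have cp : chart_dom c p := chart_inv_dom hM cx.
  have px : chart_map c p = x by rewrite /p (chart_invK hM cx).
  (* Testing with the value at [p] itself, the section has a positive product with [xi] near [p].
     There it equals [sg xi] and is smooth. *)
  have [Bp cs] := V c p cp; pose xi := loc s c p; have xi0 : xi != 0 := B_neq0 cp Bp.
  have f0 : 0 < form xi c p by rewrite (form_loc xi Bp) exprn_gt0 //; exact: dotr_gt0.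
  have n1 : \forall y \near x, 0 < dotr xi (loc s c (chart_inv c y)).
    have n0 : \forall q \near p, 0 < dotr xi (loc s c q).
      have h := near_pos (dotr_continuous (xi := xi) cs) (dotr_gt0 xi0); exact: h.
    exact: (chart_inv_cont hM cx) _ n0.
  have [r1 r10 rP] := form_near cp f0; rewrite px in rP.
  rewrite -px in n1; have [r2 r20 rQ] := chart_ball_sub hM cp n1; rewrite px in rQ.
  pose r := Num.min r1 r2; exists [set y | `|y - x| < r].
    by rewrite /= subrr normr0 /r lt_min r10.
  have rr y : `|y - x| < r -> `|y - x| < r1 /\ `|y - x| < r2 by rewrite /r lt_min => /andP.
  have sS : smooth_on [set y | `|y - x| < r] (fun y => sg xi c (chart_inv c y)).
    rewrite -px; apply: sg_smooth; rewrite px => y /rr[/rP] //.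
  apply: (smooth_on_ext (@oball_open _ _ x r)) sS => y yr.
  have [y1 y2] := rr y yr; have [cy fy] := rP _ y1; have [_ dy] := rQ _ y2.
  have cq := chart_inv_dom hM cy; have [By _] := V c _ cq.
  apply: (rank_one_eq (etrans (sgE cq fy) By) _ dy); rewrite /sg.
  rewrite dotr_mulmx.
  by apply: mulr_gt0; [rewrite invr_gt0 sqrtr_gt0; exact: fy | exact: fy].
- by move=> c p cp; have [-> _] := V c p cp.
Qed.

End LineSection.

Section Bivectors.
Context {R : realType} {n : nat} {M : rmfd R n}.
Variable T : tensor_field M 3.
Hypotheses (hR : riemannian M) (hT : is_form T).
Implicit Types (c d : chart M) (p : M).

Let hM : smooth_manifold M. Proof. by case: hR. Qed.
Let oC c : open (chart_codom c). Proof. exact: codom_open hM c. Qed.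

(** Contravariant tensors of rank 2: the common form in which the inverse metric, the powers of Q
    and the square of a vector field can be added. *)
Definition parallel_bivector (B : chart M -> M -> 'M[R]_n) :=
  [/\ forall c d p, chart_dom c p -> chart_dom d p -> B d p = (jac c d p)^T *m B c p *m jac c d p,
      forall c, smooth_on (chart_codom c) (B c \o chart_inv c) &
      forall c p i, chart_dom c p -> partial c i (B c) p =
        - ((skew_connection T c p i)^T *m B c p + B c p *m skew_connection T c p i)].

Lemma ginv_bivector : parallel_bivector (fun c p => invmx (metric c p)).
Proof.
split.
- by move=> c d p cp dp; rewrite (ginv_jac hR cp dp).
- by move=> c; exact: ginv_smooth.
- by move=> c p i cp; case: (ginv_par hR hT i cp).
Qed.

Lemma bivector_endo B A : parallel_bivector B -> parallel_endo T A ->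
  parallel_bivector (fun c p => B c p *m A c p).
Proof.
move=> [Bj Bs Bp] [Aj As Ap]; split.
- by move=> c d p cp dp; rewrite (Bj c d p cp dp) -!mulmxA -(Aj c d p cp dp) !mulmxA.
- by move=> c; have h := smooth_on_mulmx (@oC c) (@Bs c) (@As c); exact: h.
- move=> c p i cp.
  have d1 := is_derive_partial i cp (@Bs c); have d2 := is_derive_partial i cp (@As c).
  case: (is_derive_mulmx d1 d2) => _ E; apply: (etrans E).
  rewrite /= (chart_mapK hM cp) (Bp c p i cp) (Ap c p i cp).
  rewrite mulNmx mulmxDl mulmxBr !mulmxA opprD [in RHS]opprD -addrA; congr (_ + _).
  by rewrite addrA addNr sub0r.
Qed.

Lemma bivectorD B B' : parallel_bivector B -> parallel_bivector B' ->
  parallel_bivector (fun c p => B c p + B' c p).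
Proof.
move=> [Bj Bs Bp] [Bj' Bs' Bp']; split.
- by move=> c d p cp dp; rewrite (Bj c d p cp dp) (Bj' c d p cp dp) mulmxDr mulmxDl.
- by move=> c; have h := smooth_on_addmx (@oC c) (@Bs c) (@Bs' c); exact: h.
- move=> c p i cp.
  have d1 := is_derive_partial i cp (@Bs c); have d2 := is_derive_partial i cp (@Bs' c).
  case: (is_deriveD d1 d2) => _ E; apply: (etrans E).
  by rewrite (Bp c p i cp) (Bp' c p i cp) mulmxDr mulmxDl -opprD addrACA.
Qed.

Lemma bivectorZ a B : parallel_bivector B -> parallel_bivector (fun c p => a *: B c p).
Proof.
move=> [Bj Bs Bp]; split.
- by move=> c d p cp dp; rewrite (Bj c d p cp dp) -scalemxAr -scalemxAl.
- by move=> c; have h := smooth_on_scalemx (@oC c) (smooth_on_cst a) (@Bs c); exact: h.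
- move=> c p i cp.
  have d1 := is_derive_partial i cp (@Bs c).
  case: (is_deriveZ a d1) => _ E; apply: (etrans E).
  by rewrite (Bp c p i cp) -scalemxAr -scalemxAl -scalerDr scalerN.
Qed.

Lemma bivector_vec y : parallel_vec T y -> parallel_bivector (fun c p => (y c p)^T *m y c p).
Proof.
move=> [yj ys yp]; split.
- by move=> c d p cp dp; rewrite (yj c d p cp dp) trmx_mul -!mulmxA.
- by move=> c; have h := smooth_on_mulmx (@oC c) (smooth_on_trmx (@oC c) (@ys c)) (@ys c); exact: h.
- move=> c p i cp.
  have d1 := is_derive_partial i cp (@ys c).
  case: (is_derive_mulmx (is_derive_trmx d1) d1) => _ E; apply: (etrans E).
  rewrite /= (chart_mapK hM cp) (yp c p i cp) linearN /= trmx_mul mulNmx mulmxN -opprD.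
  by rewrite -!mulmxA.
Qed.

Lemma vecZ a y : parallel_vec T y -> parallel_vec T (fun c p => a *: y c p).
Proof.
move=> [yj ys yp]; split.
- by move=> c d p cp dp; rewrite (yj c d p cp dp) -scalemxAl.
- by move=> c; have h := smooth_on_scalemx (@oC c) (smooth_on_cst a) (@ys c); exact: h.
- move=> c p i cp.
  have d1 := is_derive_partial i cp (@ys c).
  case: (is_deriveZ a d1) => _ E; apply: (etrans E).
  by rewrite (yp c p i cp) -scalemxAl scalerN.
Qed.

Lemma dotr_lin (y u v : 'rV[R]_n) a b : dotr y (a *: u + b *: v) = a * dotr y u + b * dotr y v.
Proof.
rewrite /dotr !mulr_sumr -big_split; apply: eq_bigr => i _ /=.
by rewrite !mxE; ring.
Qed.

Lemma sym_root_eq0 (y D : 'rV[R]_n) : y != 0 -> D^T *m y + y^T *m D = 0 -> D = 0.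
Proof.
move=> /dotr_gt0 y0 e.
have E : dotr y D *: y + dotr y y *: D = 0.
  by rewrite -!mul_scalar_mx -!mulmx_dotr -!mulmxA -mulmxDr e mulmx0.
have dE : dotr y (dotr y D *: y + dotr y y *: D) = (dotr y D + dotr y D) * dotr y y.
  by rewrite dotr_lin; ring.
have : (dotr y D + dotr y D) * dotr y y = 0.
  by rewrite -dE E /dotr big1 // => i _; rewrite mxE mulr0.
move/eqP; rewrite mulf_eq0 [X in _ || X]gt_eqF // orbF -mulr2n mulrn_eq0 /= => /eqP z.
by move/eqP: E; rewrite z scale0r add0r scaler_eq0 gt_eqF //= => /eqP.
Qed.

(** Differentiating y^T y = B covariantly gives D^T y + y^T D = 0 for the covariant derivative [D]
    of [y]; by [sym_root_eq0] this forces D = 0 wherever [y] is nonzero. *)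
Lemma bivector_root (y : chart M -> M -> 'rV[R]_n) B : parallel_bivector B ->
  (forall c d p, chart_dom c p -> chart_dom d p -> y d p = y c p *m jac c d p) ->
  (forall c, smooth_on (chart_codom c) (y c \o chart_inv c)) ->
  (forall c p, chart_dom c p -> y c p != 0) ->
  (forall c p, chart_dom c p -> (y c p)^T *m y c p = B c p) -> parallel_vec T y.
Proof.
move=> [Bj Bs Bp] yj ys y0 yB; split=> // c p i cp.
have d1 := is_derive_partial i cp (@ys c).
have d2 := is_derive_partial i cp (@Bs c).
have d3 := is_derive_mulmx (is_derive_trmx d1) d1.
have E : \forall x \near chart_map c p, ((y c \o chart_inv c) x)^T *m (y c \o chart_inv c) x = (B c \o chart_inv c) x.
  have := open_nbhs_nbhs (conj (@oC c) (chart_map_codom cp)).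
  by apply: filterS => x cx; exact: yB (chart_inv_dom hM cx).
have d4 := near_eq_is_derive E d3.
have := is_derive_uniq d4 d2; rewrite (Bp c p i cp) /= (chart_mapK hM cp) -(yB c p cp).
move: (partial c i (y c) p) (skew_connection T c p i) (y c p) (y0 c p cp) => D C u u0 e.
apply/eqP; rewrite -subr_eq0 opprK; apply/eqP; apply: sym_root_eq0 u0 _.
by rewrite linearD /= trmx_mul mulmxDl mulmxDr addrACA e !mulmxA addNr.
Qed.

End Bivectors.

Lemma gram1_unit {R : realType} n (g E : 'M[R]_n) : E *m g *m E^T = 1%:M -> E \in unitmx.
Proof. by move=> e; have [_] := mulmx1_unit e; rewrite unitmx_tr. Qed.

Lemma gram1_inv {R : realType} n (g E : 'M[R]_n) : E *m g *m E^T = 1%:M -> invmx g = E^T *m E.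
Proof.
move=> e; have uE := gram1_unit e.
have e' : g *m (E^T *m E) = 1%:M.
  by apply: (can_inj (mulKmx uE)); rewrite mulmx1 !mulmxA e mul1mx.
have [ug _] := mulmx1_unit e'.
by apply: (can_inj (mulKmx ug)); rewrite mulmxV // e'.
Qed.

Definition torsion_frame {R : realType} (M : rmfd R 8) (Phi : tensor_field M 4) (T : tensor_field M 3)
    (a1 a2 b : R) (c : chart M) (p : M) (E : 'M[R]_8) :=
  adapted Phi c p E /\ pull E (T c p) = torsion_II a1 a2 b.

(** * The two parallel fields in the kernel of the torsion *)

Section Kernel.
Context {R : realType}.
Variables (M : rmfd R 8) (Phi : tensor_field M 4) (T : tensor_field M 3) (a1 a2 b : R).
Hypotheses (hM : spin7_manifold Phi) (hsc : simply_connected M).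
Hypothesis hT : characteristic_torsion Phi T.
Hypothesis hpar : parallel_tensor (skew_connection T) T.
Hypothesis hiso : isotropy_is Phi T (so3 R) \/ isotropy_is Phi T (su3 R).
Hypothesis b_gt0 : 0 < b.
Let tau := torsion_II a1 a2 b.
Let frame := torsion_frame Phi T a1 a2 b.
Hypothesis hII : forall (c : chart M) p, chart_dom c p -> exists E, frame c p E.
Variable p0 : M.

Let hR : riemannian M. Proof. by case: hM. Qed.
Let hS : smooth_manifold M. Proof. by case: hR. Qed.
Let tf : is_form T. Proof. by case: hT. Qed.
Let Tpar : parallel_form T T. Proof. by split. Qed.
Let Ppar : parallel_form T Phi. Proof. by split; [case: hM | case: hT]. Qed.

Lemma frame_unit c p E : frame c p E -> E \in unitmx.
Proof.
by move=> [[e _ _] _]; exact: gram1_unit e.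
Qed.

Lemma frame_ginv c p E : chart_dom c p -> frame c p E -> invmx (metric c p) = E^T *m E.
Proof.
by move=> _ [[e _ _] _]; exact: gram1_inv.
Qed.

Lemma frame_cfield k (t : tensor_field M k) (f : tensor_field M k.+1) c p E :
  chart_dom c p -> frame c p E ->
  cfield t f c p = cvec 1%:M (pull E (t c p)) (pull E (f c p)) *m E.
Proof.
by move=> cp F; rewrite /cfield (frame_ginv cp F) cvec_pull mulmx1 mulmxA.
Qed.

Lemma frame_qendo c p E : chart_dom c p -> frame c p E ->
  E *m qendo T c p = qmx 1%:M tau *m E.
Proof.
move=> cp F; have TE : pull E (T c p) = tau by case: F.
by rewrite /qendo (frame_ginv cp F) -TE qmx_pull mulmx1 !mulmxA.
Qed.

Lemma frame_pull_qendo c p E : chart_dom c p -> frame c p E ->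
  pull E (pull (qendo T c p) (T c p)) = pull (qmx 1%:M tau) tau.
Proof.
move=> cp F; rewrite pull_mul (frame_qendo cp F) -pull_mul; by case: F => [_ ->].
Qed.

Definition unit78 (al be : R) : 'rV[R]_8 := al *: delta_mx 0 i7 + be *: delta_mx 0 i8.

(** The coefficients [al] and [be] are the same in all frames, so the field has constant length and
    the complementary direction in the plane of e_7 and e_8 has constant coefficients too. *)
Lemma parallel_unit_field : exists (y : chart M -> M -> 'rV[R]_8) al be,
  [/\ al ^+ 2 + be ^+ 2 = 1, parallel_vec T y &
      forall c p E, chart_dom c p -> frame c p E -> y c p = unit78 al be *m E].
Proof.
(* The contraction of [T] with [Phi] vanishes exactly in this case, and the pull-back of [T] by Q is
   contracted instead; the divisor is its coefficient in [cvec_pull_torsion_II], nonzero because [b]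
   is positive. *)
have [[a10 a20]|nz] := pselect (a1 = 0 /\ a2 = 0).
  exists (fun c p => (80 * 12 ^+ 3 * b ^+ 7)^-1 *: cfield (fun c p => pull (qendo T c p) (T c p)) Phi c p), 0, 1.
  split; first by rewrite expr0n expr1n add0r.
    apply: (vecZ hR); apply: (cfield_par hR tf) Ppar.
    exact: (endo_pull_par hR Tpar (qendo_par hR tf Tpar)).
  move=> c p E cp F; rewrite (frame_cfield _ _ cp F) (frame_pull_qendo cp F).
  case: F => [[_ _ ->] _]; rewrite /tau a10 a20 cvec_pull_torsion_II -scalemxAl scalerA mulVf.
    by rewrite scale1r /unit78 scale0r add0r scale1r.
  by rewrite !mulf_neq0 ?expf_neq0 // gt_eqF.
pose ka := Num.sqrt ((24 * a1) ^+ 2 + (84 * a2) ^+ 2).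
have k0 : 0 < (24 * a1) ^+ 2 + (84 * a2) ^+ 2.
  rewrite lt_neqAle addr_ge0 ?sqr_ge0 // andbT; apply/eqP => /esym/eqP.
  rewrite paddr_eq0 ?sqr_ge0 // !sqrf_eq0 !mulf_eq0 !pnatr_eq0 /= => /andP[/eqP h1 /eqP h2].
  exact: nz.
have k2 : ka ^+ 2 = (24 * a1) ^+ 2 + (84 * a2) ^+ 2 by rewrite sqr_sqrtr // ltW.
have k1 : ka != 0 by rewrite gt_eqF // sqrtr_gt0.
exists (fun c p => ka^-1 *: cfield T Phi c p), (ka^-1 * (24 * a1)), (ka^-1 * - (84 * a2)); split.
- by rewrite [(ka^-1 * (24 * a1)) ^+ 2]exprMn [(ka^-1 * - _) ^+ 2]exprMn sqrrN -mulrDr -k2 -exprMn mulVf // expr1n.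
- exact: (vecZ hR) (cfield_par hR tf Tpar Ppar).
move=> c p E cp F; rewrite (frame_cfield _ _ cp F); case: F => [[_ _ ->] ->].
by rewrite /tau cvec_torsion_II scalemxAl scalerBr !scalerA -scaleNr mulrN.
Qed.

Let s1 := qx a1 a2 b + qz a1 a2 b.
Let s2 := qx a1 a2 b * qz a1 a2 b - qy a1 a2 b ^+ 2.

(** [s2] is 16 times a sum of nonnegative terms. Besides the stated case, their vanishing would
    require b = 5 a2 and 2 b = 3 a2, which contradicts [b > 0]. *)
Lemma degenerate_torsion : s2 = 0 -> a1 = 0 /\ b = - 2 * a2.
Proof.
have -> : s2 = 16 * ((a1 ^+ 2) ^+ 2 + a1 ^+ 2 * (2 * a2 + b) ^+ 2 + a1 ^+ 2 * (5 * a2 - b) ^+ 2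
    + (2 * a2 + b) ^+ 2 * ((5 * a2 - b) ^+ 2 + (3 * a2 - 2 * b) ^+ 2)).
  by rewrite /s2 /qx /qy /qz; ring.
move=> e; have n1 : 0 <= (a1 ^+ 2) ^+ 2 by exact: sqr_ge0.
have n2 : 0 <= a1 ^+ 2 * (2 * a2 + b) ^+ 2 by rewrite mulr_ge0 // sqr_ge0.
have n3 : 0 <= a1 ^+ 2 * (5 * a2 - b) ^+ 2 by rewrite mulr_ge0 // sqr_ge0.
have n4 : 0 <= (2 * a2 + b) ^+ 2 * ((5 * a2 - b) ^+ 2 + (3 * a2 - 2 * b) ^+ 2).
  by rewrite mulr_ge0 ?addr_ge0 // sqr_ge0.
have z (x y u w : R) : 16 * (x + y + u + w) = 0 -> 0 <= x -> 0 <= y -> 0 <= u -> 0 <= w -> x = 0 /\ w = 0.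
  by move=> *; lra.
have [/eqP h1 /eqP h2] := z _ _ _ _ e n1 n2 n3 n4.
split; first by move: h1; rewrite !expf_eq0 => /eqP.
move: h2; rewrite mulf_eq0 paddr_eq0 ?sqr_ge0 // !expf_eq0 /= => /orP[/eqP u|/andP[/eqP v /eqP w]]; first by lra.
exfalso; move: b_gt0; lra.
Qed.

Lemma conj_skew n (G B : 'M[R]_n) : B^T = - B -> (G *m B *m G^T)^T = - (G *m B *m G^T).
Proof. by move=> sk; rewrite !trmx_mul trmxK sk mulNmx mulmxN mulmxA. Qed.

(** Let [G] be the change from the frame of type II to the frame of the isotropy hypothesis; it
    preserves [Phi0] and the metric. In the degenerate case [G] would conjugate [Bd], [Bb] and [Be]
    into so(3) or su(3), whose elements annihilate e_7 and e_8. The rows 7 and 8 of [G], which are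
    independent, would then lie in the line spanned by e_8. *)
Lemma s2_neq0 : s2 != 0.
Proof.
apply/eqP => /degenerate_torsion[a10 ba].
have [c cp] := chart_at hS p0; have [E F] := hII cp.
have [h [hh [E' [P' I']]]] : exists h, (h = so3 R \/ h = su3 R) /\
    exists E', adapted Phi c p0 E' /\ isotropy_algebra (pull E' (T c p0)) = [set A | A \in h].
  by case: hiso => h; [exists (so3 R) | exists (su3 R)]; split; [left | | right |]; try exact: h.
have U := frame_unit F; have U' : E' \in unitmx. by case: P' => e _ _; exact: gram1_unit e.
pose G := E' *m invmx E; have GE : G *m E = E' by rewrite /G mulmxKV.
have UG : G \in unitmx by rewrite unitmx_mul U' unitmx_inv.
have TE : pull E (T c p0) = tau by case: F.
have PG : pull G (Phi0 R) = Phi0 R.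
  have P1 : pull E (Phi c p0) = Phi0 R by case: F => [[]].
  have P2 : pull E' (Phi c p0) = Phi0 R by case: P'.
  by rewrite -{1}P1 pull_mul GE.
have GO : G *m G^T = 1%:M.
  have e' : G *m E *m metric c p0 *m (G *m E)^T = 1%:M by rewrite GE; case: P'.
  case: F => [[e _ _] _]; rewrite -e' (trmx_mul G E) !mulmxA.
  by rewrite -[G *m E *m _]mulmxA -[G *m (E *m _) *m E^T]mulmxA e mulmx1.
have GV : invmx G = G^T by apply: (can_inj (mulKmx UG)); rewrite mulmxV // GO.
have key B : isotropy_algebra (torsion_II a1 a2 b) B -> forall l : 'I_8, (6 <= l)%N ->
    delta_mx 0 l *m G *m B = 0 :> 'rV[R]_8.
  move=> [[sk kP] kT] l l6.
  have : isotropy_algebra (pull E' (T c p0)) (G *m B *m invmx G).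
    split; first split.
    - by rewrite GV conj_skew.
    - by rewrite -{1}PG dact_pull // kP; exact: pull0.
    - by rewrite -GE -pull_mul TE dact_pull // kT; exact: pull0.
  rewrite I' /= => /(so_su_kernel hh)/(_ l l6)/(congr1 (mulmx ^~ G)).
  have -> : delta_mx 0 l *m (G *m B *m invmx G) *m G = delta_mx 0 l *m G *m B :> 'rV[R]_8.
    by rewrite -!mulmxA mulVmx // mulmx1.
  by rewrite mul0mx.
have [kd kb ke] := @isotropy_degenerate R a2.
have w l (l6 : (6 <= val l)%N) : exists x, delta_mx 0 l *m G = x *: delta_mx 0 i8 :> 'rV[R]_8.
  move: key; rewrite a10 ba => key.
  exists ((delta_mx 0 l *m G : 'rV[R]_8) 0 i8); apply: kernel_degenerate; exact: key.
have [x ex] := w i7 isT; have [y ey] := w i8 isT.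
have [z [t [nz e]]] : exists z t : R, (z != 0) || (t != 0) /\
    z *: delta_mx 0 i7 + t *: delta_mx 0 i8 = 0 :> 'rV[R]_8.
  have [x0|x0] := eqVneq x 0.
    exists 1, 0; rewrite oner_eq0; split=> //; apply: (can_inj (mulmxK UG)).
    by rewrite mul0mx mulmxDl -!scalemxAl ex x0 !scale0r scaler0 addr0.
  exists y, (- x); rewrite oppr_eq0 x0 orbT; split=> //; apply: (can_inj (mulmxK UG)).
  by rewrite mul0mx mulmxDl -!scalemxAl ex ey !scalerA mulNr mulrC -scalerDl subrr scale0r.
move/rowP: e => e; move: (e i7) (e i8); rewrite !mxE /= !mulr1 !mulr0 addr0 add0r => z0 t0.
by rewrite z0 t0 eqxx in nz.
Qed.

Lemma frame_projector c p E : chart_dom c p -> frame c p E ->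
  s2^-1 *: (invmx (metric c p) *m qendo T c p *m qendo T c p - s1 *: (invmx (metric c p) *m qendo T c p)
    + s2 *: invmx (metric c p)) = E^T *m p78 *m E.
Proof.
move=> cp F; have q := frame_qendo cp F; rewrite (frame_ginv cp F).
have -> : E^T *m E *m qendo T c p = E^T *m qmx 1%:M tau *m E by rewrite -mulmxA q mulmxA.
have -> : E^T *m qmx 1%:M tau *m E *m qendo T c p = E^T *m (qmx 1%:M tau *m qmx 1%:M tau) *m E.
  by rewrite -mulmxA q !mulmxA.
have -> : p78 = s2^-1 *: (s2 *: p78) :> 'M[R]_8 by rewrite scalerA mulVf ?s2_neq0 // scale1r.
rewrite -kernel_projector -/s1 -/s2 -/tau -scalemxAr -scalemxAl; congr (_ *: _).
rewrite mulmxDr mulmxBr mulmxDl mulmxBl -!scalemxAr -!scalemxAl mulmx1.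
by [].
Qed.

Lemma unit78_compl al be : al ^+ 2 + be ^+ 2 = 1 ->
  p78 = (unit78 al be)^T *m unit78 al be + (unit78 (- be) al)^T *m unit78 (- be) al.
Proof.
move=> e; apply/matrixP => i j; rewrite !mxE !big_ord1 !mxE /= -!val_eqE /=.
case: (val i == 6%N) (val i == 7%N) (val j == 6%N) (val j == 7%N) => [] [] [] [] /=; rewrite ?(mulr1, mulr0, addr0, add0r, mul0r); lra.
Qed.

(** The size is written [1 + 1] so that block operations reach the two rows; it is convertible with
    2, and [6 + (1 + 1)] with 8. *)
Definition e78 : 'M[R]_(1 + 1, 8) :=
  col_mx (delta_mx ord0 i7 : 'rV[R]_8) (delta_mx ord0 i8 : 'rV[R]_8).

Lemma row_e78 (r : 'rV[R]_(1 + 1)) :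
  r *m e78 = unit78 (lsubmx r 0 0) (rsubmx r 0 0).
Proof.
by rewrite -{1}[r]hsubmxK mul_row_col (mx11_scalar (lsubmx r)) (mx11_scalar (rsubmx r)) !mul_scalar_mx !mxE.
Qed.

Lemma e78_orth : e78 *m e78^T = 1%:M.
Proof.
rewrite /e78 tr_col_mx mul_col_row !trmx_delta !mul_delta_mx_cond /=.
rewrite !mulr1n !mulr0n.
have -> : delta_mx ord0 ord0 = 1%:M :> 'M[R]_1 by apply/matrixP => i j; rewrite !ord1 !mxE.
by rewrite -scalar_mx_block.
Qed.

Lemma ins_torsion_unit78 al be : ins (unit78 al be) tau = 0.
Proof.
rewrite ins_sum big1 // => l _; have [l6|l6] := leqP 6 l; first by rewrite ins_torsion_II // scaler0.
rewrite !mxE -!val_eqE /= !ltn_eqF ?(leq_trans l6) //; by rewrite !mulr0 addr0 scale0r.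
Qed.

Lemma is_derive_col_mx {W : normedModType R} (x v : W) m p q (f : W -> 'M[R]_(m, q)) (h : W -> 'M[R]_(p, q)) f' h' :
  is_derive x v f f' -> is_derive x v h h' -> is_derive x v (fun y => col_mx (f y) (h y)) (col_mx f' h').
Proof.
move=> /is_derive_mxP df /is_derive_mxP dh; apply/is_derive_mxP => a j.
have [k ->|k ->] := split_ordP a.
  rewrite col_mxEu (_ : (fun y => _) = fun y => f y k j); first exact: df.
  by apply/funext => y; rewrite col_mxEu.
rewrite col_mxEd (_ : (fun y => _) = fun y => h y k j); first exact: dh.
by apply/funext => y; rewrite col_mxEd.
Qed.

Lemma parallel_kernel_frame : exists V : chart M -> M -> 'M[R]_(1 + 1, 8),
  parallel_frame T V /\ forall c p E, chart_dom c p -> frame c p E ->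
    exists2 K : 'M[R]_(1 + 1), K *m K^T = 1%:M & V c p = K *m e78 *m E.
Proof.
have [y [al [be [ab yP yE]]]] := parallel_unit_field.
pose A := qendo T; pose g := fun (c : chart M) p => invmx (metric c p).
(* The projector on the kernel of Q with an index raised, as a polynomial in Q, minus the square of
   the first field: in every frame it is the square of the orthogonal unit vector in the plane. *)
pose B (c : chart M) p := s2^-1 *: ((g c p *m A c p *m A c p + (- s1) *: (g c p *m A c p)) + s2 *: g c p)
  + (- 1) *: ((y c p)^T *m y c p).
have BP : parallel_bivector T B.
  have gP : parallel_bivector T g := ginv_bivector hR tf.
  have AP : parallel_endo T A := qendo_par hR tf Tpar.
  have gA := bivector_endo hR gP AP.
  have gAA := bivector_endo hR gA AP.
  have h1 := bivectorD hR gAA (bivectorZ hR (- s1) gA).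
  have h2 := bivectorZ hR s2^-1 (bivectorD hR h1 (bivectorZ hR s2 gP)).
  exact: (bivectorD hR h2 (bivectorZ hR (- 1) (bivector_vec hR yP))).
have BE c p E : chart_dom c p -> frame c p E ->
    B c p = (unit78 (- be) al *m E)^T *m (unit78 (- be) al *m E).
  move=> cp F; rewrite /B scaleNr (frame_projector cp F) (yE c p E cp F) (unit78_compl ab).
  by rewrite scaleN1r !trmx_mul mulmxDr mulmxDl !mulmxA addrAC subrr add0r.
have w0 : unit78 (- be) al != 0.
  apply/eqP => /rowP h; move: (h i7) (h i8); rewrite !mxE /= => h7 h8.
  have a0 : al = 0 by lra.
  have b0 : be = 0 by lra.
  by move: ab; rewrite a0 b0 expr0n addr0 => /eqP; rewrite eq_sym oner_eq0.
have wE0 c p E : chart_dom c p -> frame c p E -> unit78 (- be) al *m E != 0.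
  move=> cp F; apply: contra_neq w0 => e; apply: (can_inj (mulmxK (frame_unit F))).
  by rewrite e mul0mx.
have Br c p : chart_dom c p -> exists2 u : 'rV[R]_8, u != 0 & B c p = u^T *m u.
  move=> cp; have [E F] := hII cp; exists (unit78 (- be) al *m E); first exact: wE0 cp F.
  exact: BE.
have [z [zj zs zB]] : exists z : chart M -> M -> 'rV[R]_8,
  [/\ forall c d p, chart_dom c p -> chart_dom d p -> z d p = z c p *m jac c d p,
      forall c, smooth_on (chart_codom c) (z c \o chart_inv c) &
      forall c p, chart_dom c p -> (z c p)^T *m z c p = B c p].
  by case: (BP) => Bj Bs _; exact: (line_section hS hsc Bj Bs Br p0).
have z0 c p : chart_dom c p -> z c p != 0.
  move=> cp; have [u u0 Bu] := Br c p cp; apply: contra_neq u0 => e.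
  have := zB c p cp; rewrite e Bu mulmx0 => /esym h.
  have := rank_one_pm (y := 0) (etrans h (esym (mulmx0 _ _))); rewrite oppr0; by case.
have zP : parallel_vec T z := bivector_root hR BP zj zs z0 zB.
have VE c p E : chart_dom c p -> frame c p E -> exists2 K : 'M[R]_(1 + 1), K *m K^T = 1%:M &
    col_mx (y c p) (z c p) = K *m e78 *m E.
  (* The second field is a root of [B], so a frame determines it only up to the sign [e]. Hence the
     matrix [K] is orthogonal but may have either determinant. *)
  move=> cp F; have [e e1 ze] : exists2 e : R, e ^+ 2 = 1 & z c p = unit78 (e * - be) (e * al) *m E.
    have zz : (z c p)^T *m z c p = (unit78 (- be) al *m E)^T *m (unit78 (- be) al *m E).
      by rewrite (zB c p cp) (BE c p E cp F).
    have [->|->] := rank_one_pm zz; first by exists 1; rewrite ?expr1n ?mul1r.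
    exists (- 1); first by rewrite sqrrN expr1n.
    by rewrite /unit78 -!scalerA -scalerDr !scaleN1r mulNmx.
  exists (block_mx al%:M be%:M (e * - be)%:M (e * al)%:M : 'M[R]_(1 + 1)).
    rewrite tr_block_mx mulmx_block !tr_scalar_mx -!scalar_mxM -!raddfD /= [RHS]scalar_mx_block.
    have e2 : e * e = 1 by rewrite -expr2.
    have -> : al * al + be * be = 1 by rewrite -!expr2.
    have -> : al * (e * - be) + be * (e * al) = 0 by ring.
    have -> : e * - be * al + e * al * be = 0 by ring.
    have -> : e * - be * (e * - be) + e * al * (e * al) = 1.
      transitivity (e * e * (al * al + be * be)); first by ring.
      by rewrite e2 mul1r -!expr2.
    have -> : 0%:M = 0 :> 'M[R]_1 by apply/matrixP => i j; rewrite !mxE mul0rn.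
    by [].
  rewrite -[block_mx _ _ _ _]submxK block_mxKul block_mxKur block_mxKdl block_mxKdr.
  rewrite block_mxEv !mul_col_mx !row_e78 !row_mxKl !row_mxKr !mxE !mulr1n.
  by rewrite (yE c p E cp F) ze.
exists (fun c p => col_mx (y c p) (z c p)); split; last exact: VE.
case: yP => yj ys yp; case: zP => _ _ zp; split.
- by move=> c d p cp dp; rewrite mul_col_mx -(yj c d p cp dp) -(zj c d p cp dp).
- by move=> c; have h := smooth_on_col_mx (@codom_open _ _ _ hS c) (ys c) (zs c); exact: h.
- move=> c p cp; have [E F] := hII cp; have [K KK ->] := VE c p E cp F.
  case: F => [[e _ _] _]; move: (metric c p) e => G e.
  have -> : K *m e78 *m E *m G *m (K *m e78 *m E)^T = K *m (e78 *m (E *m G *m E^T) *m e78^T) *m K^T.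
    by rewrite !trmx_mul !mulmxA.
  by rewrite e mulmx1 e78_orth mulmx1.
- move=> c p i cp.
  have d1 := is_derive_partial i cp (@ys c); have d2 := is_derive_partial i cp (@zs c).
  case: (is_derive_col_mx d1 d2) => _ e; apply: (etrans e).
  by rewrite (yp c p i cp) (zp c p i cp) mul_col_mx opp_col_mx.
- move=> c p s cp; have [E F] := hII cp; have [K KK ->] := VE c p E cp F.
  have U := frame_unit F; apply: (pull_inj U); rewrite pull0 mulmxA pull_ins.
  case: F => [_ ->].
  by rewrite mulmxA row_e78 ins_torsion_unit78.
Qed.

End Kernel.

(** * The almost Hermitian factor *)

Section GrayHervella.
Context {R : realType} {n : nat}.
Implicit Types (x y z : 'rV[R]_n) (J : 'M[R]_n) (A B : 'I_n -> 'M[R]_n).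

Lemma trilinE A x y z :
  trilin A x y z = \sum_i \sum_j \sum_l x 0 i * y 0 j * z 0 l * A i j l.
Proof.
apply: eq_bigr => i _; rewrite mxE mulr_sumr exchange_big; apply: eq_bigr => l _ /=.
rewrite !mxE mulr_suml mulr_sumr; apply: eq_bigr => j _; ring.
Qed.

Lemma trilinD A B x y z : trilin (fun i => A i + B i) x y z = trilin A x y z + trilin B x y z.
Proof. by rewrite -big_split; apply: eq_bigr => i _ /=; rewrite mulmxDr mulmxDl mxE mulrDr. Qed.

Lemma trilinZ a A x y z : trilin (fun i => a *: A i) x y z = a * trilin A x y z.
Proof.
rewrite mulr_sumr; apply: eq_bigr => i _ /=.
by rewrite -scalemxAr -scalemxAl mxE mulrCA.
Qed.

Lemma trilin_mulr J A x y z : trilin (fun i => A i *m J^T) x y z = trilin A x y (z *m J).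
Proof. by apply: eq_bigr => i _; rewrite trmx_mul !mulmxA. Qed.

Lemma trilin_mull J A x y z : trilin (fun i => J *m A i) x y z = trilin A x (y *m J) z.
Proof. by apply: eq_bigr => i _; rewrite !mulmxA. Qed.

Lemma trilin_sum J A x y z : trilin (fun i => \sum_k J i k *: A k) x y z = trilin A (x *m J) y z.
Proof.
rewrite /trilin; under [RHS]eq_bigr => k _ do rewrite mxE mulr_suml.
rewrite exchange_big; apply: eq_bigr => i _ /=.
rewrite mulmx_sumr mulmx_suml summxE mulr_sumr; apply: eq_bigr => k _.
by rewrite -scalemxAr -scalemxAl mxE mulrA.
Qed.

Lemma trilinNl A x y z : trilin A (- x) y z = - trilin A x y z.
Proof. by rewrite -sumrN; apply: eq_bigr => i _; rewrite mxE mulNr. Qed.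

Lemma trilinNm A x y z : trilin A x (- y) z = - trilin A x y z.
Proof. by rewrite -sumrN; apply: eq_bigr => i _; rewrite !mulNmx [in LHS]mxE mulrN. Qed.

Lemma trilinNr A x y z : trilin A x y (- z) = - trilin A x y z.
Proof. by rewrite -sumrN; apply: eq_bigr => i _; rewrite linearN /= mulmxN [in LHS]mxE mulrN. Qed.

Variable t : tens R n 3.
Hypothesis ta : Defs.alternating t.

Definition slot (i : 'I_n) : 'M[R]_n := \matrix_(j, l) t (ix3 i j l).
Let tau := trilin slot.

Lemma slot_swap x y z : tau x y z = - tau x z y.
Proof.
rewrite /tau !trilinE -sumrN; apply: eq_bigr => i _.
rewrite [X in _ = - X]exchange_big -sumrN; apply: eq_bigr => j _ /=.
rewrite -sumrN; apply: eq_bigr => l _.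
by rewrite !mxE (alt23 i j l ta); ring.
Qed.

Lemma slot_rot x y z : tau x y z = - tau y x z.
Proof.
rewrite /tau !trilinE [X in _ = - X]exchange_big -sumrN; apply: eq_bigr => i _ /=.
rewrite -sumrN; apply: eq_bigr => j _; rewrite -sumrN; apply: eq_bigr => l _.
by rewrite !mxE (alt12 i j l ta); ring.
Qed.

Variables (g J : 'M[R]_n).
Hypotheses (gi_sym : (invmx g)^T = invmx g) (JJ : J *m J = - 1%:M).

(** The 2-form T(., ., z), whose traces with J express the contraction condition. *)
Let b z : 'M[R]_n := \matrix_(i, j) \sum_l t (ix3 i j l) * z 0 l.

Let tau_b x y z : tau x y z = (x *m b z *m y^T) 0 0.
Proof.
rewrite /tau trilinE mxE exchange_big /=; apply: eq_bigr => j _.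
rewrite !mxE mulr_suml; apply: eq_bigr => i _; rewrite mxE mulr_sumr mulr_suml.
by apply: eq_bigr => l _; rewrite mxE; ring.
Qed.

Let b_skew z : (b z)^T = - b z.
Proof.
apply/matrixP => i j; rewrite !mxE -sumrN; apply: eq_bigr => l _.
by rewrite (alt12 j i l ta) mulNr.
Qed.

Let tr_skew (A : 'M[R]_n) : A^T = - A -> \tr (invmx g *m A) = 0.
Proof.
move=> sk; have : \tr (invmx g *m A) = - \tr (invmx g *m A).
  by rewrite -{1}mxtrace_tr trmx_mul gi_sym sk mulNmx linearN /= mxtrace_mulC.
by lra.
Qed.

Let tr_pair (A : 'M[R]_n) : \sum_i \sum_j invmx g i j * A i j = \tr (invmx g *m A^T).
Proof.
by apply: eq_bigr => i _; rewrite mxE; apply: eq_bigr => j _; rewrite mxE.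
Qed.

Hypothesis trace0 : forall z, \tr (invmx g *m J *m b z) = 0.

Let TJ i := \sum_k J i k *: slot k.
Let A i := (- 2^-1) *: (slot i *m J^T + J *m slot i).
Let A1 i := (- 4^-1) *: (slot i *m J^T + TJ i + J *m slot i + (- 1) *: (J *m (TJ i *m J^T))).

Let xJJ x : x *m J *m J = - x.
Proof. by rewrite -mulmxA JJ mulmxN mulmx1. Qed.

(* A is nabla^g Omega for the torsion t, and A1 comes from the part of t of type
   (3,0) + (0,3). *)
Let AE x y z : trilin A x y z = - 2^-1 * (tau x y (z *m J) + tau x (y *m J) z).
Proof. by rewrite /A trilinZ trilinD trilin_mulr trilin_mull. Qed.

Let A1E x y z : trilin A1 x y z = - 4^-1 * (tau x y (z *m J) + tau (x *m J) y z + tau x (y *m J) z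
  - tau (x *m J) (y *m J) (z *m J)).
Proof.
rewrite /A1 trilinZ !trilinD trilin_mulr trilin_mull trilinZ trilin_sum.
by rewrite (trilin_mull J (fun i => TJ i *m J^T)) (trilin_mulr J TJ) trilin_sum mulN1r.
Qed.

(** A1(x, y, z) is - t'(Jx, y, z), where t'(x, y, z) = (t(x, y, z) - t(Jx, Jy, z) - t(x, Jy, Jz) -
    t(Jx, y, Jz)) / 4 is the part of type (3,0) + (0,3). It is totally skew, and removing it from A
    leaves a tensor invariant under J in the first two arguments. *)
Lemma torsion_W1_W3 : exists A1 A3 : 'I_n -> 'M[R]_n,
  [/\ GH_W1 J A1, GH_W3 g J A3 & forall i, A1 i + A3 i = A i].
Proof.
have A_W : GH_W J A.
  move=> x y z; rewrite !AE; split.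
    by rewrite (slot_swap x z) (slot_swap x (z *m J)); ring.
  by rewrite !xJJ /tau trilinNr trilinNm -/tau; ring.
have A1_W : GH_W J A1.
  move=> x y z; rewrite !A1E; split.
    rewrite (slot_swap x z) (slot_swap (x *m J) z) (slot_swap x (z *m J)) (slot_swap _ (z *m J) (y *m J)).
    by ring.
  by rewrite !xJJ /tau !(trilinNr, trilinNm) -/tau; ring.
exists A1, (fun i => A i + (- 1) *: A1 i); split; last by move=> i; rewrite scaleN1r addrC subrK.
  split=> // x z; rewrite A1E.
  have z0 u v : tau u u v = 0 by have := slot_rot u u v; lra.
  by rewrite !z0 (slot_rot x (x *m J)); ring.
have A3E x y z : trilin (fun i => A i + (- 1) *: A1 i) x y z = 4^-1 * (- tau x y (z *m J) - tau x (y *m J) z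
     + tau (x *m J) y z - tau (x *m J) (y *m J) (z *m J)).
  by rewrite (trilinD A (fun i => -1 *: A1 i)) (trilinZ _ A1) AE A1E; field.
split.
- move=> x y z; rewrite !(trilinD A (fun i => -1 *: A1 i)) !(trilinZ _ A1); split.
    by rewrite (A_W x y z).1 (A1_W x y z).1; ring.
  by rewrite (A_W x y z).2 (A1_W x y z).2; ring.
- move=> x y z; rewrite !A3E !xJJ /tau !(trilinNl, trilinNm) -/tau; ring.
(* [C] is the matrix of A3 for fixed [z]. Two of its four terms are skew and have no trace against
   the symmetric inverse metric; the traces of the other two are those of [trace0]. *)
- move=> z; pose C : 'M[R]_n := 4^-1 *: (- b (z *m J) - b z *m J^T + J *m b z - J *m b (z *m J) *m J^T).
  transitivity (\sum_i \sum_j invmx g i j * C i j).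
    apply: eq_bigr => i _; apply: eq_bigr => j _; congr (_ * _); rewrite A3E !tau_b.
    pose u : 'rV[R]_n := delta_mx 0 i; pose v : 'rV[R]_n := delta_mx 0 j.
    have e (D : 'M[R]_n) : (u *m D *m v^T) 0 0 = D i j by rewrite trmx_delta -rowE -colE !mxE.
    have e2 (D : 'M[R]_n) : (u *m D *m (v *m J)^T) 0 0 = (D *m J^T) i j by rewrite -e trmx_mul !mulmxA.
    have e3 (D : 'M[R]_n) : (u *m J *m D *m v^T) 0 0 = (J *m D) i j by rewrite -e !mulmxA.
    have e4 (D : 'M[R]_n) : (u *m J *m D *m (v *m J)^T) 0 0 = (J *m D *m J^T) i j.
      by rewrite -e trmx_mul !mulmxA.
    rewrite -/u -/v e e2 e3 e4 /C.
    by move: (b z *m J^T) (J *m b z) (J *m b (z *m J) *m J^T) => X1' X2' X3'; rewrite !mxE.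
  rewrite tr_pair /C linearZ /= -scalemxAr linearZ /=.
  have -> : (- b (z *m J) - b z *m J^T + J *m b z - J *m b (z *m J) *m J^T)^T =
     b (z *m J) + J *m b z + (J *m b z)^T + J *m b (z *m J) *m J^T.
    rewrite !(linearD, linearN) /= !trmx_mul trmxK !b_skew mulmxN mulNmx !opprK !mulmxA.
    by rewrite mulmxN mulNmx opprK.
  rewrite !mulmxDr !linearD /= tr_skew // (tr_skew (A := J *m b (z *m J) *m J^T)).
    rewrite mulmxA trace0 -[\tr (_ *m (J *m b z)^T)]mxtrace_tr trmx_mul trmxK gi_sym mxtrace_mulC mulmxA trace0.
    by rewrite !addr0 mulr0.
  by rewrite !trmx_mul trmxK b_skew mulNmx mulmxN mulmxA.
Qed.

End GrayHervella.

(** * Parallel 2-forms and the derivative of the Kaehler form *)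

Section TwoForms.
Context {R : realType}.

Lemma ins_alternating n k (w : 'rV[R]_n) (t : tens R n k.+1) : Defs.alternating t ->
  Defs.alternating (ins w t).
Proof.
move=> h s j; rewrite !ffunE mulr_sumr; apply: eq_bigr => l _; rewrite mulrCA; congr (_ * _).
have := h (lift_perm ord0 ord0 s) (icons l j); rewrite odd_lift_perm /= => <-; congr (t _).
apply/ffunP => a; rewrite !ffunE.
case: (unliftP ord0 a) => [b ->|->]; first by rewrite lift_perm_lift liftK ffunE.
by rewrite lift_perm_id unlift_none.
Qed.

Lemma ins_subE n k (v w : 'rV[R]_n) (t s : tens R n k.+1) j :
  (ins v t - ins w s) j = \sum_l (v 0 l * t (icons l j) - w 0 l * s (icons l j)).
Proof. by rewrite !ffunE -sumrB. Qed.

Lemma mx2_inj n (t s : tens R n 2) : mx2 t = mx2 s -> t = s.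
Proof.
move=> /matrixP e; apply/ffunP => j; have := e (j 0) (j 1); rewrite !mxE.
have -> : ix2 (j 0) (j 1) = j; last by [].
apply/ffunP => a; rewrite ffunE.
by case: a => -[|[|//]] h /=; congr (j _); exact: val_inj.
Qed.

Lemma mx2_pull m n (A : 'M[R]_(m, n)) (t : tens R n 2) : mx2 (pull A t) = A *m mx2 t *m A^T.
Proof.
apply/matrixP => i j; rewrite mxE ix2E -insE -insE -!pull_ins ffunE.
rewrite (bigD1 (ffun0 (card_ord 0))) //= big_ord0 mulr1 [X in _ + X]big1 ?addr0; last first.
  by move=> l /eqP[]; apply/ffunP => -[].
rewrite ffunE mxE; apply: eq_bigr => b _; rewrite -rowE [in RHS]mxE mulrC [A^T _ _]mxE.
rewrite [row j A 0 b]mxE; congr (_ * _); rewrite ffunE; apply: eq_bigr => a _.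
by rewrite -rowE !mxE ix2E.
Qed.

Lemma mx2_dact n (C : 'M[R]_n) (t : tens R n 2) : mx2 (dact C t) = C *m mx2 t + mx2 t *m C^T.
Proof.
apply/matrixP => i j; rewrite !mxE ffunE big_ord_recl big_ord1; congr (_ + _).
  apply: eq_bigr => l _; rewrite mxE; congr (_ * t _); first by rewrite ffunE.
  by apply/ffunP => a; rewrite !ffunE; case: a => -[|[|//]] h.
apply: eq_bigr => l _; rewrite !mxE mulrC; congr (t _ * C _ _); last by rewrite ffunE.
by apply/ffunP => a; rewrite !ffunE; case: a => -[|[|//]] h.
Qed.

Lemma mx2_skew n (t : tens R n 2) : Defs.alternating t -> (mx2 t)^T = - mx2 t.
Proof.
move=> h; apply/matrixP => i j; rewrite !mxE.
have := h (tperm 0 1) (ix2 i j); rewrite odd_tperm /= expr1 mulN1r => <-; congr (t _).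
apply/ffunP => a; rewrite !ffunE.
by case: tpermP => [->|->|] //; case: a => -[|[|//]] h' // n0 n1; [case: n0|case: n1]; exact: val_inj.
Qed.

Context {n : nat} {M : rmfd R n}.
Variable T : tensor_field M 3.
Hypotheses (hR : riemannian M) (hT : is_form T).
Implicit Types (c d : chart M) (p : M).

Let hM : smooth_manifold M. Proof. by case: hR. Qed.
Let oC c : open (chart_codom c). Proof. exact: codom_open hM c. Qed.

Lemma frame_vec k (V : chart M -> M -> 'M[R]_(k, n)) (w : 'rV[R]_k) : parallel_frame T V ->
  parallel_vec T (fun c p => w *m V c p).
Proof.
move=> [Vj Vs _ Vp _]; split.
- by move=> c d p cp dp; rewrite (Vj c d p cp dp) mulmxA.
- by move=> c; have h := smooth_on_mulmx (@oC c) (smooth_on_cst w) (Vs c); exact: h.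
- move=> c p i cp.
  have d1 := is_derive_partial i cp (Vs c).
  case: (is_derive_mulmx (is_derive_cst w (chart_map c p) (delta_mx 0 i)) d1) => _ e; apply: (etrans e).
  by rewrite mul0mx add0r (Vp c p i cp) mulmxN mulmxA.
Qed.

Lemma form_ins_par k (y : chart M -> M -> 'rV[R]_n) (t : tensor_field M k.+1) :
  parallel_vec T y -> parallel_form T t -> parallel_form T (fun c p => ins (y c p) (t c p)).
Proof.
move=> [yj ys yp] tp; have [[tj ts ta] _] := tp; split; first split.
- by move=> c d p cp dp; rewrite (yj c d p cp dp) (tj c d p cp dp) pull_ins.
- by move=> c j; apply: (smooth_on_ins (@oC c)) => //; exact: ys.
- by move=> c p cp; apply: ins_alternating; exact: ta.
- move=> c p i cp; apply/ffunP => j; rewrite /nabla [LHS]ffunE [X in X + _]ffunE [X in _ + X]ffunE [RHS]ffunE.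
  apply/eqP; rewrite subr_eq0; apply/eqP.
  have dy := is_derive_partial i cp (@ys c); rewrite (yp c p i cp) in dy.
  move/is_derive_mxP: dy => dy.
  have dt l := form_par hR i cp tp (icons l j).
  have h := is_derive_sumr (fun l => is_derive_mulr (dy 0 l) (dt l)).
  rewrite /partial (_ : _ \o _ = fun x => \sum_l (y c \o chart_inv c) x 0 l * t c (chart_inv c x) (icons l j)); last first.
    by apply/funext => x /=; rewrite ffunE.
  case: h => _ e; apply: (etrans e); rewrite /= (chart_mapK hM cp).
  have E := dact_ins (skew_connection T c p i) (y c p) (t c p).
  rewrite E ins_subE.
  apply: eq_bigr => l _; congr (_ + _); rewrite -mulNr; congr (_ * _).
  by move: (y c p *m _) => w; rewrite mxE.
Qed.

Lemma form_endo_par (t : tensor_field M 2) : parallel_form T t ->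
  parallel_endo T (fun c p => mx2 (t c p) *m invmx (metric c p)).
Proof.
move=> tp; have [[tj ts _] _] := tp; split.
- move=> c d p cp dp; rewrite (tj c d p cp dp) mx2_pull -!mulmxA; congr (_ *m (_ *m _)).
  by rewrite mulmxA; exact: (ginv_jac hR cp dp).
- move=> c; have sg := @ginv_smooth _ _ _ hR c.
  have sw : smooth_on (chart_codom c) (fun x => mx2 (t c (chart_inv c x))).
    apply/(smooth_on_mxP (@oC c)) => i j; apply: (smooth_on_ext (@oC c)) (ts c (ix2 i j)) => x _.
    by rewrite mxE.
  by have h := smooth_on_mulmx (@oC c) sw sg; exact: h.
- move=> c p i cp.
  have dg := ginv_par hR hT i cp.
  have dw : is_derive (chart_map c p) (delta_mx 0 i) (fun x => mx2 (t c (chart_inv c x)))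
      (mx2 (dact (skew_connection T c p i) (t c p))).
    apply/is_derive_mxP => a b; rewrite (_ : (fun x => _) = fun x => t c (chart_inv c x) (ix2 a b)).
      by rewrite mxE; exact: form_par.
    by apply/funext => x; rewrite mxE.
  have e : (fun y => invmx (metric c (chart_inv c y))) (chart_map c p) = invmx (metric c p).
    by rewrite (chart_mapK hM cp).
  have et : (fun y => mx2 (t c (chart_inv c y))) (chart_map c p) = mx2 (t c p) by rewrite (chart_mapK hM cp).
  case: (is_derive_mulmx dw dg) => _; rewrite e et => E; apply: (etrans E).
  rewrite mx2_dact mulmxDl mulmxN mulmxDr opprD !mulmxA addrA.
  by rewrite -[X in X - _]addrA subrr addr0.
Qed.

Lemma skew_connection_lc c p i :
  skew_connection T c p i = levi_civita c p i + 2^-1 *: (slot (T c p) i *m invmx (metric c p)).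
Proof.
apply/matrixP => j l; rewrite /levi_civita /skew_connection [LHS]mxE [RHS]mxE.
rewrite [X in _ = X + _]mxE [X in _ = _ + X]mxE [(_ *m invmx _) _ _]mxE -mulrDr -big_split; congr (_ * _).
apply: eq_bigr => m _ /=; rewrite [(0 : tens R n 3) _]ffunE [slot _ _ _ _]mxE addr0 mulrDl.
by [].
Qed.

(** The Kaehler form is parallel for the connection with torsion, so its Levi-Civita derivative is
    the action of the difference of the two connections, which is half of the torsion. *)
Lemma nabla_kahler_form (t : tensor_field M 2) (J : endo_field M) c p i : parallel_form T t ->
  (forall c p, chart_dom c p -> J c p *m metric c p = mx2 (t c p)) -> chart_dom c p ->
  \matrix_(j, k) nabla (@levi_civita R n M) (kahler_form J) c p i (ix2 j k) =
  2^-1 *: (slot (T c p) i *m invmx (metric c p) *m mx2 (t c p)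
    + mx2 (t c p) *m (slot (T c p) i *m invmx (metric c p))^T).
Proof.
move=> tp Jt cp; have kt d q : chart_dom d q -> kahler_form J d q = t d q.
  move=> dq; apply: mx2_inj; rewrite -(Jt d q dq); apply/matrixP => a b.
  by rewrite mxE ffunE !ffunE.
set S := slot _ _ *m _.
have -> : \matrix_(j, k) nabla (@levi_civita R n M) (kahler_form J) c p i (ix2 j k) =
    mx2 (dact (2^-1 *: S) (t c p)).
  apply/matrixP => a b; rewrite mxE [RHS]mxE /nabla ffunE (kt c p cp).
  have -> : 2^-1 *: S = skew_connection T c p i - levi_civita c p i.
    by rewrite skew_connection_lc addrC addKr.
  rewrite dactDl -(scaleN1r (levi_civita c p i)) dactZl scaleN1r [RHS]ffunE; congr (_ + _); rewrite ffunE.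
  have dt := form_par hR i cp tp (ix2 a b).
  have E : \forall x \near chart_map c p, t c (chart_inv c x) (ix2 a b) =
      ((fun q => kahler_form J c q (ix2 a b)) \o chart_inv c) x.
    have := open_nbhs_nbhs (conj (@oC c) (chart_map_codom cp)).
    by apply: filterS => x cx /=; rewrite (kt c _ (chart_inv_dom hM cx)).
  by case: (near_eq_is_derive E dt).
by rewrite mx2_dact linearZ /= -scalemxAl -scalemxAr -scalerDr.
Qed.

End TwoForms.

(** * Tensors fixed by parallel transport and annihilated by the holonomy algebra *)

Section Holonomy.
Context {R : realType} {m : nat}.
Variables (X : rmfd R m) (TX : tensor_field X 3).
Hypotheses (hX : riemannian X) (hTX : is_form TX).

Lemma parallel_along_par (g : R -> X) (F : chart X -> R -> 'M[R]_m) : C1_curve g ->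
  parallel_along (skew_connection TX) g F -> par_along TX g F.
Proof.
move=> [cg hg] [Fj FD]; split=> // c t ct; exists (velocity c g t).
  by have [dg _] := hg c t ct; rewrite /velocity derive1E; exact: derivableP.
have := FD c t ct; congr (is_derive _ _ _ _); congr (- _).
rewrite /cn mulmx_sumr; apply: eq_bigr => i _.
by rewrite -scalemxAr.
Qed.

Lemma transport_metric p c q d P : transport (skew_connection TX) p c q d P ->
  P *m metric d q *m P^T = metric c p.
Proof.
elim=> [g F c' d' C1 pF c0 d1 F0|p' c' q' d' r e P' Q _ h1 _ h2].
  have := par_metric hX hTX (C1.1) (parallel_along_par C1 pF) d1 c0.
  by rewrite F0 trmx1 mul1mx mulmx1.
by rewrite trmx_mul -h1 -h2 !mulmxA.
Qed.

(** [th] stands for a parallel tensor of the ambient manifold in the frame completed by [V], which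
    has [k] more directions than [X]; [ext] lets a transport of [X] fix these directions. *)
Variables (k j : nat) (th : chart X -> X -> tens R (m + k) j).
Let ext (P : 'M[R]_m) : 'M[R]_(m + k) := block_mx P 0 0 1%:M.
Hypothesis th_par : forall (g : R -> X) (P : chart X -> R -> 'M[R]_m), continuous g ->
  par_along TX g P -> forall (d e : chart X) u v, chart_dom d (g u) -> chart_dom e (g v) ->
  pull (ext (P d u)) (th d (g u)) = pull (ext (P e v)) (th e (g v)).

Lemma transport_fixes p c q d P : transport (skew_connection TX) p c q d P ->
  pull (ext P) (th d q) = th c p.
Proof.
elim=> [g F c' d' C1 pF c0 d1 F0|p' c' q' d' r e P' Q _ h1 _ h2].
  rewrite (th_par C1.1 (parallel_along_par C1 pF) d1 c0) F0 /ext.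
  by rewrite -scalar_mx_block pull1.
rewrite -h1 -h2 pull_mul /ext mulmx_block !mul0mx !mulmx0 !mulmx1 !addr0 !add0r.
by [].
Qed.

Lemma is_derive_ext (u : R -> 'M[R]_m) (A : 'M[R]_m) (t : R) : is_derive t 1 u A ->
  is_derive t 1 (fun s => ext (u s)) (block_mx A 0 0 0).
Proof.
move=> /is_derive_mxP du; apply/is_derive_mxP => a b.
have [x ->|x ->] := split_ordP a; have [y ->|y ->] := split_ordP b.
- rewrite block_mxEul (_ : (fun s => _) = fun s => u s x y); first exact: du.
  by apply/funext => s; rewrite /ext block_mxEul.
- rewrite block_mxEur mxE (_ : (fun s => _) = fun=> 0); first exact: is_derive_cst.
  by apply/funext => s; rewrite /ext block_mxEur mxE.
- rewrite block_mxEdl mxE (_ : (fun s => _) = fun=> 0); first exact: is_derive_cst.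
  by apply/funext => s; rewrite /ext block_mxEdl mxE.
- rewrite block_mxEdr mxE (_ : (fun s => _) = fun=> (1%:M : 'M[R]_k) x y); first exact: is_derive_cst.
  by apply/funext => s; rewrite /ext block_mxEdr.
Qed.

(** The one-parameter group of [A] consists of transports along loops, which fix [th];
    differentiating at time 0 gives the infinitesimal statement. *)
Lemma holonomy_kills c p A : holonomy_algebra (skew_connection TX) c p A ->
  dact (block_mx A 0 0 0 : 'M[R]_(m + k)) (th c p) = 0.
Proof.
move=> [u [u0 du hu]]; set B : 'M[R]_(m + k) := block_mx _ _ _ _.
have d0 : is_derive (0 : R) 1 (fun s => ext (u s)) B.
  by apply: is_derive_ext; have := du 0; rewrite u0 mul1mx.
have e0 : ext (u 0) = 1%:M by rewrite u0 /ext -scalar_mx_block.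
have dA a b : is_derive (0 : R) 1 (fun s => ext (u s) a b) ((B *m ext (u 0) - ext (u 0) *m 0) a b).
  by rewrite e0 mulmx1 mulmx0 subr0; have /is_derive_mxP := d0; exact.
have dt l : is_derive (0 : R) 1 (fun _ : R => th c p l) (dact 0 (th c p) l).
  have -> : dact 0 (th c p) = 0 by rewrite -[0 : 'M[R]_(m + k)](scale0r 0) dactZl scale0r.
  by rewrite ffunE; exact: is_derive_cst.
apply/ffunP => l; have := is_derive_pull_conn l dA dt; rewrite e0 pull1 => d1.
have d2 : is_derive (0 : R) 1 (fun s => pull (ext (u s)) (th c p) l) 0.
  rewrite (_ : (fun s => _) = fun=> th c p l); first exact: is_derive_cst.
  by apply/funext => s; rewrite (transport_fixes (hu s)).
by rewrite (is_derive_uniq d1 d2) ffunE.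
Qed.

Lemma holonomy_skew c p A : holonomy_algebra (skew_connection TX) c p A ->
  A *m metric c p + metric c p *m A^T = 0.
Proof.
move=> [u [u0 du hu]]; set g := metric c p.
have d0 : is_derive (0 : R) 1 u A by have := du 0; rewrite u0 mul1mx.
have dg : is_derive (0 : R) 1 (fun _ : R => g) 0 by exact: is_derive_cst.
have d1 := is_derive_mulmx (is_derive_mulmx d0 dg) (is_derive_trmx d0).
have d2 : is_derive (0 : R) 1 (fun s => u s *m g *m (u s)^T) 0.
  rewrite (_ : (fun s => _) = fun=> g); first exact: is_derive_cst.
  by apply/funext => s; rewrite (transport_metric (hu s)).
have := is_derive_uniq d1 d2.
by rewrite u0 trmx1 mulmx0 addr0 mulmx1 mul1mx.
Qed.

End Holonomy.

Section Conjugation.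
Context {R : realType} {n : nat}.
Implicit Types E df A g : 'M[R]_n.

Lemma dact_conj k E df A (t : tens R n k) : E \in unitmx -> df \in unitmx -> dact A t = 0 ->
  dact (E *m (df *m A *m invmx df) *m invmx E) (pull E (pull df t)) = 0.
Proof. by move=> uE ud h; rewrite !dact_pull // h !pull0. Qed.

Lemma skew_conj E df A g : g^T = g -> E \in unitmx -> df \in unitmx ->
  E *m (df *m g *m df^T) *m E^T = 1%:M -> A *m g + g *m A^T = 0 ->
  (E *m (df *m A *m invmx df) *m invmx E)^T = - (E *m (df *m A *m invmx df) *m invmx E).
Proof.
move=> gs uE ud e sk; pose K := E *m df.
have uK : K \in unitmx by rewrite unitmx_mul uE ud.
have eK : K *m (g *m K^T) = 1%:M by rewrite trmx_mul -e !mulmxA.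
have -> : E *m (df *m A *m invmx df) *m invmx E = K *m (A *m g) *m K^T.
  transitivity (K *m A *m (g *m K^T)); last by rewrite !mulmxA.
  apply: (can_inj (mulmxK uK)); rewrite -[K *m A *m _ *m K]mulmxA (mulmx1C eK) mulmx1.
  rewrite /K -!mulmxA; do 2 congr (_ *m _).
  by rewrite (mulKmx uE) mulVmx // mulmx1.
move/eqP: sk; rewrite addr_eq0 => /eqP sk.
by apply: conj_skew; rewrite trmx_mul gs sk opprK.
Qed.

End Conjugation.

(** * Linear algebra relating the model to the factor X *)

Section Reduction.
Context {R : realType}.

Lemma ins_addv n k (v w : 'rV[R]_n) (t : tens R n k.+1) : ins (v + w) t = ins v t + ins w t.
Proof.
apply/ffunP => j; rewrite !ffunE -big_split; apply: eq_bigr => l _ /=.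
by rewrite !mxE mulrDl.
Qed.

Lemma ins_scalev n k (a : R) (v : 'rV[R]_n) (t : tens R n k.+1) : ins (a *: v) t = a *: ins v t.
Proof.
apply/ffunP => j; rewrite !ffunE scaler_sumr; apply: eq_bigr => l _ /=.
by rewrite mxE; exact: esym (mulrA _ _ _).
Qed.

Lemma ins_unit78 (a b c d : R) :
  ins (unit78 c d) (ins (unit78 a b) (Phi0 R)) = (a * d - b * c) *: Z2.
Proof.
have e (x y : R) k (t : tens R 8 k.+1) :
    ins (unit78 x y) t = x *: ins (delta_mx 0 i7) t + y *: ins (delta_mx 0 i8) t.
  by rewrite /unit78 ins_addv !ins_scalev.
move: (@Phi0_77 R) (@Phi0_88 R) (@Phi0_78 R); rewrite /Z2; move: (Phi0 R) => t h77 h88 h78.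
rewrite !e !(insD, insZ) h77 h88 h78 !scaler0 add0r addr0.
by rewrite !scalerN !scalerA scalerBl addrC [d * a]mulrC [c * b]mulrC.
Qed.

Lemma e78_p78 : (e78 : 'M[R]_(1 + 1, 8))^T *m e78 = p78.
Proof.
by rewrite /e78 tr_col_mx mul_row_col !trmx_delta !mul_delta_mx.
Qed.

Lemma e78_Z2 : e78 *m mx2 Z2 = 0 :> 'M[R]_(1 + 1, 8).
Proof. transitivity (e78 *m (p78 *m mx2 Z2) : 'M[R]_(1 + 1, 8)); last by rewrite Z2_78 mulmx0.
by rewrite -e78_p78 !mulmxA e78_orth mul1mx.
Qed.

Section Pointwise.
Variables (g E W : 'M[R]_8) (K : 'M[R]_(1 + 1)) (de : R).
Hypotheses (Eg : E *m g *m E^T = 1%:M) (KK : K *m K^T = 1%:M) (de1 : de ^+ 2 = 1).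
Hypothesis EW : E *m W *m E^T = de *: mx2 Z2.
Let V := K *m e78 *m E.

Let uE : E \in unitmx. Proof. exact: gram1_unit Eg. Qed.

Let inj (m : nat) (A B : 'M[R]_(m, 8)) : A *m E^T = B *m E^T -> A = B.
Proof. by apply: (can_inj (mulmxK _)); rewrite unitmx_tr. Qed.

Lemma frame_form_kernel : V *m W = 0.
Proof.
apply: inj; rewrite mul0mx /V -!mulmxA [E *m _]mulmxA EW.
by rewrite -!scalemxAr e78_Z2 mulmx0 scaler0.
Qed.

(** In the frame [E] this is the identity Z^2 = -1 on span(e_1, ..., e_6): the sign [de] disappears
    in the square, and since [K] is orthogonal, [V] gives the same projector on the plane as
    [e78]. *)
Lemma frame_form_sqr : W *m (E^T *m E) *m W = - (g - g *m V^T *m V *m g).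
Proof.
have inj' (A B : 'M[R]_8) : E *m A *m E^T = E *m B *m E^T -> A = B.
  by move=> /inj; apply: (can_inj (mulKmx uE)).
apply: inj'.
have -> : E *m (W *m (E^T *m E) *m W) *m E^T = (E *m W *m E^T) *m (E *m W *m E^T) by rewrite !mulmxA.
rewrite EW -scalemxAl -scalemxAr scalerA -expr2 de1 scale1r Z2_sqr.
rewrite mulmxN mulNmx mulmxBr mulmxBl Eg opprB; congr (_ - _).
have -> : E *m (g *m V^T *m V *m g) *m E^T = (E *m g *m E^T) *m (e78^T *m (K^T *m K) *m e78) *m (E *m g *m E^T).
  by rewrite /V !trmx_mul !mulmxA.
by rewrite Eg (mulmx1C KK) mulmx1 mul1mx mulmx1 e78_p78.
Qed.

End Pointwise.

Section Adapted.
Variables (m k : nat).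
Local Notation n := (m + k)%N.
Variables (g W : 'M[R]_n) (S : 'M[R]_(m, n)) (V : 'M[R]_(k, n)).
Let gX := S *m g *m S^T.
Hypotheses (ug : g \in unitmx) (gs : g^T = g) (uX : gX \in unitmx).
Hypotheses (SV : S *m g *m V^T = 0) (VV : V *m g *m V^T = 1%:M).

Lemma VgS : V *m g *m S^T = 0.
Proof. by apply: trmx_inj; rewrite !trmx_mul trmxK gs trmx0 mulmxA. Qed.

Lemma metric_splitting : col_mx S V *m g *m (col_mx S V)^T = block_mx gX 0 0 1%:M.
Proof. by rewrite tr_col_mx mul_col_mx mul_col_row SV VgS VV. Qed.

Lemma ginv_splitting : invmx g = S^T *m invmx gX *m S + V^T *m V.
Proof.
pose Q := col_mx S V; pose D : 'M[R]_n := block_mx (invmx gX) 0 0 1%:M.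
have e : Q *m (g *m Q^T *m D) = 1%:M.
  rewrite !mulmxA metric_splitting mulmx_block !mul0mx !mulmx0 !mulmx1 !addr0 !add0r mulmxV //.
  by rewrite -scalar_mx_block.
have e' := mulmx1C e.
apply: (can_inj (mulKmx ug)); rewrite mulmxV // -[LHS]e' -!mulmxA; congr (_ *m _).
rewrite /D /Q tr_col_mx mul_block_col mul_row_col !mul0mx !mul1mx addr0 add0r.
by rewrite mulmxA.
Qed.

Hypotheses (VW : V *m W = 0) (Ws : W^T = - W).
Hypothesis WW : W *m invmx g *m W = - (g - g *m V^T *m V *m g).
Let J := S *m W *m S^T *m invmx gX.

Lemma complex_sqr : J *m J = - 1%:M.
Proof.
have -> : J *m J = S *m (W *m (S^T *m invmx gX *m S) *m W) *m S^T *m invmx gX.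
  by rewrite /J !mulmxA.
have -> : S^T *m invmx gX *m S = invmx g - V^T *m V by rewrite ginv_splitting addrK.
have -> : W *m (invmx g - V^T *m V) *m W = W *m invmx g *m W.
  by rewrite mulmxBr mulmxBl -[W *m (V^T *m V) *m W]mulmxA -[V^T *m V *m W]mulmxA VW !mulmx0 subr0.
rewrite WW mulmxN !mulNmx mulmxBr mulmxBl -/gX !mulmxA SV !mul0mx subr0.
by rewrite mulmxV.
Qed.

Lemma complex_isometry : J *m gX *m J^T = gX.
Proof.
have JX : J *m gX = S *m W *m S^T by rewrite /J mulmxKV.
have gXs : gX^T = gX by rewrite /gX !trmx_mul trmxK gs mulmxA.
have e : (J *m gX)^T = - (J *m gX).
  by rewrite JX !trmx_mul trmxK Ws mulNmx mulmxN mulmxA.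
have -> : J *m gX *m J^T = J *m (J *m gX)^T by rewrite (trmx_mul J gX) gXs; exact: esym (mulmxA J gX J^T).
by rewrite e mulmxN mulmxA complex_sqr mulNmx mul1mx opprK.
Qed.

Lemma tangent_contraction : S^T *m invmx gX *m S *m W *m (S^T *m invmx gX *m S)^T = invmx g *m W *m (invmx g)^T.
Proof.
have -> : S^T *m invmx gX *m S = invmx g - V^T *m V by rewrite ginv_splitting addrK.
have WV : W *m V^T = 0.
  by apply: trmx_inj; rewrite trmx_mul trmxK Ws mulmxN VW oppr0 trmx0.
rewrite mulmxBl -[V^T *m V *m W]mulmxA VW mulmx0 subr0 linearB /= mulmxBr trmx_mul trmxK.
by rewrite -[X in _ - X]mulmxA [W *m _]mulmxA WV mul0mx mulmx0 subr0.
Qed.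

End Adapted.

Lemma sum_ix2 n (F : {ffun 'I_2 -> 'I_n} -> R) : \sum_j F j = \sum_a \sum_b F (ix2 a b).
Proof.
rewrite (@sum_ffunS R n 1 F (@icons n 1)) //; apply: eq_bigr => a _.
rewrite (@sum_ffunS R n 0 _ (@icons n 0)) //; apply: eq_bigr => b _.
rewrite (bigD1 (ffun0 (card_ord 0))) //= big1 ?addr0 ?ix2E // => j /eqP[].
by apply/ffunP => -[].
Qed.

Lemma trace_slot n (gi : 'M[R]_n) (om : tens R n 2) (t : tens R n 3) (z : 'rV[R]_n) :
  Defs.alternating t ->
  \tr (gi^T *m mx2 om *m gi *m (\matrix_(i, j) \sum_l t (ix3 i j l) * z 0 l)) = - ip gi om (ins z t).
Proof.
move=> ta; have -> : ip gi om (ins z t) = \sum_i pull gi^T om i * ins z t i by rewrite pull_adj trmxK.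
rewrite sum_ix2.
have -> : gi^T *m mx2 om *m gi = mx2 (pull gi^T om) by rewrite mx2_pull trmxK.
rewrite -sumrN; apply: eq_bigr => i _; rewrite mxE -sumrN; apply: eq_bigr => j _.
rewrite !mxE -mulrN; congr (_ * _); rewrite ffunE -sumrN; apply: eq_bigr => l _.
have -> : icons l (ix2 i j) = ix3 l i j by rewrite ix3E ix2E.
by rewrite (alt12 l i j ta) (alt23 i l j ta) (alt12 i j l ta) !opprK mulrN opprK mulrC.
Qed.

End Reduction.

Section Final.
Context {R : realType}.

(** The pointwise content of the reduction: the three identities for an orthogonal complex structure
    with its form, and the trace condition assumed in [torsion_W1_W3]. *)
Lemma reduced_structure (g E : 'M[R]_8) (K : 'M[R]_(1 + 1)) (S : 'M[R]_(6, 8)) (V : 'M[R]_(1 + 1, 8))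
    (om : tens R 8 2) (t : tens R 8 3) (de a1 a2 b : R) :
  g^T = g -> E *m g *m E^T = 1%:M -> K *m K^T = 1%:M -> V = K *m e78 *m E ->
  V *m g *m V^T = 1%:M -> S *m g *m V^T = 0 -> S *m g *m S^T \in unitmx ->
  de ^+ 2 = 1 -> pull E om = de *: Z2 -> Defs.alternating om -> Defs.alternating t ->
  pull E t = torsion_II a1 a2 b -> Defs.alternating (pull S t) ->
  let gX := S *m g *m S^T in let J := mx2 (pull S om) *m invmx gX in
  [/\ J *m J = - 1%:M, J *m gX *m J^T = gX, J *m gX = mx2 (pull S om) &
      forall z : 'rV[R]_6, \tr (invmx gX *m J *m (\matrix_(i, j) \sum_l pull S t (ix3 i j l) * z 0 l)) = 0].
Proof.
move=> gs Eg KK VE VV SV uX de1 pom oma ta pt tXa gX J.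
have uE := gram1_unit Eg.
have ug : g \in unitmx.
  have [] := mulmx1_unit Eg; rewrite unitmx_mul => /andP[_]; by [].
have gi := gram1_inv Eg.
pose W := mx2 om; have Ws : W^T = - W := mx2_skew oma.
have EW : E *m W *m E^T = de *: mx2 Z2.
  by rewrite -mx2_pull pom; apply/matrixP => i j; rewrite !mxE ffunE.
have VW : V *m W = 0 by rewrite VE; exact: frame_form_kernel Eg EW.
have WW : W *m invmx g *m W = - (g - g *m V^T *m V *m g).
  by rewrite gi VE; exact: frame_form_sqr Eg KK de1 EW.
have JE : J = S *m W *m S^T *m invmx gX by rewrite /J mx2_pull.
split.
- by rewrite JE; exact: (@complex_sqr R 6 (1 + 1) g W S V ug gs uX SV VV VW WW).
- by rewrite JE; exact: (@complex_isometry R 6 (1 + 1) g W S V ug gs uX SV VV VW Ws WW).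
- by rewrite /J mulmxKV.
move=> z.
have gXs : gX^T = gX by rewrite /gX !trmx_mul trmxK gs mulmxA.
have giX : (invmx gX)^T = invmx gX by rewrite trmx_inv gXs.
have -> : invmx gX *m J = (invmx gX)^T *m mx2 (pull S om) *m invmx gX by rewrite giX /J mulmxA.
apply: (etrans (trace_slot (invmx gX) (pull S om) z tXa)); apply/eqP; rewrite oppr_eq0; apply/eqP.
rewrite -pull_ins ip_pull.
(* The inverse metric of [M] is that of the slice plus the square of [V], and [V] annihilates the
   2-form; contractions with the form therefore agree in [M] and in the slice. *)
have -> : ip (S^T *m invmx gX *m S) om (ins (z *m S) t) = ip (invmx g) om (ins (z *m S) t).
  pose B := S^T *m invmx gX *m S.
  have Bs : B^T = B by rewrite /B !trmx_mul trmxK giX mulmxA.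
  have gis : (invmx g)^T = invmx g by rewrite trmx_inv gs.
  have e (A : 'M[R]_8) : A^T = A -> ip A om (ins (z *m S) t) = \sum_i pull A om i * ins (z *m S) t i.
    by move=> As; rewrite pull_adj As.
  have eB : pull B om = pull (invmx g) om.
    apply: mx2_inj; rewrite !mx2_pull.
    exact: (@tangent_contraction R 6 (1 + 1) g W S V ug gs uX SV VV VW Ws).
  by rewrite (e _ Bs) (e _ gis) eB.
rewrite (ins_sum (z *m S)) ip_sumr big1 // => l _.
(* In the frame [E] this is [cvec_Z2], multiplied by the sign [de]. *)
have c0 : cvec (invmx g) om t = 0.
  have := cvec_pull E 1%:M om t; rewrite pom pt cvecZ cvec_Z2 scaler0 mulmx1 -gi => /esym e.
  have uET : E^T \in unitmx by rewrite unitmx_tr.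
  by apply: (can_inj (mulmxK uET)); rewrite mul0mx.
by move/rowP: c0 => /(_ l); rewrite !mxE => ->; rewrite mulr0.
Qed.

Lemma slot_skew n (t : tens R n 3) l : Defs.alternating t -> (slot t l)^T = - slot t l.
Proof. by move=> ta; apply/matrixP => i j; rewrite !mxE (alt23 l j i ta). Qed.

(** On the plane of e_7 and e_8, Phi(., ., u, v) depends on the first two arguments through their
    determinant, so the sign is the determinant of the orthogonal matrix [K]. *)
Lemma kernel_rotation (K : 'M[R]_(1 + 1)) (E : 'M[R]_8) (ph : tens R 8 4) : K *m K^T = 1%:M ->
  pull E ph = Phi0 R -> exists2 de : R, de ^+ 2 = 1 &
  pull E (ins (delta_mx 0 (rshift 1 ord0) *m (K *m e78 *m E)) (ins (delta_mx 0 (lshift 1 ord0) *m (K *m e78 *m E)) ph))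
    = de *: Z2.
Proof.
move=> KK pE; pose r0 : 'rV[R]_(1 + 1) := delta_mx 0 (lshift 1 ord0) *m K.
pose r1 : 'rV[R]_(1 + 1) := delta_mx 0 (rshift 1 ord0) *m K.
rewrite [delta_mx _ _ *m _]mulmxA [delta_mx _ _ *m (K *m _)]mulmxA -/r1 pull_ins.
rewrite [delta_mx _ _ *m _]mulmxA [delta_mx _ _ *m (K *m _)]mulmxA -/r0 pull_ins pE !row_e78 ins_unit78.
exists (lsubmx r0 0 0 * rsubmx r1 0 0 - rsubmx r0 0 0 * lsubmx r1 0 0) => //.
have det2 (x y z t : R) : x * x + y * y = 1 -> x * z + y * t = 0 -> z * z + t * t = 1 ->
    (x * t - y * z) ^+ 2 = 1.
  move=> h1 h2 h3; transitivity ((x * x + y * y) * (z * z + t * t) - (x * z + y * t) ^+ 2); first by ring.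
  by rewrite h1 h2 h3 expr0n mulr1 subr0.
have r0E : r0 = row (lshift 1 ord0) K by rewrite rowE.
have r1E : r1 = row (rshift 1 ord0) K by rewrite rowE.
rewrite r0E r1E; have := KK => /matrixP k.
move: (k (lshift 1 ord0) (lshift 1 ord0)) (k (lshift 1 ord0) (rshift 1 ord0)) (k (rshift 1 ord0) (rshift 1 ord0)).
rewrite !mxE !big_split_ord /= !big_ord1 !mxE /=.
exact: det2.
Qed.

End Final.

Theorem theorem6p4 (R : realType) (M : rmfd R 8)
    (Phi : tensor_field M 4) (T : tensor_field M 3)
    (hM : spin7_manifold Phi)
    (hcomplete : geodesically_complete M)
    (hsc : simply_connected M)
    (hT : characteristic_torsion Phi T)
    (hT0 : exists (c : chart M) (p : M), chart_dom c p /\ T c p != 0)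
    (hpar : parallel_tensor (skew_connection T) T)
    (hiso : isotropy_is Phi T (so3 R) \/ isotropy_is Phi T (su3 R))
    (hII : type_II Phi T) :
  exists (X : rmfd R 6) (J : endo_field X) (TX : tensor_field X 3)
         (f : M -> product X (euclidean 2)),
    [/\ almost_hermitian J, type_W1_W3 J, ah_characteristic_torsion J TX,
        riemannian_isometry f & holonomy_in_iso Phi T (skew_connection TX) f].
Proof.
have [c0 [p0 [cp0 _]]] := hT0.
have [a1 [a2 [b [b0 hF]]]] := hII.
have hR : riemannian M by case: hM.
have tf : is_form T by case: hT.
have Tpar : parallel_form T T by split.
have Ppar : parallel_form T Phi by split; [case: hM | case: hT].
have [V [VP VE]] := parallel_kernel_frame hM hsc hT hpar hiso b0 hF p0.
have [_ _ VgV _ _] := VP.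
(* Phi(V_1, V_2, ., .), the form that restricts to the Kaehler form of [X]; the inner contraction
   fills the first slot. *)
pose Om : tensor_field M 2 := fun c p => ins (delta_mx 0 (rshift 1 ord0) *m V c p)
  (ins (delta_mx 0 (lshift 1 ord0) *m V c p) (Phi c p)).
have OmP : parallel_form T Om.
  have v0 := frame_vec hR (delta_mx 0 (lshift 1 ord0)) VP.
  have v1 := frame_vec hR (delta_mx 0 (rshift 1 ord0)) VP.
  have h := form_ins_par hR v1 (form_ins_par hR v0 Ppar); exact: h.
have [X [a [i [S [f [[hX fiso] SX forms diffs trans]]]]]] := @splitting R 6 (1 + 1) M T V p0 hR tf VP hcomplete hsc.
pose TX : tensor_field X 3 := fun d x => pull (S d x) (T (a d) (i x)).
pose OX : tensor_field X 2 := fun d x => pull (S d x) (Om (a d) (i x)).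
have TXf : is_form TX by exact: (forms 3 T tf).1.
have OXP : parallel_form TX OX.
  by have [h1 h2] := forms 2 Om OmP.1; split; [exact: h1 | exact: (h2 OmP.2)].
(* Solves g(JX, Y) = Omega(X, Y), the convention of [kahler_form]. *)
pose J : endo_field X := fun d x => mx2 (OX d x) *m invmx (metric d x).
have red d x : chart_dom d x -> [/\ J d x *m J d x = - 1%:M, J d x *m metric d x *m (J d x)^T = metric d x,
    J d x *m metric d x = mx2 (OX d x) &
    forall z : 'rV[R]_6, \tr (invmx (metric d x) *m J d x *m (\matrix_(k, l) \sum_j TX d x (ix3 k l j) * z 0 j)) = 0].
  move=> dx; have [cp gX SV] := SX d x dx.
  have [E F] := hF _ _ cp; have [K KK VKE] := VE _ _ _ cp F.
  have [[Eg _ EP] ET] := F.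
  have [de de1 pO] := kernel_rotation KK EP; rewrite -VKE in pO.
  have uX := metric_unit hX dx; rewrite gX in uX.
  have TXa : Defs.alternating (TX d x) by case: TXf => _ _; exact.
  have Oma : Defs.alternating (Om (a d) (i x)) by case: OmP => -[_ _ h] _; exact: h.
  have Ta : Defs.alternating (T (a d) (i x)) by case: tf => _ _; exact.
  have := reduced_structure (metric_sym hR cp) Eg KK VKE (VgV _ _ cp) SV uX de1 pO Oma Ta ET TXa.
  by rewrite /= -gX.
exists X, J, TX, f; split.
- split=> //; have [Jj Js _] := form_endo_par hX TXf OXP; split=> //.
  + by move=> c p cp; have [] := red c p cp.
  + by move=> c p cp; have [] := red c p cp.
- move=> c p cp; have [JJ _ Jg tr0] := red c p cp.
  have TXa : Defs.alternating (TX c p) by case: TXf => _ _; exact.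
  have gis : (invmx (metric c p))^T = invmx (metric c p) by rewrite trmx_inv (metric_sym hX cp).
  have [A1 [A3 [h1 h3 e]]] := torsion_W1_W3 TXa gis JJ tr0.
  exists A1, A3; split=> // l; rewrite e (nabla_kahler_form hX l OXP _ cp); last by move=> c' p' /red[].
  rewrite -/(J c p); set W := mx2 (OX c p); have Ws : W^T = - W.
    by apply: mx2_skew; case: OXP => -[_ _ h] _; exact: h.
  (* The inverse metric is symmetric, while [W] and the slots of the torsion are skew. Transposition
     thus matches the expression of [torsion_W1_W3] with that of [nabla_kahler_form], the sign being
     absorbed by the factor - 1/2. *)
  have JT : (J c p)^T = - (invmx (metric c p) *m W) by rewrite trmx_mul gis Ws mulmxN.
  rewrite JT trmx_mul gis (slot_skew l TXa) mulmxN mulmxN scaleNr -scalerN; congr (_ *: _).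
  by rewrite opprD opprK mulmxN {1}/J -/W !mulmxA.
- split=> // c p l cp; have [_ _ Jp] := form_endo_par hX TXf OXP.
  by rewrite (Jp c p l cp) subrK subrr.
- exact: fiso.
move=> c d p cp dx.
have [E F] := hF c p cp; have [[Eg Edet EP] ET] := F; exists E; split=> // A hA df B.
(* The coordinate frame of [X] completed by [V]; in it an endomorphism of [X] extended by zero is
   the block matrix of [holonomy_in_iso]. *)
pose x := (f p).1; pose Q : 'M[R]_8 := col_mx (S d x) (V (a d) (i x)).
have [A0 [dA gA tA]] := diffs c p d cp dx.
have [ap gX SV] := SX d x dx.
have uX := metric_unit hX dx; rewrite gX in uX.
have gE : Q *m metric (a d) (i x) *m Q^T = block_mx (metric d x) 0 0 (1%:M : 'M[R]_(1 + 1)).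
  by rewrite gX; exact: (@metric_splitting R 6 (1 + 1) _ _ _ (metric_sym hR ap) SV (VgV _ _ ap)).
have uA : A0 \in unitmx.
  by have := metric_unit hR cp; rewrite -gA !unitmx_mul => /andP[/andP[]].
have dQ : df *m Q = A0 by exact: dA.
have udf : df \in unitmx by move: uA; rewrite -dQ unitmx_mul => /andP[].
have uE : E \in unitmx := frame_unit (conj (And3 Eg Edet EP) ET).
pose th k (t : tensor_field M k) (d : chart X) (x : X) : tens R (6 + (1 + 1)) k :=
  pull (col_mx (S d x) (V (a d) (i x))) (t (a d) (i x)).
(* Valid for every parallel form on [M]: [Phi] gives membership in spin(7), together with skew
   symmetry, and [T] gives the isotropy condition. *)
have kill k (t : tensor_field M k) : parallel_form T t ->
    dact (E *m B *m invmx E) (pull E (t c p)) = 0.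
  move=> [tfm tp]; have -> : t c p = pull df (th k t d x).
    by rewrite -(tA k t tfm tp) /th pull_mul dQ.
  apply: dact_conj uE udf _.
  apply: (@holonomy_kills R 6 X TX (1 + 1) k (th k t) _ d x A hA) => g P cg pP e e' u v eu ev.
  have := trans k t g P tfm tp cg pP e e' u v eu ev.
  by rewrite /th !pull_mul !mul_block_col !mul0mx !mul1mx !addr0 !add0r.
have sk : (E *m B *m invmx E)^T = - (E *m B *m invmx E).
  apply: (skew_conj (g := block_mx (metric d x) 0 0 (1%:M : 'M[R]_(1 + 1)))) uE udf _ _.
  - by rewrite tr_block_mx (metric_sym hX dx) !trmx0 trmx1.
  - have -> : df *m block_mx (metric d x) 0 0 (1%:M : 'M[R]_(1 + 1)) *m df^T = metric c p.
      by rewrite -gE -gA -dQ trmx_mul !mulmxA.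
    exact: Eg.
  - have h := holonomy_skew hX TXf hA.
    rewrite tr_block_mx !mulmx_block !trmx0 !mul0mx !mulmx0 !addr0 add_block_mx h !addr0.
    exact: block_mx0.
split; first split=> //.
  by have := kill 4 Phi Ppar; rewrite EP.
exact: kill 3 T Tpar.
Qed.
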